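(* Let $(w(t))_{t\ge0}$ be a Brownian motion on $\mathbb{H}P^n$ started at $0$, let $r(t)=\arctan|w(t)|$ and let $\mathfrak a(t)$ be its quaternionic stochastic area process. Then $$\big(r(t),\mathfrak a(t)\big)_{t\ge0}\overset{d}{=}\Big(r(t),\gamma_{\int_0^t\tan^2r(s)\,ds}\Big)_{t\ge0},$$ where $(\gamma_t)_{t\ge0}$ is a standard Brownian motion in $\mathbb{R}^3$ independent of $r$.
   Context: $n\ge1$. $\mathbb{H}$ is the field of quaternions with units $I,J,K$; imaginary quaternions $xI+yJ+zK$ are identified with $(x,y,z)\in\mathbb{R}^3$. The quaternionic projective space $\mathbb{H}P^n$ is described by inhomogeneous coordinates $w=(w_1,\dots,w_n)\in\mathbb{H}^n$ (valid off a set which Brownian motion started at $0$ almost surely never hits), in which its Riemannian metric is $\frac{\sum_j|dw_j|^2}{1+|w|^2}-\frac{|\sum_j dw_j\overline{w_j}|^2}{(1+|w|^2)^2}$; $0$ is the point $w=0$. Brownian motion has generator $\frac12\Delta_{\mathbb{H}P^n}$ (half the Laplace–Beltrami operator). Its quaternionic stochastic area process is $$\mathfrak a(t)=\frac12\sum_{j=1}^n\int_0^t\frac{dw_j(s)\overline{w_j}(s)-w_j(s)d\overline{w_j}(s)}{1+|w(s)|^2}\in\mathbb{R}^3$$ (Stratonovich, equivalently Itô, integrals). *)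

(* Defs.v *)
From HB Require Import structures.
From mathcomp Require Import all_boot all_order all_algebra.
From mathcomp Require Import all_classical all_reals all_analysis.
Set Implicit Arguments.
Unset Strict Implicit.
Unset Printing Implicit Defensive.
Import Order.TTheory GRing.Theory Num.Theory.
Import numFieldNormedType.Exports.
Local Open Scope classical_set_scope.
Local Open Scope ring_scope.

(* A quaternion x0 + x1 I + x2 J + x3 K is the row vector (x0, x1, x2, x3); a
   point of H^n is a matrix w : 'M[R]_(n, 4) whose rows are w_1, ..., w_n. *)
Section Quaternions.
Variable R : realType.
Implicit Types (p q : 'rV[R]_4).

Definition quat (a b c d : R) : 'rV[R]_4 := \row_(i < 4) [:: a; b; c; d]`_i.

Definition qRe q : R := q 0 (inord 0).
Definition qI q : R := q 0 (inord 1).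
Definition qJ q : R := q 0 (inord 2).
Definition qK q : R := q 0 (inord 3).

Definition qmul p q : 'rV[R]_4 := quat
  (qRe p * qRe q - qI p * qI q - qJ p * qJ q - qK p * qK q)
  (qRe p * qI q + qI p * qRe q + qJ p * qK q - qK p * qJ q)
  (qRe p * qJ q - qI p * qK q + qJ p * qRe q + qK p * qI q)
  (qRe p * qK q + qI p * qJ q - qJ p * qI q + qK p * qRe q).

Definition qconj q : 'rV[R]_4 := quat (qRe q) (- qI q) (- qJ q) (- qK q).

(* (x, y, z) in R^3 as the imaginary quaternion xI + yJ + zK. *)
Definition qimag (v : 'rV[R]_3) : 'rV[R]_4 :=
  quat 0 (v 0 (inord 0)) (v 0 (inord 1)) (v 0 (inord 2)).

(* The library norm `| x | of a matrix is the sup norm, hence this one. *)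
Definition normsq (m k : nat) (x : 'M[R]_(m, k)) : R :=
  \sum_(i < m) \sum_(j < k) x i j ^+ 2.

End Quaternions.

Section LaplaceBeltrami.
Variables (R : realType) (m k : nat).
Implicit Types (f : 'M[R]_(m, k) -> R) (x u v : 'M[R]_(m, k)).

Definition coordv (a : 'I_(m * k)) : 'M[R]_(m, k) := vec_mx (delta_mx 0 a).

Definition partial (a : 'I_(m * k)) f : 'M[R]_(m, k) -> R :=
  fun x => 'D_(coordv a) f x.

Definition smooth f := forall s : seq 'I_(m * k),
  continuous (foldr partial f s) /\
  forall a x, derivable (foldr partial f s) x (coordv a).

Definition compactly_supported f := compact (closure [set x | f x != 0]).

(* [metric x] is the quadratic form v |-> g_x(v, v) of a Riemannian metric g;
   [gram x] recovers the matrix of g_x by polarization. *)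
Variable metric : 'M[R]_(m, k) -> 'M[R]_(m, k) -> R.

Definition gram x : 'M[R]_(m * k) := \matrix_(a, b)
  ((metric x (coordv a + coordv b) - metric x (coordv a)
    - metric x (coordv b)) / 2).

Definition laplace_beltrami f x : R :=
  (Num.sqrt (\det (gram x)))^-1 *
  \sum_a partial a (fun y => Num.sqrt (\det (gram y)) *
     \sum_b invmx (gram y) a b * partial b f y) x.

End LaplaceBeltrami.

Section Processes.
Variable R : realType.

(* Time is the half line [0, +oo[ ; values of a process at negative times are
   ignored by all the definitions below. *)
Definition sigma_process (T : Type) (E : topologicalType) (X : R -> T -> E)
    (I : set R) : set (set T) :=
  <<s [set A | exists u (U : set E), [/\ I u, open U & A = X u @^-1` U]] >>.

Definition path_sigma (E : topologicalType) : set (set (R -> E)) :=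
  sigma_process (fun t (x : R -> E) => x t) `[0, +oo[.

Section OneSpace.
Context d (T : measurableType d) (P : probability T R).

Definition measurable_process (E : topologicalType) (X : R -> T -> E) :=
  sigma_process X `[0, +oo[ `<=` measurable.

Definition continuous_process (E : topologicalType) (X : R -> T -> E) :=
  forall o, {within `[0, +oo[, continuous (fun t => X t o)}.

Definition independent_processes (E F : topologicalType)
    (X : R -> T -> E) (Y : R -> T -> F) :=
  forall A B, sigma_process X `[0, +oo[ A -> sigma_process Y `[0, +oo[ B ->
    P (A `&` B) = (P A * P B)%E.

Definition martingale (F : R -> set (set T)) (M : R -> T -> R) :=
  [/\ forall t : R, 0 <= t -> forall B : set R, measurable B -> F t (M t @^-1` B),
      forall t : R, 0 <= t -> P.-integrable setT (EFin \o M t)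
    & forall s t : R, 0 <= s <= t -> forall A, F s A ->
        \int[P]_(o in A) M t o = \int[P]_(o in A) M s o].

Definition brownian_motion (k : nat) (g : R -> T -> 'rV[R]_k) :=
  [/\ measurable_process g,
      continuous_process g,
      {ae P, forall o, g 0 o = 0}
    & forall s t : R, 0 <= s < t -> forall A, sigma_process g `[0, s] A ->
        forall B : 'I_k -> set R, (forall i, measurable (B i)) ->
        P (A `&` [set o | forall i, B i (g t o 0 i - g s o 0 i)]) =
        (P A * \big[*%E/1%E]_(i < k)
                 normal_prob 0%R (Num.sqrt (t - s)%R) (B i))%E].

(* Diffusion with generator L started at x0, as a solution of the martingale
   problem for L on smooth functions with compact support. *)
Definition diffusion (m k : nat)
    (L : ('M[R]_(m, k) -> R) -> 'M[R]_(m, k) -> R)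
    (x0 : 'M[R]_(m, k)) (X : R -> T -> 'M[R]_(m, k)) :=
  [/\ measurable_process X,
      continuous_process X,
      {ae P, forall o, X 0 o = x0}
    & forall f, smooth f -> compactly_supported f ->
        martingale (fun t => sigma_process X `[0, t])
          (fun t o => f (X t o) - f (X 0 o)
             - \int[lebesgue_measure]_(s in `[0, t]) L f (X s o))].

End OneSpace.

Definition same_law d (T : measurableType d) (P : probability T R)
    d' (T' : measurableType d') (P' : probability T' R) (E : topologicalType)
    (X : R -> T -> E) (X' : R -> T' -> E) :=
  forall C, path_sigma C ->
    P [set o | C (X ^~ o)] = P' [set o | C (X' ^~ o)].

(* Stratonovich sums of the integrals of dX Y and Y dX along the partition
   a = t_0 < t_1 < ... < t_N, where s = [:: t_1; ...; t_N]. *)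
Section Stratonovich.
Implicit Types (X Y : R -> 'rV[R]_4) (a : R) (s : seq R).

Definition incr X a s i : 'rV[R]_4 := X (a :: s)`_i.+1 - X (a :: s)`_i.
Definition avg Y a s i : 'rV[R]_4 :=
  2^-1 *: (Y (a :: s)`_i + Y (a :: s)`_i.+1).

Definition strat_dXY X Y a s : 'rV[R]_4 :=
  \sum_(i < size s) qmul (incr X a s i) (avg Y a s i).
Definition strat_YdX Y X a s : 'rV[R]_4 :=
  \sum_(i < size s) qmul (avg Y a s i) (incr X a s i).

Definition mesh_lt (e a : R) s :=
  forall i, (i < size s)%N -> (a :: s)`_i.+1 - (a :: s)`_i < e.

End Stratonovich.
End Processes.

Section QuaternionicProjectiveSpace.
Variables (R : realType) (n : nat).
Implicit Types (w v : 'M[R]_(n, 4)).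

Definition hp_metric w v : R :=
  normsq v / (1 + normsq w)
  - normsq (\sum_j qmul (row j v) (qconj (row j w))) / (1 + normsq w) ^+ 2.

(* The chart H^n is the complement in HP^n of a hyperplane which Brownian motion
   started at 0 almost surely never hits: in the chart, Brownian motion is the
   diffusion with generator half the Laplacian, and it does not explode. *)
Definition hp_brownian_motion d (T : measurableType d) (P : probability T R)
    (w : R -> T -> 'M[R]_(n, 4)) :=
  diffusion P (fun f x => 2^-1 * laplace_beltrami hp_metric f x) 0 w.

Definition area_sum (w : R -> 'M[R]_(n, 4)) (s : seq R) : 'rV[R]_4 :=
  2^-1 *: \sum_j
    (strat_dXY (fun t => row j (w t))
               (fun t => (1 + normsq (w t))^-1 *: qconj (row j (w t))) 0 s
     - strat_YdX (fun t => (1 + normsq (w t))^-1 *: row j (w t))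
                 (fun t => qconj (row j (w t))) 0 s).

(* For each t, the sums converge in probability to a(t) as the mesh of the
   partition of [0, t] tends to 0. *)
Definition stochastic_area d (T : measurableType d) (P : probability T R)
    (w : R -> T -> 'M[R]_(n, 4)) (a : R -> T -> 'rV[R]_3) :=
  measurable_process a /\
  forall t : R, 0 <= t -> forall e eta : R, 0 < e -> 0 < eta ->
    exists2 delta : R, 0 < delta &
      forall s : seq R, itv_partition 0 t s -> mesh_lt delta 0 s ->
        (P [set o | (e <= `| area_sum (w ^~ o) s - qimag (a t o) |)%R]
         <= eta%:E)%E.

Definition hp_radius w : R := atan (Num.sqrt (normsq w)).

End QuaternionicProjectiveSpace.

(* Main.v *)
(* Write phi = 1 / (1 + |w|^2) = cos^2 r. Along the area, only the vertical fields
   e_l w matter: they are orthogonal to the radial direction, and in the direction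
   lam the area has quadratic variation |lam|^2 \int tan^2 r. Without a stochastic
   calculus at hand, this is exploited through moments. The martingale problem,
   applied to cut-off products of phi^m with polynomials in w, gives
   recursions over the steps of a fine partition for
     E [cos (G + lam . a) e^(- kap \int tan^2 r) phi^m],
   triangular in m up to small errors, because half the Laplacian maps phi^m to a
   combination of phi^m and phi^(m-1). They depend on lam and kap through
   kap + |lam|^2 / 2 only, and when this number is 2 m0 (m0 + 1) the recursion closes
   on m >= m0: there, rotating by lam . a may be traded for killing at rate
   |lam|^2 / 2. Iterating over successive times and undoing the killing by bounded
   limits yields
     E [cos (sum mu . a) prod phi^q] = E [e^(- V / 2) prod phi^q],
   where V is the variance of sum mu . gamma at the times of the clock
   \int tan^2 r. The same identity holds for a Brownian motion run with an independent
   clock, and these functions determine the joint law. *)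
Require Import Defs.
From HB Require Import structures.
From mathcomp Require Import all_boot all_order all_algebra.
From mathcomp Require Import all_classical all_reals all_analysis.
From mathcomp Require Import measurable_realfun ring lra zify.
Set Implicit Arguments.
Unset Strict Implicit.
Unset Printing Implicit Defensive.
Import Order.TTheory GRing.Theory Num.Theory.
Import numFieldNormedType.Exports.
Local Open Scope classical_set_scope.
Local Open Scope ring_scope.

(** * Bounded random variables *)

Section BoundedMeasurable.
Context d (T : measurableType d) (R : realType).
Implicit Types (f g : T -> R).

(** A factor |w|^2 lowers the order of a moment by one, since |w|^2 phi = 1 - phi, and the
    generator, the rotation and the killing all produce such factors: the moment of order m calls
    for that of order m - 1 with coefficient 2m(m+1) - kap - |lam|^2 / 2. This is the obstacle,
    because the descent ends at order 0, which calls for the mean of the unbounded 1 / phi. Making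
    the coefficient vanish at m0 cuts the descent there; above m0 it is nonnegative, so that the
    recursion has nonnegative coefficients and an elementary error bound. The price is twofold:
    since kap must be nonnegative, m0 has to be large compared with lam, and only weights containing
    phi^m0 and a strong killing are reached. Both are removable because they depend on the radial
    part alone: bounded approximations of their inverses are limits of polynomials in the values of
    phi at finitely many times, and the identity with several times holds against all such
    polynomials. *)

Definition bounded_measurable f :=
  measurable_fun setT f /\ exists M : R, forall o, `|f o| <= M.

Lemma bounded_measurable_pos f : bounded_measurable f ->
  exists2 M : R, 0 < M & forall o, `|f o| <= M.
Proof.
move=> [_ [M hM]]; exists (`|M| + 1); first by rewrite ltr_wpDl.
move=> o; apply: le_trans (hM o) _; apply: le_trans (ler_norm _) _.
by rewrite lerDl.
Qed.

Lemma bounded_measurable_cst c : bounded_measurable (fun=> c).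
Proof. by split; [exact: measurable_cst | exists `|c|]. Qed.

Lemma bounded_measurableD f g : bounded_measurable f -> bounded_measurable g ->
  bounded_measurable (fun o => f o + g o).
Proof.
move=> [mf [M hM]] [mg [N hN]]; split; first exact: measurable_funD.
by exists (M + N) => o; apply: le_trans (ler_normD _ _) _; exact: lerD.
Qed.

Lemma bounded_measurableM f g : bounded_measurable f -> bounded_measurable g ->
  bounded_measurable (fun o => f o * g o).
Proof.
move=> [mf [M hM]] [mg [N hN]]; split; first exact: measurable_funM.
by exists (M * N) => o; rewrite normrM ler_pM.
Qed.

Lemma bounded_measurableN f : bounded_measurable f ->
  bounded_measurable (fun o => - f o).
Proof.
move=> [mf [M hM]]; split; first exact: measurable_funN.
by exists M => o; rewrite normrN.
Qed.

Lemma bounded_measurableB f g : bounded_measurable f -> bounded_measurable g ->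
  bounded_measurable (fun o => f o - g o).
Proof. by move=> hf hg; apply: bounded_measurableD => //; exact: bounded_measurableN. Qed.

Lemma bounded_measurable_norm f : bounded_measurable f ->
  bounded_measurable (fun o => `|f o|).
Proof.
move=> [mf [M hM]]; split; first exact: measurableT_comp.
by exists M => o; rewrite normr_id.
Qed.

Lemma bounded_measurableX f n : bounded_measurable f ->
  bounded_measurable (fun o => f o ^+ n).
Proof.
move=> [mf [M hM]]; split; first exact: measurable_funX.
by exists (M ^+ n) => o; rewrite normrX lerXn2r ?nnegrE// (le_trans _ (hM o)).
Qed.

Lemma bounded_measurable_sum (I : Type) (s : seq I) (Q : pred I) (f : I -> T -> R) :
  (forall i, Q i -> bounded_measurable (f i)) ->
  bounded_measurable (fun o => \sum_(i <- s | Q i) f i o).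
Proof.
move=> hf; elim: s => [|i s IH].
  under eq_fun do rewrite big_nil; exact: bounded_measurable_cst.
case: (boolP (Q i)) => Qi; last by under eq_fun do rewrite big_cons (negbTE Qi).
under eq_fun do rewrite big_cons Qi.
exact: (bounded_measurableD (hf i Qi) IH).
Qed.

Lemma bounded_measurable_prod (I : Type) (s : seq I) (Q : pred I) (f : I -> T -> R) :
  (forall i, Q i -> bounded_measurable (f i)) ->
  bounded_measurable (fun o => \prod_(i <- s | Q i) f i o).
Proof.
move=> hf; elim: s => [|i s IH].
  under eq_fun do rewrite big_nil; exact: bounded_measurable_cst.
case: (boolP (Q i)) => Qi; last by under eq_fun do rewrite big_cons (negbTE Qi).
under eq_fun do rewrite big_cons Qi.
exact: (bounded_measurableM (hf i Qi) IH).
Qed.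

Lemma bounded_measurable_comp (h : R -> R) f (M : R) : continuous h ->
  (forall x, `|h x| <= M) -> measurable_fun setT f ->
  bounded_measurable (fun o => h (f o)).
Proof.
move=> ch hM mf; split; last by exists M.
by apply: measurableT_comp => //; exact: continuous_measurable_fun.
Qed.

Lemma bounded_measurable_cos f : measurable_fun setT f ->
  bounded_measurable (fun o => cos (f o)).
Proof. by apply: (@bounded_measurable_comp cos f 1); [exact: continuous_cos | exact: cos_max]. Qed.

Lemma bounded_measurable_sin f : measurable_fun setT f ->
  bounded_measurable (fun o => sin (f o)).
Proof. by apply: (@bounded_measurable_comp sin f 1); [exact: continuous_sin | exact: sin_max]. Qed.

Lemma bounded_measurable_indic (A : set T) : measurable A ->
  bounded_measurable (\1_A : T -> R).
Proof.
move=> mA; split; first exact: measurable_indic.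
by exists 1 => o; rewrite indicE; case: (_ \in _); rewrite ?normr1 ?normr0.
Qed.

Lemma bounded_measurable_expR f : bounded_measurable f ->
  bounded_measurable (fun o => expR (f o)).
Proof.
move=> [mf [M hM]]; split.
  by apply: measurableT_comp => //; exact: measurable_expR.
exists (expR M) => o; rewrite ger0_norm ?expR_ge0// ler_expR.
exact: le_trans (ler_norm _) (hM o).
Qed.

End BoundedMeasurable.

Section Expectation.
Context d (T : measurableType d) (R : realType) (P : probability T R).
Implicit Types (f g : T -> R).

Definition mean f : R := \int[P]_o f o.

Lemma bounded_measurable_integrable f : bounded_measurable f ->
  P.-integrable setT (EFin \o f).
Proof.
move=> [mf [M hM]]; apply: measurable_bounded_integrable => //.
  by apply: le_lt_trans (probability_le1 P measurableT) _; exact: ltry.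
exists M; split; first exact: num_real.
by move=> N MN o _ /=; apply: le_trans (hM o) (ltW MN).
Qed.
Hint Resolve bounded_measurable_integrable : core.

Lemma mean_cst c : mean (fun=> c) = c.
Proof. rewrite /mean Rintegral_cst// -[RHS]mulr1; congr (_ * _).
exact: (congr1 fine (probability_setT P)). Qed.

Lemma meanD f g : bounded_measurable f -> bounded_measurable g ->
  mean (fun o => f o + g o) = mean f + mean g.
Proof. by move=> hf hg; rewrite /mean RintegralD//; apply: bounded_measurable_integrable. Qed.

Lemma meanB f g : bounded_measurable f -> bounded_measurable g ->
  mean (fun o => f o - g o) = mean f - mean g.
Proof. by move=> hf hg; rewrite /mean RintegralB//; apply: bounded_measurable_integrable. Qed.

Lemma meanZ c f : bounded_measurable f -> mean (fun o => c * f o) = c * mean f.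
Proof. by move=> hf; rewrite /mean RintegralZl//; apply: bounded_measurable_integrable. Qed.

Lemma mean_sum (I : Type) (s : seq I) (Q : pred I) (f : I -> T -> R) :
  (forall i, Q i -> bounded_measurable (f i)) ->
  mean (fun o => \sum_(i <- s | Q i) f i o) = \sum_(i <- s | Q i) mean (f i).
Proof.
move=> hf; elim: s => [|i s IH].
  by rewrite big_nil; under eq_fun do rewrite big_nil; exact: mean_cst.
rewrite big_cons; case: (boolP (Q i)) => Qi; last by under eq_fun do rewrite big_cons (negbTE Qi).
under eq_fun do rewrite big_cons Qi.
rewrite meanD ?IH//; first exact: hf.
exact: bounded_measurable_sum.
Qed.

Lemma le_mean f g : bounded_measurable f -> bounded_measurable g ->
  (forall o, f o <= g o) -> mean f <= mean g.
Proof. by move=> hf hg fg; apply: le_Rintegral => //; exact: bounded_measurable_integrable. Qed.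

Lemma mean_ge0 f : (forall o, 0 <= f o) -> 0 <= mean f.
Proof. by move=> h; apply: Rintegral_ge0 => o _; exact: h. Qed.

Lemma le_norm_mean f : bounded_measurable f -> `|mean f| <= mean (fun o => `|f o|).
Proof. by move=> hf; apply: le_normr_Rintegral => //; exact: bounded_measurable_integrable. Qed.

Lemma norm_mean_le f g : bounded_measurable f -> bounded_measurable g ->
  (forall o, `|f o| <= g o) -> `|mean f| <= mean g.
Proof.
move=> hf hg fg; apply: le_trans (le_norm_mean hf) _.
by apply: le_mean => //; exact: bounded_measurable_norm.
Qed.

Lemma mean_bounded f (M : R) : bounded_measurable f -> (forall o, `|f o| <= M) -> `|mean f| <= M.
Proof.
move=> hf fM; rewrite -[leRHS](mean_cst M).
by apply: norm_mean_le => //; exact: bounded_measurable_cst.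
Qed.

Lemma ae_eq_mean f g : measurable_fun setT f -> measurable_fun setT g ->
  {ae P, forall o, f o = g o} -> mean f = mean g.
Proof.
move=> mf mg fg; rewrite /mean /Rintegral; congr fine.
apply: ae_eq_integral => //; [exact/measurable_EFinP|exact/measurable_EFinP|].
by apply: filterS fg => o /= -> _.
Qed.

Lemma mean_indic (A : set T) : measurable A -> mean \1_A = fine (P A).
Proof. by move=> mA; rewrite /mean /Rintegral integral_indic// setIT. Qed.

Lemma cvg_mean (f_ : nat -> T -> R) f (M : R) :
  (forall k, measurable_fun setT (f_ k)) -> measurable_fun setT f ->
  (forall k o, `|f_ k o| <= M) ->
  {ae P, forall o, f_ ^~ o @ \oo --> f o} ->
  mean (f_ k) @[k --> \oo] --> mean f.
Proof.
move=> mf_ mf hM cf.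
have hb k : bounded_measurable (f_ k) by split; [|exists M].
have hE : forall (h : T -> R), bounded_measurable h ->
    (mean h)%:E = (\int[P]_o (h o)%:E)%E.
  move=> h hh; rewrite /mean /Rintegral fineK//.
  by apply: integrable_fin_num => //; exact: bounded_measurable_integrable.
have cfE : {ae P, forall o, setT o -> (EFin \o f_ k) o @[k --> \oo] --> (EFin \o f) o}.
  by apply: filterS cf => o h _; apply: cvg_EFin => //; exact: nearW.
have [int_f _ hc] := @dominated_convergence _ _ _ P setT measurableT
  (fun k => EFin \o f_ k) (EFin \o f) (cst M%:E)
  (fun k => proj2 (measurable_EFinP _ _) (mf_ k)) (proj2 (measurable_EFinP _ _) mf)
  cfE (bounded_measurable_integrable (bounded_measurable_cst T M))
  (aeW _ (fun o k _ => hM k o)).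
have -> : mean f = fine (\int[P]_o (f o)%:E)%E by [].
apply: fine_cvg; rewrite fineK; last exact: integrable_fin_num.
exact: hc.
Qed.

End Expectation.


(** The sum counts the positive integers up to k that are at most z, so it is the minimum of k and
    the integer part of z. The third clause drives the induction. *)
Lemma sum_le_indic (R : realType) (z : R) k : 0 <= z ->
  let S := \sum_(j < k) (j.+1%:R <= z)%R%:R : R in
  [/\ S <= z, z <= k%:R -> z - 1 <= S & k%:R <= z -> S = k%:R].
Proof.
move=> z0; elim: k => [|k [h1 h2 h3]].
  by rewrite big_ord0; split => // h; lra.
rewrite big_ord_recr/= -[k.+1%:R]natr1; case: (lerP (k%:R + 1) z) => hz /=.
  have hk : k%:R <= z by lra.
  by rewrite h3//; split => //; lra.
rewrite addr0; split=> [|_|h]; [exact: h1| |lra].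
case: (lerP z k%:R) => hk; first exact: h2.
by rewrite h3; lra.
Qed.

(** Layer-cake approximation: the superlevel conditions at the levels j/k recover a number of [0, 1]
    up to 1/k. *)
Lemma norm_floor_sum (R : realType) (y : R) k : 0 <= y <= 1 -> (0 < k)%N ->
  `|k%:R^-1 * (\sum_(j < k) (j.+1%:R <= k%:R * y)%R%:R) - y| <= k%:R^-1.
Proof.
move=> /andP[y0 y1] k0; have kR : 0 < k%:R :> R by rewrite ltr0n.
have [h1 h2 _] := @sum_le_indic R (k%:R * y) k (mulr_ge0 (ltW kR) y0).
have {}h2 := h2 (ler_piMr (ltW kR) y1).
rewrite -[X in _ - X](mulKf (lt0r_neq0 kR)) -mulrBr normrM gtr0_norm ?invr_gt0//.
rewrite ler_piMr ?invr_ge0 ?(ltW kR)// ler_norml; apply/andP; split; lra.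
Qed.

(* Doubly exponential cut-off: exp (- n exp (n x)) tends to the indicator of x < 0. *)
Lemma cvg_indic_lt0 (R : realType) (x : R) :
  expR (- (n%:R * expR (n%:R * x))) @[n --> \oo] --> ((x < 0)%R%:R : R).
Proof.
have cn : (n%:R : R) @[n --> \oo] --> +oo by exact: cvgr_idn.
case: ltP => x0.
  have -> : (true%:R : R) = expR (- 0) by rewrite oppr0 expR0.
  apply: continuous_cvg; first exact: continuous_expR.
  apply: cvgN.
  apply: (@squeeze_cvgr _ _ _ _ (cst 0) (fun n => 2 / (x ^+ 2 * n%:R))).
  - near=> n; have n0 : (0 < n%:R :> R) by near: n; exact: nbhs_infty_gtr.
    apply/andP; split; first by rewrite mulr_ge0// expR_ge0.
    have nx : 0 < - (n%:R * x) by rewrite -mulrN mulr_gt0// oppr_gt0.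
    have := expR_ge1Dxn 1 (ltW nx); rewrite factE /= => h.
    rewrite -[n%:R * x]opprK expRN.
    have h2 : (- (n%:R * x)) ^+ 2 / 2 <= expR (- (n%:R * x)).
      by apply: le_trans h; rewrite lerDr.
    have h3 : 0 < (- (n%:R * x)) ^+ 2 / 2 by rewrite divr_gt0// exprn_gt0.
    apply: le_trans (_ : n%:R * ((- (n%:R * x)) ^+ 2 / 2)^-1 <= _).
      by rewrite ler_wpM2l// lef_pV2// posrE// (lt_le_trans h3).
    rewrite sqrrN exprMn le_eqVlt; apply/orP; left; apply/eqP.
    field; rewrite gt_eqF//= lt_eqF//.
  - exact: cvg_cst.
  - rewrite -[X in _ --> X](mulr0 (2 / x ^+ 2)).
    under eq_fun do rewrite invfM mulrA.
    apply: cvgM; first exact: cvg_cst.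
    have /gtr0_cvgV0 hV : \forall n \near \oo, 0 < (n%:R : R) by exact: nbhs_infty_gtr.
    exact: hV.2 cn.
apply: (@squeeze_cvgr _ _ _ _ (cst 0) (fun n => expR (- n%:R))).
- near=> n; rewrite expR_ge0/= ler_expR lerN2 ler_peMr//.
  by rewrite -[leLHS]expR0 ler_expR mulr_ge0.
- exact: cvg_cst.
- exact: cvgn_expR.
Unshelve. all: by end_near.
Qed.

(** * A monotone class argument on two probability spaces at once *)

Section Closure.
Context d (T : measurableType d) d' (T' : measurableType d') (R : realType).
Variables (P : probability T R) (P' : probability T' R).
Variable base : (T -> R) -> (T' -> R) -> Prop.

(** A derivation builds a random variable on T and its counterpart on T' by the same operations, so
    an equality of means on the base propagates to the pair. Limits are asked for almost everywhere
    on each space separately, because null sets of the two spaces do not correspond. *)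
Inductive closure : (T -> R) -> (T' -> R) -> Prop :=
| closure_base f f' : bounded_measurable f -> bounded_measurable f' ->
    base f f' -> closure f f'
| closure_lin (a b : R) f f' g g' : closure f f' -> closure g g' ->
    closure (fun o => a * f o + b * g o) (fun o => a * f' o + b * g' o)
| closure_lim (f_ : nat -> T -> R) (f'_ : nat -> T' -> R) f f' (M : R) :
    (forall k, closure (f_ k) (f'_ k)) ->
    (forall k o, `|f_ k o| <= M) -> (forall k o, `|f'_ k o| <= M) ->
    bounded_measurable f -> bounded_measurable f' ->
    {ae P, forall o, f_ ^~ o @ \oo --> f o} ->
    {ae P', forall o, f'_ ^~ o @ \oo --> f' o} ->
    closure f f'.

Lemma closure_bounded f f' : closure f f' -> bounded_measurable f /\ bounded_measurable f'.
Proof.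
elim=> // a b g g' h h' _ [bg bg'] _ [bh bh'].
by split; apply: bounded_measurableD; apply: bounded_measurableM => //;
  exact: bounded_measurable_cst.
Qed.

Lemma closureD f f' g g' : closure f f' -> closure g g' ->
  closure (fun o => f o + g o) (fun o => f' o + g' o).
Proof.
move=> hf hg; have := closure_lin 1 1 hf hg.
by under eq_fun do rewrite !mul1r; under [X in closure _ X -> _]eq_fun do rewrite !mul1r.
Qed.

Lemma closureZ a f f' : closure f f' ->
  closure (fun o => a * f o) (fun o => a * f' o).
Proof.
move=> hf; have := closure_lin a 0 hf hf.
by under eq_fun do rewrite mul0r addr0; under [X in closure _ X -> _]eq_fun do rewrite mul0r addr0.
Qed.

(** The weights are arbitrary bounded variables outside the closure. Later one of them carries the
    area, or is zero, which turns an equality of means into an orthogonality, or is a constant,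
    which turns it into an independence. *)
Lemma closure_mean (W : T -> R) (W' : T' -> R) :
  bounded_measurable W -> bounded_measurable W' ->
  (forall f f', base f f' -> mean P (fun o => W o * f o) = mean P' (fun o => W' o * f' o)) ->
  forall f f', closure f f' -> mean P (fun o => W o * f o) = mean P' (fun o => W' o * f' o).
Proof.
move=> bW bW' hb f f'; elim=> {f f'} [f f' _ _ /hb //|a b f f' g g' hf ef hg eg|f_ f'_ f f' M h IH hM hM' bf bf' cf cf'].
  have [bf bf'] := closure_bounded hf; have [bg bg'] := closure_bounded hg.
  have e : (fun o => W o * (a * f o + b * g o)) = (fun o => a * (W o * f o) + b * (W o * g o)).
    by apply/funext => o; ring.
  have e' : (fun o => W' o * (a * f' o + b * g' o)) = (fun o => a * (W' o * f' o) + b * (W' o * g' o)).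
    by apply/funext => o; ring.
  have bmZ d0 (S : measurableType d0) (c : R) (h k : S -> R) : bounded_measurable h ->
      bounded_measurable k -> bounded_measurable (fun o => c * (h o * k o)).
    by move=> bh bk; apply: bounded_measurableM; [exact: bounded_measurable_cst | exact: bounded_measurableM].
  rewrite e e' !meanD; try exact: bmZ.
  by rewrite !meanZ ?ef ?eg//; exact: bounded_measurableM.
have [N N0 hN] := bounded_measurable_pos bW.
have [N' N'0 hN'] := bounded_measurable_pos bW'.
have c1 : mean P (fun o => W o * f_ k o) @[k --> \oo] --> mean P (fun o => W o * f o).
  apply: (@cvg_mean _ _ _ P _ _ (N * M)).
  - by move=> k; apply: (bounded_measurableM bW (closure_bounded (h k)).1).1.
  - exact: (bounded_measurableM bW bf).1.
  - by move=> k o; rewrite normrM ler_pM.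
  - by apply: filterS cf => o ho; apply: cvgM => //; exact: cvg_cst.
have c2 : mean P' (fun o => W' o * f'_ k o) @[k --> \oo] --> mean P' (fun o => W' o * f' o).
  apply: (@cvg_mean _ _ _ P' _ _ (N' * M)).
  - by move=> k; apply: (bounded_measurableM bW' (closure_bounded (h k)).2).1.
  - exact: (bounded_measurableM bW' bf').1.
  - by move=> k o; rewrite normrM ler_pM.
  - by apply: filterS cf' => o ho; apply: cvgM => //; exact: cvg_cst.
apply: (cvg_unique _ c1 _); first exact: norm_hausdorff.
by rewrite /= (funext IH).
Qed.

Lemma closure_mean_eq : (forall f f', base f f' -> mean P f = mean P' f') ->
  forall f f', closure f f' -> mean P f = mean P' f'.
Proof.
move=> hb f f' hf.
have b1 e (S : measurableType e) := bounded_measurable_cst S (1 : R).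
have m1 e (S : measurableType e) (Q : probability S R) (h : S -> R) :
    mean Q (fun o => 1 * h o) = mean Q h.
  by congr (mean Q _); apply/funext => o; rewrite mul1r.
have := closure_mean (b1 _ T) (b1 _ T') _ hf; rewrite !m1; apply=> g g' /hb.
by rewrite !m1.
Qed.

Section Algebra.
Hypothesis baseM : forall f f' g g', base f f' -> base g g' ->
  closure (fun o => f o * g o) (fun o => f' o * g' o).

Let closureM_base f f' g g' : closure f f' -> base g g' ->
  bounded_measurable g -> bounded_measurable g' ->
  closure (fun o => f o * g o) (fun o => f' o * g' o).
Proof.
move=> hf hg bg bg'; elim: hf => {f f'} [f f' _ _ hf|a b f f' h h' hf ef hh eh|f_ f'_ f f' M h IH hM hM' bf bf' cf cf'].
- exact: baseM.
- have := closure_lin a b ef eh; congr closure; apply/funext => o; ring.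
- have [N N0 hN] := bounded_measurable_pos bg.
  have [N' N'0 hN'] := bounded_measurable_pos bg'.
  have M0 : 0 <= M by apply: le_trans (hM 0%N point) => //.
  apply: (@closure_lim _ _ _ _ (M * (N + N')) IH).
  + move=> k o; rewrite normrM ler_pM//; apply: le_trans (hN o) _; rewrite lerDl; exact: ltW.
  + move=> k o; rewrite normrM ler_pM//; apply: le_trans (hN' o) _; rewrite lerDr; exact: ltW.
  + exact: bounded_measurableM.
  + exact: bounded_measurableM.
  + by apply: filterS cf => o ho; apply: cvgM => //; exact: cvg_cst.
  + by apply: filterS cf' => o ho; apply: cvgM => //; exact: cvg_cst.
Qed.

(** The usual two-stage argument: an induction varies one factor only, so the other is first taken
    in the base and then in the whole closure. *)
Lemma closureM f f' g g' : closure f f' -> closure g g' ->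
  closure (fun o => f o * g o) (fun o => f' o * g' o).
Proof.
move=> hf hg; have [bf bf'] := closure_bounded hf.
elim: hg => {g g'} [g g' bg bg' hg|a b g g' h h' hg eg hh eh|g_ g'_ g g' M h IH hM hM' bg bg' cg cg'].
- exact: closureM_base.
- have := closure_lin a b eg eh; congr closure; apply/funext => o; ring.
- have [N N0 hN] := bounded_measurable_pos bf.
  have [N' N'0 hN'] := bounded_measurable_pos bf'.
  apply: (@closure_lim _ _ _ _ ((N + N') * M) IH).
  + move=> k o; rewrite normrM ler_pM//; apply: le_trans (hN o) _; rewrite lerDl; exact: ltW.
  + move=> k o; rewrite normrM ler_pM//; apply: le_trans (hN' o) _; rewrite lerDr; exact: ltW.
  + exact: bounded_measurableM.
  + exact: bounded_measurableM.
  + by apply: filterS cg => o ho; apply: cvgM => //; exact: cvg_cst.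
  + by apply: filterS cg' => o ho; apply: cvgM => //; exact: cvg_cst.
Qed.

Hypothesis base1 : closure (fun=> 1) (fun=> 1).

Lemma closure_cst c : closure (fun=> c) (fun=> c).
Proof.
have := closureZ c base1.
by under eq_fun do rewrite mulr1; under [X in closure _ X -> _]eq_fun do rewrite mulr1.
Qed.

Lemma closureB f f' g g' : closure f f' -> closure g g' ->
  closure (fun o => f o - g o) (fun o => f' o - g' o).
Proof.
move=> hf hg; have := closure_lin 1 (-1) hf hg.
by under eq_fun do rewrite mul1r mulN1r; under [X in closure _ X -> _]eq_fun do rewrite mul1r mulN1r.
Qed.

Lemma closureX f f' n : closure f f' ->
  closure (fun o => f o ^+ n) (fun o => f' o ^+ n).
Proof.
move=> hf; elim: n => [|n IH]; first exact: closure_cst.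
have := closureM hf IH.
by under eq_fun do rewrite -exprS; under [X in closure _ X -> _]eq_fun do rewrite -exprS.
Qed.

Lemma closure_sum (I : Type) (s : seq I) (f : I -> T -> R) (f' : I -> T' -> R) :
  (forall i, closure (f i) (f' i)) ->
  closure (fun o => \sum_(i <- s) f i o) (fun o => \sum_(i <- s) f' i o).
Proof.
move=> hf; elim: s => [|i s IH].
  under eq_fun do rewrite big_nil; under [X in closure _ X]eq_fun do rewrite big_nil; exact: closure_cst.
under eq_fun do rewrite big_cons; under [X in closure _ X]eq_fun do rewrite big_cons.
exact: closureD.
Qed.

Lemma closure_prod (I : Type) (s : seq I) (f : I -> T -> R) (f' : I -> T' -> R) :
  (forall i, closure (f i) (f' i)) ->
  closure (fun o => \prod_(i <- s) f i o) (fun o => \prod_(i <- s) f' i o).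
Proof.
move=> hf; elim: s => [|i s IH].
  under eq_fun do rewrite big_nil; under [X in closure _ X]eq_fun do rewrite big_nil; exact: closure_cst.
under eq_fun do rewrite big_cons; under [X in closure _ X]eq_fun do rewrite big_cons.
exact: closureM.
Qed.

(** The value is rescaled to (y + M) / (2 M) in [0, 1] and approximated by the staircase of
    [norm_floor_sum], a linear combination of indicators of superlevel sets. *)
Lemma closure_le f f' (M : R) : bounded_measurable f -> bounded_measurable f' ->
  0 < M -> (forall o, `|f o| <= M) -> (forall o, `|f' o| <= M) ->
  (forall c, closure (fun o => (c <= f o)%R%:R) (fun o => (c <= f' o)%R%:R)) ->
  closure f f'.
Proof.
move=> bf bf' M0 hf hf' hc.
pose a k (y : R) : R := k%:R^-1 * (\sum_(j < k) (j.+1%:R <= k%:R * ((y + M) / (2 * M)))%R%:R).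
have y01 y : `|y| <= M -> 0 <= (y + M) / (2 * M) <= 1.
  rewrite ler_norml => /andP[h1 h2]; have M2 : 0 < 2 * M by lra.
  by rewrite divr_ge0 ?(ltW M2)//=; [rewrite ler_pdivrMr//; lra | lra].
have cvg_a y : `|y| <= M -> - M + 2 * M * a k.+1 y @[k --> \oo] --> y.
  move=> hy; apply/cvgrPdist_le => e e0; near=> k.
  have hk := norm_floor_sum (y01 _ hy) (ltn0Sn k).
  have M2 : 0 < 2 * M by lra.
  have -> : y - (- M + 2 * M * a k.+1 y) = - (2 * M) * (a k.+1 y - (y + M) / (2 * M)).
    by field; lra.
  rewrite normrM normrN (gtr0_norm M2); apply: le_trans (_ : 2 * M * k.+1%:R^-1 <= _).
    by rewrite ler_pM2l.
  rewrite ler_pdivrMr ?ltr0n//.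
  have : 2 * M / e <= k%:R by near: k; exact: nbhs_infty_ger.
  rewrite ler_pdivrMr// -natr1; lra.
have bound y k : `|y| <= M -> `|- M + 2 * M * a k.+1 y| <= 4 * M.
  move=> hy; have := norm_floor_sum (y01 _ hy) (ltn0Sn k); have /andP[h1 h2] := y01 _ hy.
  have k1 : (k.+1%:R^-1 : R) <= 1 by rewrite invf_le1 ?ltr0n// ler1n.
  rewrite -/(a k.+1 y) ler_norml => /andP[h3 h4].
  move: (a k.+1 y) ((y + M) / (2 * M)) (k.+1%:R^-1) k1 h1 h2 h3 h4 => A Y z k1 h1 h2 h3 h4.
  have a1 : 0 <= (A + 1) * M by rewrite mulr_ge0 ?(ltW M0)//; lra.
  have a2 : 0 <= (2 - A) * M by rewrite mulr_ge0 ?(ltW M0)//; lra.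
  rewrite ler_norml; apply/andP; split; lra.
have cl k : closure (fun o => - M + 2 * M * a k (f o)) (fun o => - M + 2 * M * a k (f' o)).
  apply: closureD; first exact: closure_cst.
  rewrite /a; do 2 (apply: closureZ); apply: closure_sum => j.
  have e (g : R) : (j.+1%:R <= k%:R * ((g + M) / (2 * M)))%R =
      (j.+1%:R / k%:R * (2 * M) - M <= g)%R.
    have k0 : (0 < k)%N by exact: leq_ltn_trans (ltn_ord j).
    rewrite lerBlDr -ler_pdivlMr ?mulr_gt0// ler_pdivrMr ?ltr0n//.
    by rewrite mulrC.
  under eq_fun do rewrite e; under [X in closure _ X]eq_fun do rewrite e.
  exact: hc.
apply: (closure_lim (fun k => cl k.+1) (M := 4 * M)) => //.
- by move=> k o; exact: bound.
- by move=> k o; exact: bound.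
- by apply: aeW => o; exact: cvg_a.
- by apply: aeW => o; exact: cvg_a.
Unshelve. all: by end_near.
Qed.

(** Partial sums of the exponential series are polynomials, bounded by the exponential of a bound of
    the variable. *)
Lemma closure_expR f f' : closure f f' ->
  closure (fun o => expR (f o)) (fun o => expR (f' o)).
Proof.
move=> hf; have [bf bf'] := closure_bounded hf.
have [N N0 hN] := bounded_measurable_pos bf.
have [N' N'0 hN'] := bounded_measurable_pos bf'.
have hb x M k : `|x| <= M -> `|series (exp_coeff x) k| <= expR M.
  move=> xM; have M0 : 0 <= M by exact: le_trans xM.
  apply: le_trans (_ : series (exp_coeff M) k <= _).
    rewrite /series/=; apply: le_trans (ler_norm_sum _ _ _) _.
    apply: ler_sum => i _; rewrite /exp_coeff/= normrM normrX [X in _ * X]ger0_norm ?invr_ge0//.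
    by rewrite ler_wpM2r ?invr_ge0// lerXn2r ?nnegrE.
  apply: nondecreasing_cvgn_le; last exact: is_cvg_series_exp_coeff.
  by apply: nondecreasing_series => i _ _; exact: exp_coeff_ge0.
apply: (@closure_lim (fun k o => series (exp_coeff (f o)) k) (fun k o => series (exp_coeff (f' o)) k) _ _ (expR (N + N'))).
- move=> k; rewrite /series/=; apply: closure_sum => i.
  rewrite /exp_coeff/=.
  have := closureZ (i`!%:R^-1) (closureX i hf).
  by under eq_fun do rewrite mulrC; under [X in closure _ X -> _]eq_fun do rewrite mulrC.
- move=> k o; apply: hb; apply: le_trans (hN o) _; rewrite lerDl; exact: ltW.
- move=> k o; apply: hb; apply: le_trans (hN' o) _; rewrite lerDr; exact: ltW.
- exact: bounded_measurable_expR.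
- exact: bounded_measurable_expR.
- by apply: aeW => o; exact: is_cvg_series_exp_coeff.
- by apply: aeW => o; exact: is_cvg_series_exp_coeff.
Qed.

(** At [f o = 0] the cut-off equals [expR (- n)], which tends to 0: the limit is the indicator of
    the strict inequality even if the level 0 has positive probability. *)
Lemma closure_lt0 f f' : closure f f' ->
  closure (fun o => (f o < 0)%R%:R) (fun o => (f' o < 0)%R%:R).
Proof.
move=> hf; have [bf bf'] := closure_bounded hf.
have ha n : closure (fun o => expR (- (n%:R * expR (n%:R * f o)))) (fun o => expR (- (n%:R * expR (n%:R * f' o)))).
  have := closure_expR (closureZ (- n%:R) (closure_expR (closureZ n%:R hf))).
  by under eq_fun do rewrite mulNr; under [X in closure _ X -> _]eq_fun do rewrite mulNr.
have hm e (S : measurableType e) (h : S -> R) : bounded_measurable h ->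
    bounded_measurable (fun o => (h o < 0)%R%:R : R).
  move=> [mh _]; split; last by exists 1 => o; case: (_ < _); rewrite ?normr1 ?normr0.
  rewrite (_ : (fun _ => _) = \1_(h @^-1` `]-oo, 0[)).
    by apply: measurable_indic; rewrite -[X in measurable X]setTI; exact: mh.
  by apply/funext => o; rewrite indicE; congr ((nat_of_bool _)%:R); apply/idP/idP => ho; [rewrite inE/= in_itv | move: ho; rewrite inE/= in_itv].
apply: (closure_lim ha (M := 1)) => //.
- by move=> k o; rewrite ger0_norm ?expR_ge0// expR_le1 oppr_le0 mulr_ge0// expR_ge0.
- by move=> k o; rewrite ger0_norm ?expR_ge0// expR_le1 oppr_le0 mulr_ge0// expR_ge0.
- exact: hm.
- exact: hm.
- by apply: aeW => o; exact: cvg_indic_lt0.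
- by apply: aeW => o; exact: cvg_indic_lt0.
Qed.

(** Geometric series for x + e = 1 - (1 - x - e): the ratio has absolute value less than 1 on [0, 1]
    because 0 < e < 1, and the partial sums are at most 2 / e uniformly in x. *)
Lemma closure_inv f f' (e : R) : 0 < e < 1 -> closure f f' ->
  (forall o, 0 <= f o <= 1) -> (forall o, 0 <= f' o <= 1) ->
  closure (fun o => (f o + e)^-1) (fun o => (f' o + e)^-1).
Proof.
move=> /andP[e0 e1] hf f01 f'01; have [bf bf'] := closure_bounded hf.
have hz x : 0 <= x <= 1 -> `|1 - x - e| < 1.
  by move=> /andP[x0 x1]; rewrite ltr_norml; apply/andP; split; lra.
have h1 (x : R) : x + e = 1 - (1 - x - e) by ring.
have hb (x : R) k : 0 <= x <= 1 -> `|series (geometric 1 (1 - x - e)) k| <= 2 / e.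
  move=> x01; have hx := hz _ x01; case/andP: (x01) => x0 x1.
  have d0 : 0 < x + e by lra.
  rewrite geometric_seriesE; last by apply/negP => /eqP E; move: d0; rewrite h1 E subrr ltxx.
  rewrite /= mul1r -h1 normrM normfV (gtr0_norm d0).
  have h2 : `|1 - (1 - x - e) ^+ k| <= 2.
    apply: le_trans (ler_normB _ _) _; rewrite normr1 normrX.
    have := exprn_ile1 k (normr_ge0 _) (ltW hx); lra.
  apply: ler_pM => //; first by rewrite invr_ge0 ltW.
  by rewrite lef_pV2// ?posrE// lerDr.
have hm d0 (S : measurableType d0) (h : S -> R) : bounded_measurable h ->
    (forall o, 0 <= h o <= 1) -> bounded_measurable (fun o => (h o + e)^-1).
  move=> [mh _] h01; split.
    apply: (@measurable_fun_cvg _ _ _ _ (fun k o => series (geometric 1 (1 - h o - e)) k)).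
      move=> k; rewrite /series/=; apply: measurable_sum => i.
      apply: measurable_funM => //; apply: measurable_funX.
      by apply: measurable_funB => //; apply: measurable_funB.
    move=> o _; rewrite h1 -[X in _ --> X]mul1r; apply: cvg_geometric_series.
    exact: hz.
  exists (2 / e) => o; have /andP[h0 _] := h01 o.
  have d0' : 0 < h o + e by lra.
  rewrite normfV (gtr0_norm d0'); apply: le_trans (_ : e^-1 <= _).
    by rewrite lef_pV2// ?posrE// lerDr.
  by have : 0 < e^-1 by [rewrite invr_gt0]; lra.
apply: (@closure_lim (fun k o => series (geometric 1 (1 - f o - e)) k) (fun k o => series (geometric 1 (1 - f' o - e)) k) _ _ (2 / e)).
- move=> k; rewrite /series/=; apply: closure_sum => i.
  apply: closureZ; apply: closureX; apply: closureB; last exact: closure_cst.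
  by apply: closureB => //; exact: closure_cst.
- by move=> k o; exact: hb.
- by move=> k o; exact: hb.
- exact: hm.
- exact: hm.
- by apply: aeW => o; rewrite h1 -[X in _ --> X]mul1r; apply: cvg_geometric_series; exact: hz.
- by apply: aeW => o; rewrite h1 -[X in _ --> X]mul1r; apply: cvg_geometric_series; exact: hz.
Qed.

End Algebra.
End Closure.

(** * Smooth functions and the Laplacian in the chart *)

Section Flat.
Variable R : realType.

(** The classical flat function is the case k = 0. All powers of the inverse are included so that
    the family is closed under differentiation, up to linear combinations. *)
Definition flat (k : nat) (x : R) : R :=
  if 0 < x then x^-1 ^+ k * expR (- x^-1) else 0.

Lemma flat_ge0 k x : 0 <= flat k x.
Proof.
rewrite /flat; case: ifP => // x0.
by rewrite mulr_ge0 ?expR_ge0// exprn_ge0// invr_ge0 ltW.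
Qed.

Lemma flat_gt0 k x : 0 < x -> 0 < flat k x.
Proof. by move=> x0; rewrite /flat x0 mulr_gt0 ?expR_gt0// exprn_gt0// invr_gt0. Qed.

Lemma flat_le0 k x : x <= 0 -> flat k x = 0.
Proof. by rewrite /flat ltNge => ->. Qed.

(** A single term of the exponential series, that of order k + 2, beats the inverse power and leaves
    x^2; this yields the derivative 0 at the origin. *)
Lemma flat_le_sqr k x : flat k x <= (k.+2)`!%:R * x ^+ 2.
Proof.
rewrite /flat; case: ifP => [x0|_]; last by rewrite mulr_ge0// sqr_ge0.
have y0 : 0 < x^-1 by rewrite invr_gt0.
have := expR_ge1Dxn k.+1 (ltW y0); set y := x^-1 => h.
have f0 : (0 : R) < (k.+2)`!%:R by rewrite ltr0n fact_gt0.
have h2 : y ^+ k.+2 / (k.+2)`!%:R <= expR y by apply: le_trans h; rewrite lerDr.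
have -> : x = y^-1 by rewrite invrK.
rewrite expRN ler_pdivrMr ?expR_gt0// exprVn.
rewrite ler_pdivrMr// in h2.
have -> : x ^- k = y ^+ k.+2 * x ^+ 2.
  rewrite /y -addn2 exprD -mulrA -exprMn mulVf ?gt_eqF// expr1n mulr1 exprVn//.
rewrite (_ : y^-1 = x); last by rewrite /y invrK.
by rewrite [leRHS]mulrAC ler_wpM2r ?sqr_ge0// mulrC.
Qed.

Lemma is_derive_flat (k : nat) (x : R) :
  is_derive x 1 (flat k) (flat k.+2 x - k%:R * flat k.+1 x).
Proof.
have [x0|x0|->] := ltgtP x 0.
- rewrite !flat_le0 ?ltW// mulr0 subrr.
  apply: (@near_eq_is_derive _ _ _ (cst (0 : R))).
    near=> y; by rewrite flat_le0// ltW//; near: y; exact: lt_nbhsl.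
- have xn : x != 0 by rewrite gt_eqF.
  pose F := (fun y : R => y^-1 ^+ k * expR (- y^-1) : R).
  apply: (@near_eq_is_derive _ R R F).
    near=> y; rewrite /flat ifT//; near: y; exact: lt_nbhsr.
  have dV : is_derive x 1 (fun y : R => y^-1) (- x ^- 2).
    by apply: is_derive_eq; first exact: is_deriveV; rewrite scaler1.
  have d1 := is_deriveX k dV.
  have d2 : is_derive x 1 (fun y : R => expR (- y^-1)) (expR (- x^-1) * (- - x ^- 2)).
    exact: (@is_derive1_comp _ expR (fun y => - y^-1)).
  rewrite (_ : F = (fun y : R => y^-1) ^+ k * (fun y => expR (- y^-1))); last first.
    by apply/funext => y; rewrite /F !fctE.
  have := is_deriveM d1 d2 => /is_derive_eq; apply.
  rewrite /flat x0/= /GRing.scale/=.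
  rewrite (_ : ([eta GRing.inv] ^+ k) x = x^-1 ^+ k); last by rewrite fctE.
  rewrite -!exprVn; set E := expR _; set y := x^-1.
  case: (k) => [|j]; rewrite ?exprS /=; ring.
- rewrite !flat_le0// mulr0 subrr.
  have cv : (fun h : R => h^-1 *: (flat k (h *: (1 : R) + 0) - flat k 0)) @ 0^' --> (0 : R).
    apply/cvgrPdist_le => e e0; near=> h.
    have hn : h != 0 by near: h; exact: nbhs_dnbhs_neq.
    have he : `|h| <= e / (k.+2)`!%:R.
      near: h; apply: dnbhs0_le.
      by rewrite divr_gt0// ltr0n fact_gt0.
    rewrite sub0r normrN addr0 /GRing.scale/= mulr1 (flat_le0 _ (lexx 0)) subr0.
    rewrite normrM normfV (ger0_norm (flat_ge0 _ _)) mulrC ler_pdivrMr ?normr_gt0//.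
    apply: le_trans (flat_le_sqr _ _) _; rewrite -real_normK ?num_real// expr2 mulrA.
    rewrite ler_wpM2r// mulrC -ler_pdivlMr// ltr0n fact_gt0//.
  apply: DeriveDef; first by apply/cvg_ex; exists 0.
  exact: cvg_lim cv.
Unshelve. all: by end_near.
Qed.

End Flat.

Section SmoothFunctions.
Variables (R : realType) (m k : nat).
Notation V := 'M[R]_(m, k).
Implicit Types (f g : V -> R) (x : V) (a b : 'I_(m * k)).

Definition crd a x : R := mxvec x 0 a.

(** A syntactic class of smooth functions: it is stable under [partial], so smoothness is proved by
    one structural induction, and every rule of calculus used below applies without separate
    differentiability arguments. *)
Inductive tame : (V -> R) -> Prop :=
| tame_cst c : tame (fun=> c)
| tame_crd a : tame (crd a)
| tameD f g : tame f -> tame g -> tame (fun x => f x + g x)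
| tameM f g : tame f -> tame g -> tame (fun x => f x * g x)
| tame_flat l f : tame f -> tame (fun x => flat l (f x))
| tameV f : tame f -> (forall x, 0 < f x) -> tame (fun x => (f x)^-1).

Lemma tameN f : tame f -> tame (fun x => - f x).
Proof.
move=> hf; have := tameM (tame_cst (-1)) hf.
by under eq_fun do rewrite mulN1r.
Qed.

Lemma tameB f g : tame f -> tame g -> tame (fun x => f x - g x).
Proof. by move=> hf hg; apply: tameD => //; exact: tameN. Qed.

Lemma tameX f n : tame f -> tame (fun x => f x ^+ n).
Proof.
move=> hf; elim: n => [|n IH]; first exact: tame_cst.
have := tameM hf IH; by under eq_fun do rewrite -exprS.
Qed.

Lemma tame_sum (I : Type) (s : seq I) (F : I -> V -> R) :
  (forall i, tame (F i)) -> tame (fun x => \sum_(i <- s) F i x).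
Proof.
move=> hF; elim: s => [|i s IH].
  by under eq_fun do rewrite big_nil; exact: tame_cst.
by under eq_fun do rewrite big_cons; exact: tameD.
Qed.

Lemma derive_comp1 (h : R -> R) f x v : differentiable f x -> derivable h (f x) 1 ->
  'D_v (fun y => h (f y)) x = 'D_1 h (f x) * 'D_v f x.
Proof.
move=> df /derivable1_diffP dh.
rewrite deriveE; last exact: differentiable_comp.
rewrite (diff_comp df dh)/= deriv1E; last exact/derivable1_diffP.
by rewrite -deriveE// derive1E /GRing.scale/= mulrC.
Qed.

Lemma tame_differentiable f : tame f -> forall x, differentiable f x.
Proof.
elim=> {f} [c x|a x|f g _ hf _ hg x|f g _ hf _ hg x|l f _ hf x|f _ hf f0 x].
- exact: differentiable_cst.
- case/mxvec_indexP: a => i j; rewrite (_ : crd _ = (fun y : V => y i j)).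
    exact: differentiable_coord.
  by apply/funext => y; rewrite /crd mxvecE.
- exact: differentiableD.
- exact: differentiableM.
- apply: (differentiable_comp (hf x)); apply/derivable1_diffP.
  by have [] := is_derive_flat l (f x).
- by apply: differentiableV => //; rewrite gt_eqF.
Qed.

Lemma crdD a x y : crd a (x + y) = crd a x + crd a y.
Proof. by rewrite /crd linearD mxE. Qed.

Lemma crdZ a (c : R) x : crd a (c *: x) = c * crd a x.
Proof. by rewrite /crd linearZ mxE. Qed.

Lemma crd_coordv a b : crd b (coordv R a) = (a == b)%:R.
Proof. by rewrite /crd /coordv vec_mxK mxE eqxx eq_sym. Qed.

Lemma partial_crd a b : partial a (crd b) = (fun=> (a == b)%:R).
Proof.
apply/funext => x; rewrite /partial /derive -(crd_coordv a b).
apply: cvg_lim; first exact: norm_hausdorff.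
apply: cvg_near_cst; near=> h.
have hn : h != 0 by near: h; exact: nbhs_dnbhs_neq.
by rewrite /= crdD crdZ addrK /GRing.scale/= mulKf.
Unshelve. all: by end_near.
Qed.

Lemma tame_derivable f : tame f -> forall x v, derivable f x v.
Proof. by move=> hf x v; apply: diff_derivable; exact: tame_differentiable. Qed.

Lemma partialD a f g : tame f -> tame g ->
  partial a (fun x => f x + g x) = (fun x => partial a f x + partial a g x).
Proof. by move=> hf hg; apply/funext => x; rewrite /partial deriveD//; exact: tame_derivable. Qed.

Lemma partialM a f g : tame f -> tame g ->
  partial a (fun x => f x * g x) = (fun x => partial a f x * g x + f x * partial a g x).
Proof.
move=> hf hg; apply/funext => x; rewrite /partial deriveM; try exact: tame_derivable.
by rewrite /GRing.scale/= addrC; congr (_ + _); rewrite mulrC.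
Qed.

Lemma partial_cst a (c : R) : partial a (fun=> c) = (fun=> 0 : R).
Proof. by apply/funext => x; rewrite /partial derive_cst. Qed.

Lemma partial_flat a l f : tame f -> partial a (fun x => flat l (f x)) =
  (fun x => (flat l.+2 (f x) - l%:R * flat l.+1 (f x)) * partial a f x).
Proof.
move=> hf; apply/funext => x; have [dF eF] := is_derive_flat l (f x).
by rewrite /partial derive_comp1 ?eF//; exact: tame_differentiable.
Qed.

Lemma partialV a f : tame f -> (forall x, 0 < f x) ->
  partial a (fun x => (f x)^-1) = (fun x => - ((f x)^-1 * (f x)^-1) * partial a f x).
Proof.
move=> hf f0; apply/funext => x; rewrite /partial deriveV ?gt_eqF//; last exact: tame_derivable.
by rewrite /GRing.scale/= -exprVn expr2.
Qed.

Lemma tame_partial f a : tame f -> tame (partial a f).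
Proof.
elim=> {f} [c|b|f g hf hpf hg hpg|f g hf hpf hg hpg|l f hf hpf|f hf hpf f0].
- by rewrite partial_cst; exact: tame_cst.
- by rewrite partial_crd; exact: tame_cst.
- by rewrite partialD//; exact: tameD.
- by rewrite partialM//; apply: tameD; exact: tameM.
- rewrite partial_flat//; apply: tameM => //; apply: tameB; first exact: tame_flat.
  by apply: tameM; [exact: tame_cst | exact: tame_flat].
- by rewrite partialV//; apply: tameM => //; apply: tameN; apply: tameM; exact: tameV.
Qed.

Lemma tame_continuous f : tame f -> continuous f.
Proof. by move=> hf x; apply: differentiable_continuous; exact: tame_differentiable. Qed.

Lemma tame_smooth f : tame f -> smooth f.
Proof.
move=> hf s; have h : tame (foldr (@partial R m k) f s).
  by elim: s => //= a s IH; exact: tame_partial.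
by split; [exact: tame_continuous | move=> a x; exact: tame_derivable].
Qed.

Lemma partial_sum a (I : Type) (s : seq I) (F : I -> V -> R) :
  (forall i, tame (F i)) ->
  partial a (fun x => \sum_(i <- s) F i x) = (fun x => \sum_(i <- s) partial a (F i) x).
Proof.
move=> hF; elim: s => [|i s IH].
  under eq_fun do rewrite big_nil; rewrite partial_cst.
  by under [RHS]eq_fun do rewrite big_nil.
under eq_fun do rewrite big_cons; under [RHS]eq_fun do rewrite big_cons.
by rewrite partialD// ?IH//; exact: tame_sum.
Qed.

Lemma partialX a f n : tame f -> partial a (fun x => f x ^+ n) =
  (fun x => n%:R * f x ^+ n.-1 * partial a f x).
Proof.
move=> hf; elim: n => [|n IH].
  by rewrite partial_cst; apply/funext => x; rewrite !mul0r.
have -> : (fun x => f x ^+ n.+1) = (fun x => f x * f x ^+ n).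
  by apply/funext => x; rewrite exprS.
rewrite partialM//; last exact: tameX.
rewrite IH; apply/funext => x /=; case: n {IH} => [|n]; first by rewrite expr0; ring.
rewrite /= exprS -[n.+2%:R]natr1; ring.
Qed.

Lemma partial_locally_cst a f c x : (\forall y \near x, f y = c) -> partial a f x = 0.
Proof.
move=> h; rewrite /partial (@near_eq_derive _ _ _ f (cst c)) ?derive_cst//.
Qed.

End SmoothFunctions.

(** * The metric and the Laplacian in quaternionic coordinates *)

Section Geometry.
Variables (R : realType) (n : nat).
Notation V := 'M[R]_(n, 4).
Implicit Types (x y u v : V) (f g : V -> R) (a b : 'I_(n * 4)).

Definition ip x y : R := \sum_i \sum_j x i j * y i j.

(* [xi l x] is e_l x for e_0, ..., e_3 = 1, I, J, K, so that the components of the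
   quaternion \sum_j v_j \overline{x_j} are the [ip v (xi l x)]. *)
Definition xi (l : 'I_4) x : V := \matrix_(i, j)
  (nth [::] [:: [:: x i (inord 0); x i (inord 1); x i (inord 2); x i (inord 3)];
     [:: - x i (inord 1); x i (inord 0); - x i (inord 3); x i (inord 2)];
     [:: - x i (inord 2); x i (inord 3); x i (inord 0); - x i (inord 1)];
     [:: - x i (inord 3); - x i (inord 2); x i (inord 1); x i (inord 0)]] l)`_j.

Lemma sum_ord4 (F : 'I_4 -> R) : \sum_j F j =
  F (inord 0) + F (inord 1) + F (inord 2) + F (inord 3).
Proof.
rewrite !big_ord_recl big_ord0 addr0 !addrA.
by do ! (congr (_ + _)); congr (F _); apply/val_inj; rewrite /= inordK.
Qed.

Lemma ord4P (Q : 'I_4 -> Prop) : Q (inord 0) -> Q (inord 1) -> Q (inord 2) -> Q (inord 3) ->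
  forall l, Q l.
Proof.
move=> h0 h1 h2 h3 l.
have -> : l = inord l by apply/val_inj; rewrite /= inordK.
by case: l => [[|[|[|[|//]]]] ?] /=.
Qed.

Lemma ipC x y : ip x y = ip y x.
Proof. by apply: eq_bigr => i _; apply: eq_bigr => j _; rewrite mulrC. Qed.

Lemma normsq_ip x : normsq x = ip x x.
Proof. by apply: eq_bigr => i _; apply: eq_bigr => j _; rewrite expr2. Qed.

Lemma normsq_ge0 x : 0 <= normsq x.
Proof. by rewrite /normsq; do 2 (apply: sumr_ge0 => ? _); rewrite sqr_ge0. Qed.

Lemma sum_crd x y : \sum_a crd a x * crd a y = ip x y.
Proof.
rewrite /ip pair_bigA /= (reindex _ (curry_mxvec_bij n 4))/=.
by apply: eq_bigr => -[i j] _ /=; rewrite /crd !mxvecE.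
Qed.

Lemma ip_coordv a x : ip (coordv R a) x = crd a x.
Proof.
rewrite -sum_crd (bigD1 a)//= crd_coordv eqxx mul1r big1 ?addr0// => b ba.
by rewrite crd_coordv eq_sym (negbTE ba) mul0r.
Qed.

Lemma normsq_crd x : normsq x = \sum_a crd a x ^+ 2.
Proof. by rewrite normsq_ip -sum_crd; apply: eq_bigr => a _; rewrite expr2. Qed.

(** Left multiplications by the units are isometries, and they carry x to four mutually orthogonal
    vectors. *)
Lemma ip_xi l1 l2 x : ip (xi l1 x) (xi l2 x) = (l1 == l2)%:R * normsq x.
Proof.
rewrite /ip /normsq mulr_sumr; apply: eq_bigr => i _.
rewrite !sum_ord4 !mxE !inordK//.
by elim/ord4P: l1; elim/ord4P: l2; rewrite -val_eqE /= !inordK//= ?mulr0n ?mulr1n; ring.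
Qed.

Lemma xi0 x : xi (inord 0) x = x.
Proof. by apply/matrixP => i; apply: ord4P; rewrite mxE !inordK. Qed.

Lemma xi_xi l x : xi l (xi l x) = if l == inord 0 then x else - x.
Proof.
elim/ord4P: l; rewrite -val_eqE /= !inordK//=; apply/matrixP => i; apply: ord4P;
  rewrite !mxE !inordK//= ?opprK//.
Qed.

Lemma xiD l x y : xi l (x + y) = xi l x + xi l y.
Proof.
by elim/ord4P: l; apply/matrixP => i; apply: ord4P;
  rewrite !mxE !inordK//= ?opprD.
Qed.

Lemma xiZ l (c : R) x : xi l (c *: x) = c *: xi l x.
Proof.
by elim/ord4P: l; apply/matrixP => i; apply: ord4P;
  rewrite !mxE !inordK//= ?mulrN.
Qed.

Lemma ip_xi_skew l x y : l != inord 0 -> ip (xi l x) y = - ip x (xi l y).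
Proof.
move=> l0; rewrite /ip -sumrN; apply: eq_bigr => i _.
rewrite !sum_ord4 !mxE !inordK//; move: l0.
by elim/ord4P: l; rewrite -val_eqE /= !inordK//= => _; ring.
Qed.

Lemma qmul_conj_xi x v l :
  (\sum_j qmul (row j v) (qconj (row j x))) 0 l = ip v (xi l x).
Proof.
rewrite summxE /ip; apply: eq_bigr => i _; rewrite !sum_ord4.
by elim/ord4P: l; rewrite /qmul /qconj /quat /qRe /qI /qJ /qK !mxE !inordK//=; ring.
Qed.

Definition phi x : R := (1 + normsq x)^-1.

Lemma phi_gt0 x : 0 < phi x.
Proof. by rewrite invr_gt0 ltr_wpDr ?normsq_ge0. Qed.

Lemma phi_le1 x : phi x <= 1.
Proof. by rewrite invf_le1 ?lerDl ?normsq_ge0// ltr_wpDr ?normsq_ge0. Qed.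

Lemma phiE x : (1 + normsq x) * phi x = 1.
Proof. by rewrite /phi divff// gt_eqF// ltr_wpDr ?normsq_ge0. Qed.

Lemma normsq_phi x : normsq x * phi x = 1 - phi x.
Proof. by rewrite -[X in X - _](phiE x); ring. Qed.

Lemma hp_metric_xi x v :
  hp_metric x v = phi x * normsq v - phi x ^+ 2 * \sum_l ip v (xi l x) ^+ 2.
Proof.
rewrite /hp_metric mulrC -/(phi x); congr (_ - _).
rewrite -exprVn -/(phi x) mulrC; congr (_ * _).
rewrite /normsq big_ord1; apply: eq_bigr => l _.
by rewrite qmul_conj_xi.
Qed.

Let D := (n * 4)%N.
(** With this matrix the metric is a multiple of the identity minus a perturbation of rank at most
    4, so that its determinant and inverse reduce to 4 by 4 matrices, which are scalar by
    [XiXiT]. *)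
Definition Xi x : 'M[R]_(4, D) := \matrix_(l, a) crd a (xi l x).

Lemma XiXiT x : Xi x *m (Xi x)^T = (normsq x)%:M.
Proof.
apply/matrixP => i j; rewrite !mxE.
under eq_bigr do rewrite !mxE.
by rewrite sum_crd ip_xi mulrC mulr_natr.
Qed.

Lemma gram_hp x : gram (@hp_metric R n) x = phi x *: (1%:M - phi x *: ((Xi x)^T *m Xi x)).
Proof.
apply/matrixP => a b; rewrite !mxE !hp_metric_xi.
have ipDl (u v y : V) : ip (u + v) y = ip u y + ip v y.
  by rewrite -!sum_crd -big_split/=; apply: eq_bigr => c _; rewrite crdD mulrDl.
have e l : ip (coordv R a + coordv R b) (xi l x) ^+ 2 =
    ip (coordv R a) (xi l x) ^+ 2 + ip (coordv R b) (xi l x) ^+ 2 +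
    2 * (crd a (xi l x) * crd b (xi l x)).
  by rewrite ipDl !ip_coordv; ring.
under eq_bigr do rewrite e.
rewrite !big_split/= -mulr_sumr.
have -> : normsq (coordv R a + coordv R b) = normsq (coordv R a) + normsq (coordv R b) + 2 * (a == b)%:R.
  by rewrite !normsq_ip ipDl ![ip _ (_ + _)]ipC !ipDl !ip_coordv !crd_coordv [b == a]eq_sym; ring.
have -> : \sum_j (Xi x)^T a j * Xi x j b = \sum_l crd a (xi l x) * crd b (xi l x).
  by apply: eq_bigr => l _; rewrite !mxE.
by field.
Qed.

(** Sylvester's determinant identity, from two triangular factorizations of one block matrix. *)
Lemma det_1B_comm p q (A : 'M[R]_(p, q)) (B : 'M[R]_(q, p)) :
  \det (1%:M - A *m B) = \det (1%:M - B *m A).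
Proof.
have e1 : block_mx 1%:M A B 1%:M = block_mx 1%:M 0 B 1%:M *m block_mx 1%:M A 0 (1%:M - B *m A).
  by rewrite mulmx_block !mul1mx !mulmx1 ?mul0mx ?mulmx0 ?addr0 ?add0r [B *m A + _]addrC subrK.
have e2 : block_mx 1%:M A B 1%:M = block_mx 1%:M A 0 1%:M *m block_mx (1%:M - A *m B) 0 B 1%:M.
  by rewrite mulmx_block !mul1mx !mulmx1 ?mul0mx ?mulmx0 ?addr0 ?add0r subrK.
have := congr1 determinant e2; rewrite e1 !det_mulmx !det_ublock !det_lblock !det1 !mul1r !mulr1.
by move->.
Qed.

Lemma det_gram_hp x : \det (gram (@hp_metric R n) x) = phi x ^+ (D + 4).
Proof.
rewrite gram_hp detZ scalemxAl det_1B_comm -scalemxAr XiXiT exprD; congr (_ * _).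
rewrite (_ : 1%:M - _ = (phi x)%:M) ?det_scalar//.
apply/matrixP => i j; rewrite !mxE; case: (i == j); rewrite ?mulr0n ?mulr0 ?subr0// !mulr1n.
by rewrite mulrC normsq_phi; ring.
Qed.

Lemma inv_gram_hp x :
  invmx (gram (@hp_metric R n) x) = (1 + normsq x) *: (1%:M + (Xi x)^T *m Xi x).
Proof.
have h : gram (@hp_metric R n) x *m ((1 + normsq x) *: (1%:M + (Xi x)^T *m Xi x)) = 1%:M.
  rewrite gram_hp -scalemxAl -scalemxAr scalerA mulrC phiE scale1r.
  rewrite mulmxBl mul1mx mulmxDr mulmx1 -!scalemxAl.
  have -> : (Xi x)^T *m Xi x *m ((Xi x)^T *m Xi x) = normsq x *: ((Xi x)^T *m Xi x).
    by rewrite mulmxA -(mulmxA _ (Xi x)) XiXiT mul_mx_scalar -scalemxAl.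
  rewrite scalerA -scalerDl (_ : phi x + phi x * normsq x = 1) ?scale1r ?addrK//.
  by rewrite -[RHS](phiE x); ring.
have [u _] := mulmx1_unit h.
by rewrite -[RHS](mulKmx u) h mulmx1.
Qed.


Lemma sum_coordv x : x = \sum_a crd a x *: coordv R a.
Proof.
apply: (can_inj mxvecK); rewrite linear_sum/= [LHS]row_sum_delta.
by apply: eq_bigr => a _; rewrite linearZ/= /coordv vec_mxK.
Qed.

Definition xi_coef (l : 'I_4) a b : R := crd a (xi l (coordv R b)).

Lemma crd_xi l a x : crd a (xi l x) = \sum_b crd b x * xi_coef l a b.
Proof.
rewrite {1}(sum_coordv x); elim: (index_enum _) => [|b s IH].
  rewrite !big_nil -(scale0r (0 : V)) xiZ crdZ mul0r//.
by rewrite !big_cons xiD xiZ crdD crdZ IH.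
Qed.

Lemma tame_crd_xi l a : tame (fun x => crd a (xi l x)).
Proof.
under eq_fun do rewrite crd_xi.
by apply: tame_sum => b; apply: tameM; [exact: tame_crd | exact: tame_cst].
Qed.

Lemma tame_normsq : tame (@normsq R n 4).
Proof.
rewrite (_ : @normsq _ _ _ = fun x => \sum_a crd a x ^+ 2); last exact/funext/normsq_crd.
by apply: tame_sum => a; apply: tameX; exact: tame_crd.
Qed.

Let den_gt0 x : 0 < 1 + normsq x.
Proof. by rewrite ltr_wpDr ?normsq_ge0. Qed.

Lemma tame_phi : tame phi.
Proof.
by apply: tameV => //; apply: tameD; [exact: tame_cst | exact: tame_normsq].
Qed.

Lemma partial_normsq a : partial a (@normsq R n 4) = (fun x => 2 * crd a x).
Proof.
rewrite (_ : @normsq _ _ _ = fun x => \sum_a crd a x ^+ 2); last exact/funext/normsq_crd.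
rewrite partial_sum; last by move=> b; apply: tameX; exact: tame_crd.
apply/funext => x; rewrite (bigD1 a)//= partialX ?partial_crd ?eqxx; last exact: tame_crd.
rewrite /= big1 ?addr0 ?mulr1// => b ba.
by rewrite partialX ?partial_crd 1?eq_sym ?(negbTE ba) ?mulr0//; exact: tame_crd.
Qed.

Lemma partial_phi a : partial a phi = (fun x => - 2 * phi x ^+ 2 * crd a x).
Proof.
rewrite /phi partialV//; last by apply: tameD; [exact: tame_cst | exact: tame_normsq].
rewrite partialD ?partial_cst ?partial_normsq; [|exact: tame_cst|exact: tame_normsq].
by apply/funext => x; ring.
Qed.

Lemma partial_crd_xi l a b : partial b (fun x => crd a (xi l x)) = (fun=> xi_coef l a b).
Proof.
rewrite (_ : (fun x => crd a (xi l x)) = fun x => \sum_b crd b x * xi_coef l a b); last first.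
  by apply/funext => x; exact: crd_xi.
rewrite partial_sum; last by move=> c; apply: tameM; [exact: tame_crd | exact: tame_cst].
apply/funext => x.
under eq_bigr => c _.
  rewrite partialM ?partial_crd ?partial_cst; [|exact: tame_crd|exact: tame_cst].
  rewrite mulr0 addr0; over.
by rewrite (bigD1 b)//= eqxx mul1r big1 ?addr0// => c cb; rewrite eq_sym (negbTE cb) mul0r.
Qed.

Lemma xi_divergence l : \sum_a xi_coef l a a = if l == inord 0 then (n * 4)%:R else 0.
Proof.
case: eqP => [->|/eqP l0].
  rewrite (eq_bigr (fun=> 1)); last by move=> a _; rewrite /xi_coef xi0 crd_coordv eqxx.
  by rewrite big_const iter_addr addr0 card_ord.
rewrite big1// => a _; rewrite /xi_coef -ip_coordv.
by have := ip_xi_skew (coordv R a) (coordv R a) l0; rewrite ipC; lra.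
Qed.

(** The derivative along a linear vector field: the Euler field for l = 0, and the infinitesimal
    left multiplication by I, J or K otherwise. *)
Definition xi_deriv l f x : R := \sum_a crd a (xi l x) * partial a f x.

Lemma tame_xi_deriv l f : tame f -> tame (xi_deriv l f).
Proof.
move=> hf; apply: tame_sum => a; apply: tameM; first exact: tame_crd_xi.
exact: tame_partial.
Qed.

(** The generator in nondivergence form: being a polynomial expression in partial derivatives, it
    visibly preserves tameness and supports and obeys a product rule. *)
Definition hp_laplacian f x : R := 2^-1 * (1 + normsq x) *
  (\sum_a partial a (partial a f) x
   + \sum_l \sum_a \sum_b crd a (xi l x) * crd b (xi l x) * partial a (partial b f) x
   - 4 * \sum_a crd a x * partial a f x).

Lemma partial_xi_deriv l a f : tame f -> partial a (xi_deriv l f) =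
  (fun x => \sum_b (xi_coef l b a * partial b f x + crd b (xi l x) * partial a (partial b f) x)).
Proof.
move=> hf; rewrite /xi_deriv partial_sum; last first.
  by move=> b; apply: tameM; [exact: tame_crd_xi | exact: tame_partial].
apply/funext => x; apply: eq_bigr => b _.
by rewrite partialM ?partial_crd_xi//; [exact: tame_crd_xi | exact: tame_partial].
Qed.

(** The coefficient of the Euler derivative collects 4n - 2 from the divergence of the fields and
    -2(2n + 1) from the gradient of the volume density, hence -4 whatever n is. *)
Lemma laplace_beltrami_hp f x : tame f ->
  2^-1 * laplace_beltrami (@hp_metric R n) f x = hp_laplacian f x.
Proof.
move=> hf; rewrite /laplace_beltrami /hp_laplacian.
have sq y : Num.sqrt (\det (gram (@hp_metric R n) y)) = phi y ^+ (2 * n + 2).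
  rewrite det_gram_hp (_ : D + 4 = (2 * n + 2) * 2)%N; last by rewrite /D; lia.
  by rewrite exprM sqrtr_sqr ger0_norm// exprn_ge0// ltW// phi_gt0.
(* The gradient field without its scalar factor 1 + |y|^2; that factor cancels one power of phi in
   the density phi^(2n + 2). *)
pose G a y := partial a f y + \sum_l crd a (xi l y) * xi_deriv l f y.
have tG a : tame (G a).
  apply: tameD; first exact: tame_partial.
  by apply: tame_sum => l; apply: tameM; [exact: tame_crd_xi | exact: tame_xi_deriv].
have inner a : (fun y => Num.sqrt (\det (gram (@hp_metric R n) y)) *
     \sum_b invmx (gram (@hp_metric R n) y) a b * partial b f y) =
     (fun y => phi y ^+ (2 * n + 1) * G a y).
  apply/funext => y; rewrite sq inv_gram_hp addn2 addn1 exprSr -mulrA; congr (_ * _).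
  transitivity (phi y * (1 + normsq y) * G a y); last by rewrite mulrC [phi y * _]mulrC phiE mulr1.
  rewrite -mulrA; congr (_ * _).
  transitivity ((1 + normsq y) * \sum_b ((a == b)%:R + \sum_l crd a (xi l y) * crd b (xi l y)) * partial b f y).
    rewrite mulr_sumr; apply: eq_bigr => b _; rewrite !mxE mulrA; congr (_ * (_ + _) * _).
    by apply: eq_bigr => l _; rewrite !mxE.
  congr (_ * _); rewrite /G (eq_bigr (fun b => (a == b)%:R * partial b f y + \sum_l crd a (xi l y) * (crd b (xi l y) * partial b f y))); last first.
    by move=> b _; rewrite mulrDl mulr_suml; congr (_ + _); apply: eq_bigr => l _; ring.
  rewrite big_split/=; congr (_ + _).
    by rewrite (bigD1 a)//= eqxx mul1r big1 ?addr0// => b ba; rewrite eq_sym (negbTE ba) mul0r.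
  by rewrite exchange_big/=; apply: eq_bigr => l _; rewrite -mulr_sumr.
rewrite sq; under eq_bigr do rewrite inner.
set E := \sum_a crd a x * partial a f x.
have EX : xi_deriv (inord 0) f x = E by apply: eq_bigr => a _; rewrite xi0.
have xG : \sum_a crd a x * G a x = (1 + normsq x) * E.
  rewrite /G; under eq_bigr do rewrite mulrDr mulr_sumr.
  rewrite big_split/= mulrDl mul1r; congr (_ + _).
  rewrite exchange_big/= -EX.
  have h l : \sum_a crd a x * (crd a (xi l x) * xi_deriv l f x) = (inord 0 == l)%:R * normsq x * xi_deriv l f x.
    rewrite -ip_xi xi0 -sum_crd mulr_suml; apply: eq_bigr => a _; ring.
  under eq_bigr do rewrite h.
  rewrite (bigD1 (inord 0))//= eqxx mul1r big1 ?addr0// => l l0.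
  by rewrite eq_sym (negbTE l0) !mul0r.
have dG : \sum_a partial a (G a) x = \sum_a partial a (partial a f) x
   + \sum_l \sum_a \sum_b crd a (xi l x) * crd b (xi l x) * partial a (partial b f) x
   + ((n * 4)%:R - 2) * E.
  have h a : partial a (G a) x = partial a (partial a f) x + \sum_l (xi_coef l a a * xi_deriv l f x +
     (\sum_b crd a (xi l x) * xi_coef l b a * partial b f x +
      \sum_b crd a (xi l x) * crd b (xi l x) * partial a (partial b f) x)).
    rewrite /G partialD; [|exact: tame_partial|by apply: tame_sum => l; apply: tameM; [exact: tame_crd_xi | exact: tame_xi_deriv]].
    congr (_ + _); rewrite partial_sum; last by move=> l; apply: tameM; [exact: tame_crd_xi | exact: tame_xi_deriv].
    apply: eq_bigr => l _; rewrite partialM ?partial_crd_xi ?partial_xi_deriv//; [|exact: tame_crd_xi|exact: tame_xi_deriv].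
    congr (_ + _); rewrite mulr_sumr -big_split/=; apply: eq_bigr => b _; ring.
  under eq_bigr do rewrite h.
  rewrite big_split/= -addrA; congr (_ + _); rewrite exchange_big/=.
  (* Differentiating a field along itself gives [xi l (xi l x)], that is x for l = 0 and - x
     otherwise. The four signs add up to -2, and the divergence of the Euler field supplies 4n. *)
  transitivity (\sum_l (\sum_a \sum_b crd a (xi l x) * crd b (xi l x) * partial a (partial b f) x +
     ((if l == inord 0 then (n * 4)%:R else 0) * E + (if l == inord 0 then 1 else -1) * E))).
    apply: eq_bigr => l _; rewrite !big_split/= -mulr_suml xi_divergence addrA addrC; congr (_ + _).
    congr (_ + _); first by case: eqP => [->|]; rewrite ?EX// !mul0r.
    rewrite exchange_big/= mulr_sumr; apply: eq_bigr => b _.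
    by rewrite -mulr_suml -crd_xi xi_xi; case: ifP => _; rewrite ?mul1r// -scaleN1r crdZ mulrA.
  rewrite big_split/=; congr (_ + _).
  by rewrite sum_ord4 -!val_eqE/= !inordK//=; ring.
have dphi a : partial a (fun y => phi y ^+ (2 * n + 1) * G a y) x =
  (2 * n + 1)%:R * phi x ^+ (2 * n) * (- 2 * phi x ^+ 2) * (crd a x * G a x) + phi x ^+ (2 * n + 1) * partial a (G a) x.
  rewrite partialM//; last by apply: tameX; exact: tame_phi.
  by rewrite partialX ?partial_phi; [rewrite addn1 /=; ring | exact: tame_phi].
under eq_bigr do rewrite dphi.
rewrite big_split/= -!mulr_sumr xG dG.
have p0 := lt0r_neq0 (phi_gt0 x).
have q : 1 + normsq x = (phi x)^-1 by rewrite /phi invrK.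
have P0 : phi x ^+ (2 * n) != 0 by rewrite expf_neq0.
rewrite q (exprD _ (2 * n) 2) (exprD _ (2 * n) 1) expr1 natrD !natrM; move: P0; set P := phi x ^+ (2 * n) => P0.
move: (\sum_a _) (\sum_l _) => S1 S2.
by field; rewrite p0.
Qed.

(** Normalised for the generator, half the Laplacian: there is no factor 2, so this is the rate of
    the covariation of f(w) and g(w). *)
Definition carre_du_champ f g x : R := (1 + normsq x) *
  (\sum_a partial a f x * partial a g x + \sum_l xi_deriv l f x * xi_deriv l g x).

Lemma hp_laplacianM f g x : tame f -> tame g ->
  hp_laplacian (fun y => f y * g y) x =
  f x * hp_laplacian g x + g x * hp_laplacian f x + carre_du_champ f g x.
Proof.
move=> hf hg; rewrite /hp_laplacian /carre_du_champ.
have h1 a : partial a (fun y => f y * g y) x = g x * partial a f x + f x * partial a g x.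
  by rewrite partialM// mulrC.
have h2 a b : partial a (partial b (fun y => f y * g y)) x =
   g x * partial a (partial b f) x + f x * partial a (partial b g) x +
   (partial a f x * partial b g x + partial b f x * partial a g x).
  have tf := tame_partial b hf; have tg := tame_partial b hg.
  rewrite (partialM b hf hg) (partialD a (tameM tf hg) (tameM hf tg)) (partialM a tf hg) (partialM a hf tg).
  move: (partial a (partial b f) x) (partial a (partial b g) x) (partial a f x) (partial a g x) (partial b f x) (partial b g x) (f x) (g x) => *; ring.
have e1 : \sum_a partial a (partial a (fun y => f y * g y)) x =
   g x * (\sum_a partial a (partial a f) x) + f x * (\sum_a partial a (partial a g) x) +
   2 * (\sum_a partial a f x * partial a g x).
  rewrite !mulr_sumr -!big_split/=; apply: eq_bigr => a _; rewrite h2.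
  move: (partial a (partial a f) x) (partial a (partial a g) x) (partial a f x) (partial a g x) (f x) (g x) => *; ring.
have e2 : \sum_l \sum_a \sum_b crd a (xi l x) * crd b (xi l x) * partial a (partial b (fun y => f y * g y)) x =
   g x * (\sum_l \sum_a \sum_b crd a (xi l x) * crd b (xi l x) * partial a (partial b f) x) +
   f x * (\sum_l \sum_a \sum_b crd a (xi l x) * crd b (xi l x) * partial a (partial b g) x) +
   2 * \sum_l xi_deriv l f x * xi_deriv l g x.
  rewrite !mulr_sumr -!big_split/=; apply: eq_bigr => l _.
  have -> : 2 * (xi_deriv l f x * xi_deriv l g x) =
     \sum_a \sum_b crd a (xi l x) * crd b (xi l x) * (partial a f x * partial b g x + partial b f x * partial a g x).
    rewrite mulr_natl mulr2n {2}[_ * xi_deriv l g x]mulrC /xi_deriv !big_distrlr/= -big_split/=.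
    apply: eq_bigr => a _; rewrite -big_split/=; apply: eq_bigr => b _.
    move: (partial a f x) (partial a g x) (partial b f x) (partial b g x) => *; ring.
  rewrite !mulr_sumr -!big_split/=; apply: eq_bigr => a _.
  rewrite !mulr_sumr -!big_split/=; apply: eq_bigr => b _; rewrite h2.
  move: (partial a (partial b f) x) (partial a (partial b g) x) (partial a f x) (partial a g x) (partial b f x) (partial b g x) (f x) (g x) => *; ring.
have e3 : \sum_a crd a x * partial a (fun y => f y * g y) x =
   g x * (\sum_a crd a x * partial a f x) + f x * (\sum_a crd a x * partial a g x).
  rewrite !mulr_sumr -!big_split/=; apply: eq_bigr => a _; rewrite h1.
  move: (partial a f x) (partial a g x) (f x) (g x) => *; ring.
have comb (q s1 s2 s3 fx gx a1 a2 a3 b1 b2 b3 c1 c2 : R) :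
  s1 = gx * a1 + fx * b1 + 2 * c1 -> s2 = gx * a2 + fx * b2 + 2 * c2 ->
  s3 = gx * a3 + fx * b3 ->
  2^-1 * q * (s1 + s2 - 4 * s3) = fx * (2^-1 * q * (b1 + b2 - 4 * b3)) +
    gx * (2^-1 * q * (a1 + a2 - 4 * a3)) + q * (c1 + c2).
  by move=> -> -> ->; field.
exact: comb e1 e2 e3.
Qed.

End Geometry.

(** * Cut-off functions and the powers of phi *)

Section Supports.
Variables (R : realType) (n : nat).
Notation V := 'M[R]_(n, 4).
Implicit Types (x y : V) (f g : V -> R).

Lemma vec_mx_continuous m k : continuous (@vec_mx R m k).
Proof.
move=> v A [Q hQ QA].
exists (fun _ a => [set z | forall i j, mxvec_index i j = a -> Q i j z]) => /=.
  move=> i0 a; case/mxvec_indexP: a => i j.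
  have := hQ i j; rewrite mxE (ord1 i0); apply: filterS => z Qz i' j' e.
  by have /cast_ord_inj/enum_rank_inj [-> ->] := e.
by move=> z hz; apply: QA => i j; rewrite mxE; exact: hz.
Qed.

Lemma normsq_continuous : continuous (@normsq R n 4).
Proof. exact: tame_continuous (@tame_normsq R n). Qed.

Lemma compact_normsq_le (M : R) : compact [set x : V | normsq x <= M].
Proof.
pose B := [set v : 'rV[R]_(n * 4) | forall i, v ord0 i \in `[- (`|M| + 1), `|M| + 1]].
have cB : compact B.
  apply: (@rV_compact _ _ (fun=> `[- (`|M| + 1), `|M| + 1]%classic)).
  by move=> _; apply: segment_compact.
apply: (@subclosed_compact _ _ (vec_mx @` B)).
- apply: (@preimage_closed _ _ (@normsq R n 4) [set z | z <= M]); last exact: closed_le.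
  by move=> x _; exact: normsq_continuous.
- by apply: continuous_compact => //; apply: continuous_subspaceT; exact: vec_mx_continuous.
move=> x /= xM; exists (mxvec x); last exact: mxvecK.
move=> i /=; rewrite in_itv/= -ler_norml.
have h : crd i x ^+ 2 <= M.
  apply: le_trans xM; rewrite normsq_crd (bigD1 i)//= lerDl.
  by apply: sumr_ge0 => j _; exact: sqr_ge0.
rewrite -[mxvec _ _ _]/(crd i x) leNgt; apply/negP => h2.
have M0 : 0 <= M by apply: le_trans h; exact: sqr_ge0.
have : `|M| < `|crd i x| ^+ 2.
  by move: h2; rewrite (ger0_norm M0) => h2; nra.
by rewrite real_normK ?num_real// ltNge (le_trans h)// ler_norm.
Qed.

Definition supported (M : R) f := forall x, M < normsq x -> f x = 0.

Lemma supported_compactly M f : supported M f -> compactly_supported f.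
Proof.
move=> hf; apply: (@subclosed_compact _ _ [set x : V | normsq x <= M]).
- exact: closed_closure.
- exact: compact_normsq_le.
- have cl : closed [set x : V | normsq x <= M].
    apply: (@preimage_closed _ _ (@normsq R n 4) [set z | z <= M]); last exact: closed_le.
    by move=> x _; exact: normsq_continuous.
  rewrite [X in _ `<=` X](proj1 (closure_id _) cl).
  apply: closureS => x /= fx; rewrite leNgt; apply/negP => /hf fx0.
  by rewrite fx0 eqxx in fx.
Qed.

Lemma supported_bounded M f : continuous f -> supported M f ->
  exists2 C : R, 0 < C & forall x, `|f x| <= C.
Proof.
move=> cf sf.
have : compact (f @` [set x : V | normsq x <= M]).
  apply: continuous_compact; last exact: compact_normsq_le.
  exact: continuous_subspaceT.
move=> /compact_bounded [C [_ hC]]; exists (`|C| + 1); first by rewrite ltr_wpDl.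
move=> x; case: (lerP (normsq x) M) => xM; last by rewrite sf// normr0 addr_ge0.
apply: (hC (`|C| + 1)); last by exists x.
by apply: le_lt_trans (ler_norm _) _; rewrite ltrDl.
Qed.

Lemma supported_partial M f a : supported M f -> supported M (partial a f).
Proof.
move=> sf x xM; apply: (@partial_locally_cst _ _ _ a f 0).
near=> y; apply: sf; near: y.
have : nbhs (normsq x) [set z | M < z] by exact: lt_nbhsr.
exact: normsq_continuous.
Unshelve. all: by end_near.
Qed.

Lemma supported_hp_laplacian M f : supported M f -> supported M (hp_laplacian f).
Proof.
move=> sf x xM; rewrite /hp_laplacian.
rewrite big1 => [|a _]; last by rewrite (supported_partial _ (supported_partial _ sf)).
rewrite big1 => [|l _]; last first.
  rewrite big1// => a _; rewrite big1// => b _.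
  by rewrite (supported_partial _ (supported_partial _ sf))// mulr0.
rewrite big1 => [|a _]; last by rewrite (supported_partial _ sf)// mulr0.
by rewrite mulr0 subr0 addr0 mulr0.
Qed.

Lemma tame_hp_laplacian f : tame f -> tame (hp_laplacian f).
Proof.
move=> hf; have c0 := @tame_cst R n 4; have tp := @tame_partial R n 4.
apply: tameM.
  by apply: tameM; [exact: c0 | apply: tameD; [exact: c0 | exact: tame_normsq]].
apply: tameB; [apply: tameD|].
- by apply: tame_sum => a; apply: (tp); apply: (tp).
- do 3 (apply: tame_sum => ?); apply: tameM; last by apply: (tp); apply: (tp).
  by apply: tameM; exact: tame_crd_xi.
- apply: tameM; first exact: c0.
  by apply: tame_sum => a; apply: tameM; [exact: tame_crd | exact: tp].
Qed.

Section Cutoff.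
Variable M : R.

Let p x := flat 0 (M + 2 - normsq x).
Let q x := flat 0 (normsq x - (M + 1)).

(** Equal to 1 up to squared norm M + 1 and to 0 from M + 2 on. The margin above M makes it locally
    constant at every point of the closed ball of squared radius M, boundary included. *)
Definition cutoff x : R := p x * (p x + q x)^-1.

Let pq_gt0 x : 0 < p x + q x.
Proof.
case: (ltP (normsq x) (M + 2)) => h.
  by rewrite ltr_wpDr ?flat_ge0// flat_gt0// subr_gt0.
by rewrite ltr_wpDl ?flat_ge0// flat_gt0// subr_gt0; lra.
Qed.

Lemma tame_cutoff : tame cutoff.
Proof.
have tp : tame p.
  by apply: tame_flat; apply: tameB; [exact: tame_cst | exact: tame_normsq].
have tq : tame q.
  by apply: tame_flat; apply: tameB; [exact: tame_normsq | exact: tame_cst].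
by apply: tameM => //; apply: tameV => //; exact: tameD.
Qed.

Lemma cutoff01 x : 0 <= cutoff x <= 1.
Proof.
have p0 : 0 <= p x by exact: flat_ge0.
have q0 : 0 <= q x by exact: flat_ge0.
rewrite /cutoff mulr_ge0//=; last by rewrite invr_ge0 ltW.
by rewrite ler_pdivrMr// mul1r lerDl.
Qed.

Lemma cutoff1 x : normsq x <= M + 1 -> cutoff x = 1.
Proof.
move=> h; rewrite /cutoff (_ : q x = 0) ?addr0; last by rewrite /q flat_le0// subr_le0.
by rewrite divff// gt_eqF// /p flat_gt0//; lra.
Qed.

Lemma supported_cutoff : supported (M + 2) cutoff.
Proof. by move=> x h; rewrite /cutoff {1}/p flat_le0 ?mul0r// subr_le0 ltW. Qed.

Lemma cutoff_near1 x : normsq x <= M -> \forall y \near x, cutoff y = 1.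
Proof.
move=> h; near=> y; apply: cutoff1; apply: ltW; near: y.
have : nbhs (normsq x) [set z | z < M + 1] by apply: lt_nbhsl; lra.
exact: normsq_continuous.
Unshelve. all: by end_near.
Qed.

Lemma partial_cutoff a x : normsq x <= M -> partial a cutoff x = 0.
Proof. by move=> /cutoff_near1 /partial_locally_cst; apply. Qed.

Lemma partial2_cutoff a b x : normsq x <= M -> partial a (partial b cutoff) x = 0.
Proof.
move=> h; apply: (@partial_locally_cst _ _ _ a _ 0).
have := cutoff_near1 h => /near_join; apply: filterS => y hy.
exact: partial_locally_cst hy.
Qed.

End Cutoff.

Definition phi_cut (M : R) (m : nat) x : R := phi x ^+ m * cutoff M x.

Lemma tame_phi_cut M m : tame (phi_cut M m).
Proof. by apply: tameM; [apply: tameX; exact: tame_phi | exact: tame_cutoff]. Qed.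

Lemma supported_phi_cut M m : supported (M + 2) (phi_cut M m).
Proof. by move=> x h; rewrite /phi_cut supported_cutoff// mulr0. Qed.

Lemma phi_cut_ge0 M m x : 0 <= phi_cut M m x.
Proof.
by have /andP[h _] := cutoff01 M x; rewrite mulr_ge0// exprn_ge0// ltW// phi_gt0.
Qed.

Lemma phi_cut_le M m x : phi_cut M m x <= phi x ^+ m.
Proof.
have /andP[_ h] := cutoff01 M x; by rewrite ler_piMr ?exprn_ge0 ?(ltW (phi_gt0 _)).
Qed.

Lemma phi_cutE M m x : normsq x <= M -> phi_cut M m x = phi x ^+ m.
Proof. by move=> h; rewrite /phi_cut cutoff1 ?mulr1//; lra. Qed.

Lemma partial_phiX a m : partial a (fun x => @phi R n x ^+ m) =
  (fun x => - (2 * m%:R) * (phi x ^+ m.+1 * crd a x)).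
Proof.
rewrite partialX; last exact: tame_phi.
rewrite partial_phi; apply/funext => x; case: m => [|m]; first by rewrite !mul0r mulr0 oppr0 mul0r.
by rewrite !exprS /=; ring.
Qed.

Lemma partial_phi_cut M m a x : normsq x <= M ->
  partial a (phi_cut M m) x = - (2 * m%:R) * (phi x ^+ m.+1 * crd a x).
Proof.
move=> h; rewrite /phi_cut partialM; [|by apply: tameX; exact: tame_phi|exact: tame_cutoff].
rewrite partial_cutoff// mulr0 addr0 cutoff1 ?mulr1; last lra.
by rewrite partial_phiX.
Qed.

Lemma ip_xi_diag l x : ip x (xi l x) = (l == inord 0)%:R * normsq x.
Proof. by rewrite -{1}(xi0 x) ip_xi eq_sym. Qed.

(** The form with the factor |x|^2 is kept, instead of a combination of two powers of phi, because
    rotation and killing will add multiples of |x|^2 phi^m to it. *)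
Lemma hp_laplacian_phiX m x : hp_laplacian (fun y => @phi R n y ^+ m) x =
  (2 * m%:R * (m%:R + 1) * normsq x - 4 * n%:R * m%:R) * phi x ^+ m.
Proof.
have h2 a b : partial a (partial b (fun y => @phi R n y ^+ m)) x =
   - (2 * m%:R) * (phi x ^+ m.+1 * (a == b)%:R) + 4 * m%:R * (m%:R + 1) * phi x ^+ m.+2 * (crd a x * crd b x).
  rewrite partial_phiX partialM; [|exact: tame_cst|by apply: tameM; [apply: tameX; exact: tame_phi|exact: tame_crd]].
  rewrite partial_cst partialM; [|by apply: tameX; exact: tame_phi|exact: tame_crd].
  rewrite partial_phiX partial_crd -natr1; ring.
have e1 : \sum_a partial a (partial a (fun y => @phi R n y ^+ m)) x =
   - (2 * m%:R) * phi x ^+ m.+1 * (n * 4)%:R + 4 * m%:R * (m%:R + 1) * phi x ^+ m.+2 * normsq x.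
  rewrite (eq_bigr _ (fun a _ => h2 a a)) big_split/= -!mulr_sumr; congr (_ + _).
    rewrite -mulrA; congr (_ * (_ * _)).
    rewrite (eq_bigr (fun=> 1)) => [|a _]; last by rewrite eqxx.
    by rewrite big_const iter_addr addr0 card_ord.
  by rewrite sum_crd -normsq_ip.
have e2 : \sum_l \sum_a \sum_b crd a (xi l x) * crd b (xi l x) * partial a (partial b (fun y => @phi R n y ^+ m)) x =
   - (2 * m%:R) * phi x ^+ m.+1 * (4 * normsq x) + 4 * m%:R * (m%:R + 1) * phi x ^+ m.+2 * normsq x ^+ 2.
  have e3 l : \sum_a \sum_b crd a (xi l x) * crd b (xi l x) * partial a (partial b (fun y => @phi R n y ^+ m)) x =
     - (2 * m%:R) * phi x ^+ m.+1 * normsq x + 4 * m%:R * (m%:R + 1) * phi x ^+ m.+2 * ip x (xi l x) ^+ 2.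
    have -> : normsq x = \sum_a crd a (xi l x) * crd a (xi l x) by rewrite sum_crd ip_xi eqxx mul1r.
    rewrite expr2 -sum_crd big_distrlr/= !mulr_sumr -big_split/=.
    apply: eq_bigr => a _; rewrite mulr_sumr.
    rewrite (eq_bigr (fun b => (a == b)%:R * (- (2 * m%:R) * phi x ^+ m.+1 * (crd a (xi l x) * crd a (xi l x)))
       + 4 * m%:R * (m%:R + 1) * phi x ^+ m.+2 * (crd a x * crd a (xi l x) * (crd b x * crd b (xi l x))))).
      rewrite big_split/=; congr (_ + _).
      by rewrite (bigD1 a)//= eqxx mul1r big1 ?addr0// => b ba; rewrite eq_sym (negbTE ba) mul0r.
    move=> b _; rewrite h2; case: (eqVneq a b) => [->|_]; rewrite ?mulr0n ?mulr1n; ring.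
  under eq_bigr do rewrite e3 ip_xi_diag.
  by rewrite sum_ord4 -!val_eqE/= !inordK//=; ring.
have e3 : \sum_a crd a x * partial a (fun y => @phi R n y ^+ m) x = - (2 * m%:R) * phi x ^+ m.+1 * normsq x.
  rewrite normsq_ip -sum_crd mulr_sumr; apply: eq_bigr => a _; rewrite partial_phiX; ring.
rewrite /hp_laplacian e1 e2 e3 !exprS natrM.
have p1 : phi x * normsq x = 1 - phi x by rewrite mulrC normsq_phi.
have u1 : (1 + normsq x) * phi x = 1 by exact: phiE.
transitivity ((1 + normsq x) * phi x * (2 * m%:R * (m%:R + 1) * ((1 + normsq x) * phi x) * normsq x - 4 * n%:R * m%:R) * phi x ^+ m).
  by field.
by rewrite u1; ring.
Qed.

Lemma hp_laplacian_phi_cut M m x : normsq x <= M ->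
  hp_laplacian (phi_cut M m) x =
  (2 * m%:R * (m%:R + 1) * normsq x - 4 * n%:R * m%:R) * phi x ^+ m.
Proof.
move=> h; rewrite /phi_cut hp_laplacianM; [|by apply: tameX; exact: tame_phi|exact: tame_cutoff].
rewrite cutoff1 ?mul1r; last lra.
have -> : hp_laplacian (cutoff M) x = 0.
  rewrite /hp_laplacian big1 => [|a _]; last by rewrite partial2_cutoff.
  rewrite big1 => [|l _]; last by do 2 (rewrite big1// => ? _); rewrite partial2_cutoff// mulr0.
  rewrite big1 => [|a _]; last by rewrite partial_cutoff// mulr0.
  by rewrite mulr0 subr0 addr0 mulr0.
have -> : carre_du_champ (fun x => phi x ^+ m) (cutoff M) x = 0.
  rewrite /carre_du_champ big1 => [|a _]; last by rewrite partial_cutoff// mulr0.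
  rewrite big1 ?addr0 ?mulr0// => l _.
  rewrite [X in _ * X](_ : _ = 0) ?mulr0// /xi_deriv big1// => a _.
  by rewrite partial_cutoff// mulr0.
by rewrite mulr0 add0r addr0 hp_laplacian_phiX.
Qed.

End Supports.

(** * The area over one step and the generator applied to its powers *)

Section AreaIncrement.
Variables (R : realType) (n : nat).
Notation V := 'M[R]_(n, 4).
Implicit Types (x y z : V) (f g : V -> R) (lam : 'rV[R]_3).

Lemma ipDr x y z : ip x (y + z) = ip x y + ip x z.
Proof. by rewrite -!sum_crd -big_split/=; apply: eq_bigr => a _; rewrite crdD mulrDr. Qed.

Lemma ipZr (c : R) x y : ip x (c *: y) = c * ip x y.
Proof. by rewrite -!sum_crd mulr_sumr; apply: eq_bigr => a _; rewrite crdZ; ring. Qed.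

Lemma ip0r x : ip x 0 = 0.
Proof. by rewrite -(scale0r (0 : V)) ipZr mul0r. Qed.

Lemma ip_sumr (I : Type) (s : seq I) x (F : I -> V) :
  ip x (\sum_(i <- s) F i) = \sum_(i <- s) ip x (F i).
Proof.
elim: s => [|i s IH]; first by rewrite !big_nil ip0r.
by rewrite !big_cons ipDr IH.
Qed.

(** The product of the imaginary quaternion lam with x, seen as a tangent vector at x. *)
Definition vertical lam x : V := \sum_(i < 3) lam 0 i *: xi (inord i.+1) x.

Lemma inord_succ_neq0 (i : 'I_3) : (inord i.+1 : 'I_4) != inord 0.
Proof. by rewrite -val_eqE/= !inordK// ltnS. Qed.

Lemma ip_vertical lam x : ip x (vertical lam x) = 0.
Proof.
rewrite ip_sumr big1// => i _.
by rewrite ipZr ip_xi_diag (negbTE (inord_succ_neq0 i)) mul0r mulr0.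
Qed.

Lemma ip_xi_vertical lam l x : ip (xi l x) (vertical lam x) =
  (\sum_(i < 3) lam 0 i * (l == inord i.+1)%:R) * normsq x.
Proof.
rewrite ip_sumr mulr_suml; apply: eq_bigr => i _.
by rewrite ipZr ip_xi mulrA.
Qed.

Definition sqnorm lam : R := \sum_(i < 3) lam 0 i ^+ 2.

Lemma sqnorm_ge0 lam : 0 <= sqnorm lam.
Proof. by apply: sumr_ge0 => i _; exact: sqr_ge0. Qed.

Lemma ip_vertical2 lam x : ip (vertical lam x) (vertical lam x) = sqnorm lam * normsq x.
Proof.
rewrite {1}/vertical ipC ip_sumr /sqnorm mulr_suml; apply: eq_bigr => i _.
rewrite ipZr ipC ip_xi_vertical (bigD1 i)//= eqxx mulr1 big1 ?addr0; first by ring.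
move=> j ji; rewrite (_ : (_ == _) = false) ?mulr0//.
have hi := ltn_ord i; have hj := ltn_ord j.
apply/negP => /eqP /(congr1 val); rewrite /= !inordK// => -[/val_inj e].
by rewrite e eqxx in ji.
Qed.

Lemma sum_ip_xi_vertical lam x :
  \sum_l ip (xi l x) (vertical lam x) ^+ 2 = sqnorm lam * normsq x ^+ 2.
Proof.
rewrite sum_ord4 !ip_xi_vertical /sqnorm !big_ord_recr !big_ord0 /= -!val_eqE/= !inordK//=.
by ring.
Qed.

(* The contribution of a step of the path from [x] to [y] to the component of the
   Stratonovich sum [area_sum] along [lam]. *)
Definition area_step lam x y : R :=
  2^-1 * (phi x + phi y) * ip y (vertical lam x).

Lemma area_step_diag lam x : area_step lam x x = 0.
Proof. by rewrite /area_step ip_vertical mulr0. Qed.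

Lemma ip_sum_crd z : (fun y => ip y z) = (fun y => \sum_a crd a y * crd a z).
Proof. by apply/funext => y; rewrite sum_crd. Qed.

Lemma tame_ip z : tame (fun y => ip y z).
Proof.
rewrite ip_sum_crd; apply: tame_sum => a.
by apply: tameM; [exact: tame_crd | exact: tame_cst].
Qed.

Lemma partial_ip a z : partial a (fun y => ip y z) = (fun=> crd a z).
Proof.
rewrite ip_sum_crd partial_sum; last first.
  by move=> b; apply: tameM; [exact: tame_crd | exact: tame_cst].
apply/funext => x; rewrite (bigD1 a)//= partialM ?partial_cst ?partial_crd; [|exact: tame_crd|exact: tame_cst].
rewrite eqxx mul1r mulr0 addr0 big1 ?addr0// => b ba.
rewrite partialM ?partial_cst ?partial_crd; [|exact: tame_crd|exact: tame_cst].
by rewrite eq_sym (negbTE ba) mul0r mulr0 addr0.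
Qed.

Let mean_phi x y : R := 2^-1 * (phi x + phi y).

Let tame_mean_phi x : tame (mean_phi x).
Proof.
apply: tameM; first exact: tame_cst.
by apply: tameD; [exact: tame_cst | exact: tame_phi].
Qed.

Lemma tame_area_step lam x : tame (area_step lam x).
Proof. by apply: tameM; [exact: tame_mean_phi | exact: tame_ip]. Qed.

Let partial_mean_phi a x y : partial a (mean_phi x) y = - phi y ^+ 2 * crd a y.
Proof.
rewrite /mean_phi partialM; [|exact: tame_cst|by apply: tameD; [exact: tame_cst | exact: tame_phi]].
rewrite partial_cst mul0r add0r partialD; [|exact: tame_cst|exact: tame_phi].
by rewrite partial_cst partial_phi; field.
Qed.

Lemma partial_area_step lam a x :
  partial a (area_step lam x) x = phi x * crd a (vertical lam x).
Proof.
rewrite /area_step partialM ?partial_ip; [|exact: tame_mean_phi|exact: tame_ip].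
by rewrite ip_vertical mulr0 add0r; field.
Qed.

Lemma xi_deriv_area_step lam l x :
  xi_deriv l (area_step lam x) x = phi x * ip (xi l x) (vertical lam x).
Proof.
rewrite /xi_deriv -sum_crd mulr_sumr; apply: eq_bigr => a _.
by rewrite partial_area_step; ring.
Qed.

(** The Euclidean part phi^2 |x|^2 and the part phi^2 |x|^4 along the fields [xi] add up to phi
    |x|^2 because (1 + |x|^2) phi = 1; the outer factor of the bracket then leaves |x|^2, which is
    tan^2 r. *)
Lemma carre_du_champ_area_step lam x :
  carre_du_champ (area_step lam x) (area_step lam x) x = sqnorm lam * normsq x.
Proof.
rewrite /carre_du_champ.
have -> : \sum_a partial a (area_step lam x) x * partial a (area_step lam x) x =
    phi x ^+ 2 * (sqnorm lam * normsq x).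
  rewrite -ip_vertical2 -sum_crd mulr_sumr; apply: eq_bigr => a _.
  by rewrite partial_area_step; ring.
have -> : \sum_l xi_deriv l (area_step lam x) x * xi_deriv l (area_step lam x) x =
    phi x ^+ 2 * (sqnorm lam * normsq x ^+ 2).
  rewrite -sum_ip_xi_vertical mulr_sumr; apply: eq_bigr => l _.
  by rewrite xi_deriv_area_step; ring.
have e := phiE x.
transitivity (((1 + normsq x) * phi x) ^+ 2 * (sqnorm lam * normsq x)); first by ring.
by rewrite e expr1n mul1r.
Qed.

Definition radial_at x g := exists c : R, forall a, partial a g x = c * crd a x.

Lemma radial_xi_deriv x g (c : R) l : (forall a, partial a g x = c * crd a x) ->
  xi_deriv l g x = c * ((l == inord 0)%:R * normsq x).
Proof.
move=> hc; rewrite -ip_xi_diag -sum_crd mulr_sumr; apply: eq_bigr => a _.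
by rewrite hc; ring.
Qed.

Lemma carre_du_champ_area_step_radial lam x g : radial_at x g ->
  carre_du_champ (area_step lam x) g x = 0.
Proof.
move=> [c hc]; rewrite /carre_du_champ.
have -> : \sum_a partial a (area_step lam x) x * partial a g x = 0.
  transitivity (phi x * c * ip x (vertical lam x)); last by rewrite ip_vertical mulr0.
  rewrite -sum_crd mulr_sumr; apply: eq_bigr => a _.
  by rewrite partial_area_step hc; ring.
rewrite big1 ?addr0 ?mulr0// => l _; rewrite xi_deriv_area_step (radial_xi_deriv _ hc).
case: eqP => [->|_]; last by rewrite mul0r !mulr0.
by rewrite xi0 ip_vertical mulr0 mul0r.
Qed.

(** The averaged weight has a radial gradient, orthogonal to the vertical vector, so the
    Stratonovich midpoint creates no drift; this is the agreement of the Stratonovich and Ito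
    integrals. *)
Lemma hp_laplacian_area_step lam x : hp_laplacian (area_step lam x) x = 0.
Proof.
rewrite /area_step (hp_laplacianM x (tame_mean_phi x) (tame_ip (vertical lam x))).
rewrite ip_vertical mul0r addr0.
have -> : hp_laplacian (fun y => ip y (vertical lam x)) x = 0.
  rewrite /hp_laplacian; under eq_bigr do rewrite !partial_ip partial_cst.
  rewrite big1// big1 => [|l _]; last first.
    by do 2 (rewrite big1// => ? _); rewrite partial_ip partial_cst mulr0.
  rewrite (eq_bigr (fun a => crd a x * crd a (vertical lam x))); last by move=> a _; rewrite partial_ip.
  by rewrite sum_crd ip_vertical; ring.
rewrite mulr0 add0r /carre_du_champ.
have hc a : partial a (mean_phi x) x = - phi x ^+ 2 * crd a x by exact: partial_mean_phi.
have -> : \sum_a partial a (mean_phi x) x * partial a (fun y => ip y (vertical lam x)) x = 0.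
  transitivity (- phi x ^+ 2 * ip x (vertical lam x)); last by rewrite ip_vertical mulr0.
  rewrite -sum_crd mulr_sumr; apply: eq_bigr => a _.
  by rewrite hc partial_ip; ring.
rewrite big1 ?addr0 ?mulr0// => l _; rewrite (radial_xi_deriv _ hc).
case: eqP => [->|_]; last by rewrite mul0r !mulr0 mul0r.
rewrite [X in _ * X](_ : _ = 0) ?mulr0//.
transitivity (ip x (vertical lam x)); last by rewrite ip_vertical.
by rewrite -sum_crd; apply: eq_bigr => a _; rewrite xi0 partial_ip.
Qed.

Lemma xi_derivM l f g x : tame f -> tame g ->
  xi_deriv l (fun y => f y * g y) x = g x * xi_deriv l f x + f x * xi_deriv l g x.
Proof.
move=> hf hg; rewrite /xi_deriv !mulr_sumr -big_split/=; apply: eq_bigr => a _.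
by rewrite (partialM a hf hg); ring.
Qed.

Lemma carre_du_champMr f g h x : tame f -> tame g -> tame h ->
  carre_du_champ f (fun y => g y * h y) x =
  h x * carre_du_champ f g x + g x * carre_du_champ f h x.
Proof.
move=> hf hg hh; rewrite /carre_du_champ.
have -> : \sum_a partial a f x * partial a (fun y => g y * h y) x =
  h x * (\sum_a partial a f x * partial a g x) + g x * (\sum_a partial a f x * partial a h x).
  rewrite !mulr_sumr -big_split/=; apply: eq_bigr => a _; rewrite (partialM a hg hh).
  by move: (partial a f x) (partial a g x) (partial a h x) => *; ring.
have -> : \sum_l xi_deriv l f x * xi_deriv l (fun y => g y * h y) x =
  h x * (\sum_l xi_deriv l f x * xi_deriv l g x) + g x * (\sum_l xi_deriv l f x * xi_deriv l h x).
  rewrite !mulr_sumr -big_split/=; apply: eq_bigr => l _; rewrite (xi_derivM _ _ hg hh).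
  by move: (xi_deriv l f x) (xi_deriv l g x) (xi_deriv l h x) => *; ring.
by move: (\sum_a _) (\sum_a _) (\sum_l _) (\sum_l _) => *; ring.
Qed.

Section Powers.
Variables (lam : 'rV[R]_3) (x : V) (g : V -> R).
Hypotheses (tg : tame g) (rg : radial_at x g).
Let F := area_step lam x.
Let tF : tame F := tame_area_step lam x.
Let t1 : tame (fun y => F y * g y) := tameM tF tg.
Let t2 : tame (fun y => F y * (F y * g y)) := tameM tF t1.
Let t3 : tame (fun y => F y * (F y * (F y * g y))) := tameM tF t2.

Let F0 : F x = 0. Proof. exact: area_step_diag. Qed.
Let LF : hp_laplacian F x = 0. Proof. exact: hp_laplacian_area_step. Qed.
Let GF1 : carre_du_champ F g x = 0.
Proof. exact: carre_du_champ_area_step_radial. Qed.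
Let GF2 : carre_du_champ F (fun y => F y * g y) x = sqnorm lam * normsq x * g x.
Proof. by rewrite carre_du_champMr// carre_du_champ_area_step F0 mul0r addr0 mulrC. Qed.
Let GF3 : carre_du_champ F (fun y => F y * (F y * g y)) x = 0.
Proof. by rewrite carre_du_champMr// F0 !mul0r addr0. Qed.
Let GF4 : carre_du_champ F (fun y => F y * (F y * (F y * g y))) x = 0.
Proof. by rewrite carre_du_champMr// F0 !mul0r addr0. Qed.

Lemma hp_laplacian_step1 : hp_laplacian (fun y => F y * g y) x = 0.
Proof. by rewrite hp_laplacianM// F0 LF GF1 mul0r mulr0 !addr0. Qed.

(** Since F vanishes at x, a second-order operator keeps only the term in which two factors F are
    differentiated once each. With a single factor the bracket with the radial g vanishes, and with
    three or more a factor F(x) = 0 remains. *)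
Lemma hp_laplacian_step2 : hp_laplacian (fun y => F y * (F y * g y)) x =
  sqnorm lam * normsq x * g x.
Proof. by rewrite hp_laplacianM// F0 LF GF2 mul0r mulr0 !add0r. Qed.

Lemma hp_laplacian_step3 : hp_laplacian (fun y => F y * (F y * (F y * g y))) x = 0.
Proof. by rewrite hp_laplacianM// F0 LF GF3 mul0r mulr0 !add0r. Qed.

Lemma hp_laplacian_step4 :
  hp_laplacian (fun y => F y * (F y * (F y * (F y * g y)))) x = 0.
Proof. by rewrite hp_laplacianM// F0 LF GF4 mul0r mulr0 !add0r. Qed.

End Powers.

Lemma hp_laplacianD f g x : tame f -> tame g ->
  hp_laplacian (fun y => f y + g y) x = hp_laplacian f x + hp_laplacian g x.
Proof.
move=> hf hg; rewrite /hp_laplacian.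
have h1 a y : partial a (fun y => f y + g y) y = partial a f y + partial a g y by rewrite partialD.
have h2 a b : partial a (partial b (fun y => f y + g y)) x =
    partial a (partial b f) x + partial a (partial b g) x.
  by rewrite (partialD b hf hg) (partialD a (tame_partial b hf) (tame_partial b hg)).
have e1 : \sum_a partial a (partial a (fun y => f y + g y)) x =
   \sum_a partial a (partial a f) x + \sum_a partial a (partial a g) x.
  by rewrite -big_split/=; apply: eq_bigr => a _; exact: h2.
have e2 : \sum_l \sum_a \sum_b crd a (xi l x) * crd b (xi l x) * partial a (partial b (fun y => f y + g y)) x =
   \sum_l \sum_a \sum_b crd a (xi l x) * crd b (xi l x) * partial a (partial b f) x +
   \sum_l \sum_a \sum_b crd a (xi l x) * crd b (xi l x) * partial a (partial b g) x.
  by do 3 (rewrite -big_split/=; apply: eq_bigr => ? _); rewrite h2 mulrDr.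
have e3 : \sum_a crd a x * partial a (fun y => f y + g y) x =
   \sum_a crd a x * partial a f x + \sum_a crd a x * partial a g x.
  by rewrite -big_split/=; apply: eq_bigr => a _; rewrite h1 mulrDr.
have comb (q s1 s2 s3 a1 a2 a3 b1 b2 b3 : R) : s1 = a1 + b1 -> s2 = a2 + b2 -> s3 = a3 + b3 ->
  2^-1 * q * (s1 + s2 - 4 * s3) = 2^-1 * q * (a1 + a2 - 4 * a3) + 2^-1 * q * (b1 + b2 - 4 * b3).
  by move=> -> -> ->; field.
exact: comb e1 e2 e3.
Qed.

Lemma hp_laplacianZ (c : R) f x : tame f ->
  hp_laplacian (fun y => c * f y) x = c * hp_laplacian f x.
Proof.
move=> hf; rewrite (hp_laplacianM x (@tame_cst R n 4 c) hf).
have -> : hp_laplacian (fun=> c) x = 0 :> R.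
  rewrite /hp_laplacian.
  rewrite big1 => [|a _]; last by rewrite !partial_cst.
  rewrite big1 => [|l _]; last by do 2 (rewrite big1// => ? _); rewrite !partial_cst mulr0.
  rewrite big1 => [|a _]; last by rewrite !partial_cst mulr0.
  by rewrite mulr0 subr0 addr0 mulr0.
rewrite mulr0 addr0 /carre_du_champ big1 => [|a _]; last by rewrite partial_cst mul0r.
rewrite big1 ?addr0 ?mulr0 ?addr0// => l _.
by rewrite [X in X * _](_ : _ = 0) ?mul0r// /xi_deriv big1// => a _; rewrite partial_cst mulr0.
Qed.

(** The martingale problem handles functions of the current point, whereas the start x of a step is
    random. In a sum of products u(x) v(y) the factor u is a weight known at the start of the step
    and v is part of the test function. *)
Inductive separable : (V -> V -> R) -> Prop :=
| separable_prod (u v : V -> R) : continuous u -> tame v -> separable (fun x y => u x * v y)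
| separableD (f g : V -> V -> R) : separable f -> separable g -> separable (fun x y => f x y + g x y).

Lemma separable_cst c : separable (fun _ _ => c).
Proof.
have := separable_prod (tame_continuous (@tame_cst R n 4 c)) (@tame_cst R n 4 1).
by congr separable; apply/funext => x; apply/funext => y; rewrite mulr1.
Qed.

Lemma separable_l (u : V -> R) : continuous u -> separable (fun x _ => u x).
Proof.
move=> cu; have := separable_prod cu (@tame_cst R n 4 1).
by congr separable; apply/funext => x; apply/funext => y; rewrite mulr1.
Qed.

Lemma separable_r (v : V -> R) : tame v -> separable (fun _ y => v y).
Proof.
move=> tv; have := separable_prod (tame_continuous (@tame_cst R n 4 1)) tv.
by congr separable; apply/funext => x; apply/funext => y; rewrite mul1r.
Qed.

Lemma separableM (f g : V -> V -> R) : separable f -> separable g -> separable (fun x y => f x y * g x y).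
Proof.
move=> hf; elim=> {g} [u v cu tv|g1 g2 _ h1 _ h2]; last first.
  by have := separableD h1 h2; congr separable; apply/funext => x; apply/funext => y; rewrite mulrDr.
elim: hf => {f} [u' v' cu' tv'|f1 f2 _ h1 _ h2]; last first.
  by have := separableD h1 h2; congr separable; apply/funext => x; apply/funext => y; rewrite mulrDl.
have cuu : continuous (fun x => u' x * u x) by move=> x; apply: continuousM; [exact: cu'|exact: cu].
have := separable_prod cuu (tameM tv' tv).
by congr separable; apply/funext => x; apply/funext => y; ring.
Qed.

Lemma separable_sum (I : Type) (s : seq I) (F : I -> V -> V -> R) :
  (forall i, separable (F i)) -> separable (fun x y => \sum_(i <- s) F i x y).
Proof.
move=> hF; elim: s => [|i s IH].
  have := separable_cst 0; congr separable.
  by apply/funext => x; apply/funext => y; rewrite big_nil.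
have := separableD (hF i) IH; congr separable.
by apply/funext => x; apply/funext => y; rewrite big_cons.
Qed.

Lemma separable_area_step lam : separable (area_step lam).
Proof.
apply: separableM.
  apply: separableM; first exact: separable_cst.
  apply: separableD; first by apply: separable_l; apply: tame_continuous; exact: tame_phi.
  by apply: separable_r; exact: tame_phi.
have -> : (fun x y => ip y (vertical lam x)) =
    (fun x y => \sum_(i < 3) \sum_a lam 0 i * (crd a (xi (inord i.+1) x) * crd a y)).
  apply/funext => x; apply/funext => y; rewrite ip_sumr; apply: eq_bigr => i _.
  by rewrite ipZr -sum_crd mulr_sumr; apply: eq_bigr => a _; rewrite [crd a y * _]mulrC.
apply: separable_sum => i; apply: separable_sum => a.
apply: separableM; first exact: separable_cst.
by apply: separable_prod; [apply: tame_continuous; exact: tame_crd_xi | exact: tame_crd].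
Qed.

(** With averaged weights the products of x with its own conjugate and of y with its own conjugate
    cancel. A quarter of (p + q) times the difference of y conj(x) and x conj(y) remains, which is
    half of (p + q) times the imaginary part of y conj(x). *)
Let strat_step x y (j : 'I_n) (l : 'I_4) (p q : R) :
  2^-1 * ((qmul (row j y - row j x) (2^-1 *: (p *: qconj (row j x) + q *: qconj (row j y)))) 0 l
   - (qmul (2^-1 *: (p *: row j x + q *: row j y)) (qconj (row j y) - qconj (row j x))) 0 l) =
  if l == inord 0 then 0 else 2^-1 * (p + q) * \sum_c y j c * xi l x j c.
Proof.
rewrite sum_ord4; elim/ord4P: l; rewrite -val_eqE /= !inordK//=;
  rewrite /qmul /qconj /quat /qRe /qI /qJ /qK !mxE !inordK//=;
  move: (x j (inord 0)) (x j (inord 1)) (x j (inord 2)) (x j (inord 3))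
    (y j (inord 0)) (y j (inord 1)) (y j (inord 2)) (y j (inord 3)) => *; by field.
Qed.

Lemma area_sumE (w : R -> V) (s : seq R) l : (area_sum w s) 0 l =
  if l == inord 0 then 0 else
  \sum_(i < size s) 2^-1 * (phi (w (0 :: s)`_i) + phi (w (0 :: s)`_i.+1)) *
     ip (w (0 :: s)`_i.+1) (xi l (w (0 :: s)`_i)).
Proof.
rewrite /area_sum mxE summxE mulr_sumr.
have h (j : 'I_n) : 2^-1 * (strat_dXY (fun t => row j (w t))
               (fun t => (1 + normsq (w t))^-1 *: qconj (row j (w t))) 0 s
     - strat_YdX (fun t => (1 + normsq (w t))^-1 *: row j (w t))
                 (fun t => qconj (row j (w t))) 0 s) 0 l =
   \sum_(i < size s) if l == inord 0 then 0 else
      2^-1 * (phi (w (0 :: s)`_i) + phi (w (0 :: s)`_i.+1)) * \sum_c w (0 :: s)`_i.+1 j c * xi l (w (0 :: s)`_i) j c.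
  rewrite /strat_dXY /strat_YdX -sumrB summxE mulr_sumr; apply: eq_bigr => i _.
  by rewrite -strat_step !mxE.
rewrite (eq_bigr _ (fun j _ => h j)) exchange_big/=; case: eqP => _.
  by rewrite big1// => i _; rewrite big1.
by apply: eq_bigr => i _; rewrite -mulr_sumr.
Qed.

Lemma sum_area_step lam (w : R -> V) (s : seq R) :
  \sum_(i < size s) area_step lam (w (0 :: s)`_i) (w (0 :: s)`_i.+1) =
  \sum_(k < 3) lam 0 k * (area_sum w s) 0 (inord k.+1).
Proof.
under [RHS]eq_bigr => k _ do rewrite area_sumE (negbTE (inord_succ_neq0 k)) mulr_sumr.
rewrite exchange_big/=; apply: eq_bigr => i _.
rewrite /area_step ip_sumr mulr_sumr; apply: eq_bigr => k _.
by rewrite ipZr; ring.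
Qed.

End AreaIncrement.

(** * Time integrals and the martingale problem *)

Section Paths.
Variable R : realType.
Implicit Types (h : R -> R) (s t : R).
Local Notation mu := lebesgue_measure.

Lemma segment_uniform_continuity h t (e : R) : continuous h -> 0 < e ->
  exists2 d : R, 0 < d &
    forall x y : R, x \in `[0, t] -> `|x - y| < d -> `|h x - h y| <= e.
Proof.
move=> ch e0.
have := (@compact_near_coveringP R `[0, t]%classic).1 (@segment_compact R 0 t).
move=> /(_ R (nbhs (0 : R)) (fun d x => forall y : R, `|x - y| < `|d| -> `|h x - h y| <= e) _) H.
have {}H : \forall d \near (0 : R), forall x : R, `[0, t]%classic x -> forall y : R, `|x - y| < `|d| -> `|h x - h y| <= e.
  apply: H => x xt.
  have := ch x; move=> /cvgrPdist_lt /(_ (e / 2)) /(_ (divr_gt0 e0 (ltr0Sn _ 1)))/nbhs_ballP [r r0 hr].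
  exists (ball x (r / 2), ball 0 (r / 2)) => /=.
    by split; apply: nbhsx_ballx; rewrite divr_gt0.
  have rp : 0 < r := r0.
  move=> [x' d] [/= + +] y xy; rewrite /ball/= sub0r normrN => hx hd.
  have h1 : `|h x - h x'| < e / 2 by apply: hr; rewrite /ball/=; lra.
  have h2 : `|h x - h y| < e / 2.
    apply: hr; rewrite /ball/=.
    by apply: le_lt_trans (ler_distD x' _ _) _; lra.
  by apply: le_trans (ler_distD (h x) _ _) _; rewrite distrC; lra.
have /nbhs_ballP [r r0 hr] := H.
have rp : 0 < r := r0.
exists (r / 2); first by rewrite divr_gt0.
move=> x y xt xy; apply: (hr (r / 2)) => //.
  by rewrite /ball/= sub0r normrN gtr0_norm ?divr_gt0//; move: r0 => /=; lra.
by rewrite [X in _ < X]gtr0_norm ?divr_gt0.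
Qed.

Definition primitive h t : R := \int[mu]_(s in `[0, t]) h s.

Lemma continuous_integrable h s t : continuous h -> mu.-integrable `[s, t] (EFin \o h).
Proof.
move=> ch; apply: continuous_compact_integrable; first exact: segment_compact.
exact: continuous_subspaceT.
Qed.

Lemma primitiveB h s t : continuous h -> 0 <= s <= t ->
  primitive h t - primitive h s = \int[mu]_(r in `[s, t]) h r.
Proof.
move=> ch /andP[s0 st]; rewrite /primitive Rintegral_itvB ?bnd_simp//.
- rewrite Rintegral_itv_obnd_cbnd//.
  apply: (@integrableS _ _ _ mu `[s, t]) => //; last exact: continuous_integrable.
  exact: subset_itv_oc_cc.
- exact: continuous_integrable.
Qed.

Lemma primitive_cst (c t : R) : 0 <= t -> primitive (fun=> c) t = c * t.
Proof.
move=> t0; rewrite /primitive Rintegral_cst//=; congr (_ * _).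
by rewrite lebesgue_measure_itv/= lte_fin; case: ltgtP t0 => //= *; rewrite ?subr0.
Qed.

Lemma norm_primitiveB_le h s t (c e : R) : continuous h -> 0 <= s <= t ->
  (forall r, r \in `[s, t] -> `|h r - c| <= e) ->
  `|primitive h t - primitive h s - (t - s) * c| <= e * (t - s).
Proof.
move=> ch st he; case/andP: (st) => s0 st'.
have cc (a : R) : continuous (fun _ : R => a) by move=> x; exact: cvg_cst.
have ic (a : R) : \int[mu]_(r in `[s, t]) a = a * (t - s).
  rewrite -(primitiveB (cc a) st) !primitive_cst//; last exact: le_trans st'.
  by ring.
have cB : continuous (fun r => h r - c) by move=> x; apply: cvgB; [exact: ch | exact: cvg_cst].
have eB : \int[mu]_(r in `[s, t]) (h r - c) = \int[mu]_(r in `[s, t]) h r - \int[mu]_(r in `[s, t]) c.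
  by apply: RintegralB => //; exact: continuous_integrable.
rewrite primitiveB// [(t - s) * c]mulrC -(ic c) -eB.
apply: le_trans (le_normr_Rintegral _ _) _ => //; first exact: continuous_integrable.
rewrite -(ic e); apply: le_Rintegral => //; last first.
- exact: continuous_integrable.
- have cN : continuous (fun r => `|h r - c|) by move=> x; apply: cvg_norm; exact: cB.
  exact: continuous_integrable cN.
Qed.

Definition node s t (N i : nat) : R := s + (t - s) * (i%:R / N%:R).

Lemma node0 s t N : node s t N 0 = s.
Proof. by rewrite /node mul0r mulr0 addr0. Qed.

Lemma nodeN s t N : (0 < N)%N -> node s t N N = t.
Proof. by move=> N0; rewrite /node divff ?mulr1 ?subrKC// pnatr_eq0 -lt0n. Qed.

Lemma node_step s t N i : node s t N i.+1 - node s t N i = (t - s) / N%:R.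
Proof. by rewrite /node -natr1; ring. Qed.

Lemma sum_cst_over (a : R) N : (0 < N)%N -> \sum_(i < N) a / N%:R = a.
Proof. by move=> N0; rewrite sumr_const card_ord -(mulr_natr (a / N%:R)) divfK// pnatr_eq0 -lt0n. Qed.

Lemma le_node s t N i j : s <= t -> (i <= j)%N -> node s t N i <= node s t N j.
Proof.
move=> st ij; rewrite /node lerD2l ler_wpM2l ?subr_ge0//.
by rewrite ler_wpM2r ?invr_ge0// ler_nat.
Qed.

Lemma node_ge s t N i : s <= t -> s <= node s t N i.
Proof. by move=> st; rewrite -[leLHS](node0 s t N) le_node. Qed.

Lemma node_le s t N i : s <= t -> (i <= N)%N -> node s t N i <= t.
Proof.
move=> st iN; case: (posnP N) => N0.
  by rewrite /node N0 invr0 mulr0 mulr0 addr0.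
by rewrite -[leRHS](nodeN s t N0) le_node.
Qed.

(** Absolute values stand inside the sum: each step will carry its own random weight, so a bound on
    the difference between the whole Riemann sum and the integral would not suffice. *)
Definition riemann_error h s t N : R := \sum_(i < N)
  `|primitive h (node s t N i.+1) - primitive h (node s t N i) - (t - s) / N%:R * h (node s t N i)|.

Lemma riemann_error_cvg0 h s t : continuous h -> 0 <= s <= t ->
  riemann_error h s t N @[N --> \oo] --> 0.
Proof.
move=> ch st; case/andP: (st) => s0 st'.
apply/cvgrPdist_le => e e0.
have e1 : 0 < e / (t - s + 1) by rewrite divr_gt0//; lra.
have [d d0 hd] := segment_uniform_continuity t ch e1.
near=> N; rewrite sub0r normrN ger0_norm; last by apply: sumr_ge0.
have N0 : (0 < N)%N by near: N; exact: nbhs_infty_gt.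
have NR : 0 < N%:R :> R by rewrite ltr0n.
have hN : (t - s) / N%:R < d.
  rewrite ltr_pdivrMr// mulrC -ltr_pdivrMr//; near: N; exact: nbhs_infty_gtr.
apply: le_trans (_ : \sum_(i < N) (e / (t - s + 1) * (t - s)) / N%:R <= _).
  apply: ler_sum => i _; rewrite -[leRHS]mulrA -(node_step s t N i).
  have hi : node s t N i <= node s t N i.+1 by exact: le_node.
  apply: norm_primitiveB_le => //.
    by rewrite hi andbT (le_trans s0)// node_ge.
  move=> r; rewrite in_itv/= => /andP[r1 r2].
  have := node_step s t N i => E.
  apply: hd.
    rewrite in_itv/= (le_trans _ r1) ?(le_trans s0 (node_ge _ _ _))//=.
    by apply: le_trans r2 _; exact: node_le.
  by rewrite ger0_norm; lra.
by rewrite sum_cst_over// mulrAC ler_pdivrMr ?ler_pM2l//; lra.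
Unshelve. all: by end_near.
Qed.

Lemma riemann_sum_error h s t N : (0 < N)%N ->
  `|(t - s) / N%:R * \sum_(i < N) h (node s t N i) - (primitive h t - primitive h s)|
  <= riemann_error h s t N.
Proof.
move=> N0; have -> : primitive h t - primitive h s =
    \sum_(i < N) (primitive h (node s t N i.+1) - primitive h (node s t N i)).
  by rewrite -(big_mkord xpredT (fun i => primitive h (node s t N i.+1) - primitive h (node s t N i))) telescope_sumr// node0 nodeN.
rewrite mulr_sumr -sumrB; apply: le_trans (ler_norm_sum _ _ _) _.
by apply: ler_sum => i _; rewrite distrC.
Qed.

Lemma riemann_sum_cvg h s t : continuous h -> 0 <= s <= t ->
  (t - s) / N%:R * \sum_(i < N) h (node s t N i) @[N --> \oo] --> primitive h t - primitive h s.
Proof.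
move=> ch st; apply/cvgrPdist_le => e e0.
have /cvgrPdist_le /(_ _ e0) H := riemann_error_cvg0 ch st.
near=> N; rewrite distrC; apply: le_trans (riemann_sum_error _ _ _ _) _.
  by near: N; exact: nbhs_infty_gt.
have : `|0 - riemann_error h s t N| <= e by near: N; exact: H.
by rewrite sub0r normrN => /(le_trans (ler_norm _)).
Unshelve. all: by end_near.
Qed.

Lemma norm_primitiveB h s t (C : R) : continuous h -> 0 <= s <= t ->
  (forall r, r \in `[s, t] -> `|h r| <= C) -> `|primitive h t - primitive h s| <= C * (t - s).
Proof.
move=> ch st hC; have := @norm_primitiveB_le h s t 0 C ch st.
by rewrite mulr0 subr0; apply => r rst; rewrite subr0; exact: hC.
Qed.

Lemma riemann_error_le h s t N (C : R) : continuous h -> 0 <= s <= t ->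
  (forall r, `|h r| <= C) -> riemann_error h s t N <= 2 * C * (t - s).
Proof.
move=> ch st hC; case/andP: (st) => s0 st'.
have C0 : 0 <= C by apply: le_trans (hC 0).
case: (posnP N) => [->|N0]; first by rewrite /riemann_error big_ord0 mulr_ge0 ?mulr_ge0 ?subr_ge0.
have NR : 0 < N%:R :> R by rewrite ltr0n.
apply: le_trans (_ : \sum_(i < N) (2 * C * (t - s)) / N%:R <= _).
  apply: ler_sum => i _; rewrite -[leRHS]mulrA -(node_step s t N i).
  have hi : node s t N i <= node s t N i.+1 by exact: le_node.
  apply: norm_primitiveB_le => //.
    by rewrite hi andbT (le_trans s0)// node_ge.
  by move=> r _; apply: le_trans (ler_normB _ _) _; have := hC r; have := hC (node s t N i); lra.
by rewrite sum_cst_over.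
Qed.

Lemma primitive_mono h s t : continuous h -> (forall r, 0 <= h r) -> 0 <= s <= t ->
  primitive h s <= primitive h t.
Proof.
by move=> ch h0 st; rewrite -subr_ge0 primitiveB//; apply: Rintegral_ge0.
Qed.

Lemma primitive0 h : primitive h 0 = 0.
Proof. by rewrite /primitive set_itv1 Rintegral_set1. Qed.

End Paths.

(** * Random variables known from a part of a process *)

Section Adapted.
Context d (T : measurableType d) (R : realType) (E : topologicalType).
Variable X : R -> T -> E.
Implicit Types (I J : set R) (K L : T -> R).

Definition events I : set (set T) :=
  [set A | exists u (U : set E), [/\ I u, open U & A = X u @^-1` U]].

Definition adapted I K := forall B : set R, measurable B -> sigma_process X I (K @^-1` B).

Lemma adaptedP I K : adapted I K <->
  @measurable_fun _ _ (g_sigma_algebraType (events I)) R setT K.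
Proof.
split=> [h _ B mB|h B mB]; first by rewrite setTI; exact: h.
by have := h measurableT B mB; rewrite setTI.
Qed.

Lemma sigma_process_sub I J : I `<=` J -> sigma_process X I `<=` sigma_process X J.
Proof.
move=> IJ; apply: smallest_sub; first exact: smallest_sigma_algebra.
move=> A [u [U [Iu oU AE]]]; apply: sub_sigma_algebra.
by exists u, U; split => //; exact: IJ.
Qed.

Lemma adapted_sub I J K : I `<=` J -> adapted I K -> adapted J K.
Proof. by move=> IJ h B mB; apply: sigma_process_sub IJ _ _; exact: h. Qed.

Lemma adapted_comp I u (f : E -> R) : I u -> continuous f -> adapted I (fun o => f (X u o)).
Proof.
move=> Iu cf; apply/adaptedP.
apply: (measurability (@RGenOInfty.G R)).
  exact: RGenOInfty.measurableE.
move=> _ [_ [r ->] <-]; rewrite setTI; apply: sub_sigma_algebra.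
exists u, (f @^-1` `]r, +oo[); split => //.
by move/continuousP: cf; apply; rewrite set_itvE; exact: open_gt.
Qed.

Lemma adapted_cst I c : adapted I (fun=> c).
Proof. by apply/adaptedP; exact: measurable_cst. Qed.

Lemma adaptedD I K L : adapted I K -> adapted I L -> adapted I (fun o => K o + L o).
Proof. by move=> /adaptedP hK /adaptedP hL; apply/adaptedP; exact: measurable_funD. Qed.

Lemma adaptedM I K L : adapted I K -> adapted I L -> adapted I (fun o => K o * L o).
Proof. by move=> /adaptedP hK /adaptedP hL; apply/adaptedP; exact: measurable_funM. Qed.

Lemma adapted_continuous I (h : R -> R) K : continuous h -> adapted I K ->
  adapted I (fun o => h (K o)).
Proof.
move=> ch /adaptedP hK; apply/adaptedP; apply: (measurableT_comp _ hK).
exact: continuous_measurable_fun.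
Qed.

Lemma adapted_le I K (c : R) : adapted I K -> adapted I (fun o => (K o <= c)%R%:R).
Proof.
move=> hK B mB.
have -> : (fun o => (K o <= c)%R%:R : R) @^-1` B =
  K @^-1` ((fun r => (r <= c)%R%:R : R) @^-1` B) by [].
apply: hK; rewrite -[X in measurable X]setTI.
have -> : (fun r => (r <= c)%R%:R : R) = \1_(`]-oo, c]).
  apply/funext => r; rewrite indicE; congr ((nat_of_bool _)%:R).
  by apply/idP/idP => h; [rewrite inE/= in_itv | move: h; rewrite inE/= in_itv].
exact: measurable_indic.
Qed.

Lemma adapted_sum I (A : Type) (s : seq A) (F : A -> T -> R) :
  (forall i, adapted I (F i)) -> adapted I (fun o => \sum_(i <- s) F i o).
Proof.
move=> hF; elim: s => [|i s IH].
  by under eq_fun do rewrite big_nil; exact: adapted_cst.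
by under eq_fun do rewrite big_cons; exact: adaptedD.
Qed.

Lemma adapted_prod I (A : Type) (s : seq A) (F : A -> T -> R) :
  (forall i, adapted I (F i)) -> adapted I (fun o => \prod_(i <- s) F i o).
Proof.
move=> hF; elim: s => [|i s IH].
  by under eq_fun do rewrite big_nil; exact: adapted_cst.
by under eq_fun do rewrite big_cons; exact: adaptedM.
Qed.

Hypothesis mX : measurable_process X.

Lemma adapted_measurable I K : I `<=` `[0, +oo[ -> adapted I K -> measurable_fun setT K.
Proof.
move=> I0 h _ B mB; rewrite setTI; apply: mX; apply: sigma_process_sub I0 _ _.
exact: h.
Qed.

(** A monotone class argument with the same variable on both sides of the closure, weighted by W on
    one side and by 0 on the other. *)
Lemma mean_orthogonal (P : probability T R) I (W K : T -> R) (M : R) : I `<=` `[0, +oo[ ->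
  bounded_measurable W -> (forall A, sigma_process X I A -> mean P (fun o => W o * \1_A o) = 0) ->
  adapted I K -> 0 < M -> (forall o, `|K o| <= M) -> mean P (fun o => W o * K o) = 0.
Proof.
move=> I0 bW hW aK M0 KM.
pose base (f f' : T -> R) := f = f' /\ exists2 A, sigma_process X I A & f = \1_A.
have hb : forall f f', base f f' -> mean P (fun o => W o * f o) = mean P (fun o => 0 * f' o).
  move=> f f' [<- [A hA ->]]; rewrite hW//.
  by rewrite (_ : (fun o => 0 * _) = (fun=> 0)) ?mean_cst//; apply/funext => o; rewrite mul0r.
have mA A : sigma_process X I A -> measurable A.
  by move=> hA; apply: mX; apply: sigma_process_sub I0 _ hA.
have bI A : sigma_process X I A -> bounded_measurable (\1_A : T -> R).
  by move=> hA; apply: bounded_measurable_indic; exact: mA.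
have cb A : sigma_process X I A -> closure P P base (\1_A) (\1_A).
  by move=> hA; apply: closure_base; [exact: bI|exact: bI|split => //; exists A].
have c1 : closure P P base (fun=> 1) (fun=> 1).
  have sT : sigma_process X I setT.
    by have := @adapted_cst I 0 setT measurableT; rewrite preimage_setT.
  by have := cb _ sT; rewrite indicT.
have bK : bounded_measurable K.
  by split; [exact: adapted_measurable I0 aK | exists M].
have cK : closure P P base K K.
  apply: (closure_le c1 bK bK M0 KM KM) => c.
  have -> : (fun o => (c <= K o)%R%:R : R) = \1_(K @^-1` `[c, +oo[).
    apply/funext => o; rewrite indicE; congr ((nat_of_bool _)%:R).
    by apply/idP/idP => h; [rewrite inE/= in_itv/= h | move: h; rewrite inE/= in_itv/= andbT].
  by apply: cb; apply: aK.
rewrite (closure_mean bW (bounded_measurable_cst T (0 : R)) hb cK).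
by rewrite (_ : (fun o => 0 * _) = (fun=> 0)) ?mean_cst//; apply/funext => o; rewrite mul0r.
Qed.

End Adapted.

Section ContinuousPaths.
Context (R : realType) (E : topologicalType).

(** Freezing the path at its value at 0 for negative times replaces continuity within the half line
    by continuity everywhere, which composes and integrates freely. *)
Lemma continuous_extension (h : R -> E) : {within `[0, +oo[, continuous h} ->
  continuous (fun r : R => h (Num.max 0 r)).
Proof.
move=> /subspace_continuousP ch r.
have h0 : `[0, +oo[%classic (Num.max 0 r) by rewrite /= in_itv/= le_max lexx.
apply: (cvg_comp (fun r : R => Num.max 0 r) h _ (ch _ h0)).
move=> A /= wA; have cm : continuous (fun r : R => Num.max 0 r).
  by move=> z; apply: continuous_max; [exact: cst_continuous | exact: cvg_id].
have : \forall z \near r, (`[0, +oo[%classic (Num.max 0 z) -> A (Num.max 0 z)) := cm r _ wA.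
by apply: filterS => z; apply; rewrite /= in_itv/= le_max lexx.
Qed.

End ContinuousPaths.

(** * Orthogonality of the increments of test functions to the past *)

Section Increments.
Variables (R : realType) (n : nat).
Notation V := 'M[R]_(n, 4).
Context d (T : measurableType d) (P : probability T R).
Variable w : R -> T -> V.
Hypothesis hw : hp_brownian_motion P w.
Implicit Types (x y : V) (f g : V -> R) (s t r : R) (o : T).

Definition past t : set R := `[0, t]%classic.

Lemma past_sub s t : s <= t -> past s `<=` past t.
Proof. by move=> st r; rewrite /past/= !in_itv/= => /andP[-> rs]; rewrite (le_trans rs). Qed.

Lemma past_ge0 t : past t `<=` `[0, +oo[.
Proof. by move=> r; rewrite /past/= !in_itv/= andbT => /andP[]. Qed.

Lemma hp_measurable : measurable_process w. Proof. by case: hw. Qed.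

Definition path o r : V := w (Num.max 0 r) o.

Lemma pathE o r : 0 <= r -> path o r = w r o.
Proof. by move=> r0; rewrite /path max_r. Qed.

Lemma path_continuous o : continuous (path o).
Proof. by have [_ cw _ _] := hw; exact: (@continuous_extension R V (fun r => w r o) (cw o)). Qed.

Lemma along_continuous f o : continuous f -> continuous (fun r => f (path o r)).
Proof. by move=> cf r; apply: (cvg_comp _ _ (@path_continuous o r)); exact: cf. Qed.

Lemma adapted_path t s f : 0 <= s <= t -> continuous f -> adapted w (past t) (fun o => f (path o s)).
Proof.
move=> /andP[s0 st] cf.
have -> : (fun o => f (path o s)) = (fun o => f (w s o)) by apply/funext => o; rewrite pathE.
by apply: adapted_comp => //; rewrite /past/= in_itv/= s0.
Qed.

Lemma measurable_path s f : continuous f -> measurable_fun setT (fun o => f (path o s)).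
Proof.
move=> cf; have -> : (fun o => f (path o s)) = (fun o => f (path o (Num.max 0 s))).
  by apply/funext => o; rewrite /path maxA maxxx.
apply: (adapted_measurable hp_measurable (@past_ge0 (Num.max 0 s))).
by apply: adapted_path => //; rewrite le_max !lexx.
Qed.

Definition test f := tame f /\ exists M, supported M f.

Lemma test_bounded f : test f -> exists2 C : R, 0 < C & forall x, `|f x| <= C.
Proof. by move=> [tf [M sf]]; apply: supported_bounded sf; exact: tame_continuous. Qed.

Lemma test_hp_laplacian f : test f -> test (hp_laplacian f).
Proof.
move=> [tf [M sf]]; split; first exact: tame_hp_laplacian.
by exists M; exact: supported_hp_laplacian.
Qed.

Lemma bounded_measurable_test f s : test f -> bounded_measurable (fun o => f (path o s)).
Proof.
move=> tf; have [C _ hC] := test_bounded tf; split; last by exists C.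
by apply: measurable_path; apply: tame_continuous; case: tf.
Qed.

Definition drift f t o : R := primitive (fun r => hp_laplacian f (path o r)) t.

Lemma hp_martingale f : test f -> martingale P (fun t => sigma_process w (past t))
  (fun t o => f (path o t) - f (path o 0) - drift f t o).
Proof.
move=> [tf [M sf]]; case: hw => _ _ _ /(_ f (tame_smooth tf) (supported_compactly sf)).
have e t o : 0 <= t -> f (w t o) - f (w 0 o) -
    \int[lebesgue_measure]_(s in `[0, t]) (2^-1 * laplace_beltrami (@hp_metric R n) f (w s o)) =
    f (path o t) - f (path o 0) - drift f t o.
  move=> t0; rewrite !pathE//; congr (_ - _).
  apply: eq_Rintegral => r; rewrite inE/= in_itv/= => /andP[r0 _].
  by rewrite laplace_beltrami_hp// pathE.
move=> [h1 h2 h3]; split.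
- move=> t t0 B mB; have := h1 t t0 B mB; congr (sigma_process _ _ _).
  by apply/seteqP; split => o /=; rewrite e.
- move=> t t0; have := h2 t t0; congr (_.-integrable _ _).
  by apply/funext => o /=; rewrite e.
- move=> s t st A hA; have := h3 s t st A hA; case/andP: st => s0 st h3A.
  have t0 := le_trans s0 st.
  have ei u : 0 <= u -> \int[P]_(o in A) (f (w u o) - f (w 0 o) -
      \int[lebesgue_measure]_(s in `[0, u]) (2^-1 * laplace_beltrami (@hp_metric R n) f (w s o))) =
      \int[P]_(o in A) (f (path o u) - f (path o 0) - drift f u o).
    by move=> u0; apply: eq_Rintegral => o _; exact: e.
  by rewrite -(ei t t0) -(ei s s0).
Qed.

Lemma bounded_measurable_drift f t : test f -> 0 <= t -> bounded_measurable (drift f t).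
Proof.
move=> tf t0; have [h1 _ _] := hp_martingale tf.
have mM : measurable_fun setT (fun o => f (path o t) - f (path o 0) - drift f t o).
  apply: (adapted_measurable hp_measurable (@past_ge0 t)) => B mB.
  exact: h1.
split.
  have -> : drift f t = fun o => f (path o t) - f (path o 0) - (f (path o t) - f (path o 0) - drift f t o).
    by apply/funext => o; ring.
  have mf u := (bounded_measurable_test u tf).1.
  by apply: measurable_funB => //; apply: measurable_funB; exact: mf.
have [C C0 hC] := test_bounded (test_hp_laplacian tf); exists (C * t) => o.
have cL : continuous (fun r => hp_laplacian f (path o r)).
  by apply: along_continuous; apply: tame_continuous; case: (test_hp_laplacian tf).
have := @norm_primitiveB _ (fun r => hp_laplacian f (path o r)) 0 t C cL.
by rewrite primitive0 !subr0 lexx t0; apply.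
Qed.

Definition increment f s t o : R := f (path o t) - f (path o s) - (drift f t o - drift f s o).

Lemma bounded_measurable_increment f s t : test f -> 0 <= s <= t ->
  bounded_measurable (increment f s t).
Proof.
move=> tf /andP[s0 st]; have t0 := le_trans s0 st.
by do 2 (apply: bounded_measurableB); by [exact: bounded_measurable_test | exact: bounded_measurable_drift].
Qed.

Lemma mean_increment f s t K (M : R) : test f -> 0 <= s <= t -> adapted w (past s) K ->
  0 < M -> (forall o, `|K o| <= M) -> mean P (fun o => increment f s t o * K o) = 0.
Proof.
move=> tf st aK M0 KM.
apply: (mean_orthogonal hp_measurable (@past_ge0 s) _ _ aK M0 KM).
  exact: bounded_measurable_increment.
move=> A hA; case/andP: (st) => s0 st'; have t0 := le_trans s0 st'.
have mA : measurable A.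
  by apply: hp_measurable; apply: sigma_process_sub (@past_ge0 s) _ hA.
have [_ _ h3] := hp_martingale tf.
have := h3 s t st A hA.
have bM u : 0 <= u -> bounded_measurable (fun o => (f (path o u) - f (path o 0) - drift f u o) * \1_A o).
  move=> u0; apply: bounded_measurableM; last exact: bounded_measurable_indic.
  apply: bounded_measurableB; last exact: bounded_measurable_drift.
  by apply: bounded_measurableB; exact: bounded_measurable_test.
have eA (g : T -> R) : \int[P]_(o in A) g o = mean P (fun o => g o * \1_A o).
  rewrite Rintegral_mkcond; apply: eq_Rintegral => o _; rewrite patchE indicE.
  by case: ifP => _; rewrite ?mulr1 ?mulr0.
rewrite !eA => e.
have -> : (fun o => increment f s t o * \1_A o) =
  (fun o => (f (path o t) - f (path o 0) - drift f t o) * \1_A o -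
            (f (path o s) - f (path o 0) - drift f s o) * \1_A o).
  by apply/funext => o; rewrite /increment; ring.
rewrite (meanB P (bM t t0) (bM s s0)); apply/eqP; rewrite subr_eq0; apply/eqP; exact: e.
Qed.

(* [J] behaves like a weight known at time [t]; this notion, unlike measurability
   with respect to the past, is stable under limits in probability. *)
Definition admissible t (J : T -> R) :=
  [/\ bounded_measurable J, 0 <= t &
    forall f s u K M, test f -> t <= s <= u -> adapted w (past s) K -> 0 < M ->
      (forall o, `|K o| <= M) -> mean P (fun o => J o * (increment f s u o * K o)) = 0].

Lemma admissible_cst c : admissible 0 (fun=> c).
Proof.
split => // [|f s u K M tf /andP[s0 su] aK M0 KM]; first exact: bounded_measurable_cst.
have bK : bounded_measurable K.
  by split; [exact: (adapted_measurable hp_measurable (@past_ge0 s)) | exists M].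
rewrite meanZ; first by rewrite (mean_increment tf _ aK M0 KM) ?mulr0// s0.
by apply: bounded_measurableM => //; apply: bounded_measurable_increment; rewrite ?s0.
Qed.

Lemma admissible_le s t J : s <= t -> admissible s J -> admissible t J.
Proof.
move=> st [bJ s0 hJ]; split=> //; first exact: le_trans st.
move=> f r u K M tf /andP[tr ru] aK M0 KM; apply: hJ KM => //.
by rewrite ru andbT (le_trans st).
Qed.

Lemma admissibleM t J K (M : R) : admissible t J -> adapted w (past t) K ->
  (forall o, `|K o| <= M) -> admissible t (fun o => J o * K o).
Proof.
move=> [bJ t0 hJ] aK KM.
have bK : bounded_measurable K.
  by split; [exact: (adapted_measurable hp_measurable (@past_ge0 t)) | exists M].
split=> //; first exact: bounded_measurableM.
move=> f s u L N tf /andP[ts su] aL N0 LN.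
have -> : (fun o => J o * K o * (increment f s u o * L o)) =
  (fun o => J o * (increment f s u o * (K o * L o))) by apply/funext => o; ring.
apply: (hJ f s u _ ((`|M| + 1) * N)) => //.
- by rewrite ts.
- by apply: adaptedM => //; apply: adapted_sub aK; exact: past_sub.
- by rewrite mulr_gt0// ltr_wpDl.
- move=> o; rewrite normrM ler_pM//; apply: le_trans (KM o) _.
  by apply: le_trans (ler_norm _) _; rewrite lerDl.
Qed.

Lemma admissibleD t J K : admissible t J -> admissible t K -> admissible t (fun o => J o + K o).
Proof.
move=> [bJ t0 hJ] [bK _ hK]; split=> //; first exact: bounded_measurableD.
move=> f s u L N tf su aL N0 LN.
have bL : bounded_measurable L.
  by split; [exact: (adapted_measurable hp_measurable (@past_ge0 s)) | exists N].
have bI : bounded_measurable (fun o => increment f s u o * L o).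
  apply: bounded_measurableM => //; apply: bounded_measurable_increment => //.
  by case/andP: su => ts ->; rewrite (le_trans t0).
have -> : (fun o => (J o + K o) * (increment f s u o * L o)) =
  (fun o => J o * (increment f s u o * L o) + K o * (increment f s u o * L o)).
  by apply/funext => o; ring.
rewrite meanD; [|exact: bounded_measurableM|exact: bounded_measurableM].
by rewrite (hJ _ _ _ _ _ tf su aL N0 LN) (hK _ _ _ _ _ tf su aL N0 LN) addr0.
Qed.

Lemma admissibleZ t (c : R) J : admissible t J -> admissible t (fun o => c * J o).
Proof.
move=> hJ; have := admissibleM hJ (@adapted_cst _ _ _ _ w (past t) c) (M := `|c|) (fun=> lexx _).
by under eq_fun do rewrite mulrC.
Qed.

(** Convergence in mean is enough because the increment of a test function times a bounded adapted
    variable is bounded. *)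
Lemma admissible_lim t (J_ : nat -> T -> R) J : (forall k, admissible t (J_ k)) ->
  bounded_measurable J -> mean P (fun o => `|J_ k o - J o|) @[k --> \oo] --> 0 ->
  admissible t J.
Proof.
move=> hJ bJ cJ; have [_ t0 _] := hJ 0%N; split=> // f s u L N tf su aL N0 LN.
have bL : bounded_measurable L.
  by split; [exact: (adapted_measurable hp_measurable (@past_ge0 s)) | exists N].
have bI : bounded_measurable (fun o => increment f s u o * L o).
  apply: bounded_measurableM => //; apply: bounded_measurable_increment => //.
  by case/andP: su => ts ->; rewrite (le_trans t0).
have [C C0 hC] := bounded_measurable_pos bI.
have bJk k : bounded_measurable (J_ k) by case: (hJ k).
apply/eqP; rewrite -normr_le0; apply/ler_addgt0Pl => e e0; rewrite addr0.
have /cvgrPdist_le /(_ (e / C)) := cJ; rewrite divr_gt0// => /(_ isT) [k _ /(_ k (leqnn k))] hk.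
have [_ _ /(_ f s u L N tf su aL N0 LN) z] := hJ k.
rewrite sub0r normrN in hk.
rewrite -[X in `|X|]subr0 -z -meanB; [|exact: bounded_measurableM|exact: bounded_measurableM].
have bB : bounded_measurable (fun o => `|J_ k o - J o|).
  by apply: bounded_measurable_norm; exact: bounded_measurableB.
apply: le_trans (_ : mean P (fun o => C * `|J_ k o - J o|) <= _).
  apply: norm_mean_le.
  - by apply: bounded_measurableB; exact: bounded_measurableM.
  - by apply: bounded_measurableM => //; exact: bounded_measurable_cst.
  move=> o; rewrite -mulrBl normrM mulrC distrC ler_wpM2r//; exact: hC.
rewrite meanZ// mulrC -ler_pdivlMr//; apply: le_trans hk; exact: ler_norm.
Qed.

End Increments.

(** * Moments along a partition *)

Section StepErrors.
Variables (R : realType) (n : nat).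
Notation V := 'M[R]_(n, 4).
Context d (T : measurableType d) (P : probability T R).
Variable w : R -> T -> V.
Hypothesis hw : hp_brownian_motion P w.
Implicit Types (x y : V) (f g : V -> R) (r : R) (o : T).
Local Notation path := (path w).

Lemma ball_bounded (u : V -> R) (M : R) : continuous u ->
  exists2 C : R, 0 < C & forall x, normsq x <= M -> `|u x| <= C.
Proof.
move=> cu; have : compact (u @` [set x : V | normsq x <= M]).
  apply: continuous_compact; last exact: compact_normsq_le.
  exact: continuous_subspaceT.
move=> /compact_bounded [C [_ hC]]; exists (`|C| + 1); first by rewrite ltr_wpDl.
move=> x xM; apply: (hC (`|C| + 1)); last by exists x.
by apply: le_lt_trans (ler_norm _) _; rewrite ltrDl.
Qed.

Definition in_ball (M : R) x : R := (normsq x <= M)%R%:R.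

Lemma in_ball01 M x : 0 <= in_ball M x <= 1.
Proof. by rewrite /in_ball ler0n lern1 leq_b1. Qed.

Lemma norm_in_ball M x : `|in_ball M x| <= 1.
Proof. by have /andP[h1 h2] := in_ball01 M x; rewrite ger0_norm. Qed.

Lemma measurable_primitive f r : continuous f -> 0 <= r ->
  measurable_fun setT (fun o => primitive (fun u => f (path o u)) r).
Proof.
move=> cf r0.
apply: (@measurable_fun_cvg _ _ _ _
  (fun N o => (r - 0) / N%:R * \sum_(i < N) f (path o (node 0 r N i)))).
  move=> N; apply: measurable_funM => //; apply: measurable_sum => i.
  exact: (measurable_path hw).
move=> o _; have cp := @along_continuous _ _ _ _ _ _ hw f o cf.
have h0r : (0 : R) <= 0 <= r by apply/andP; split.
by have := riemann_sum_cvg cp h0r; rewrite primitive0 [X in (_ --> X) -> _]subr0.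
Qed.

Variables (s t : R).
Hypothesis st : 0 <= s <= t.
Let s0 : 0 <= s. Proof. by case/andP: st. Qed.
Let s_le_t : s <= t. Proof. by case/andP: st. Qed.

Definition pos N i o : V := path o (node s t N i).
Definition step N : R := (t - s) / N%:R.

Lemma node_ge0 N i : 0 <= node s t N i.
Proof. by apply: le_trans s0 _; exact: node_ge. Qed.

Lemma le_node_succ N i : 0 <= node s t N i <= node s t N i.+1.
Proof. by rewrite node_ge0 le_node. Qed.

Lemma step_ge0 N : 0 <= step N.
Proof. by rewrite /step divr_ge0// subr_ge0. Qed.

Lemma adapted_pos N i j f : (i <= j)%N -> continuous f ->
  adapted w (past (node s t N j)) (fun o => f (pos N i o)).
Proof. by move=> ij cf; apply: adapted_path => //; rewrite node_ge0 le_node. Qed.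

Lemma adapted_in_ball M N i j : (i <= j)%N ->
  adapted w (past (node s t N j)) (fun o => in_ball M (pos N i o)).
Proof.
move=> ij; apply: adapted_le; apply: adapted_pos => //.
exact: normsq_continuous.
Qed.

Lemma measurable_pos N i f : continuous f -> measurable_fun setT (fun o => f (pos N i o)).
Proof. exact: (measurable_path hw). Qed.

Lemma bounded_measurable_in_ball M N i : bounded_measurable (fun o => in_ball M (pos N i o)).
Proof.
split; last by exists 1 => o; exact: norm_in_ball.
apply: (adapted_measurable (hp_measurable hw) (@past_ge0 R (node s t N i))).
exact: adapted_in_ball.
Qed.

(** The increment of F(x, .) g over one step, with x the start of the step, minus the drift frozen
    at x. The indicator keeps the coefficients u(x) of a separable F bounded. *)
Definition step_error (M : R) (F : V -> V -> R) g N i o : R :=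
  in_ball M (pos N i o) * (F (pos N i o) (pos N i.+1 o) * g (pos N i.+1 o)
    - F (pos N i o) (pos N i o) * g (pos N i o)
    - step N * hp_laplacian (fun y => F (pos N i o) y * g y) (pos N i o)).

Lemma separable_tame (F : V -> V -> R) x : separable F -> tame (F x).
Proof.
elim=> {F} [u v cu tv|F G _ hF _ hG]; last exact: tameD.
by apply: tameM => //; exact: tame_cst.
Qed.

Lemma step_error_prod M (u v : V -> R) g N i o : tame v -> tame g ->
  step_error M (fun x y => u x * v y) g N i o =
  (in_ball M (pos N i o) * u (pos N i o)) *
  (v (pos N i.+1 o) * g (pos N i.+1 o) - v (pos N i o) * g (pos N i o)
   - step N * hp_laplacian (fun y => v y * g y) (pos N i o)).
Proof.
move=> tv tg; rewrite /step_error.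
have -> : (fun y => u (pos N i o) * v y * g y) = (fun y => u (pos N i o) * (v y * g y)).
  by apply/funext => y; rewrite mulrA.
by rewrite hp_laplacianZ; [ring | exact: tameM].
Qed.

Lemma step_errorD M (F G : V -> V -> R) g N i o : separable F -> separable G -> tame g ->
  step_error M (fun x y => F x y + G x y) g N i o =
  step_error M F g N i o + step_error M G g N i o.
Proof.
move=> sF sG tg; rewrite /step_error; set x := pos N i o.
have -> : (fun y => (F x y + G x y) * g y) = (fun y => F x y * g y + G x y * g y).
  by apply/funext => y; rewrite mulrDl.
rewrite hp_laplacianD; first by ring.
- by apply: tameM => //; exact: separable_tame.
- by apply: tameM => //; exact: separable_tame.
Qed.

Lemma testM (v g : V -> R) : tame v -> test g -> test (fun y => v y * g y).
Proof.
move=> tv [tg [M sg]]; split; first exact: tameM.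
by exists M => x xM; rewrite sg// mulr0.
Qed.

Lemma bounded_measurable_pos_test f N i : test f -> bounded_measurable (fun o => f (pos N i o)).
Proof. exact: (bounded_measurable_test hw). Qed.

Lemma bounded_measurable_ball_fun M (u : V -> R) N i : continuous u ->
  bounded_measurable (fun o => in_ball M (pos N i o) * u (pos N i o)).
Proof.
move=> cu; split.
  by apply: measurable_funM; [exact: (bounded_measurable_in_ball M N i).1 | exact: measurable_pos].
have [C C0 hC] := ball_bounded M cu; exists C => o.
rewrite /in_ball; case: (lerP (normsq _) M) => h /=; first by rewrite mul1r hC.
by rewrite mul0r normr0 ltW.
Qed.

Lemma bounded_measurable_step_error M F g N i : separable F -> test g ->
  bounded_measurable (step_error M F g N i).
Proof.
move=> sF tg; elim: sF => {F} [u v cu tv|F G sF hF sG hG]; last first.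
  have -> : step_error M (fun x y => F x y + G x y) g N i =
      fun o => step_error M F g N i o + step_error M G g N i o.
    by apply/funext => o; rewrite step_errorD//; case: tg.
  exact: bounded_measurableD.
have -> : step_error M (fun x y => u x * v y) g N i = fun o =>
  (in_ball M (pos N i o) * u (pos N i o)) *
  (v (pos N i.+1 o) * g (pos N i.+1 o) - v (pos N i o) * g (pos N i o)
   - step N * hp_laplacian (fun y => v y * g y) (pos N i o)).
  by apply/funext => o; rewrite step_error_prod//; case: tg.
have tf := testM tv tg; have tL := test_hp_laplacian tf.
apply: bounded_measurableM; first exact: bounded_measurable_ball_fun.
apply: bounded_measurableB.
  by apply: bounded_measurableB; exact: (@bounded_measurable_pos_test (fun y => v y * g y)).
apply: bounded_measurableM; first exact: bounded_measurable_cst.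
exact: (@bounded_measurable_pos_test (hp_laplacian (fun y => v y * g y))).
Qed.

Lemma mean_riemann_error_cvg f : test f ->
  mean P (fun o => riemann_error (fun r => f (path o r)) s t N) @[N --> \oo] --> 0 /\
  forall N, measurable_fun setT (fun o => riemann_error (fun r => f (path o r)) s t N).
Proof.
move=> tf; have cf : continuous f by apply: tame_continuous; case: tf.
have mR N : measurable_fun setT (fun o => riemann_error (fun r => f (path o r)) s t N).
  apply: measurable_sum => i; apply: measurableT_comp => //.
  apply: measurable_funB.
    by apply: measurable_funB; apply: measurable_primitive => //; exact: node_ge0.
  by apply: measurable_funM => //; exact: (measurable_path hw).
split=> //; have [C C0 hC] := test_bounded tf.
have cp o := @along_continuous _ _ _ _ _ _ hw f o cf.
rewrite -(mean_cst P 0); apply: (@cvg_mean _ _ _ P _ _ (2 * C * (t - s))) => //.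
- move=> N o; rewrite ger0_norm; last by apply: sumr_ge0.
  by apply: riemann_error_le.
- by apply: aeW => o; apply: riemann_error_cvg0.
Qed.

(* The step errors vanish in the limit because the drift is continuous along the paths. *)
Lemma sum_step_error M F g (e : R) : separable F -> test g -> 0 < e ->
  exists N0, forall N, (N0 <= N)%N -> forall J : nat -> T -> R,
    (forall i, admissible P w (node s t N i) (J i)) ->
    (forall i o, `|J i o| <= 2) ->
    \sum_(i < N) `|mean P (fun o => J i o * step_error M F g N i o)| <= e.
Proof.
move=> sF tg; elim: sF e => {F} [u v cu tv|F G sF hF sG hG] e e0; last first.
  have e2 : 0 < e / 2 by rewrite divr_gt0.
  have [N1 h1] := hF _ e2; have [N2 h2] := hG _ e2.
  exists (maxn N1 N2) => N; rewrite geq_max => /andP[N1N N2N] J aJ J2.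
  apply: le_trans (_ : \sum_(i < N) (`|mean P (fun o => J i o * step_error M F g N i o)| +
      `|mean P (fun o => J i o * step_error M G g N i o)|) <= _).
    apply: ler_sum => i _; apply: le_trans (ler_normD _ _).
    have bJ : bounded_measurable (J i) by case: (aJ i).
    rewrite -meanD; try by apply: bounded_measurableM => //; exact: bounded_measurable_step_error.
    rewrite le_eqVlt; apply/orP; left; apply/eqP; congr `|mean P _|.
    by apply/funext => o; rewrite step_errorD ?mulrDr//; case: tg.
  by rewrite big_split/= [leRHS]splitr; apply: lerD; [exact: h1 | exact: h2].
have tf := testM tv tg; have tL := test_hp_laplacian tf.
set f := (fun y => v y * g y) in tf tL.
have [C C0 hC] := ball_bounded M cu.
have [/cvgrPdist_le h1 h2] := mean_riemann_error_cvg tL.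
have e1 : 0 < e / (2 * C) by rewrite divr_gt0// mulr_gt0.
have [N0 _ hN0] := h1 _ e1.
exists N0 => N hN J aJ J2.
set D := fun (i : nat) o => drift w f (node s t N i.+1) o - drift w f (node s t N i) o - step N * hp_laplacian f (pos N i o).
have bD i : bounded_measurable (D i).
  apply: bounded_measurableB.
    by apply: bounded_measurableB; apply: (bounded_measurable_drift hw) => //; exact: node_ge0.
  apply: bounded_measurableM; first exact: bounded_measurable_cst.
  exact: bounded_measurable_pos_test.
apply: le_trans (_ : \sum_(i < N) 2 * C * mean P (fun o => `|D i o|) <= _).
  apply: ler_sum => i _.
  pose K o := in_ball M (pos N i o) * u (pos N i o).
  have bK : bounded_measurable K by exact: bounded_measurable_ball_fun.
  have KC o : `|K o| <= C.
    rewrite /K /in_ball; case: (lerP (normsq _) M) => h /=; first by rewrite mul1r hC.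
    by rewrite mul0r normr0 ltW.
  have aK : adapted w (past (node s t N i)) K.
    by apply: adaptedM; [exact: adapted_in_ball | exact: adapted_pos].
  have [bJ _ hJ] := aJ i.
  have bI : bounded_measurable (increment w f (node s t N i) (node s t N i.+1)).
    by apply: (bounded_measurable_increment hw) => //; exact: le_node_succ.
  (* The first term has mean 0 by admissibility of the weight; only the error D made by freezing the
     drift over the step is left. *)
  have E : (fun o => J i o * step_error M (fun x y => u x * v y) g N i o) =
      (fun o => J i o * (increment w f (node s t N i) (node s t N i.+1) o * K o) + J i o * K o * D i o).
    apply/funext => o; rewrite step_error_prod//; last by case: tg.
    by rewrite /K /D /increment -/(pos N i o) -/(pos N i.+1 o) /f; ring.
  rewrite E meanD; [|exact: (bounded_measurableM bJ (bounded_measurableM bI bK))|exact: (bounded_measurableM (bounded_measurableM bJ bK) (bD i))].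
  rewrite (hJ f _ _ _ C tf _ aK C0 KC); last by rewrite lexx le_node.
  rewrite add0r -meanZ; last exact: bounded_measurable_norm.
  apply: norm_mean_le.
    exact: (bounded_measurableM (bounded_measurableM bJ bK) (bD i)).
    by apply: bounded_measurableM; [exact: bounded_measurable_cst | exact: bounded_measurable_norm].
  move=> o; rewrite 2!normrM; apply: ler_wpM2r => //.
  by apply: ler_pM.
rewrite -mulr_sumr -mean_sum; last by move=> i _; exact: bounded_measurable_norm.
rewrite -ler_pdivlMl; last by rewrite mulr_gt0.
rewrite mulrC; have := hN0 N hN; rewrite /= sub0r normrN; apply: le_trans.
exact: ler_norm.
Qed.

End StepErrors.

(** * Error propagation and Taylor estimates *)

Section Recursion.
Variable R : realType.

Fixpoint growth (t : R) (b : nat -> R) (j : nat) : R :=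
  if j is j'.+1 then 2 + t * b j * growth t b j' else 2.

(** The diagonal factor lies in [0, 1] and amplifies nothing. Each order thus accumulates its
    initial error, its local errors and at most t times the coupling times the bound of the order
    below, which is the recursion of [growth]; its constant 2 counts the first two. At the lowest
    order [b 0 = 0] stops the descent. *)
Lemma triangular_recursion (t e delta : R) (N J : nat) (nu b : nat -> R) (D eta : nat -> nat -> R) :
  0 <= t -> 0 <= e -> 0 <= delta -> delta * N%:R <= t -> b 0%N = 0 ->
  (forall j, (j <= J)%N -> 0 <= b j /\ 0 <= delta * nu j <= 1) ->
  (forall j, (j <= J)%N -> `|D j 0%N| <= e) ->
  (forall j, (j <= J)%N -> \sum_(i < N) eta j i <= e) ->
  (forall j i, 0 <= eta j i) ->
  (forall j i, (j <= J)%N -> (i < N)%N ->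
    `|D j i.+1 - ((1 - delta * nu j) * D j i + delta * b j * D j.-1 i)| <= eta j i) ->
  forall j i, (j <= J)%N -> (i <= N)%N -> `|D j i| <= growth t b j * e.
Proof.
move=> t0 e0 d0 dN b0 hb h0 he eta0 hD.
have key j (G : R) : (j <= J)%N -> 0 <= G ->
    (forall i, (i < N)%N -> delta * b j * `|D j.-1 i| <= delta * G) ->
    forall i, (i <= N)%N -> `|D j i| <= e + \sum_(k < i) eta j k + delta * i%:R * G.
  move=> jJ G0 hG; elim=> [|i IH] iN.
    by rewrite big_ord0 mulr0 mul0r !addr0; exact: h0.
  have {}IH := IH (ltnW iN).
  have [_ /andP[n0 n1]] := hb j jJ.
  have [bj _] := hb j jJ.
  have h1 := hD j i jJ iN; have h2 := hG i iN.
  rewrite big_ord_recr/= -natr1.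
  have h3 : `|D j i.+1| <= eta j i + ((1 - delta * nu j) * `|D j i| + delta * b j * `|D j.-1 i|).
    rewrite -[D j i.+1](subrK ((1 - delta * nu j) * D j i + delta * b j * D j.-1 i)).
    apply: le_trans (ler_normD _ _) _; apply: lerD => //.
    apply: le_trans (ler_normD _ _) _; rewrite !normrM (ger0_norm d0) (ger0_norm bj).
    by rewrite (ger0_norm (_ : 0 <= 1 - delta * nu j)) ?subr_ge0.
  have h4 : (1 - delta * nu j) * `|D j i| <= `|D j i|.
    by rewrite ler_piMl// lerBlDr lerDl.
  lra.
elim=> [|j IH] i jJ iN.
  have : `|D 0%N i| <= e + \sum_(k < i) eta 0%N k.
    have H k : (k < N)%N -> delta * b 0%N * `|D 0.-1 k| <= delta * 0.
      by rewrite b0 !mulr0 mul0r.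
    by have := key 0%N 0 jJ (lexx 0) H i iN; rewrite mulr0 addr0.
  have : \sum_(k < i) eta 0%N k <= e.
    apply: le_trans (he 0%N jJ); rewrite -(subnKC iN) big_split_ord/= lerDl.
    by apply: sumr_ge0 => k _; exact: eta0.
  by rewrite /growth; lra.
have jJ' := ltnW jJ; have [bj _] := hb _ jJ.
have g0 : 0 <= growth t b j * e by apply: le_trans (IH 0%N jJ' (leq0n N)).
have H k : (k < N)%N -> delta * b j.+1 * `|D j.+1.-1 k| <= delta * (b j.+1 * (growth t b j * e)).
  move=> kN; rewrite -mulrA ler_wpM2l// ler_wpM2l//; apply: IH => //; exact: ltnW.
have := key j.+1 (b j.+1 * (growth t b j * e)) jJ (mulr_ge0 bj g0) H i iN.
have : \sum_(k < i) eta j.+1 k <= e.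
  apply: le_trans (he j.+1 jJ); rewrite -(subnKC iN) big_split_ord/= lerDl.
  by apply: sumr_ge0 => k _; exact: eta0.
have : delta * i%:R * (b j.+1 * (growth t b j * e)) <= t * (b j.+1 * (growth t b j * e)).
  apply: ler_wpM2r; first exact: mulr_ge0.
  by apply: le_trans dN; rewrite ler_wpM2l// ler_nat.
rewrite /= => h1 h2 h3.
have -> : (2 + t * b j.+1 * growth t b j) * e = 2 * e + t * (b j.+1 * (growth t b j * e)) by ring.
by lra.
Qed.

(** Successive integrations from 0 of 1 - cos and of 1 - sin, both nonnegative. A fourth power is
    taken for the sine too: it is a nonnegative polynomial in the step, so its mean can be
    controlled by the martingale problem, and one bound serves both remainders. *)
Lemma sin_cos_taylor (x : R) :
  `|cos x - (1 - x ^+ 2 / 2)| <= x ^+ 4 / 24 /\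
  `|sin x - (x - x ^+ 3 / 6)| <= x ^+ 4 / 24.
Proof.
have mono (f df : R -> R) : (forall y : R, is_derive y (1 : R) f (df y)) -> f 0 = 0 ->
    (forall y : R, 0 <= y -> 0 <= df y) -> forall y : R, 0 <= y -> 0 <= f y.
  move=> hf f0 hdf y y0.
  have cf : {within `[0, y], continuous f}.
    by apply: derivable_within_continuous => z _; exact: (@ex_derive _ _ _ _ _ _ _ (hf z)).
  have [c ci e] := @MVT_segment R f df 0 y y0 (fun z _ => hf z) cf.
  move: ci; rewrite in_itv/= => /andP[c0 _].
  by rewrite f0 !subr0 in e; rewrite e mulr_ge0// hdf.
have f1 : forall y : R, 0 <= y -> 0 <= y - sin y.
  apply: (mono _ (fun y => 1 - cos y)); last by move=> y _; rewrite subr_ge0 cos_le1.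
  by rewrite sin0 subr0.
have f2 : forall y : R, 0 <= y -> 0 <= cos y - 1 + y ^+ 2 / 2.
  apply: (mono _ (fun y => y - sin y)) => //; last by rewrite cos0; ring.
  by move=> y; apply: is_derive_eq; rewrite /GRing.scale/=; field.
have f3 : forall y : R, 0 <= y -> 0 <= sin y - y + y ^+ 3 / 6.
  apply: (mono _ (fun y => cos y - 1 + y ^+ 2 / 2)) => //; last by rewrite sin0; ring.
  by move=> y; apply: is_derive_eq; rewrite /GRing.scale/=; field.
have f4 : forall y : R, 0 <= y -> 0 <= y ^+ 4 / 24 - (cos y - 1 + y ^+ 2 / 2).
  apply: (mono _ (fun y => sin y - y + y ^+ 3 / 6)) => //; last by rewrite cos0; ring.
  by move=> y; apply: is_derive_eq; rewrite /GRing.scale/=; field.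
have g1 : forall y : R, 0 <= y -> 0 <= y - (1 - cos y).
  apply: (mono _ (fun y => 1 - sin y)); last by move=> y _; rewrite subr_ge0 sin_le1.
    by move=> y; apply: is_derive_eq; rewrite /GRing.scale/=; field.
  by rewrite cos0; ring.
have g2 : forall y : R, 0 <= y -> 0 <= y ^+ 2 / 2 - (y - sin y).
  apply: (mono _ (fun y => y - (1 - cos y))) => //; last by rewrite sin0; ring.
  by move=> y; apply: is_derive_eq; rewrite /GRing.scale/=; field.
have g3 : forall y : R, 0 <= y -> 0 <= y ^+ 3 / 6 - (cos y - 1 + y ^+ 2 / 2).
  apply: (mono _ (fun y => y ^+ 2 / 2 - (y - sin y))) => //; last by rewrite cos0; ring.
  by move=> y; apply: is_derive_eq; rewrite /GRing.scale/=; field.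
have g4 : forall y : R, 0 <= y -> 0 <= y ^+ 4 / 24 - (sin y - y + y ^+ 3 / 6).
  apply: (mono _ (fun y => y ^+ 3 / 6 - (cos y - 1 + y ^+ 2 / 2))) => //; last by rewrite sin0; ring.
  by move=> y; apply: is_derive_eq; rewrite /GRing.scale/=; field.
have pos (y : R) : 0 <= y -> `|cos y - (1 - y ^+ 2 / 2)| <= y ^+ 4 / 24 /\
  `|sin y - (y - y ^+ 3 / 6)| <= y ^+ 4 / 24.
  move=> y0; move: (f2 y y0) (f3 y y0) (f4 y y0) (g4 y y0) => a2 a3 a4 b4.
  by rewrite !ler_norml; split; apply/andP; split; lra.
have [x0|x0] := leP 0 x; first exact: pos.
have [] := pos (- x); first by rewrite oppr_ge0 ltW.
rewrite cosN sinN.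
have -> : (- x) ^+ 2 = x ^+ 2 by ring.
have -> : (- x) ^+ 3 = - x ^+ 3 by ring.
have -> : (- x) ^+ 4 = x ^+ 4 by ring.
move=> h1 h2; split=> //.
have -> : sin x - (x - x ^+ 3 / 6) = - (- sin x - (- x - - x ^+ 3 / 6)) by ring.
by rewrite normrN.
Qed.

End Recursion.

Lemma expRN_second_order (R : realType) (z : R) : 0 <= z ->
  0 <= expR (- z) - 1 + z <= z ^+ 2.
Proof.
move=> z0; have h1 := expR_ge1Dx (- z); have h2 := expR_ge1Dx z.
have p1 : 0 < expR (- z) by exact: expR_gt0.
have e1 : expR z * expR (- z) = 1 by rewrite -expRD subrr expR0.
apply/andP; split; first by lra.
have h3 : (1 + z) * expR (- z) <= 1.
  by apply: le_trans (_ : expR z * expR (- z) <= _); [exact: ler_wpM2r (ltW p1) _ _ h2 | rewrite e1].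
have h4 : 0 <= z * z by rewrite mulr_ge0.
have h5 : z * (1 - z) <= z * expR (- z) by rewrite ler_wpM2l//; lra.
by rewrite expr2; lra.
Qed.

(** To first order in the time step, killing at rate kap u replaces the coefficient a of u by a -
    kap. The remainder is of order delta^2 with an explicit constant, so its sum over t / delta
    steps vanishes in the limit. *)
Lemma killing_expansion (R : realType) (delta u a b kap d M t : R) :
  0 <= delta <= t -> 0 <= u <= M -> 0 <= kap -> 0 <= d -> b = a - kap ->
  let al := `|a| * M + d in
  `|expR (- (kap * (delta * u))) * (1 + delta * (a * u - d)) - (1 + delta * (b * u - d))|
  <= delta ^+ 2 * ((kap * M) ^+ 2 * (1 + t * al) + kap * M * al).
Proof.
move=> /andP[d0 dt] /andP[u0 uM] k0 dd -> /=; set al := _ + d.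
have M0 := le_trans u0 uM.
set z := kap * (delta * u); set y := a * u - d.
have z0 : 0 <= z by rewrite !mulr_ge0.
have zM : z <= delta * (kap * M).
  by rewrite /z mulrCA ler_wpM2l// ler_wpM2l.
have al0 : 0 <= al by rewrite addr_ge0// mulr_ge0.
have yal : `|y| <= al.
  apply: le_trans (ler_normB _ _) _; rewrite normrM (ger0_norm u0) (ger0_norm dd) lerD2r.
  by rewrite ler_wpM2l.
have /andP[r0 r1] := expRN_second_order z0.
set rho := expR (- z) - 1 + z in r0 r1 *.
have -> : expR (- z) * (1 + delta * y) - (1 + delta * ((a - kap) * u - d)) =
    rho * (1 + delta * y) - z * (delta * y).
  by rewrite /rho /z /y; ring.
have h1 : `|1 + delta * y| <= 1 + t * al.
  apply: le_trans (ler_normD _ _) _; rewrite normr1 lerD2l normrM (ger0_norm d0).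
  by apply: ler_pM.
apply: le_trans (ler_normB _ _) _; rewrite [leRHS]mulrDr; apply: lerD.
  rewrite normrM (ger0_norm r0) mulrA -exprMn; apply: ler_pM => //.
  by apply: le_trans r1 _; rewrite lerXn2r// nnegrE mulr_ge0// mulr_ge0.
rewrite normrM (ger0_norm z0) normrM (ger0_norm d0).
have -> : delta ^+ 2 * (kap * M * al) = delta * (kap * M) * (delta * al) by ring.
by apply: ler_pM => //; [exact: mulr_ge0 | rewrite ler_wpM2l].
Qed.

(** * Moments with rotation and killing over one interval *)

Section BlockSteps.
Variables (R : realType) (n : nat).
Notation V := 'M[R]_(n, 4).
Context d (T : measurableType d) (P : probability T R).
Variable w : R -> T -> V.
Hypothesis hw : hp_brownian_motion P w.
Implicit Types (x y : V) (f g : V -> R) (r : R) (o : T).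
Local Notation path := (path w).

Lemma adapted_separable (I : set R) (F : V -> V -> R) r u : separable F ->
  I r -> I u -> 0 <= r -> 0 <= u -> adapted w I (fun o => F (path o r) (path o u)).
Proof.
move=> sF Ir Iu r0 u0; have ap f v : I v -> 0 <= v -> continuous f -> adapted w I (fun o => f (path o v)).
  move=> Iv v0 cf.
  have -> : (fun o => f (path o v)) = (fun o => f (w v o)) by apply/funext => o; rewrite pathE.
  exact: adapted_comp.
elim: sF => {F} [f g cf tg|F G _ hF _ hG]; last exact: adaptedD.
by apply: adaptedM; apply: ap => //; exact: tame_continuous.
Qed.

Lemma admissible_rotation t G1 G2 q : admissible P w t G1 -> admissible P w t G2 ->
  adapted w (past t) q -> admissible P w t (fun o => G1 o * cos (q o) - G2 o * sin (q o)).
Proof.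
move=> h1 h2 aq.
have ac : adapted w (past t) (fun o => cos (q o)).
  by apply: adapted_continuous aq; exact: continuous_cos.
have as_ : adapted w (past t) (fun o => sin (q o)).
  by apply: adapted_continuous aq; exact: continuous_sin.
have a1 := admissibleM hw h1 ac (fun o => cos_max (q o)).
have a2 := admissibleZ hw (-1) (admissibleM hw h2 as_ (fun o => sin_max (q o))).
have := admissibleD hw a1 a2; congr admissible.
by apply/funext => o; rewrite mulN1r.
Qed.

Lemma norm_rotation (a b x : R) : `|a| <= 1 -> `|b| <= 1 -> `|a * cos x - b * sin x| <= 2.
Proof.
move=> ha hb; apply: le_trans (ler_normB _ _) _; rewrite !normrM.
rewrite (_ : 2 = 1 * 1 + 1 * 1); last by ring.
by apply: lerD; apply: ler_pM => //; [exact: cos_max | exact: sin_max].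
Qed.

Variables (s t : R).
Hypothesis st : 0 <= s <= t.
Local Notation pos := (pos w s t).
Local Notation step := (step s t).
Variables (lam : 'rV[R]_3) (kap : R).
Hypothesis kap0 : 0 <= kap.
Variables (G1 G2 : T -> R).
Hypotheses (aG1 : admissible P w s G1) (aG2 : admissible P w s G2).
Hypotheses (G1_le : forall o, `|G1 o| <= 1) (G2_le : forall o, `|G2 o| <= 1).

Definition phase N i o : R := \sum_(k < i) area_step lam (pos N k o) (pos N k.+1 o).
Definition killing N i o : R := expR (- (kap * (step N * \sum_(k < i) normsq (pos N k o)))).
(** Only positions strictly before node i are tested. The current position enters through the
    cut-off in [phi_cut], which is smooth, as the martingale problem requires. *)
Definition kept M N i o : R := \prod_(k < i) in_ball M (pos N k o).
(** G1 and G2 play the parts of the cosine and the sine of a phase accumulated before time s: if G1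
    = cos p and G2 = sin p, then [rotated] and [rotated'] are the cosine and the sine of p plus the
    new phase. *)
Definition rotated N i o : R := G1 o * cos (phase N i o) - G2 o * sin (phase N i o).
Definition rotated' N i o : R := G1 o * sin (phase N i o) + G2 o * cos (phase N i o).
Definition moment M N m i : R :=
  mean P (fun o => kept M N i o * killing N i o * rotated N i o * phi_cut M m (pos N i o)).

Lemma adapted_phase N i : adapted w (past (node s t N i)) (phase N i).
Proof.
have s_le_t : s <= t by case/andP: st.
elim: i => [|i IH].
  by rewrite /phase; under eq_fun do rewrite big_ord0; exact: adapted_cst.
rewrite /phase; under eq_fun do rewrite big_ord_recr/=.
apply: adaptedD; first by apply: adapted_sub IH; apply: past_sub; exact: le_node.
apply: adapted_separable; try exact: node_ge0.
- exact: separable_area_step.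
- by rewrite /past/= in_itv/= (node_ge0 st) le_node.
- by rewrite /past/= in_itv/= (node_ge0 st) lexx.
Qed.

Lemma adapted_killing N i : adapted w (past (node s t N i)) (killing N i).
Proof.
rewrite /killing; apply: (@adapted_continuous _ _ _ _ _ _ (fun z => expR (- (kap * (step N * z))))).
  move=> z; apply: (continuous_comp (f := fun z => - (kap * (step N * z)))); last exact: continuous_expR.
  by apply: cvgN; apply: cvgM; [exact: cvg_cst|apply: cvgM; [exact: cvg_cst|exact: cvg_id]].
apply: adapted_sum => k; apply: (adapted_pos st) => //; last exact: normsq_continuous.
exact: ltnW.
Qed.

Lemma adapted_kept M N i : adapted w (past (node s t N i)) (kept M N i).
Proof. by apply: adapted_prod => k; apply: (adapted_in_ball st); exact: ltnW. Qed.

Lemma killing01 N i o : 0 <= killing N i o <= 1.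
Proof.
rewrite expR_ge0 expR_le1 oppr_le0 mulr_ge0// mulr_ge0 ?step_ge0//.
by apply: sumr_ge0 => k _; exact: normsq_ge0.
Qed.

Lemma kept01 M N i o : 0 <= kept M N i o <= 1.
Proof.
elim: i => [|i /andP[h0 h1]]; first by rewrite /kept big_ord0 ler01 lexx.
have /andP[a0 a1] := in_ball01 M (pos N i o).
by rewrite /kept big_ord_recr/= mulr_ge0//= mulr_ile1.
Qed.

Lemma norm_rotated N i o : `|rotated N i o| <= 2.
Proof. exact: norm_rotation. Qed.

Lemma rotated'E N i o : rotated' N i o = - (- G2 o * cos (phase N i o) - G1 o * sin (phase N i o)).
Proof. by rewrite /rotated'; ring. Qed.

Lemma norm_rotated' N i o : `|rotated' N i o| <= 2.
Proof. by rewrite rotated'E normrN; apply: norm_rotation; rewrite ?normrN. Qed.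

Lemma admissible_node N i J : admissible P w s J -> admissible P w (node s t N i) J.
Proof. by apply: admissible_le; apply: node_ge; case/andP: st. Qed.

Lemma admissible_rotated N i : admissible P w (node s t N i) (rotated N i).
Proof. by apply: admissible_rotation (@adapted_phase N i); exact: admissible_node. Qed.

Lemma admissible_rotated' N i : admissible P w (node s t N i) (rotated' N i).
Proof.
have h1 := @admissible_node N i _ aG1.
have h2 := admissibleZ hw (-1) (@admissible_node N i _ aG2).
have := admissibleZ hw (-1) (admissible_rotation h2 h1 (@adapted_phase N i)).
by congr admissible; apply/funext => o; rewrite rotated'E !mulN1r.
Qed.

Lemma admissible_weight M N i (J : T -> R) : admissible P w (node s t N i) J ->
  admissible P w (node s t N i) (fun o => J o * (kept M N i o * killing N i o)).
Proof.
move=> hJ; apply: (@admissibleM _ _ _ _ _ _ hw _ _ _ 1) => //.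
  by apply: adaptedM; [exact: adapted_kept | exact: adapted_killing].
move=> o; have /andP[a0 a1] := kept01 M N i o; have /andP[b0 b1] := killing01 N i o.
by rewrite ger0_norm ?mulr_ge0// mulr_ile1.
Qed.

Lemma bounded_measurable_kept M N i : bounded_measurable (kept M N i).
Proof.
split; first exact: (adapted_measurable (hp_measurable hw) (@past_ge0 R (node s t N i)) (@adapted_kept M N i)).
by exists 1 => o; have /andP[k0 k1] := kept01 M N i o; rewrite ger0_norm.
Qed.

Lemma bounded_measurable_moment M N m i : bounded_measurable
  (fun o => kept M N i o * killing N i o * rotated N i o * phi_cut M m (pos N i o)).
Proof.
apply: bounded_measurableM.
  have [h _ _] := admissible_weight M (admissible_rotated N i).
  by under eq_fun do rewrite mulrC.
apply: (bounded_measurable_test hw); split; first exact: tame_phi_cut.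
by exists (M + 2); exact: supported_phi_cut.
Qed.

(** Taylor polynomials replace the trigonometric functions because polynomials in the step are
    separable. *)
Definition cos_step x y : R := 1 - area_step lam x y ^+ 2 / 2.
Definition sin_step x y : R := area_step lam x y - area_step lam x y ^+ 3 / 6.
Definition step4 x y : R := area_step lam x y ^+ 4.

Lemma separable_stepX k : separable (fun x y => area_step lam x y ^+ k).
Proof.
elim: k => [|k IH]; first exact: separable_cst.
have := separableM (@separable_area_step R n lam) IH; congr separable.
by apply/funext => x; apply/funext => y; rewrite exprS.
Qed.

Lemma separableZ (c : R) (F : V -> V -> R) : separable F -> separable (fun x y => c * F x y).
Proof. by move=> hF; apply: separableM => //; exact: separable_cst. Qed.

Lemma separable_cos_step : separable cos_step.
Proof.
have := separableD (@separable_cst R n 1) (separableZ (- 2^-1) (separable_stepX 2)).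
by congr separable; apply/funext => x; apply/funext => y; rewrite /cos_step; ring.
Qed.

Lemma separable_sin_step : separable sin_step.
Proof.
have := separableD (separable_stepX 1) (separableZ (- 6^-1) (separable_stepX 3)).
by congr separable; apply/funext => x; apply/funext => y; rewrite /sin_step; ring.
Qed.

Variables (M : R) (m : nat).
Local Notation g := (@phi_cut R n M m).
Let tg : tame g := @tame_phi_cut R n M m.

Lemma test_phi_cut : test g.
Proof. by split=> //; exists (M + 2); exact: supported_phi_cut. Qed.

Let radial x : normsq x <= M -> radial_at x g.
Proof.
move=> h; exists (- (2 * m%:R) * phi x ^+ m.+1) => a.
by rewrite partial_phi_cut// mulrA.
Qed.

(** Here rotation becomes killing: the quadratic term of the cosine has drift - |lam|^2 |x|^2 / 2
    times the power of phi, exactly what killing at the rate |lam|^2 / 2 along the clock would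
    give. *)
Lemma step_error_cos N i o : step_error w s t M cos_step g N i o =
  in_ball M (pos N i o) * (cos_step (pos N i o) (pos N i.+1 o) * g (pos N i.+1 o)
   - (1 + step N * ((2 * m%:R * (m%:R + 1) - 2^-1 * sqnorm lam) * normsq (pos N i o) - 4 * n%:R * m%:R))
     * phi (pos N i o) ^+ m).
Proof.
rewrite /step_error; set x := pos N i o; rewrite /in_ball.
case: (lerP (normsq x) M) => h; last by rewrite !mul0r.
congr (_ * _).
have tF := tame_area_step lam x.
have -> : (fun y => cos_step x y * g y) =
    (fun y => g y + - 2^-1 * (area_step lam x y * (area_step lam x y * g y))).
  by apply/funext => y; rewrite /cos_step; ring.
have t2 : tame (fun y => area_step lam x y * (area_step lam x y * g y)) by do 2 apply: tameM => //.
rewrite hp_laplacianD//; last by apply: tameM => //; exact: tame_cst.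
rewrite hp_laplacianZ// (hp_laplacian_step2 lam x tg) hp_laplacian_phi_cut//.
have -> : cos_step x x = 1 by rewrite /cos_step area_step_diag; ring.
by rewrite (@phi_cutE R n M m x h); ring.
Qed.

Lemma step_error_sin N i o : step_error w s t M sin_step g N i o =
  in_ball M (pos N i o) * (sin_step (pos N i o) (pos N i.+1 o) * g (pos N i.+1 o)).
Proof.
rewrite /step_error; set x := pos N i o; rewrite /in_ball.
case: (lerP (normsq x) M) => h; last by rewrite !mul0r.
congr (_ * _).
have tF := tame_area_step lam x.
have -> : (fun y => sin_step x y * g y) = (fun y => area_step lam x y * g y +
    - 6^-1 * (area_step lam x y * (area_step lam x y * (area_step lam x y * g y)))).
  by apply/funext => y; rewrite /sin_step; ring.
have t3 : tame (fun y => area_step lam x y * (area_step lam x y * (area_step lam x y * g y))).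
  by do 3 apply: tameM => //.
rewrite hp_laplacianD//; [|exact: tameM|by apply: tameM => //; exact: tame_cst].
rewrite hp_laplacianZ// (@hp_laplacian_step1 _ _ lam x g tg (radial h)) (hp_laplacian_step3 lam x tg).
by rewrite {2}/sin_step area_step_diag; ring.
Qed.

Lemma step_error4 N i o : step_error w s t M step4 g N i o =
  in_ball M (pos N i o) * (step4 (pos N i o) (pos N i.+1 o) * g (pos N i.+1 o)).
Proof.
rewrite /step_error; set x := pos N i o; rewrite /in_ball.
case: (lerP (normsq x) M) => h; last by rewrite !mul0r.
congr (_ * _).
have -> : (fun y => step4 x y * g y) = (fun y => area_step lam x y *
    (area_step lam x y * (area_step lam x y * (area_step lam x y * g y)))).
  by apply/funext => y; rewrite /step4; ring.
rewrite (hp_laplacian_step4 lam x tg) {2}/step4 area_step_diag.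
by ring.
Qed.

(** A positive power of phi is small far away, so paths that leave the ball can be discarded at a
    cost 1 / (1 + M); order 0 offers no such decay. *)
Lemma phi_cut_outside k x : (0 < k)%N -> M < normsq x -> 0 <= M ->
  phi_cut M k x <= (1 + M)^-1.
Proof.
move=> k0 Mx M0; apply: le_trans (phi_cut_le _ _ _) _.
have p1 : phi x <= (1 + M)^-1.
  have e := phiE x; rewrite /phi lef_pV2 ?posrE ?lerD2l; [exact: ltW|lra|lra].
case: k k0 => // k _; rewrite exprS; apply: le_trans p1.
by rewrite ler_piMr ?exprn_ile1 ?phi_le1// ltW// phi_gt0.
Qed.

Definition drift_rate : R := 2 * m%:R * (m%:R + 1) - 2^-1 * sqnorm lam.
Definition killing_error : R := (kap * M) ^+ 2 * (1 + t * (`|drift_rate| * M + 4 * n%:R * m%:R)) +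
  kap * M * (`|drift_rate| * M + 4 * n%:R * m%:R).

Definition cos_weight N i o : R :=
  rotated N i o * expR (- (kap * (step N * normsq (pos N i o)))) * (kept M N i o * killing N i o).
Definition sin_weight N i o : R :=
  rotated' N i o * expR (- (kap * (step N * normsq (pos N i o)))) * (kept M N i o * killing N i o).

Let killed_le1 N i o : 0 <= expR (- (kap * (step N * normsq (pos N i o)))) <= 1.
Proof.
rewrite expR_ge0 expR_le1 oppr_le0 mulr_ge0// mulr_ge0//; first exact: step_ge0.
exact: normsq_ge0.
Qed.

Let adapted_killed N i :
  adapted w (past (node s t N i)) (fun o => expR (- (kap * (step N * normsq (pos N i o))))).
Proof.
apply: (@adapted_continuous _ _ _ _ _ _ (fun z => expR (- (kap * (step N * z))))).
  move=> z; apply: (continuous_comp (f := fun z => - (kap * (step N * z)))); last exact: continuous_expR.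
  by apply: cvgN; apply: cvgM; [exact: cvg_cst|apply: cvgM; [exact: cvg_cst|exact: cvg_id]].
by apply: (adapted_pos st) => //; exact: normsq_continuous.
Qed.

Let admissible_killed N i J : admissible P w (node s t N i) J -> admissible P w (node s t N i)
  (fun o => J o * expR (- (kap * (step N * normsq (pos N i o)))) * (kept M N i o * killing N i o)).
Proof.
move=> hJ; apply: admissible_weight.
apply: (@admissibleM _ _ _ _ _ _ hw _ _ _ 1) => // o.
by have /andP[h0 h1] := killed_le1 N i o; rewrite ger0_norm.
Qed.

Lemma admissible_cos_weight N i : admissible P w (node s t N i) (cos_weight N i).
Proof. by apply: admissible_killed; exact: admissible_rotated. Qed.

Lemma admissible_sin_weight N i : admissible P w (node s t N i) (sin_weight N i).
Proof. by apply: admissible_killed; exact: admissible_rotated'. Qed.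

Let norm_killed N i o (x : R) : `|x| <= 2 ->
  `|x * expR (- (kap * (step N * normsq (pos N i o)))) * (kept M N i o * killing N i o)| <= 2.
Proof.
move=> hx; have /andP[a0 a1] := killed_le1 N i o.
have /andP[b0 b1] := kept01 M N i o; have /andP[c0 c1] := killing01 N i o.
rewrite !normrM (ger0_norm a0) (ger0_norm b0) (ger0_norm c0).
apply: le_trans hx; rewrite -mulrA ler_piMr// mulr_ile1 ?mulr_ge0//.
by rewrite mulr_ile1.
Qed.

Lemma norm_cos_weight N i o : `|cos_weight N i o| <= 2.
Proof. by apply: norm_killed; exact: norm_rotated. Qed.

Lemma norm_sin_weight N i o : `|sin_weight N i o| <= 2.
Proof. by apply: norm_killed; exact: norm_rotated'. Qed.

Lemma killing_succ N i o :
  killing N i.+1 o = killing N i o * expR (- (kap * (step N * normsq (pos N i o)))).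
Proof.
rewrite /killing big_ord_recr/= -expRD; congr expR.
by move: (\sum_(k < i) _) => *; ring.
Qed.

Lemma kept_succ N i o : kept M N i.+1 o = kept M N i o * in_ball M (pos N i o).
Proof. by rewrite /kept big_ord_recr. Qed.

Lemma rotated_succ N i o : let S := area_step lam (pos N i o) (pos N i.+1 o) in
  rotated N i.+1 o = rotated N i o * cos S - rotated' N i o * sin S.
Proof.
move=> S; have e : phase N i.+1 o = phase N i o + S by rewrite /phase big_ord_recr.
by rewrite /rotated /rotated' e cosD sinD; ring.
Qed.

Hypotheses (M0 : 0 <= M) (m_gt0 : (0 < m)%N).
Variables (b nu : R).
Hypotheses (b0 : 0 <= b) (bE : b = drift_rate - kap) (nuE : nu = b + 4 * n%:R * m%:R).
Hypothesis b_or : b = 0 \/ (1 < m)%N.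

(** Three errors appear path by path: the Taylor remainder, bounded by the fourth power of the step;
    the second-order effect of killing; and the loss outside the ball, charged to the decrease of
    [kept] so that it telescopes. By [b_or] the lower moment has coefficient zero or positive order,
    hence is small outside the ball. *)
Lemma moment_step_pointwise N i o : 0 <= step N * nu <= 1 -> step N <= t ->
  `|kept M N i.+1 o * killing N i.+1 o * rotated N i.+1 o * phi_cut M m (pos N i.+1 o)
    - ((1 - step N * nu) * (kept M N i o * killing N i o * rotated N i o * phi_cut M m (pos N i o))
       + step N * b * (kept M N i o * killing N i o * rotated N i o * phi_cut M m.-1 (pos N i o)))
    - (cos_weight N i o * step_error w s t M cos_step g N i o
       - sin_weight N i o * step_error w s t M sin_step g N i o)|
  <= step_error w s t M step4 g N i o + 2 * step N ^+ 2 * killing_error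
     + 2 * (1 + step N * b) / (1 + M) * (kept M N i o - kept M N i.+1 o).
Proof.
move=> nu01 dt; rewrite killing_succ kept_succ rotated_succ.
rewrite step_error_cos step_error_sin step_error4 /cos_weight /sin_weight.
have A2 := norm_rotated N i o; have A'2 := norm_rotated' N i o.
have /andP[Th0 Th1] := kept01 M N i o; have /andP[K0 K1] := killing01 N i o.
have /andP[k0 k1] := killed_le1 N i o.
have g1_ge0 := phi_cut_ge0 M m (pos N i.+1 o).
have [hc hs] := sin_cos_taylor (area_step lam (pos N i o) (pos N i.+1 o)).
have dl0 : 0 <= step N by exact: step_ge0.
rewrite /cos_step /sin_step /step4.
set S := area_step _ _ _ in hc hs *; set Th := kept _ _ _ _ in Th0 Th1 *.
set K := killing _ _ _ in K0 K1 *; set A := rotated _ _ _ in A2 *; set A' := rotated' _ _ _ in A'2 *.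
set g1 := phi_cut _ _ (pos N i.+1 o) in g1_ge0 *.
set x := pos N i o in k0 k1 *; set dl := step N in dl0 dt nu01 k0 k1 *.
set dd : R := 4 * n%:R * m%:R; have nuE' : nu = b + dd := nuE.
have dd0 : 0 <= dd by rewrite /dd !mulr_ge0.
have u0 : 0 <= normsq x by exact: normsq_ge0.
have t0 : 0 <= t by exact: le_trans dt.
have Cc0 : 0 <= killing_error.
  have al0 : 0 <= `|drift_rate| * M + dd by rewrite addr_ge0// mulr_ge0.
  by rewrite /killing_error -/dd addr_ge0// ?mulr_ge0 ?sqr_ge0// ?addr_ge0// mulr_ge0.
have le4 (p q r : R) : 0 <= p <= 1 -> `|q| <= r -> `|p * q| <= r.
  move=> /andP[p0 p1] qr; rewrite normrM (ger0_norm p0); apply: le_trans qr.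
  by rewrite ler_piMl.
rewrite /in_ball; case: (lerP (normsq x) M) => xM.
  have -> : phi_cut M m x = phi x ^+ m by exact: phi_cutE.
  (* This trades the factor |x|^2 of the drift for the moment of order m - 1, and adds b to the
     decay rate nu. *)
  have -> : phi_cut M m.-1 x = (1 + normsq x) * phi x ^+ m.
    rewrite (phi_cutE _ xM); case: m m_gt0 => // m' _.
    by rewrite exprS mulrA phiE mul1r.
  have p0 : 0 <= phi x ^+ m by rewrite exprn_ge0// ltW// phi_gt0.
  have p1 : phi x ^+ m <= 1 by rewrite exprn_ile1 ?phi_le1// ltW// phi_gt0.
  set p := phi x ^+ m in p0 p1 *.
  have hk := @killing_expansion R dl (normsq x) drift_rate b kap dd M t.
  have {}hk := hk (introT andP (conj dl0 dt)) (introT andP (conj u0 xM)) kap0 dd0 bE.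
  rewrite /= -/dd -[X in _ <= dl ^+ 2 * X]/killing_error in hk.
  rewrite -/drift_rate /=.
  set k := expR _ in k0 k1 hk *.
  set y := drift_rate * normsq x - dd in hk *.
  rewrite [X in `|X|](_ : _ = Th * K * k * (A * (cos S - (1 - S ^+ 2 / 2)) - A' * (sin S - (S - S ^+ 3 / 6))) * g1 +
     Th * K * p * A * (k * (1 + dl * y) - (1 + dl * (b * normsq x - dd)))); last by rewrite nuE'; ring.
  have S40 : 0 <= S ^+ 4 by rewrite (_ : S ^+ 4 = (S ^+ 2) ^+ 2) ?sqr_ge0//; ring.
  rewrite mulr1 subrr mulr0 addr0 mul1r; apply: le_trans (ler_normD _ _) _; apply: lerD.
    rewrite normrM (ger0_norm g1_ge0) ler_wpM2r//; apply: (le4) => //.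
      by rewrite !mulr_ge0//= !mulr_ile1// mulr_ge0.
    apply: le_trans (ler_normB _ _) _; rewrite !normrM.
    have := ler_pM (normr_ge0 _) (normr_ge0 _) A2 hc.
    have := ler_pM (normr_ge0 _) (normr_ge0 _) A'2 hs.
    by lra.
  rewrite -mulrA; apply: (le4) => //; first by rewrite !mulr_ge0//= !mulr_ile1// mulr_ge0.
  by rewrite normrM -mulrA; apply: ler_pM.
(* The start of the step is outside the ball: the new moment and the step errors vanish, and what
   was carried by the old moments is lost. *)
have h1 : phi_cut M m x <= (1 + M)^-1 by exact: phi_cut_outside.
have h2 : b * phi_cut M m.-1 x <= b * (1 + M)^-1.
  case: b_or => [->|m1]; first by rewrite !mul0r.
  by rewrite ler_wpM2l// phi_cut_outside//; case: m m1 => // -[].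
have g00 := phi_cut_ge0 M m x; have h00 := phi_cut_ge0 M m.-1 x.
set g0 := phi_cut M m x in h1 g00 *; set h0 := phi_cut M m.-1 x in h2 h00 *.
set k := expR _; rewrite (_ : false%:R = 0 :> R)// !(mul0r, mulr0) [X in _ <= X + _]add0r.
have /andP[n0 n1] := nu01.
have -> : 0 - ((1 - dl * nu) * (Th * K * A * g0) + dl * b * (Th * K * A * h0)) - (0 - 0) =
  - (Th * (K * (A * ((1 - dl * nu) * g0 + dl * (b * h0))))) by ring.
rewrite normrN subr0 normrM (ger0_norm Th0) [leRHS]addrC; apply: ler_wpDr; first by rewrite mulr_ge0// mulr_ge0// sqr_ge0.
rewrite mulrC ler_wpM2r//; apply: (le4); rewrite ?K0//.
rewrite normrM -[2 * _ / _]mulrA; apply: ler_pM => //.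
rewrite ger0_norm; last by rewrite addr_ge0// mulr_ge0 ?subr_ge0// mulr_ge0.
rewrite [leRHS]mulrDl mul1r; apply: lerD; last by rewrite -[leRHS]mulrA ler_wpM2l.
by apply: le_trans h1; rewrite ler_piMl// lerBlDr lerDl.
Qed.

Lemma moment_step N i : 0 <= step N * nu <= 1 -> step N <= t ->
  `|moment M N m i.+1 - ((1 - step N * nu) * moment M N m i + step N * b * moment M N m.-1 i)|
  <= `|mean P (fun o => cos_weight N i o * step_error w s t M cos_step g N i o)|
   + `|mean P (fun o => sin_weight N i o * step_error w s t M sin_step g N i o)|
   + `|mean P (fun o => 1 * step_error w s t M step4 g N i o)|
   + 2 * step N ^+ 2 * killing_error
   + 2 * (1 + step N * b) / (1 + M) * (mean P (kept M N i) - mean P (kept M N i.+1)).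
Proof.
move=> nu01 dt.
have hX k j : bounded_measurable (fun o => kept M N j o * killing N j o * rotated N j o * phi_cut M k (pos N j o)).
  exact: bounded_measurable_moment.
have [bc _ _] := admissible_cos_weight N i; have [bs _ _] := admissible_sin_weight N i.
have tp := test_phi_cut.
have b1 := bounded_measurable_step_error hw st M N i separable_cos_step tp.
have b2 := bounded_measurable_step_error hw st M N i separable_sin_step tp.
have b3 := bounded_measurable_step_error hw st M N i (separable_stepX 4) tp.
have bk j : bounded_measurable (kept M N j) by exact: bounded_measurable_kept.
set X1 := (fun o => kept M N i.+1 o * killing N i.+1 o * rotated N i.+1 o * phi_cut M m (pos N i.+1 o)).
set Xm := (fun o => kept M N i o * killing N i o * rotated N i o * phi_cut M m (pos N i o)).
set Xp := (fun o => kept M N i o * killing N i o * rotated N i o * phi_cut M m.-1 (pos N i o)).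
pose E1 o := cos_weight N i o * step_error w s t M cos_step g N i o.
pose E2 o := sin_weight N i o * step_error w s t M sin_step g N i o.
pose Rem o := X1 o - ((1 - step N * nu) * Xm o + step N * b * Xp o) - (E1 o - E2 o).
have bE1 : bounded_measurable E1 by exact: bounded_measurableM.
have bE2 : bounded_measurable E2 by exact: bounded_measurableM.
have bZ (c : R) (X : T -> R) : bounded_measurable X -> bounded_measurable (fun o => c * X o).
  by move=> bX; apply: bounded_measurableM => //; exact: bounded_measurable_cst.
have bX1 : bounded_measurable X1 by exact: hX.
have bXm : bounded_measurable Xm by exact: hX.
have bXp : bounded_measurable Xp by exact: hX.
have bR : bounded_measurable Rem.
  by apply: bounded_measurableB; apply: bounded_measurableB => //; apply: bounded_measurableD; exact: bZ.
have hR : `|mean P Rem| <= `|mean P (fun o => 1 * step_error w s t M step4 g N i o)|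
   + 2 * step N ^+ 2 * killing_error
   + 2 * (1 + step N * b) / (1 + M) * (mean P (kept M N i) - mean P (kept M N i.+1)).
  have bB : bounded_measurable (fun o => kept M N i o - kept M N i.+1 o) by exact: bounded_measurableB.
  have bC := bounded_measurable_cst T (2 * step N ^+ 2 * killing_error).
  apply: le_trans (_ : mean P (fun o => step_error w s t M step4 g N i o + 2 * step N ^+ 2 * killing_error
     + 2 * (1 + step N * b) / (1 + M) * (kept M N i o - kept M N i.+1 o)) <= _).
    apply: norm_mean_le => //.
      by apply: bounded_measurableD; [exact: bounded_measurableD | exact: bZ].
    by move=> o; exact: moment_step_pointwise.
  rewrite meanD; [|exact: bounded_measurableD|exact: bZ].
  rewrite meanD// mean_cst meanZ// meanB// lerD2r lerD2r.
  apply: le_trans (ler_norm _) _; rewrite le_eqVlt; apply/orP; left; apply/eqP.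
  by congr `|mean P _|; apply/funext => o; rewrite mul1r.
have -> : moment M N m i.+1 - ((1 - step N * nu) * moment M N m i + step N * b * moment M N m.-1 i) =
   mean P E1 - mean P E2 + mean P Rem.
  rewrite /moment -/X1 -/Xm -/Xp /Rem meanB//; last 2 first.
  - by apply: bounded_measurableB => //; apply: bounded_measurableD; exact: bZ.
  - exact: bounded_measurableB.
  rewrite meanB//; last by apply: bounded_measurableD; exact: bZ.
  rewrite (meanB P bE1 bE2) meanD; [|exact: bZ|exact: bZ].
  rewrite (meanZ P _ bXm) (meanZ P _ bXp).
  by move: (mean P X1) (mean P Xm) (mean P Xp) (mean P E1) (mean P E2) (step N) => *; ring.
apply: le_trans (ler_normD _ _) _; rewrite -!addrA addrA; apply: lerD; first exact: ler_normB.
by rewrite addrA.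
Qed.

(** Five errors of size e / 5. The ball is fixed before the partition: the decreases of [kept] sum
    up to at most 1, so the loss outside the ball is bounded uniformly in N. *)
Lemma moment_recursion (e : R) : 0 < e -> 2 * (1 + t * b) / (1 + M) <= e / 5 ->
  exists N0, forall N, (N0 <= N)%N -> [/\ 0 <= step N * nu <= 1, step N <= t &
  \sum_(i < N) `|moment M N m i.+1 - ((1 - step N * nu) * moment M N m i +
     step N * b * moment M N m.-1 i)| <= e].
Proof.
move=> e0 hM; have tp := test_phi_cut; have e5 : 0 < e / 5 by rewrite divr_gt0.
have [N1 h1] := sum_step_error hw st M separable_cos_step tp e5.
have [N2 h2] := sum_step_error hw st M separable_sin_step tp e5.
have [N3 h3] := sum_step_error hw st M (separable_stepX 4) tp e5.
have [s0 s_le_t] := andP st; have t0 := le_trans s0 s_le_t.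
have nu0 : 0 <= nu by rewrite nuE addr_ge0// !mulr_ge0.
(* The first summand makes the diagonal factor nonnegative, the second makes the accumulated killing
   error at most e / 5. *)
pose N4 := Num.bound (t * nu + 2 * t * t * `|killing_error| / (e / 5)).
have q0 : 0 <= 2 * t * t * `|killing_error| / (e / 5).
  by apply: divr_ge0; [rewrite mulr_ge0// !mulr_ge0 | exact: ltW].
exists (maxn (maxn N1 N2) (maxn N3 N4.+1)) => N; rewrite !geq_max => /andP[/andP[n1 n2] /andP[n3 n4]].
have NN : (0 < N)%N by exact: leq_trans n4.
have N0 : 0 < N%:R :> R by rewrite ltr0n.
have hN : t * nu + 2 * t * t * `|killing_error| / (e / 5) <= N%:R.
  apply: ltW; apply: lt_le_trans (_ : N4%:R <= _); last by rewrite ler_nat ltnW.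
  by apply: archi_boundP; rewrite addr_ge0// mulr_ge0.
have d0 : 0 <= step N by exact: step_ge0.
have dN : step N <= t / N%:R by rewrite /step ler_wpM2r ?invr_ge0 ?ler0n// gerBl.
have dt : step N <= t.
  by apply: le_trans dN _; rewrite ler_pdivrMr// ler_peMr// ler1n.
have nu01 : 0 <= step N * nu <= 1.
  rewrite mulr_ge0//=; apply: le_trans (_ : t / N%:R * nu <= _); first by rewrite ler_wpM2r.
  by rewrite mulrAC ler_pdivrMr// mul1r; lra.
split => //.
apply: le_trans (ler_sum _ (fun (i : 'I_N) _ => @moment_step N i nu01 dt)) _.
rewrite 4!big_split/=.
have -> : e = e / 5 + e / 5 + e / 5 + e / 5 + e / 5 by field.
apply: lerD; last first.
  rewrite -mulr_sumr.
  have -> : \sum_(i < N) (mean P (kept M N i) - mean P (kept M N i.+1)) =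
      mean P (kept M N 0) - mean P (kept M N N).
    have tel (f : nat -> R) j : \sum_(i < j) (f i - f i.+1) = f 0%N - f j.
      by elim: j => [|j IH]; rewrite ?big_ord0 ?subrr// big_ord_recr/= IH; ring.
    exact: (tel (fun j => mean P (kept M N j))).
  have bk j : bounded_measurable (kept M N j) by exact: bounded_measurable_kept.
  have k0 : mean P (kept M N 0) <= 1.
    rewrite -(mean_cst P 1); apply: le_mean => //; first exact: bounded_measurable_cst.
    by move=> o; have /andP[] := kept01 M N 0 o.
  have kN : 0 <= mean P (kept M N N).
    by apply: mean_ge0 => o; have /andP[] := kept01 M N N o.
  have c0 : 0 <= 2 * (1 + step N * b) / (1 + M).
    by rewrite divr_ge0 ?addr_ge0// mulr_ge0// addr_ge0// mulr_ge0.
  apply: le_trans (_ : 2 * (1 + step N * b) / (1 + M) * 1 <= _).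
    by rewrite ler_wpM2l//; lra.
  rewrite mulr1; apply: le_trans hM; rewrite ler_wpM2r ?invr_ge0 ?addr_ge0//.
  by rewrite ler_wpM2l// lerD2l ler_wpM2r.
apply: lerD; last first.
  rewrite sumr_const card_ord -[leLHS]mulr_natr.
  apply: le_trans (_ : 2 * (t / N%:R) ^+ 2 * `|killing_error| * N%:R <= _).
    rewrite ler_wpM2r//; apply: le_trans (_ : 2 * step N ^+ 2 * `|killing_error| <= _).
      by apply: ler_wpM2l; [rewrite mulr_ge0// sqr_ge0 | exact: ler_norm].
    apply: ler_wpM2r => //; apply: ler_wpM2l => //.
    by apply: lerXn2r; rewrite ?nnegrE// divr_ge0.
  have -> : 2 * (t / N%:R) ^+ 2 * `|killing_error| * N%:R = 2 * t * t * `|killing_error| / N%:R.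
    by field; rewrite gt_eqF.
  have tn0 : 0 <= t * nu by rewrite mulr_ge0.
  rewrite ler_pdivrMr// -ler_pdivrMl// mulrC.
  by apply: le_trans hN; rewrite lerDr.
apply: lerD; last first.
  apply: h3 n3 (fun=> fun=> 1) _ _ => [i|i o]; last by rewrite normr1; lra.
  by apply: admissible_le (@admissible_cst _ _ _ _ _ _ hw 1); exact: (node_ge0 st).
apply: lerD.
  by apply: h1 n1 _ _ _ => [i|i o]; [exact: admissible_cos_weight | exact: norm_cos_weight].
by apply: h2 n2 _ _ _ => [i|i o]; [exact: admissible_sin_weight | exact: norm_sin_weight].
Qed.

End BlockSteps.

(** * Passage to the limit *)

Section PathSums.
Variables (R : realType) (W : zmodType).

Lemma sum_path_cat (F : R -> R -> W) a (p q : seq R) :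
  \sum_(i < size (p ++ q)) F (a :: p ++ q)`_i (a :: p ++ q)`_i.+1 =
  \sum_(i < size p) F (a :: p)`_i (a :: p)`_i.+1 +
  \sum_(i < size q) F (last a p :: q)`_i (last a p :: q)`_i.+1.
Proof.
elim: p a => [|x p IH] a /=; first by rewrite big_ord0 add0r.
by rewrite !big_ord_recl/= IH addrA.
Qed.

Lemma mesh_lt_cat (e a : R) (p q : seq R) :
  mesh_lt e a p -> mesh_lt e (last a p) q -> mesh_lt e a (p ++ q).
Proof.
elim: p a => [|x p IH] a //= hp hq [_|i] /=; first exact: (hp 0%N).
by move=> iN; apply: (IH x _ hq i) => // j jp; exact: (hp j.+1).
Qed.

Definition nodes (s t : R) N : seq R := mkseq (fun i => node s t N i.+1) N.

Lemma nth_nodes s t N i : (i <= N)%N -> (s :: nodes s t N)`_i = node s t N i.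
Proof. by case: i => [|i] iN; rewrite /= ?node0// nth_mkseq. Qed.

Lemma last_nodes s t N : (0 < N)%N -> last s (nodes s t N) = t.
Proof.
move=> N0; rewrite (last_nth 0) size_mkseq nth_nodes// nodeN//.
Qed.

Lemma sum_nodes (F : R -> R -> W) s t N :
  \sum_(i < size (nodes s t N)) F (s :: nodes s t N)`_i (s :: nodes s t N)`_i.+1 =
  \sum_(i < N) F (node s t N i) (node s t N i.+1).
Proof.
by rewrite size_mkseq; apply: eq_bigr => i _; rewrite !nth_nodes// ltnW.
Qed.

Lemma nodes_partition s t N : s < t -> (0 < N)%N -> itv_partition s t (nodes s t N).
Proof.
move=> st N0; split; last by rewrite last_nodes.
apply/(pathP 0) => i; rewrite size_mkseq => iN.
rewrite nth_nodes ?(ltnW iN)// nth_mkseq// -subr_gt0 node_step.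
by rewrite divr_gt0 ?subr_gt0// ltr0n.
Qed.

Lemma mesh_nodes (s t e : R) N : s <= t -> 0 < e -> (Num.bound ((t - s) / e) <= N)%N ->
  mesh_lt e s (nodes s t N).
Proof.
move=> st e0 hN i; rewrite size_mkseq => iN; rewrite !nth_nodes ?(ltnW iN)// node_step.
have N0 : 0 < N%:R :> R by rewrite ltr0n (leq_ltn_trans (leq0n i)).
rewrite ltr_pdivrMr// mulrC -ltr_pdivrMr//.
apply: lt_le_trans (_ : (Num.bound ((t - s) / e))%:R <= _); last by rewrite ler_nat.
by apply: archi_boundP; rewrite divr_ge0 ?subr_ge0// ltW.
Qed.

End PathSums.

(** * A distance for convergence in probability *)

Section TruncatedDistance.
Variable R : realType.
Implicit Types x y z : R.

(** Its mean metrizes convergence in probability without integrability of the area, and it dominates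
    differences of bounded Lipschitz functions such as the cosine. *)
Definition trunc x : R := Num.min 1 `|x|.

Lemma trunc_ge0 x : 0 <= trunc x. Proof. by rewrite le_min ler01/=. Qed.

Lemma trunc_le1 x : trunc x <= 1. Proof. by rewrite ge_min lexx. Qed.

Lemma truncD x y : trunc (x + y) <= trunc x + trunc y.
Proof.
have h := ler_normD x y; rewrite /trunc.
by case: (lerP 1 `|x + y|); case: (lerP 1 `|x|); case: (lerP 1 `|y|);
  have := normr_ge0 x; have := normr_ge0 y; lra.
Qed.

Lemma trunc_diff (f : R -> R) x y : (forall z, `|f z| <= 1) ->
  (forall z z', `|f z - f z'| <= `|z - z'|) -> `|f x - f y| <= 2 * trunc (x - y).
Proof.
move=> f1 fl; rewrite /trunc; case: (lerP 1 `|x - y|) => h.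
  by apply: le_trans (ler_normB _ _) _; have := f1 x; have := f1 y; lra.
by have := fl x y; have := normr_ge0 (x - y); lra.
Qed.

Lemma lipschitz_derive (f df : R -> R) : (forall z : R, is_derive z (1 : R) f (df z)) ->
  (forall z, `|df z| <= 1) -> forall x y, `|f x - f y| <= `|x - y|.
Proof.
move=> hf df1 x y; wlog yx : x y / y <= x => [H|].
  have [/H//|/ltW/H] := leP y x; by rewrite distrC [leRHS]distrC.
have cf : {within `[y, x], continuous f}.
  by apply: derivable_within_continuous => z _; exact: (@ex_derive _ _ _ _ _ _ _ (hf z)).
have [c _ ->] := @MVT_segment R f df y x yx (fun z _ => hf z) cf.
by rewrite normrM ler_piMl.
Qed.

Lemma cos_trunc x y : `|cos x - cos y| <= 2 * trunc (x - y).
Proof.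
apply: trunc_diff; first exact: cos_max.
apply: (@lipschitz_derive _ (fun z => - sin z)) => z; rewrite ?normrN; exact: sin_max.
Qed.

Lemma sin_trunc x y : `|sin x - sin y| <= 2 * trunc (x - y).
Proof.
apply: trunc_diff; first exact: sin_max.
by apply: (@lipschitz_derive _ cos) => z; exact: cos_max.
Qed.

End TruncatedDistance.

Lemma measurable_ge d (T : measurableType d) (R : realType) (f : T -> R) (c : R) :
  measurable_fun setT f -> measurable [set o | c <= f o].
Proof.
move=> mf; have -> : [set o | c <= f o] = setT `&` f @^-1` `[c, +oo[.
  by apply/seteqP; split => o /=; rewrite in_itv/= andbT// => -[].
exact: mf.
Qed.

(** * The phases of the partitions converge to the area *)

Section AreaConvergence.
Variables (R : realType) (n : nat).
Notation V := 'M[R]_(n, 4).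
Context d (T : measurableType d) (P : probability T R).
Variables (w : R -> T -> V) (a : R -> T -> 'rV[R]_3).
Hypothesis hw : hp_brownian_motion P w.
Hypothesis ha : stochastic_area P w a.
Implicit Types (x y : V) (f g : V -> R) (r : R) (o : T).
Local Notation path := (path w).

Lemma coord_continuous3 (k : 'I_3) : continuous (fun v : 'rV[R]_3 => v 0 k).
Proof. exact: coord_continuous. Qed.

Lemma measurable_area t k : 0 <= t -> measurable_fun setT (fun o => a t o 0 k).
Proof.
move=> t0; case: ha => ma _.
apply: (adapted_measurable ma (I := past t)) => //.
  exact: past_ge0.
apply: (adapted_comp (f := fun v : 'rV[R]_3 => v 0 k)).
  by rewrite /past/= in_itv/= t0 lexx.
exact: coord_continuous3.
Qed.

Definition dot (lam v : 'rV[R]_3) : R := \sum_(k < 3) lam 0 k * v 0 k.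

Lemma measurable_dot_area lam t : 0 <= t -> measurable_fun setT (fun o => dot lam (a t o)).
Proof.
move=> t0; apply: measurable_sum => k; apply: measurable_funM => //.
exact: measurable_area.
Qed.

Lemma measurable_area_sum s l : measurable_fun setT (fun o => area_sum (path o) s 0 l).
Proof.
have E o := area_sumE (path o) s l.
case: (l == inord 0) E => E; under eq_fun do rewrite E.
  exact: measurable_cst.
apply: measurable_sum => i; apply: measurable_funM.
  apply: measurable_funM => //; apply: measurable_funD; apply: (measurable_path hw);
    by apply: tame_continuous; exact: tame_phi.
have -> : (fun o => ip (path o (0 :: s)`_i.+1) (xi l (path o (0 :: s)`_i))) =
  (fun o => \sum_c crd c (path o (0 :: s)`_i.+1) * crd c (xi l (path o (0 :: s)`_i))).
  by apply/funext => o; rewrite sum_crd.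
apply: measurable_sum => c; apply: measurable_funM.
  by apply: (@measurable_path _ _ _ _ _ _ hw _ (fun x => crd c x)); apply: tame_continuous; exact: tame_crd.
apply: (@measurable_path _ _ _ _ _ _ hw _ (fun x => crd c (xi l x))).
by apply: tame_continuous; exact: tame_crd_xi.
Qed.

Lemma norm_row4_ge (e : R) (v : 'rV[R]_4) : 0 < e -> (e <= `|v|) = [exists l, e <= `|v 0 l|].
Proof.
move=> e0; rewrite [`|v|]/Num.norm/= mx_normrE; apply/idP/existsP.
  move=> /bigmax_geP[|[[i l] _ /= h]]; first by rewrite leNgt e0.
  by exists l; rewrite (ord1 i) in h.
move=> [l h]; apply/bigmax_geP; right; by exists (0, l).
Qed.

Lemma qimagE (v : 'rV[R]_3) (k : 'I_3) : qimag v 0 (inord k.+1) = v 0 k.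
Proof.
rewrite /qimag /quat mxE inordK; last by case: k.
by case: k => -[|[|[|//]]] h /=; congr (v 0 _); apply/val_inj; rewrite /= inordK.
Qed.

(** On the exceptional event of the convergence in probability the truncation is at most 1 and the
    probability at most e / 2; off it every component is close enough for the combination to be at
    most e / 2. *)
Lemma area_sum_cvg lam (t e : R) : 0 <= t -> 0 < e ->
  exists2 delta : R, 0 < delta & forall s, itv_partition 0 t s -> mesh_lt delta 0 s ->
    mean P (fun o => trunc (\sum_(i < size s)
       area_step lam (path o (0 :: s)`_i) (path o (0 :: s)`_i.+1) - dot lam (a t o))) <= e.
Proof.
move=> t0 e0; case: ha => _ /(_ t t0).
(* The added 1 keeps L positive when lam = 0. *)
pose L := \sum_(k < 3) `|lam 0 k| + 1.
have L0 : 0 < L by rewrite ltr_wpDl// sumr_ge0.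
have e2 : 0 < e / (2 * L) by rewrite divr_gt0// mulr_gt0.
move=> /(_ _ (e / 2) e2)[|delta d0 hd]; first by rewrite divr_gt0.
exists delta => // s ps ms; have {hd} := hd s ps ms.
have pathw o : area_sum (w ^~ o) s = area_sum (path o) s.
  have ge0 i : 0 <= (0 :: s)`_i.
    have : all (>= 0) s.
      case: ps => + _; rewrite lt_path_sortedE => /andP[h _].
      by apply: sub_all h => x /ltW.
    move=> /allP h; case: i => [|i] //=; have [iN|iN] := ltnP i (size s).
      exact: h (mem_nth _ iN).
    by rewrite nth_default.
  apply/rowP => l; rewrite !area_sumE; case: eqP => // _.
  by apply: eq_bigr => i _; rewrite !pathE.
pose D l o := area_sum (path o) s 0 l - qimag (a t o) 0 l.
set E := [set o | _].
have EE : E = \bigcup_(l in [set: 'I_4]) [set o | e / (2 * L) <= `|D l o|].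
  apply/seteqP; split => o; rewrite /E/= pathw norm_row4_ge//.
    by move=> /existsP[l hl]; exists l => //=; rewrite /D; rewrite !mxE in hl *.
  by move=> [l _ /= hl]; apply/existsP; exists l; rewrite /D in hl; rewrite !mxE in hl *.
have mE : measurable E.
  rewrite EE; apply: fin_bigcup_measurable => // l _; apply: measurable_ge.
  apply: measurableT_comp => //; apply: measurable_funB; first exact: measurable_area_sum.
  have -> : (fun o => qimag (a t o) 0 l) = (fun o => [:: 0; a t o 0 (inord 0); a t o 0 (inord 1); a t o 0 (inord 2)]`_l).
    by apply/funext => o; rewrite mxE.
  by case: l => -[|[|[|[|]]]] //= _; exact: measurable_area.
move=> PE.
have b1 : bounded_measurable (\1_E : T -> R) by exact: bounded_measurable_indic.
have bc := bounded_measurable_cst T (e / 2).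
pose Z o := \sum_(i < size s) area_step lam (path o (0 :: s)`_i) (path o (0 :: s)`_i.+1) - dot lam (a t o).
have mZ : measurable_fun setT Z.
  apply: measurable_funB; last exact: measurable_dot_area.
  under eq_fun do rewrite sum_area_step.
  by apply: measurable_sum => k; apply: measurable_funM => //; exact: measurable_area_sum.
have ZE o : Z o = \sum_(k < 3) lam 0 k * D (inord k.+1) o.
  rewrite /Z sum_area_step -sumrB; apply: eq_bigr => k _.
  by rewrite -mulrBr /D qimagE.
apply: le_trans (_ : mean P (fun o => \1_E o + e / 2) <= _); last first.
  rewrite meanD// mean_cst mean_indic// [leRHS]splitr lerD2r.
  by rewrite -lee_fin fineK// fin_num_measure.
apply: le_mean.
- split; last by exists 1 => o; rewrite ger0_norm ?trunc_ge0 ?trunc_le1.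
  apply: (@measurable_minr _ _ _ _ (fun=> 1) (fun o => `|Z o|)) => //.
  exact: measurableT_comp.
- exact: bounded_measurableD.
- move=> o; rewrite indicE; case: (boolP (o \in E)) => [_|].
    by apply: le_trans (trunc_le1 _) _; rewrite lerDl divr_ge0// ltW.
  rewrite notin_setE EE => hE; rewrite add0r.
  have hD l : `|D l o| <= e / (2 * L).
    by rewrite leNgt; apply/negP => h; apply: hE; exists l => //=; exact: ltW.
  rewrite /trunc ge_min; apply/orP; right; rewrite -/(Z o) ZE.
  apply: le_trans (ler_norm_sum _ _ _) _.
  apply: le_trans (_ : \sum_(k < 3) `|lam 0 k| * (e / (2 * L)) <= _).
    by apply: ler_sum => k _; rewrite normrM ler_wpM2l.
  rewrite -mulr_suml; apply: le_trans (_ : L * (e / (2 * L)) <= _).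
    by apply: ler_wpM2r; [exact: ltW | rewrite lerDl].
  by rewrite le_eqVlt; apply/orP; left; apply/eqP; field; rewrite gt_eqF.
Qed.

Lemma bounded_measurable_trunc (f : T -> R) : measurable_fun setT f ->
  bounded_measurable (fun o => trunc (f o)).
Proof.
move=> mf; split; last by exists 1 => o; rewrite ger0_norm ?trunc_ge0 ?trunc_le1.
apply: (@measurable_minr _ _ _ _ (fun=> 1) (fun o => `|f o|)) => //.
exact: measurableT_comp.
Qed.

Variables (s t : R).
Hypothesis st : 0 <= s <= t.
Variable lam : 'rV[R]_3.

Definition turn o : R := dot lam (a t o) - dot lam (a s o).

Lemma measurable_turn : measurable_fun setT turn.
Proof. by case/andP: st => s0 s_le_t; apply: measurable_funB; apply: measurable_dot_area; lra. Qed.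

Lemma measurable_phase N i : measurable_fun setT (phase w s t lam N i).
Proof.
apply: (adapted_measurable (hp_measurable hw) (@past_ge0 R (node s t N i))).
exact: adapted_phase.
Qed.

(** The area is specified through partitions of [0, t] only. A partition of [0, s] and its
    prolongation by the nodes of [s, t] are compared, so that the difference of their sums is the
    phase. *)
Lemma phase_cvg (e : R) : 0 < e -> exists N0, forall N, (N0 <= N)%N ->
  mean P (fun o => trunc (phase w s t lam N N o - turn o)) <= e.
Proof.
move=> e0; case/andP: (st) => s0 s_le_t; have t0 := le_trans s0 s_le_t.
have [st_eq|s_ne_t] := eqVneq s t.
  exists 0%N => N _; rewrite (_ : (fun o => _) = (fun=> 0)) ?mean_cst ?ltW//.
  apply/funext => o; rewrite /turn st_eq subrr subr0 /phase big1 => [|i _].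
    by rewrite /trunc normr0; apply/min_idPr.
  by rewrite /pos /node subrr !mul0r area_step_diag.
have s_lt_t : s < t by rewrite lt_neqAle s_ne_t.
have e2 : 0 < e / 2 by rewrite divr_gt0.
have [d1 d10 h1] := area_sum_cvg lam t0 e2; have [d2 d20 h2] := area_sum_cvg lam s0 e2.
pose d3 := Num.min d1 d2.
have d30 : 0 < d3 by rewrite lt_min d10.
(* A degenerate interval admits only the empty partition, since partitions are strictly
   increasing. *)
pose u N := if s == 0 then [::] else nodes 0 s N.
exists (maxn 1 (maxn (Num.bound ((s - 0) / d3)) (Num.bound ((t - s) / d3)))) => N.
rewrite !geq_max => /andP[N0 /andP[hN1 hN2]].
have pu : itv_partition 0 s (u N).
  rewrite /u; case: eqVneq => [->|sn0]; first by split.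
  by apply: nodes_partition; rewrite // lt_neqAle eq_sym sn0.
have lu : last 0 (u N) = s by case: pu => _ /eqP.
have mu : mesh_lt d3 0 (u N).
  by rewrite /u; case: eqP => // _; exact: mesh_nodes.
have mv : mesh_lt d3 s (nodes s t N) by exact: mesh_nodes.
have puv : itv_partition 0 t (u N ++ nodes s t N).
  by apply: itv_partition_cat pu _; exact: nodes_partition.
have muv : mesh_lt d3 0 (u N ++ nodes s t N) by apply: mesh_lt_cat => //; rewrite lu.
have mono e1 r p : e1 <= r -> mesh_lt e1 0 p -> mesh_lt r 0 p.
  by move=> er h i ip; apply: lt_le_trans (h i ip) er.
have {h1} := h1 _ puv (mono _ _ _ (_ : d3 <= d1) muv); rewrite ge_min lexx => /(_ isT) h1.
have {h2} := h2 _ pu (mono _ _ _ (_ : d3 <= d2) mu); rewrite ge_min lexx orbT => /(_ isT) h2.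
pose F o (r r' : R) := area_step lam (path o r) (path o r').
pose Z p r o := \sum_(i < size p) F o (0 :: p)`_i (0 :: p)`_i.+1 - dot lam (a r o).
have mZ p r : 0 <= r -> measurable_fun setT (Z p r).
  move=> r0; apply: measurable_funB; last exact: measurable_dot_area.
  rewrite /F; under eq_fun do rewrite sum_area_step.
  by apply: measurable_sum => k; apply: measurable_funM => //; exact: measurable_area_sum.
have E o : phase w s t lam N N o - turn o = Z (u N ++ nodes s t N) t o - Z (u N) s o.
  rewrite /Z sum_path_cat lu (sum_nodes (F o)) /turn /phase /F.
  by move: (\sum_(i < size _) _) (\sum_(i < N) _) (dot _ _) (dot _ _) => *; ring.
have m1 := mZ (u N ++ nodes s t N) t t0; have m2 := mZ (u N) s s0.
apply: le_trans (_ : mean P (fun o => trunc (Z (u N ++ nodes s t N) t o) + trunc (Z (u N) s o)) <= _).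
  apply: le_mean.
  - apply: bounded_measurable_trunc; apply: measurable_funB; [exact: measurable_phase|exact: measurable_turn].
  - by apply: bounded_measurableD; exact: bounded_measurable_trunc.
  - move=> o; rewrite E; apply: le_trans (truncD _ _) _.
    by rewrite lerD2l /trunc normrN.
rewrite meanD; [|exact: bounded_measurable_trunc|exact: bounded_measurable_trunc].
by rewrite [leRHS]splitr; apply: lerD.
Qed.

End AreaConvergence.

(** * The moments as the partition is refined *)

Section Limits.
Variables (R : realType) (n : nat).
Notation V := 'M[R]_(n, 4).
Context d (T : measurableType d) (P : probability T R).
Variables (w : R -> T -> V) (a : R -> T -> 'rV[R]_3).
Hypothesis hw : hp_brownian_motion P w.
Hypothesis ha : stochastic_area P w a.
Implicit Types (x y : V) (f g : V -> R) (r : R) (o : T).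
Local Notation path := (path w).
Variables (s t : R).
Hypothesis st : 0 <= s <= t.
Local Notation pos := (pos w s t).
Local Notation step := (step s t).

Let s0 : 0 <= s. Proof. by case/andP: st. Qed.
Let s_le_t : s <= t. Proof. by case/andP: st. Qed.
Let t0 : 0 <= t. Proof. exact: le_trans s_le_t. Qed.

(** A measurable substitute for the event that the whole path stays in the ball: countably many
    times are tested, yet all partitions are served at once, so M can be chosen before N. The index
    is clipped to remain in [s, t]. *)
Definition staying (M : R) : set T :=
  \bigcap_N \bigcap_i [set o | normsq (pos N (minn i N) o) <= M].

Lemma measurable_staying M : measurable (staying M).
Proof.
apply: bigcapT_measurable => N; apply: bigcapT_measurable => i.
have -> : [set o | normsq (pos N (minn i N) o) <= M] = [set o | - M <= - normsq (pos N (minn i N) o)].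
  by apply/seteqP; split => o /=; rewrite lerN2.
apply: measurable_ge; apply: (@measurable_path _ _ _ _ _ _ hw _ (fun x => - normsq x)) => x.
by apply: continuousN; exact: normsq_continuous.
Qed.

Lemma staying_cvg : mean P (\1_(staying k%:R)) @[k --> \oo] --> (1 : R).
Proof.
suff : mean P (\1_(staying k%:R)) @[k --> \oo] --> mean P (fun=> 1) by rewrite mean_cst.
apply: (@cvg_mean _ _ _ P _ _ 1) => //.
- by move=> k; apply: measurable_indic; exact: measurable_staying.
- by move=> k o; rewrite indicE; case: (_ \in _); rewrite ?normr1 ?normr0.
apply: aeW => o; have cu := @along_continuous _ _ _ _ _ _ hw _ o (@normsq_continuous R n).
have : compact ((fun r => normsq (path o r)) @` `[s, t]).
  by apply: continuous_compact; [exact: continuous_subspaceT | exact: segment_compact].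
move=> /compact_bounded [C [_ hC]].
apply: cvg_near_cst; near=> k.
rewrite indicE mem_set// => N _ i _ /=.
have : `|C| + 1 < k%:R by near: k; exact: nbhs_infty_gtr.
move=> /ltW; apply: le_trans; apply: le_trans (ler_norm _) _.
apply: (hC (`|C| + 1)); first by apply: le_lt_trans (ler_norm _) _; rewrite ltrDl.
exists (node s t N (minn i N)) => //=; rewrite in_itv/= node_ge//=.
by apply: node_le => //; exact: geq_minr.
Unshelve. all: by end_near.
Qed.

(** The index N + 1 includes the last node, where the cut-off power of phi will be replaced by the
    power itself. *)
Lemma kept_cvg (e : R) : 0 < e -> exists M0, forall M, M0 <= M -> forall N,
  mean P (fun o => 1 - kept w s t M N N.+1 o) <= e.
Proof.
move=> e0; have /cvgrPdist_le /(_ e e0) [k _ /(_ k (leqnn k)) /=] := staying_cvg.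
move=> hk; exists k%:R => M kM N.
have mS := measurable_staying k%:R.
have bS : bounded_measurable (\1_(staying k%:R) : T -> R) by exact: bounded_measurable_indic.
have b1 := bounded_measurable_cst T (1 : R).
apply: le_trans (_ : mean P (fun o => 1 - \1_(staying k%:R) o) <= _).
  apply: le_mean; [|exact: bounded_measurableB|].
    by apply: bounded_measurableB => //; exact: (bounded_measurable_kept hw st).
  move=> o; rewrite lerD2l lerN2 indicE; case: (boolP (o \in _)) => [|_] /=; last first.
    by have /andP[] := kept01 w s t M N N.+1 o.
  rewrite inE => So; rewrite /kept big1// => i _.
  have := So N I i I => /=; rewrite (minn_idPl _); last by rewrite -ltnS.
  by rewrite /in_ball => /le_trans/(_ kM) ->.
by rewrite meanB// mean_cst; apply: le_trans hk; exact: ler_norm.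
Qed.

Lemma kept_eq01 M N i o : (kept w s t M N i o == 0) || (kept w s t M N i o == 1).
Proof.
elim: i => [|i]; rewrite /kept; first by rewrite big_ord0 eqxx orbT.
rewrite big_ord_recr/= => /orP[] /eqP ->; rewrite ?mul0r ?mul1r ?eqxx// /in_ball.
by case: (_ <= _); rewrite eqxx ?orbT.
Qed.

Definition clock o r : R := primitive (fun v => normsq (path o v)) r.

Variables (lam : 'rV[R]_3) (kap : R).
Hypothesis kap0 : 0 <= kap.
Variables (G1 G2 : T -> R).
Hypotheses (aG1 : admissible P w s G1) (aG2 : admissible P w s G2).
Hypotheses (G1_le : forall o, `|G1 o| <= 1) (G2_le : forall o, `|G2 o| <= 1).
Local Notation turn := (turn a s t lam).

Definition turned o : R := G1 o * cos (turn o) - G2 o * sin (turn o).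
Definition damping o : R := expR (- (kap * (clock o t - clock o s))).

Lemma clock_mono o : clock o s <= clock o t.
Proof.
apply: primitive_mono => //; last by move=> r; exact: normsq_ge0.
by apply: (along_continuous hw); exact: normsq_continuous.
Qed.

Lemma damping01 o : 0 <= damping o <= 1.
Proof. by rewrite expR_ge0 expR_le1 oppr_le0 mulr_ge0// subr_ge0 clock_mono. Qed.

Lemma measurable_clock r : 0 <= r -> measurable_fun setT (clock ^~ r).
Proof. by move=> r0; apply: (measurable_primitive hw) => //; exact: normsq_continuous. Qed.

Lemma bounded_measurable_damping : bounded_measurable damping.
Proof.
split; last by exists 1 => o; have /andP[h0 h1] := damping01 o; rewrite ger0_norm.
apply: measurableT_comp => //; apply: measurableT_comp => //.
by apply: measurable_funM => //; apply: measurable_funB; exact: measurable_clock.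
Qed.

Lemma bounded_measurable_turned : bounded_measurable turned.
Proof.
have [bG1 _ _] := aG1; have [bG2 _ _] := aG2; have mt := measurable_turn ha st lam.
apply: bounded_measurableB; apply: bounded_measurableM => //.
  by split; [apply: measurableT_comp mt => //; exact: continuous_measurable_fun (@continuous_cos R) | exists 1 => o; exact: cos_max].
by split; [apply: measurableT_comp mt => //; exact: continuous_measurable_fun (@continuous_sin R) | exists 1 => o; exact: sin_max].
Qed.

Lemma norm_turned o : `|turned o| <= 2.
Proof. exact: norm_rotation. Qed.

Let K_ N := killing w s t kap N N.
Let A_ N := rotated w s t lam G1 G2 N N.

Let bK N : bounded_measurable (K_ N).
Proof.
split; last by exists 1 => o; have /andP[h0 h1] := killing01 w st kap0 N N o; rewrite ger0_norm.
exact: (adapted_measurable (hp_measurable hw) (@past_ge0 R (node s t N N)) (@adapted_killing _ _ _ _ _ _ _ st kap N N)).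
Qed.

Let bA N : bounded_measurable (A_ N).
Proof. by have [] := admissible_rotated hw st lam aG1 aG2 N N. Qed.

Let bKD N : bounded_measurable (fun o => `|K_ N o - damping o|).
Proof. by apply: bounded_measurable_norm; apply: bounded_measurableB => //; exact: bounded_measurable_damping. Qed.

Let bAD N : bounded_measurable (fun o => `|A_ N o - turned o|).
Proof. by apply: bounded_measurable_norm; apply: bounded_measurableB => //; exact: bounded_measurable_turned. Qed.

Lemma killing_cvg : mean P (fun o => `|K_ N o - damping o|) @[N --> \oo] --> 0.
Proof.
rewrite -(mean_cst P 0); apply: (@cvg_mean _ _ _ P _ _ 2) => //.
- by move=> N; have [] := bKD N.
- move=> N o; rewrite normr_id.
  have /andP[h0 h1] := damping01 o; have /andP[h2 h3] := killing01 w st kap0 N N o.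
  by rewrite ler_norml; apply/andP; split; rewrite /K_; lra.
apply: aeW => o.
rewrite -(@normr0 _ R^o) -(subrr (damping o)); apply: cvg_norm; apply: cvgB; last exact: cvg_cst.
apply: (cvg_comp (fun N => - (kap * (step N * \sum_(k < N) normsq (pos N k o)))) expR); last exact: continuous_expR.
apply: cvgN; apply: cvgM; first exact: cvg_cst.
apply: (riemann_sum_cvg (h := fun r => normsq (path o r))) => //.
by apply: (along_continuous hw); exact: normsq_continuous.
Qed.

Lemma rotated_cvg (e : R) : 0 < e -> exists N0, forall N, (N0 <= N)%N ->
  mean P (fun o => `|A_ N o - turned o|) <= e.
Proof.
move=> e0; have [|N0 hN0] := phase_cvg hw ha st lam (e := e / 4); first by rewrite divr_gt0.
exists N0 => N hN; have {}hN0 := hN0 N hN.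
have bt : bounded_measurable (fun o => trunc (phase w s t lam N N o - turn o)).
  by apply: bounded_measurable_trunc; apply: measurable_funB; [exact: (measurable_phase hw st) | exact: (measurable_turn ha st)].
apply: le_trans (_ : mean P (fun o => 4 * trunc (phase w s t lam N N o - turn o)) <= _).
  apply: le_mean => //; first by apply: bounded_measurableM => //; exact: bounded_measurable_cst.
  move=> o; have h1 := cos_trunc (phase w s t lam N N o) (turn o).
  have h2 := sin_trunc (phase w s t lam N N o) (turn o).
  have -> : A_ N o - turned o = G1 o * (cos (phase w s t lam N N o) - cos (turn o)) -
     G2 o * (sin (phase w s t lam N N o) - sin (turn o)) by rewrite /A_ /rotated /turned; ring.
  apply: le_trans (ler_normB _ _) _; rewrite !normrM.
  have h3 : `|G1 o| * `|cos (phase w s t lam N N o) - cos (turn o)| <= `|cos (phase w s t lam N N o) - cos (turn o)|.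
    by rewrite ler_piMl.
  have h4 : `|G2 o| * `|sin (phase w s t lam N N o) - sin (turn o)| <= `|sin (phase w s t lam N N o) - sin (turn o)|.
    by rewrite ler_piMl.
  lra.
by rewrite meanZ// -ler_pdivlMl// mulrC.
Qed.

Lemma bounded_measurable_phiX m r : bounded_measurable (fun o => phi (path o r) ^+ m).
Proof.
split; last by exists 1 => o; rewrite ger0_norm ?exprn_ile1 ?exprn_ge0 ?phi_le1 ?(ltW (phi_gt0 _)).
apply: (@measurable_path _ _ _ _ _ _ hw _ (fun x => phi x ^+ m)).
by apply: tame_continuous; apply: tameX; exact: tame_phi.
Qed.

Definition limit_moment m : R := mean P (fun o => turned o * damping o * phi (path o t) ^+ m).

(** The factors are exchanged for their limits one at a time. As in the recursion, the ball is fixed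
    before the partition. *)
Lemma moment_cvg (e : R) : 0 < e -> exists M0, forall M, M0 <= M ->
  exists N0, forall N, (N0 <= N)%N -> forall m,
    `|moment P w s t lam kap G1 G2 M N m N - limit_moment m| <= e.
Proof.
move=> e0; have e6 : 0 < e / 6 by rewrite divr_gt0.
have e3 : 0 < e / 3 by rewrite divr_gt0.
have [M0 hM0] := kept_cvg e6; exists M0 => M M0M.
have [N1 hN1] := rotated_cvg e3.
have /cvgrPdist_le /(_ _ e6) [N2 _ hN2] := killing_cvg.
exists (maxn 1 (maxn N1 N2)) => N; rewrite !geq_max => /andP[N0 /andP[n1 n2]] m.
have {}hN1 := hN1 N n1; have {}hN2 := hN2 N n2; have {}hM0 := hM0 M M0M N.
rewrite /= sub0r normrN in hN2.
have {}hN2 := le_trans (ler_norm _) hN2.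
have bk j : bounded_measurable (kept w s t M N j) by exact: (bounded_measurable_kept hw st).
have b1k : bounded_measurable (fun o => 1 - kept w s t M N N.+1 o).
  by apply: bounded_measurableB => //; exact: bounded_measurable_cst.
have bZ (c : R) (X : T -> R) : bounded_measurable X -> bounded_measurable (fun o => c * X o).
  by move=> bX; apply: bounded_measurableM => //; exact: bounded_measurable_cst.
have bm := bounded_measurable_moment hw st lam kap0 aG1 aG2 M N m N.
have bl : bounded_measurable (fun o => turned o * damping o * phi (path o t) ^+ m).
  apply: bounded_measurableM; last exact: bounded_measurable_phiX.
  by apply: bounded_measurableM; [exact: bounded_measurable_turned | exact: bounded_measurable_damping].
rewrite /moment /limit_moment -meanB//.
apply: le_trans (_ : mean P (fun o => 2 * (1 - kept w s t M N N.+1 o) + 2 * `|K_ N o - damping o| + `|A_ N o - turned o|) <= _).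
  apply: norm_mean_le; first exact: bounded_measurableB.
    by apply: bounded_measurableD => //; apply: bounded_measurableD; exact: bZ.
  move=> o.
  have eN : pos N N o = path o t by rewrite /pos nodeN.
  rewrite /kept big_ord_recr/= -/(kept w s t M N N o) eN -/(K_ N o) -/(A_ N o).
  have /andP[Th0 Th1] := kept01 w s t M N N o.
  have /andP[K0 K1] := killing01 w st kap0 N N o.
  have /andP[D0 D1] := damping01 o.
  have A2 : `|A_ N o| <= 2 by exact: norm_rotation.
  have A'2 := norm_turned o.
  have p0 := phi_gt0 (path o t); have p1 := phi_le1 (path o t).
  have pm0 : 0 <= phi (path o t) ^+ m by rewrite exprn_ge0// ltW.
  have pm1 : phi (path o t) ^+ m <= 1 by rewrite exprn_ile1// ltW.
  have g0 := phi_cut_ge0 M m (path o t); have g1 := phi_cut_le M m (path o t).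
  (* [kept] takes only the values 0 and 1, and nothing is lost when it is 1 and the endpoint also
     lies in the ball. *)
  have hp : `|kept w s t M N N o * phi_cut M m (path o t) - phi (path o t) ^+ m| <=
      1 - kept w s t M N N o * in_ball M (path o t).
    have /orP[/eqP ->|/eqP ->] := kept_eq01 M N N o.
      by rewrite !mul0r sub0r subr0 normrN ger0_norm.
    rewrite !mul1r /in_ball; case: (lerP (normsq _) M) => h.
      by rewrite phi_cutE// subrr normr0 subrr.
    by rewrite subr0 ler_norml; apply/andP; split; lra.
  have -> : kept w s t M N N o * K_ N o * A_ N o * phi_cut M m (path o t) - turned o * damping o * phi (path o t) ^+ m =
    A_ N o * K_ N o * (kept w s t M N N o * phi_cut M m (path o t) - phi (path o t) ^+ m) +
    A_ N o * phi (path o t) ^+ m * (K_ N o - damping o) +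
    damping o * phi (path o t) ^+ m * (A_ N o - turned o) by ring.
  apply: le_trans (ler_normD _ _) _; apply: lerD; last first.
    by rewrite normrM ler_piMl// normrM !ger0_norm// mulr_ile1.
  apply: le_trans (ler_normD _ _) _; apply: lerD.
    rewrite normrM; apply: ler_pM => //; rewrite normrM (ger0_norm K0).
    by apply: le_trans A2; rewrite ler_piMr.
  rewrite normrM ler_wpM2r// normrM (ger0_norm pm0).
  by apply: le_trans A2; rewrite ler_piMr.
rewrite meanD//; last by apply: bounded_measurableD; exact: bZ.
rewrite meanD; [|exact: bZ|exact: bZ].
rewrite !meanZ//; lra.
Qed.

(** The area is not assumed adapted. Its phase is the limit of the phases of partitions, which are
    functions of finitely many past positions, and admissibility survives this limit; that lets the
    next interval start from these weights. *)
Lemma admissible_limit : admissible P w t (fun o => turned o * damping o).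
Proof.
have bl : bounded_measurable (fun o => turned o * damping o).
  by apply: bounded_measurableM; [exact: bounded_measurable_turned | exact: bounded_measurable_damping].
(* The index is shifted because the last node is t only for a positive number of steps. *)
apply: (admissible_lim hw (J_ := fun k => fun o => A_ k.+1 o * K_ k.+1 o)) => //.
- move=> k; have eN := @nodeN R s t k.+1 isT.
  apply: (@admissibleM _ _ _ _ _ _ hw _ _ _ 1).
  + by rewrite -[X in admissible _ _ X _]eN; exact: admissible_rotated.
  + by rewrite -[X in past X]eN; exact: adapted_killing.
  + by move=> o; have /andP[h0 h1] := killing01 w st kap0 k.+1 k.+1 o; rewrite ger0_norm.
apply/cvgrPdist_le => e e0; have e4 : 0 < e / 4 by rewrite divr_gt0.
have e2 : 0 < e / 2 by rewrite divr_gt0.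
have [N1 hN1] := rotated_cvg e2.
have /cvgrPdist_le /(_ _ e4) [N2 _ hN2] := killing_cvg.
exists (maxn N1 N2) => // k /=; rewrite geq_max => /andP[n1 n2].
have {}hN1 := hN1 k.+1 (leqW n1); have {}hN2 := hN2 k.+1 (leqW n2).
rewrite /= sub0r normrN in hN2.
have {}hN2 := le_trans (ler_norm _) hN2.
rewrite sub0r normrN ger0_norm; last by apply: mean_ge0 => o.
apply: le_trans (_ : mean P (fun o => `|A_ k.+1 o - turned o| + 2 * `|K_ k.+1 o - damping o|) <= _).
  apply: le_mean.
  - by apply: bounded_measurable_norm; apply: bounded_measurableB => //; exact: bounded_measurableM.
  - by apply: bounded_measurableD => //; apply: bounded_measurableM => //; exact: bounded_measurable_cst.
  move=> o; have -> : A_ k.+1 o * K_ k.+1 o - turned o * damping o =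
     K_ k.+1 o * (A_ k.+1 o - turned o) + turned o * (K_ k.+1 o - damping o) by ring.
  have /andP[h0 h1] := killing01 w st kap0 k.+1 k.+1 o.
  apply: le_trans (ler_normD _ _) _; apply: lerD; rewrite normrM.
    by rewrite (ger0_norm h0) ler_piMl.
  by rewrite ler_wpM2r// norm_turned.
rewrite meanD//; last by apply: bounded_measurableM => //; exact: bounded_measurable_cst.
by rewrite meanZ//; lra.
Qed.

End Limits.

(** * Comparison of two systems of moments over one interval *)

Section Blocks.
Variables (R : realType) (n : nat).
Notation V := 'M[R]_(n, 4).
Context d (T : measurableType d) (P : probability T R).
Variables (w : R -> T -> V) (a : R -> T -> 'rV[R]_3).
Hypothesis hw : hp_brownian_motion P w.
Hypothesis ha : stochastic_area P w a.
Implicit Types (x y : V) (f g : V -> R) (r : R) (o : T).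
Local Notation path := (path w).

Lemma eventually_forall_le (Q : nat -> nat -> Prop) J :
  (forall j, (j <= J)%N -> exists N0, forall N, (N0 <= N)%N -> Q j N) ->
  exists N0, forall N, (N0 <= N)%N -> forall j, (j <= J)%N -> Q j N.
Proof.
elim: J => [|J IH] h.
  have [N0 hN0] := h 0%N (leqnn _); exists N0 => N hN j.
  by rewrite leqn0 => /eqP ->; exact: hN0.
have [N1 h1] := IH (fun j jJ => h j (leqW jJ)); have [N2 h2] := h J.+1 (leqnn _).
exists (maxn N1 N2) => N; rewrite geq_max => /andP[n1 n2] j.
by rewrite leq_eqVlt => /orP[/eqP ->|]; [exact: h2 | exact: h1].
Qed.

Variables (s t : R).
Hypothesis st : 0 <= s <= t.
Variables (m0 : nat).
Hypothesis m0_gt0 : (0 < m0)%N.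
Let C : R := 2 * m0%:R * (m0%:R + 1).
Let b j : R := 2 * (m0 + j)%:R * ((m0 + j)%:R + 1) - C.
Let nu j : R := b j + 4 * n%:R * (m0 + j)%:R.

Let b_mono i j : (i <= j)%N -> b i <= b j.
Proof.
move=> ij; have h : (m0 + i)%:R <= (m0 + j)%:R :> R by rewrite ler_nat leq_add2l.
rewrite lerD2r; apply: ler_pM; rewrite ?mulr_ge0 ?addr_ge0//; first by rewrite ler_wpM2l.
by rewrite lerD2r.
Qed.

Let b0 : b 0 = 0. Proof. by rewrite /b /C addn0 subrr. Qed.
Let b_ge0 j : 0 <= b j. Proof. by rewrite -b0; exact: b_mono. Qed.

Section OneSystem.
Variables (lam : 'rV[R]_3) (kap : R) (G1 G2 : T -> R).
Hypotheses (kap0 : 0 <= kap) (kapE : kap + 2^-1 * sqnorm lam = C).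
Hypotheses (aG1 : admissible P w s G1) (aG2 : admissible P w s G2).
Hypotheses (G1_le : forall o, `|G1 o| <= 1) (G2_le : forall o, `|G2 o| <= 1).
Local Notation moment := (moment P w s t lam kap G1 G2).

Lemma moment0 (M : R) N m : 0 <= M -> (0 < m)%N ->
  `|moment M N m 0 - mean P (fun o => G1 o * phi (path o s) ^+ m)| <= (1 + M)^-1.
Proof.
move=> M0 m_gt0; have [bG1 _ _] := aG1.
have e o : kept w s t M N 0 o * killing w s t kap N 0 o * rotated w s t lam G1 G2 N 0 o *
    phi_cut M m (pos w s t N 0 o) = G1 o * phi_cut M m (path o s).
  rewrite /kept /killing /rotated /phase !big_ord0 !mulr0 oppr0 expR0 cos0 sin0 /pos node0.
  by ring.
rewrite /moment/moment; under [X in mean P X]eq_fun do rewrite e.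
have bc : bounded_measurable (fun o => phi_cut M m (path o s)).
  apply: (bounded_measurable_test hw); exact: test_phi_cut.
have bp := bounded_measurable_phiX hw m s.
rewrite -meanB; [|exact: bounded_measurableM|exact: bounded_measurableM].
apply: mean_bounded.
  by apply: bounded_measurableB; exact: bounded_measurableM.
move=> o; rewrite -mulrBr normrM.
have h0 := phi_cut_ge0 M m (path o s); have h1 := phi_cut_le M m (path o s).
have i0 : 0 <= (1 + M)^-1 by rewrite invr_ge0 addr_ge0.
apply: le_trans (_ : `|phi_cut M m (path o s) - phi (path o s) ^+ m| <= _); first by rewrite ler_piMl.
case: (lerP (normsq (path o s)) M) => hM; first by rewrite phi_cutE// subrr normr0.
rewrite ler0_norm ?subr_le0// opprB; apply: le_trans (_ : phi (path o s) ^+ m <= _); first by rewrite gerBl.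
have p1 : phi (path o s) <= (1 + M)^-1.
  have e' := phiE (path o s); rewrite /phi lef_pV2 ?posrE ?lerD2l; [exact: ltW|lra|lra].
case: m m_gt0 {e bc bp h0 h1} => // k _; rewrite exprS; apply: le_trans p1.
by rewrite ler_piMr ?exprn_ile1 ?phi_le1// ltW// phi_gt0.
Qed.

Lemma moment_recursions (M e : R) J : 0 <= M -> 0 < e -> 2 * (1 + t * b J) / (1 + M) <= e / 5 ->
  exists N0, forall N, (N0 <= N)%N -> forall j, (j <= J)%N ->
    [/\ 0 <= step s t N * nu j <= 1, step s t N <= t &
  \sum_(i < N) `|moment M N (m0 + j) i.+1 - ((1 - step s t N * nu j) * moment M N (m0 + j) i +
     step s t N * b j * moment M N (m0 + j.-1) i)| <= e].
Proof.
move=> M0 e0 hM; have t0 : 0 <= t by case/andP: st; exact: le_trans.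
apply: eventually_forall_le => j jJ.
have hb : b j = 0 \/ (1 < m0 + j)%N.
  case: j jJ => [|j] _; first by left; exact: b0.
  by right; case: (m0) m0_gt0 => // k _; rewrite addSn addnS.
have hj : 2 * (1 + t * b j) / (1 + M) <= e / 5.
  apply: le_trans hM; rewrite ler_wpM2r ?invr_ge0 ?addr_ge0//.
  by rewrite ler_wpM2l// lerD2l ler_wpM2l// b_mono.
have bE : b j = drift_rate lam (m0 + j) - kap by rewrite /b /drift_rate -kapE; ring.
have mj : (0 < m0 + j)%N by rewrite addn_gt0 m0_gt0.
have [N0 hN0] := moment_recursion hw st kap0 aG1 aG2 G1_le G2_le M0 mj (b_ge0 j) bE (erefl (nu j)) hb e0 hj.
exists N0 => N /hN0 [h1 h2 h3]; split=> //.
apply: le_trans h3; rewrite le_eqVlt; apply/orP; left; apply/eqP; apply: eq_bigr => i _.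
(* The orders m0 + j.-1 and (m0 + j).-1 differ only at j = 0, where their coefficient is zero. *)
case: j {jJ hb hj bE mj hN0 h1} => [|j]; first by rewrite b0 mulr0 !mul0r.
by rewrite addnS.
Qed.

End OneSystem.

Variables (lam lam' : 'rV[R]_3) (kap kap' : R) (G1 G2 G1' G2' : T -> R).
Hypotheses (kap0 : 0 <= kap) (kapE : kap + 2^-1 * sqnorm lam = C).
Hypotheses (aG1 : admissible P w s G1) (aG2 : admissible P w s G2).
Hypotheses (G1_le : forall o, `|G1 o| <= 1) (G2_le : forall o, `|G2 o| <= 1).
Hypotheses (kap'0 : 0 <= kap') (kap'E : kap' + 2^-1 * sqnorm lam' = C).
Hypotheses (aG1' : admissible P w s G1') (aG2' : admissible P w s G2').
Hypotheses (G1'_le : forall o, `|G1' o| <= 1) (G2'_le : forall o, `|G2' o| <= 1).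

(* Both families of moments satisfy the same closed system of equations, triangular
   in [m], because [m0] is a root of the coefficient of the moment of order [m - 1]. *)
Theorem limit_moment_eq :
  (forall m, (m0 <= m)%N -> mean P (fun o => G1 o * phi (path o s) ^+ m) =
                            mean P (fun o => G1' o * phi (path o s) ^+ m)) ->
  forall m, (m0 <= m)%N -> limit_moment P w a s t lam kap G1 G2 m =
                           limit_moment P w a s t lam' kap' G1' G2' m.
Proof.
move=> init m m0m; pose J := (m - m0)%N; have mJ : m = (m0 + J)%N by rewrite subnKC.
have t0 : 0 <= t by case/andP: st; exact: le_trans.
pose G := growth t b J; have G0 : 0 <= G.
  rewrite /G; elim: (J) => [|j IH] //=; rewrite addr_ge0// !mulr_ge0//.
apply/eqP; rewrite -subr_eq0 -normr_le0; apply/ler_addgt0Pl => e' e'0; rewrite addr0.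
(* The recursion amplifies errors by G, and each of the two passages to the limit costs one more
   e. *)
pose e := e' / (G + 2); have e0 : 0 < e by rewrite divr_gt0// ltr_wpDl.
have e2 : 0 < e / 2 by rewrite divr_gt0.
have [M1 h1] := moment_cvg hw ha st lam kap0 aG1 aG2 G1_le G2_le e0.
have [M2 h2] := moment_cvg hw ha st lam' kap'0 aG1' aG2' G1'_le G2'_le e0.
(* The first summand serves the two recursions, each run with error e / 2; the second makes the
   initial moments of the two systems e-close in spite of the cut-off. *)
pose B := 2 * (1 + t * b J) / (e / 2 / 5) + 2 / e.
have e5 : 0 < e / 2 / 5 by rewrite divr_gt0.
have B1 : 0 <= 2 * (1 + t * b J) / (e / 2 / 5).
  by apply: divr_ge0; [rewrite mulr_ge0// addr_ge0// mulr_ge0 | exact: ltW].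
have B2 : 0 <= 2 / e by apply: divr_ge0; [| exact: ltW].
have B0 : 0 <= B by rewrite addr_ge0.
pose M := Num.max B (Num.max M1 M2).
have BM : B <= M by rewrite le_max lexx.
have M1M : M1 <= M by rewrite !le_max lexx orbT.
have M2M : M2 <= M by rewrite !le_max lexx !orbT.
have M0 : 0 <= M by exact: le_trans BM.
have M1_gt0 : 0 < 1 + M by rewrite ltr_wpDr.
have hM : 2 * (1 + t * b J) / (1 + M) <= e / 2 / 5.
  rewrite ler_pdivrMr// [leRHS]mulrC -ler_pdivrMr//.
  apply: le_trans (_ : B <= _); last by apply: le_trans BM _; rewrite lerDr.
  by rewrite lerDl.
have hM2 : 2 / (1 + M) <= e.
  rewrite ler_pdivrMr// [leRHS]mulrC -ler_pdivrMr//.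
  apply: le_trans (_ : B <= _); last by apply: le_trans BM _; rewrite lerDr.
  by rewrite lerDr.
have [N1 k1] := h1 M M1M; have [N2 k2] := h2 M M2M.
have [N3 k3] := moment_recursions kap0 kapE aG1 aG2 G1_le G2_le M0 e2 hM.
have [N4 k4] := moment_recursions kap'0 kap'E aG1' aG2' G1'_le G2'_le M0 e2 hM.
pose N := maxn (maxn 1 N1) (maxn N2 (maxn N3 N4)).
have n0 : (0 < N)%N by rewrite /N !leq_max leqnn.
have n1 : (N1 <= N)%N by rewrite /N !leq_max leqnn ?orbT.
have n2 : (N2 <= N)%N by rewrite /N !leq_max leqnn ?orbT.
have n3 : (N3 <= N)%N by rewrite /N !leq_max leqnn ?orbT.
have n4 : (N4 <= N)%N by rewrite /N !leq_max leqnn ?orbT.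
have {}k1 := k1 N n1 m; have {}k2 := k2 N n2 m; have {}k3 := k3 N n3; have {}k4 := k4 N n4.
pose c j i := moment P w s t lam kap G1 G2 M N (m0 + j) i.
pose c' j i := moment P w s t lam' kap' G1' G2' M N (m0 + j) i.
pose D j i := c j i - c' j i.
pose eta j i := `|D j i.+1 - ((1 - step s t N * nu j) * D j i + step s t N * b j * D j.-1 i)|.
have d0 : 0 <= step s t N by exact: step_ge0.
have hD0 : `|D J N| <= growth t b J * e.
  apply: (@triangular_recursion R t e (step s t N) N J nu b D eta) => //.
  - exact: ltW.
  - by rewrite /step divfK ?pnatr_eq0 -?lt0n// gerBl; case/andP: st.
  - by move=> j jJ; split=> //; have [] := k3 j jJ.
  - move=> j jJ; have mj : (0 < m0 + j)%N by rewrite addn_gt0 m0_gt0.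
    have i1 := moment0 lam kap G2 aG1 G1_le N M0 mj.
    have i2 := moment0 lam' kap' G2' aG1' G1'_le N M0 mj.
    rewrite -init ?leq_addr// in i2.
    rewrite /D /c /c'; apply: le_trans hM2; rewrite mulrC mulr_natr.
    set A := mean P _ in i1 i2.
    have -> : moment P w s t lam kap G1 G2 M N (m0 + j) 0 - moment P w s t lam' kap' G1' G2' M N (m0 + j) 0 =
      (moment P w s t lam kap G1 G2 M N (m0 + j) 0 - A) - (moment P w s t lam' kap' G1' G2' M N (m0 + j) 0 - A) by ring.
    by apply: le_trans (ler_normB _ _) _; rewrite mulr2n; apply: lerD.
  - move=> j jJ; have [_ _ s1] := k3 j jJ; have [_ _ s2] := k4 j jJ.
    rewrite (splitr e); apply: le_trans (lerD s1 s2); rewrite -big_split/=.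
    apply: ler_sum => i _; apply: le_trans (ler_normB _ _); rewrite /eta /D /c /c'.
    rewrite le_eqVlt; apply/orP; left; apply/eqP; congr `|_|.
    by move: (moment _ _ _ _ _ _ _ _) (moment _ _ _ _ _ _ _ _) (step _ _ _) => *; ring.
  - by move=> j i; exact: normr_ge0.
have hD : `|moment P w s t lam kap G1 G2 M N m N - moment P w s t lam' kap' G1' G2' M N m N| <= G * e.
  by rewrite mJ.
have -> : limit_moment P w a s t lam kap G1 G2 m - limit_moment P w a s t lam' kap' G1' G2' m =
  (moment P w s t lam kap G1 G2 M N m N - moment P w s t lam' kap' G1' G2' M N m N)
  - (moment P w s t lam kap G1 G2 M N m N - limit_moment P w a s t lam kap G1 G2 m)
  + (moment P w s t lam' kap' G1' G2' M N m N - limit_moment P w a s t lam' kap' G1' G2' m).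
  by move: (moment _ _ _ _ _ _ _ _ _ _ _ _) (moment _ _ _ _ _ _ _ _ _ _ _ _) (limit_moment _ _ _ _ _ _ _ _ _ _) (limit_moment _ _ _ _ _ _ _ _ _ _) => *; ring.
have -> : e' = G * e + e + e.
  by rewrite /e; field; rewrite gt_eqF// ltr_wpDl.
apply: le_trans (ler_normD _ _) _; apply: lerD => //.
by apply: le_trans (ler_normB _ _) _; apply: lerD.
Qed.

End Blocks.

(** * Several times *)

Section Marks.
Variable R : realType.
Implicit Types (I : R -> R) (s : R).

(* A mark [(tau, (mu, q))] stands for a time [tau], a covector [mu] tested against
   the position at that time and an exponent [q] of the radial part at that time. *)
Definition mark := (R * ('rV[R]_3 * nat))%type.
Implicit Types (p : mark) (l : seq mark).

Definition weight l : 'rV[R]_3 := \sum_(p <- l) p.2.1.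

(** Positions are measured from time s so that the same expression can be restarted at the next
    mark. *)
Definition tested (al : R -> 'rV[R]_3) s l : R :=
  \sum_(p <- l) (dot p.2.1 (al p.1) - dot p.2.1 (al s)).

(** For a Brownian motion run with the clock I, the covariance at two times is the clock at the
    smaller one. The double sum ignores the order of the marks, whereas the recursion over
    successive times has them sorted. *)
Definition variance_along I s l : R :=
  \sum_(p <- l) \sum_(p' <- l) dot p.2.1 p'.2.1 * (I (Num.min p.1 p'.1) - I s).

Definition monomial (X : R -> R) l : R := \prod_(p <- l) X p.1 ^+ p.2.2.

Lemma dot_sqnorm (v : 'rV[R]_3) : dot v v = sqnorm v.
Proof. by rewrite /dot /sqnorm; apply: eq_bigr => k _; rewrite expr2. Qed.

Lemma dotDl (u u' v : 'rV[R]_3) : dot (u + u') v = dot u v + dot u' v.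
Proof. by rewrite /dot -big_split/=; apply: eq_bigr => k _; rewrite mxE mulrDl. Qed.

Lemma dotC (u v : 'rV[R]_3) : dot u v = dot v u.
Proof. by apply: eq_bigr => k _; rewrite mulrC. Qed.

Lemma dot0l (v : 'rV[R]_3) : dot 0 v = 0.
Proof. by rewrite /dot big1// => k _; rewrite mxE mul0r. Qed.

Lemma dot_weightl l (v : 'rV[R]_3) : dot (weight l) v = \sum_(p <- l) dot p.2.1 v.
Proof.
rewrite /weight; elim: l => [|p l IH]; first by rewrite !big_nil dot0l.
by rewrite !big_cons dotDl IH.
Qed.

(** Abel summation: from s to the first mark all covectors act together, hence through their sum. *)
Lemma tested_cons al s p l : tested al s (p :: l) =
  (dot (weight (p :: l)) (al p.1) - dot (weight (p :: l)) (al s)) + tested al p.1 l.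
Proof.
rewrite /tested !dot_weightl -sumrB [LHS]big_cons [X in _ = X + _]big_cons -[RHS]addrA.
congr (_ + _).
by rewrite -big_split/=; apply: eq_bigr => p' _; ring.
Qed.

Lemma variance_along_cons I s p l : (forall p', p' \in l -> p.1 <= p'.1) ->
  variance_along I s (p :: l) =
  sqnorm (weight (p :: l)) * (I p.1 - I s) + variance_along I p.1 l.
Proof.
move=> pl; rewrite /variance_along -dot_sqnorm dot_weightl mulr_suml [LHS]big_cons [X in _ = X + _]big_cons.
have pl' p' : p' \in p :: l -> p.1 <= p'.1.
  by rewrite inE => /orP[/eqP ->|]; [exact: lexx | exact: pl].
rewrite -[RHS]addrA; congr (_ + _).
  rewrite dotC dot_weightl mulr_suml; apply: eq_big_seq => p' /pl' h.
  by rewrite min_l// dotC.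
rewrite -big_split/=; apply: eq_big_seq => p' /pl h.
rewrite dotC dot_weightl !big_cons min_r// mulrDl -addrA dotC; congr (_ + _).
rewrite mulr_suml -big_split/=; apply: eq_bigr => p'' _.
by rewrite dotC; ring.
Qed.

Definition mark_le : rel mark := [rel p p' | p.1 <= p'.1].

Lemma mark_le_trans : transitive mark_le.
Proof. by move=> x y z; exact: le_trans. Qed.

Lemma mark_le_total : total mark_le.
Proof. by move=> x y; exact: le_total. Qed.

Lemma variance_along_perm I s l l' : perm_eq l l' ->
  variance_along I s l = variance_along I s l'.
Proof.
move=> ll'; rewrite /variance_along (perm_big _ ll')/=.
by apply: eq_bigr => p _; exact: perm_big.
Qed.

(** Once the marks are sorted, the recursion presents the double sum as a sum of squared norms times
    increments of the clock. *)
Lemma variance_along_ge0 I s l : {homo I : x y / x <= y} ->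
  (forall p, p \in l -> s <= p.1) -> 0 <= variance_along I s l.
Proof.
move=> hI sl; rewrite (@variance_along_perm I s l (sort mark_le l)); last first.
  by rewrite perm_sym; exact/permPl/perm_sort.
have : forall p, p \in sort mark_le l -> s <= p.1.
  by move=> p; rewrite mem_sort; exact: sl.
have : sorted mark_le (sort mark_le l) := sort_sorted mark_le_total l.
elim: (sort mark_le l) s {sl} => [|p k IH] s; first by rewrite /variance_along big_nil.
rewrite /= path_sortedE; last exact: mark_le_trans.
move=> /andP[/allP pk sk] hs; rewrite variance_along_cons//.
by rewrite addr_ge0 ?mulr_ge0 ?sqnorm_ge0 ?subr_ge0 ?hI ?hs ?mem_head// IH.
Qed.

(** A crude size, invariant under permutation, monotone under removal of marks and blind to marks
    with zero covector: one m0 chosen from it works for all suffixes and for all enlarged lists. *)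
Definition total_weight l : R := \sum_(p <- l) \sum_(k < 3) `|p.2.1 0 k|.

Lemma total_weight_ge0 l : 0 <= total_weight l.
Proof. by apply: sumr_ge0 => p _; exact: sumr_ge0. Qed.

Lemma sqnorm_weight_le l : sqnorm (weight l) <= 3 * total_weight l ^+ 2.
Proof.
rewrite /sqnorm; apply: le_trans (_ : \sum_(k < 3) total_weight l ^+ 2 <= _); last first.
  by rewrite sumr_const card_ord mulr_natl.
apply: ler_sum => k _; rewrite -[leLHS]real_normK ?num_real// lerXn2r ?nnegrE ?total_weight_ge0//.
rewrite /weight summxE; apply: le_trans (ler_norm_sum _ _ _) _.
apply: ler_sum => p _; rewrite (bigD1 k)//= lerDl.
by apply: sumr_ge0.
Qed.

Lemma norm_variance_along_le I s l (M : R) :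
  (forall p p', p \in l -> p' \in l -> 0 <= I (Num.min p.1 p'.1) - I s <= M) ->
  `|variance_along I s l| <= total_weight l ^+ 2 * M.
Proof.
move=> hM; rewrite /variance_along.
apply: le_trans (ler_norm_sum _ _ _) _.
rewrite expr2 {1}/total_weight mulr_suml mulr_suml big_seq [leRHS]big_seq; apply: ler_sum => p pl.
rewrite /total_weight mulr_sumr mulr_suml.
apply: le_trans (ler_norm_sum _ _ _) _.
rewrite big_seq [leRHS]big_seq; apply: ler_sum => p' p'l.
have /andP[i0 iM] := hM p p' pl p'l.
rewrite normrM (ger0_norm i0) ler_pM//.
rewrite /dot; apply: le_trans (ler_norm_sum _ _ _) _.
rewrite mulr_suml; apply: ler_sum => k _; rewrite normrM ler_wpM2l//.
by rewrite (bigD1 k)//= lerDl; exact: sumr_ge0.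
Qed.

End Marks.

Section Chain.
Variables (R : realType) (n : nat).
Notation V := 'M[R]_(n, 4).
Context d (T : measurableType d) (P : probability T R).
Variables (w : R -> T -> V) (a : R -> T -> 'rV[R]_3).
Hypothesis hw : hp_brownian_motion P w.
Hypothesis ha : stochastic_area P w a.
Implicit Types (r s t : R) (o : T) (p : mark R) (l : seq (mark R)).
Local Notation path := (path w).
Local Notation clock := (clock w).

Definition radial o r : R := phi (path o r).

Lemma radial01 o r : 0 <= radial o r <= 1.
Proof. by rewrite phi_le1 ltW// phi_gt0. Qed.

Lemma adapted_monomial_factor r q : 0 <= r -> adapted w (past r) (fun o => radial o r ^+ q).
Proof.
move=> r0; apply: (@adapted_path _ _ _ _ _ r r (fun x => phi x ^+ q)); first by rewrite r0 lexx.
by apply: tame_continuous; apply: tameX; exact: tame_phi.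
Qed.

Lemma norm_radialX o r q : `|radial o r ^+ q| <= 1.
Proof. by have /andP[h0 h1] := radial01 o r; rewrite ger0_norm ?exprn_ge0// exprn_ile1. Qed.

Lemma bounded_measurable_radialX r q : bounded_measurable (fun o => radial o r ^+ q).
Proof. exact: (bounded_measurable_phiX hw q r). Qed.

Lemma bounded_measurable_monomial l : bounded_measurable (fun o => monomial (radial o) l).
Proof.
rewrite /monomial; apply: bounded_measurable_prod => p _.
exact: bounded_measurable_radialX.
Qed.

Section Triangular.
Variable m0 : nat.
Hypothesis m0_gt0 : (0 < m0)%N.
Let C : R := 2 * m0%:R * (m0%:R + 1).

(** On each interval the area is turned by the sum lam of the remaining covectors, so kap = C -
    |lam|^2 / 2 varies with the interval while C does not. The accumulated killing on the left is
    therefore C times the clock minus half the variance; on the right it is C times the clock. What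
    passes from one interval to the next is the equality of all moments of order at least m0. The
    bound on G1^2 + G2^2 is the one that rotations preserve. *)
Theorem chain_sorted l s G1 G2 H :
  0 <= s -> path.path <=%R s [seq p.1 | p <- l] ->
  (forall k, 2^-1 * sqnorm (weight (drop k l)) <= C) ->
  admissible P w s G1 -> admissible P w s G2 -> admissible P w s H ->
  (forall o, G1 o ^+ 2 + G2 o ^+ 2 <= 1) -> (forall o, `|H o| <= 1) ->
  (forall m, (m0 <= m)%N -> mean P (fun o => G1 o * radial o s ^+ m) =
                            mean P (fun o => H o * radial o s ^+ m)) ->
  forall m, (m0 <= m)%N -> let t := last s [seq p.1 | p <- l] in
  mean P (fun o => (G1 o * cos (tested (a ^~ o) s l) - G2 o * sin (tested (a ^~ o) s l))
    * expR (2^-1 * variance_along (clock o) s l - C * (clock o t - clock o s))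
    * monomial (radial o) l * radial o t ^+ m) =
  mean P (fun o => H o * expR (- (C * (clock o t - clock o s)))
    * monomial (radial o) l * radial o t ^+ m).
Proof.
elim: l s G1 G2 H => [|p l IH] s G1 G2 H s0 sl hC aG1 aG2 aH hG hH init m m0m /=.
  have := init m m0m; congr (_ = _); congr (mean P _); apply/funext => o.
    by rewrite /tested /variance_along /monomial !big_nil cos0 sin0 subrr !mulr0 !subr0 expR0; ring.
  by rewrite /monomial big_nil subrr mulr0 oppr0 expR0; ring.
move: sl => /= /andP[sp pl].
have st : 0 <= s <= p.1 by rewrite s0.
have t0 : 0 <= p.1 by exact: le_trans sp.
set lam := weight (p :: l); pose kap := C - 2^-1 * sqnorm lam.
have kap0 : 0 <= kap by rewrite subr_ge0; have := hC 0%N; rewrite drop0.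
have kapE : kap + 2^-1 * sqnorm lam = C by rewrite /kap subrK.
have C0 : 0 <= C by rewrite -kapE addr_ge0// mulr_ge0// sqnorm_ge0.
have CE : C + 2^-1 * sqnorm (0 : 'rV[R]_3) = C.
  by rewrite /sqnorm big1 ?mulr0 ?addr0// => k _; rewrite mxE expr0n.
have le1 (u v : R) : u ^+ 2 + v ^+ 2 <= 1 -> `|u| <= 1.
  move=> h; rewrite -(@expr_le1 _ 2)// real_normK ?num_real//.
  by apply: le_trans h; rewrite lerDl sqr_ge0.
have G1_le o : `|G1 o| <= 1 by exact: le1 (hG o).
have G2_le o : `|G2 o| <= 1 by apply: (le1 _ (G1 o)); rewrite addrC.
have G2N_le o : `|- G2 o| <= 1 by rewrite normrN.
have a0 : admissible P w s (fun=> 0 : R).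
  by apply: admissible_le s0 _; exact: (admissible_cst hw).
have aN : admissible P w s (fun o => - G2 o).
  by have := admissibleZ hw (-1) aG2; congr admissible; apply/funext => o; rewrite mulN1r.
have z_le o : `|(0 : R)| <= 1 by rewrite normr0.
(* The comparison system has no rotation at all and is killed at the full rate C. *)
have blk := limit_moment_eq hw ha st m0_gt0 kap0 kapE aG1 aG2 G1_le G2_le C0 CE aH a0 hH z_le init.
have A1 := admissible_limit hw ha st lam kap0 aG1 aG2 G1_le G2_le.
have A2 := admissible_limit hw ha st lam kap0 aN aG1 G2N_le G1_le.
have A3 := admissible_limit hw ha st 0 C0 aH a0 hH z_le.
have aX := adapted_monomial_factor p.2.2 t0.
have hX o := norm_radialX o p.1 p.2.2.
have {}A1 := admissibleM hw A1 aX hX.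
have {}A2 := admissibleZ hw (-1) (admissibleM hw A2 aX hX).
have {}A3 := admissibleM hw A3 aX hX.
(* The pair for the next interval. Its sine part is obtained from [turned], which produces cosine
   parts, by feeding it (- G2, G1) and changing the sign. *)
pose G1n o := turned a s p.1 lam G1 G2 o * damping w s p.1 kap o * radial o p.1 ^+ p.2.2.
pose G2n o := -1 * (turned a s p.1 lam (fun o => - G2 o) G1 o * damping w s p.1 kap o * radial o p.1 ^+ p.2.2).
pose Hn o := turned a s p.1 0 H (fun=> 0) o * damping w s p.1 C o * radial o p.1 ^+ p.2.2.
have HnE o : Hn o = H o * damping w s p.1 C o * radial o p.1 ^+ p.2.2.
  by rewrite /Hn /turned /turn !dot0l subrr cos0 mulr1 mul0r subr0.
have dX o kap' : 0 <= kap' -> 0 <= damping w s p.1 kap' o * radial o p.1 ^+ p.2.2 <= 1.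
  move=> k0; have /andP[d0 d1] := damping01 hw st k0 o; have /andP[x0 x1] := radial01 o p.1.
  by rewrite mulr_ge0 ?exprn_ge0// mulr_ile1 ?exprn_ge0 ?exprn_ile1.
have IHn := IH p.1 G1n G2n Hn t0 pl (fun k => hC k.+1) A1 A2 A3 _ _ _ m m0m.
have pl' p' : p' \in l -> p.1 <= p'.1.
  move: pl; rewrite (path_sortedE le_trans) => /andP[/allP h _] p'l.
  by apply: h; apply/mapP; exists p'.
set tl := last _ _ in IHn *.
transitivity (mean P (fun o => (G1n o * cos (tested (a^~ o) p.1 l) - G2n o * sin (tested (a^~ o) p.1 l)) *
     expR (2^-1 * variance_along (clock o) p.1 l - C * (clock o tl - clock o p.1)) *
     monomial (radial o) l * radial o tl ^+ m)).
  congr (mean P _); apply/funext => o.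
  rewrite tested_cons variance_along_cons// -/lam /monomial big_cons -/(monomial (radial o) l).
  rewrite -[_ - dot lam (a s o)]/(turn a s p.1 lam o) cosD sinD.
  have -> : 2^-1 * (sqnorm lam * (clock o p.1 - clock o s) + variance_along (clock o) p.1 l) - C * (clock o tl - clock o s) =
    - (kap * (clock o p.1 - clock o s)) + (2^-1 * variance_along (clock o) p.1 l - C * (clock o tl - clock o p.1)).
    by rewrite /kap; ring.
  rewrite expRD /G1n /G2n /turned /damping.
  move: (expR _) (expR _) (cos _) (sin _) (cos _) (sin _) (monomial _ _) => *; ring.
rewrite IHn.
- congr (mean P _); apply/funext => o; rewrite HnE /monomial big_cons -/(monomial (radial o) l).
  have -> : - (C * (clock o tl - clock o s)) = - (C * (clock o p.1 - clock o s)) + - (C * (clock o tl - clock o p.1)) by ring.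
  rewrite expRD /damping; move: (expR _) (expR _) (monomial _ _) => *; ring.
- move=> o; have := dX o kap kap0; rewrite /G1n /G2n /turned.
  set y := damping _ _ _ _ _ * _ => /andP[y0 y1].
  have -> : ((G1 o * cos (turn a s p.1 lam o) - G2 o * sin (turn a s p.1 lam o)) * damping w s p.1 kap o * radial o p.1 ^+ p.2.2) ^+ 2 +
    (-1 * ((- G2 o * cos (turn a s p.1 lam o) - G1 o * sin (turn a s p.1 lam o)) * damping w s p.1 kap o * radial o p.1 ^+ p.2.2)) ^+ 2 =
    (G1 o ^+ 2 + G2 o ^+ 2) * (cos (turn a s p.1 lam o) ^+ 2 + sin (turn a s p.1 lam o) ^+ 2) * y ^+ 2.
    by rewrite /y; move: (damping _ _ _ _ _) => *; ring.
  rewrite cos2Dsin2 mulr1 mulr_ile1 ?addr_ge0 ?sqr_ge0//.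
  by rewrite exprn_ile1.
- move=> o; rewrite HnE -mulrA normrM mulr_ile1//.
  by have /andP[y0 y1] := dX o C C0; rewrite ger0_norm.
(* The power of phi attached to the mark only raises the order, so the moments called for are still
   of order at least m0. *)
move=> m' m0m'; have := blk _ (leq_trans m0m' (leq_addr p.2.2 m')).
rewrite /limit_moment => e; apply: etrans (etrans e _); congr (mean P _); apply/funext => o.
  by rewrite /G1n -/(radial o p.1) exprD; ring.
by rewrite /Hn -/(radial o p.1) exprD; ring.
Qed.

Lemma suffix_weight_le l k : 3 * total_weight l ^+ 2 <= 2 * C -> 2^-1 * sqnorm (weight (drop k l)) <= C.
Proof.
move=> h; have h1 : total_weight (drop k l) <= total_weight l.
  rewrite -{2}(cat_take_drop k l) /total_weight big_cat/= lerDr.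
  exact: total_weight_ge0.
have := sqnorm_weight_le (drop k l).
have : total_weight (drop k l) ^+ 2 <= total_weight l ^+ 2.
  by rewrite lerXn2r// nnegrE total_weight_ge0.
lra.
Qed.

(** The marks are sorted and a mark at time t with zero covector and exponent 0 is appended, which
    prolongs the last interval to t without changing the tested quantities. *)
Theorem chain l t (p0 : R) : 0 <= t -> (forall p, p \in l -> 0 <= p.1 <= t) ->
  3 * total_weight l ^+ 2 <= 2 * C ->
  mean P (fun o => cos (p0 + tested (a ^~ o) 0 l) * expR (2^-1 * variance_along (clock o) 0 l - C * clock o t)
     * monomial (radial o) l * radial o t ^+ m0) =
  cos p0 * mean P (fun o => expR (- (C * clock o t)) * monomial (radial o) l * radial o t ^+ m0).
Proof.
move=> t0 lt hC.
pose pt : mark R := (t, (0, 0%N)).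
pose k := rcons (sort (@mark_le R) l) pt.
have kl : perm_eq k (pt :: l).
  by rewrite /k perm_rcons perm_cons; exact/permPl/perm_sort.
have testE al : tested al 0 k = tested al 0 l.
  by rewrite /tested (perm_big _ kl)/= big_cons !dot0l subrr add0r.
have varE I : variance_along I 0 k = variance_along I 0 l.
  rewrite (variance_along_perm I 0 kl) /variance_along big_cons big1 ?add0r => [|p' _].
    by apply: eq_bigr => p _; rewrite big_cons dotC dot0l mul0r add0r.
  by rewrite dot0l mul0r.
have monE X : monomial X k = monomial X l.
  by rewrite /monomial (perm_big _ kl)/= big_cons expr0 mul1r.
have totE : total_weight k = total_weight l.
  rewrite /total_weight (perm_big _ kl)/= big_cons big1 ?add0r// => i _.
  by rewrite mxE normr0.
have lastk : last 0 [seq p.1 | p <- k] = t by rewrite /k map_rcons last_rcons.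
have sk : path.path <=%R 0 [seq p.1 | p <- k].
  have ls p : p \in sort (@mark_le R) l -> 0 <= p.1 <= t by rewrite mem_sort; exact: lt.
  have hall : all (>= 0) [seq p.1 | p <- sort (@mark_le R) l].
    by apply/allP => _ /mapP[p /ls/andP[h _] ->].
  rewrite /k map_rcons rcons_path (path_sortedE le_trans) hall sorted_map.
  rewrite (sort_sorted (@mark_le_total R)) /=.
  have := mem_last 0 [seq p.1 | p <- sort (@mark_le R) l].
  by rewrite inE => /orP[/eqP -> //|/mapP[p /ls/andP[_ h] ->]].
have bc (c : R) : admissible P w 0 (fun=> c) by exact: admissible_cst.
have hk j : 2^-1 * sqnorm (weight (drop j k)) <= C by apply: suffix_weight_le; rewrite totE.
have c0 o : clock o 0 = 0 by rewrite /clock primitive0.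
have cs0 (o : T) : cos p0 ^+ 2 + sin p0 ^+ 2 <= 1 by rewrite cos2Dsin2.
have h := chain_sorted (lexx 0) sk hk (bc (cos p0)) (bc (sin p0)) (bc (cos p0)) cs0
  (fun=> cos_max p0) (fun m _ => erefl) (leqnn m0).
rewrite -meanZ; last first.
  apply: bounded_measurableM; last exact: bounded_measurable_radialX.
  apply: bounded_measurableM; last exact: bounded_measurable_monomial.
  have C0 : 0 <= C by rewrite /C mulr_ge0// ?addr_ge0// mulr_ge0.
  have t00 : (0 : R) <= 0 <= t by apply/andP; split.
  have := bounded_measurable_damping hw t00 C0; congr bounded_measurable.
  by apply/funext => o; rewrite /damping c0 subr0.
apply: etrans (etrans h _).
  by congr (mean P _); apply/funext => o; rewrite /= lastk testE varE monE c0 subr0 -cosD.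
by congr (mean P _); apply/funext => o; rewrite /= lastk monE c0 subr0 !mulrA.
Qed.

End Triangular.
End Chain.

(** * The clock as a functional of the radial part *)

Section Rates.
Variable R : realType.
Implicit Types (x : R -> R) (z s t : R) (k : nat).
Local Notation mu := lebesgue_measure.

(* At [z = 0] the junk value of the inverse makes the rate vanish, like that of the
   tangent at the zeros of the cosine. *)
Definition rate z : R := (1 - z) / z.

(** A bounded approximation of [rate], increasing with k and exact at z = 0, in which the only
    inverse is that of a positive shift of z^2. The index k + 2 makes the shift smaller than 1, as
    the geometric series of [closure_inv] requires. *)
Definition cut_rate k z : R := (1 - z) * z * (z ^+ 2 + k.+2%:R^-1)^-1.

Lemma cut_rate_bounds k z : 0 <= z <= 1 -> 0 <= cut_rate k z <= k.+2%:R.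
Proof.
move=> /andP[z0 z1]; have e0 : 0 < k.+2%:R^-1 :> R by rewrite invr_gt0.
have den : 0 < z ^+ 2 + k.+2%:R^-1 by rewrite ltr_wpDl// sqr_ge0.
rewrite /cut_rate !mulr_ge0 ?subr_ge0 ?invr_ge0 ?(ltW den)//=.
rewrite ler_pdivrMr// mulrDr divff// ler_wpDl ?mulr_ge0 ?sqr_ge0//.
by rewrite mulr_ile1 ?subr_ge0// gerBl.
Qed.

Lemma rate_ge0 z : 0 <= z <= 1 -> 0 <= rate z.
Proof. by move=> /andP[z0 z1]; rewrite /rate divr_ge0// subr_ge0. Qed.

Lemma cut_rate_mono z k k' : 0 <= z <= 1 -> (k <= k')%N -> cut_rate k z <= cut_rate k' z.
Proof.
move=> /andP[z0 z1] kk'; rewrite /cut_rate ler_wpM2l ?mulr_ge0 ?subr_ge0//.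
have e0 j : 0 < z ^+ 2 + j.+2%:R^-1 :> R by rewrite ltr_wpDl ?sqr_ge0// invr_gt0.
by rewrite lef_pV2 ?posrE// lerD2l lef_pV2 ?posrE// ler_nat.
Qed.

Lemma cut_rate_le z k : 0 <= z <= 1 -> cut_rate k z <= rate z.
Proof.
move=> /andP[]; rewrite le_eqVlt => /orP[/eqP <-|z0] z1.
  by rewrite /cut_rate mulr0 mul0r /rate invr0 mulr0.
rewrite /cut_rate /rate -mulrA ler_wpM2l ?subr_ge0// ler_pdivrMr; last first.
  by rewrite ltr_wpDl ?sqr_ge0// invr_gt0.
by rewrite mulrDr expr2 mulrA mulVf ?mul1r ?gt_eqF// lerDl mulr_ge0 ?invr_ge0 ?ltW.
Qed.

Lemma cut_rate_cvg z : 0 <= z <= 1 -> cut_rate k z @[k --> \oo] --> rate z.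
Proof.
move=> /andP[]; rewrite le_eqVlt => /orP[/eqP <-|z0] z1.
  rewrite /rate invr0 mulr0; under eq_fun do rewrite /cut_rate mulr0 mul0r.
  exact: cvg_cst.
have -> : rate z = (1 - z) * z * (z ^+ 2 + 0)^-1.
  by rewrite /rate addr0; field; rewrite gt_eqF.
apply: cvgM; first exact: cvg_cst.
apply: cvgV; first by rewrite addr0 expf_neq0// gt_eqF.
apply: cvgD; first exact: cvg_cst.
have := @cvg_harmonic R; rewrite -(cvg_shiftS (harmonic : R^nat)).
exact.
Qed.

Lemma cut_rate_continuous k x : continuous x -> continuous (fun s => cut_rate k (x s)).
Proof.
move=> cx s; have cc (c : R) : (fun=> c) r @[r --> s] --> c by exact: cvg_cst.
apply: cvgM.
  by apply: cvgM; [apply: cvgB; [exact: cc | exact: cx] | exact: cx].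
apply: cvgV; first by rewrite gt_eqF// ltr_wpDl ?sqr_ge0// invr_gt0.
by apply: cvgD; [under eq_fun do rewrite expr2; rewrite expr2; apply: cvgM; exact: cx | exact: cc].
Qed.

Definition cut_clock k x t : R := primitive (fun s => cut_rate k (x s)) t.
(** For an abstract process with the law of the radius the clock might be infinite; its finiteness
    is transferred from the other space in [finite_clock_ae]. *)
Definition extended_clock x t : \bar R := (\int[mu]_(s in `[0%R, t]) (rate (x s))%:E)%E.

Lemma primitive_lt0 (h : R -> R) t : t < 0 -> primitive h t = 0.
Proof.
by move=> t0; rewrite /primitive set_itv_ge ?Rintegral_set0// bnd_simp -ltNge.
Qed.

Lemma primitive_homo (h : R -> R) : continuous h -> (forall r, 0 <= h r) ->
  {homo primitive h : s t / s <= t}.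
Proof.
move=> ch h0 s t st; have [t0|t0] := ltP t 0.
  by rewrite !primitive_lt0//; exact: le_lt_trans st t0.
have [s0|s0] := ltP s 0; last by apply: primitive_mono => //; rewrite s0.
by rewrite [leLHS]primitive_lt0// -(primitive0 h); apply: primitive_mono => //; rewrite lexx.
Qed.

Variable x : R -> R.
Hypotheses (cx : continuous x) (x01 : forall s, 0 <= x s <= 1).

Lemma cut_clock_homo k : {homo cut_clock k x : s t / s <= t}.
Proof.
apply: primitive_homo; first exact: cut_rate_continuous.
by move=> r; have /andP[] := cut_rate_bounds k (x01 r).
Qed.

Lemma cut_clock_ge0 k t : 0 <= cut_clock k x t.
Proof.
by apply: Rintegral_ge0 => r _; have /andP[] := cut_rate_bounds k (x01 r).
Qed.

Lemma cut_clock0 k : cut_clock k x 0 = 0.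
Proof. exact: primitive0. Qed.

Lemma cut_clock_le k t : 0 <= t -> cut_clock k x t <= k.+2%:R * t.
Proof.
move=> t0; have t00 : (0 : R) <= 0 <= t by rewrite t0 andbT.
have h : forall r, `|cut_rate k (x r)| <= k.+2%:R.
  by move=> r; have /andP[h0 h1] := cut_rate_bounds k (x01 r); rewrite ger0_norm.
have := @norm_primitiveB R (fun r => cut_rate k (x r)) 0 t k.+2%:R (cut_rate_continuous cx) t00 (fun r _ => h r).
by rewrite primitive0 !subr0; apply: le_trans; exact: ler_norm.
Qed.

Lemma cut_clock_cvg t : (cut_clock k x t)%:E @[k --> \oo] --> extended_clock x t.
Proof.
have mk k : measurable_fun (`[0, t] : set R) (fun s => (cut_rate k (x s))%:E).
  apply/measurable_EFinP; apply: measurable_funTS.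
  by apply: continuous_measurable_fun; exact: cut_rate_continuous.
have e k : (cut_clock k x t)%:E = (\int[mu]_(s in `[0%R, t]) (cut_rate k (x s))%:E)%E.
  rewrite /cut_clock /primitive /Rintegral fineK//.
  apply: integrable_fin_num => //; apply: continuous_integrable.
  exact: cut_rate_continuous.
under eq_fun do rewrite e.
have -> : extended_clock x t = (\int[mu]_(s in `[0%R, t]) limn (fun k => (cut_rate k (x s))%:E))%E.
  apply: eq_integral => s _; apply/esym/cvg_lim => //.
  by apply: cvg_EFin; [exact: nearW | exact: cut_rate_cvg].
apply: cvg_monotone_convergence => //.
- by move=> k s _; rewrite lee_fin; have /andP[] := cut_rate_bounds k (x01 s).
- by move=> s _ k k' kk'; rewrite lee_fin cut_rate_mono.
Qed.

Lemma extended_clock_ge0 t : (0 <= extended_clock x t)%E.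
Proof. by apply: integral_ge0 => s _; rewrite lee_fin rate_ge0. Qed.

End Rates.

(** * Radial functionals as limits of polynomials in values of the radial part *)

Section MonomialClosure.
Variable R : realType.
Context d (T : measurableType d) d' (T' : measurableType d').
Variables (P : probability T R) (P' : probability T' R).
Variables (X : T -> R -> R) (X' : T' -> R -> R).
Hypotheses (cX : forall o, continuous (X o)) (cX' : forall o, continuous (X' o)).
Hypotheses (X01 : forall o s, 0 <= X o s <= 1) (X'01 : forall o s, 0 <= X' o s <= 1).
Hypotheses (mX : forall s, measurable_fun setT (X ^~ s)) (mX' : forall s, measurable_fun setT (X' ^~ s)).
Variable t : R.
Hypothesis t0 : 0 <= t.
Implicit Types (l : seq (mark R)).

Definition before l := forall p, p \in l -> 0 <= p.1 <= t.

Definition monomial_pair (f : T -> R) (f' : T' -> R) := exists2 l, before l &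
  f = (fun o => monomial (X o) l) /\ f' = (fun o => monomial (X' o) l).

Local Notation cl := (closure P P' monomial_pair).

Lemma bounded_measurable_mono e (S : measurableType e) (Y : S -> R -> R) l :
  (forall o s, 0 <= Y o s <= 1) -> (forall s, measurable_fun setT (Y ^~ s)) ->
  bounded_measurable (fun o => monomial (Y o) l).
Proof.
move=> Y01 mY; apply: bounded_measurable_prod => p _; apply: bounded_measurableX.
by split=> //; exists 1 => o; have /andP[h0 h1] := Y01 o p.1; rewrite ger0_norm.
Qed.

Lemma closure_monomial l : before l -> cl (fun o => monomial (X o) l) (fun o => monomial (X' o) l).
Proof.
move=> lt; apply: closure_base; last by exists l.
- exact: bounded_measurable_mono.
- exact: bounded_measurable_mono.
Qed.

Lemma monomial_cat (Y : R -> R) l l' : monomial Y (l ++ l') = monomial Y l * monomial Y l'.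
Proof. by rewrite /monomial big_cat. Qed.

Lemma monomial_pairM f f' g g' : monomial_pair f f' -> monomial_pair g g' ->
  cl (fun o => f o * g o) (fun o => f' o * g' o).
Proof.
move=> [l lt [-> ->]] [l' l't [-> ->]].
have := @closure_monomial (l ++ l') _; under eq_fun do rewrite monomial_cat.
under [X in (_ -> closure _ _ _ _ X) -> _]eq_fun do rewrite monomial_cat.
by apply=> p; rewrite mem_cat => /orP[/lt|/l't].
Qed.

Lemma closure1 : cl (fun=> 1) (fun=> 1).
Proof.
have := @closure_monomial [::] _; rewrite /monomial.
under eq_fun do rewrite big_nil; under [X in (_ -> closure _ _ _ _ X) -> _]eq_fun do rewrite big_nil.
exact.
Qed.

Let clM := closureM monomial_pairM.
Let clC := closure_cst closure1.

Lemma closure_process s : 0 <= s <= t -> cl (X ^~ s) (X' ^~ s).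
Proof.
move=> st; have := @closure_monomial [:: (s, (0, 1%N))] _; rewrite /monomial.
under eq_fun do rewrite big_seq1/=; under [X in (_ -> closure _ _ _ _ X) -> _]eq_fun do rewrite big_seq1/=.
by apply=> p; rewrite inE => /eqP ->.
Qed.

Lemma closure_sum_in (I : eqType) (r : seq I) (F : I -> T -> R) (F' : I -> T' -> R) :
  (forall i, i \in r -> cl (F i) (F' i)) ->
  cl (fun o => \sum_(i <- r) F i o) (fun o => \sum_(i <- r) F' i o).
Proof.
elim: r => [|i r IH] h.
  under eq_fun do rewrite big_nil; under [X in closure _ _ _ _ X]eq_fun do rewrite big_nil; exact: clC.
under eq_fun do rewrite big_cons; under [X in closure _ _ _ _ X]eq_fun do rewrite big_cons.
by apply: closureD; [apply: h; rewrite mem_head | apply: IH => j jr; apply: h; rewrite inE jr orbT].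
Qed.

Lemma closure_cut_rate k s : 0 <= s <= t ->
  cl (fun o => cut_rate k (X o s)) (fun o => cut_rate k (X' o s)).
Proof.
move=> st; have hx := closure_process st.
have sq01 (z : R) : 0 <= z <= 1 -> 0 <= z ^+ 2 <= 1.
  by move=> /andP[z0 z1]; rewrite sqr_ge0 exprn_ile1.
apply: clM; first by apply: clM => //; apply: closureB => //; exact: clC.
apply: (closure_inv monomial_pairM closure1).
- by rewrite invr_gt0 ltr0n/= invf_lt1// ltr1n.
- exact: (closureX monomial_pairM closure1).
- by move=> o; apply: sq01.
- by move=> o; apply: sq01.
Qed.

(** Riemann sums at uniform nodes are linear combinations of cut rates at single times, bounded by
    s(k + 2) uniformly in the number of nodes. *)
Lemma closure_cut_clock k s : 0 <= s <= t ->
  cl (fun o => cut_clock k (X o) s) (fun o => cut_clock k (X' o) s).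
Proof.
move=> /andP[s0 st]; have s00 : (0 : R) <= 0 <= s by rewrite s0 andbT.
have hN N : cl (fun o => (s - 0) / N%:R * \sum_(i < N) cut_rate k (X o (node 0 s N i)))
               (fun o => (s - 0) / N%:R * \sum_(i < N) cut_rate k (X' o (node 0 s N i))).
  apply: clM; first exact: clC.
  apply: closure_sum_in => i _; apply: closure_cut_rate.
  by rewrite node_ge//= (le_trans _ st)// node_le// ltnW.
have hb (Y : R -> R) N : (forall r, 0 <= Y r <= 1) ->
    `|(s - 0) / N%:R * \sum_(i < N) cut_rate k (Y (node 0 s N i))| <= s * k.+2%:R.
  move=> Y01; have hr r := cut_rate_bounds k (Y01 r).
  have q0 : 0 <= s / N%:R by rewrite divr_ge0.
  rewrite subr0 ger0_norm; last first.
    by rewrite mulr_ge0//; apply: sumr_ge0 => i _; have /andP[] := hr (node 0 s N i).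
  case: N q0 => [|N] q0; first by rewrite invr0 mulr0 mul0r mulr_ge0.
  apply: le_trans (_ : s / N.+1%:R * \sum_(i < N.+1) k.+2%:R <= _).
    by rewrite ler_wpM2l//; apply: ler_sum => i _; have /andP[] := hr (node 0 s N.+1 i).
  by rewrite sumr_const card_ord -[k.+2%:R *+ N.+1]mulr_natl mulrA divfK// pnatr_eq0.
have hm e (S : measurableType e) (Y : S -> R -> R) : (forall o, continuous (Y o)) ->
    (forall o s, 0 <= Y o s <= 1) -> (forall N, bounded_measurable (fun o => (s - 0) / N%:R * \sum_(i < N) cut_rate k (Y o (node 0 s N i)))) ->
    bounded_measurable (fun o => cut_clock k (Y o) s) /\
    forall o, (s - 0) / N%:R * \sum_(i < N) cut_rate k (Y o (node 0 s N i)) @[N --> \oo] --> cut_clock k (Y o) s.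
  move=> cY Y01 bY.
  have cv o : (s - 0) / N%:R * \sum_(i < N) cut_rate k (Y o (node 0 s N i)) @[N --> \oo] --> cut_clock k (Y o) s.
    have := riemann_sum_cvg (cut_rate_continuous (k := k) (cY o)) s00.
    by rewrite primitive0 [X in (_ --> X) -> _]subr0.
  split=> //; split.
    by apply: (@measurable_fun_cvg _ _ _ _ (fun N o => (s - 0) / N%:R * \sum_(i < N) cut_rate k (Y o (node 0 s N i)))) => // N; case: (bY N).
  by exists (k.+2%:R * s) => o; rewrite ger0_norm ?cut_clock_ge0// cut_clock_le.
have [b1 c1] := hm _ _ X cX X01 (fun N => (closure_bounded (hN N)).1).
have [b2 c2] := hm _ _ X' cX' X'01 (fun N => (closure_bounded (hN N)).2).
apply: (closure_lim hN (M := s * k.+2%:R)) => //.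
- by move=> N o; apply: hb.
- by move=> N o; apply: hb.
- exact: aeW.
- exact: aeW.
Qed.

Lemma closure_variance k l : before l ->
  cl (fun o => variance_along (cut_clock k (X o)) 0 l)
     (fun o => variance_along (cut_clock k (X' o)) 0 l).
Proof.
move=> lt; have t00 : (0 : R) <= 0 <= t by rewrite t0 andbT.
apply: closure_sum_in => p /lt/andP[p0 pt]; apply: closure_sum_in => p' /lt/andP[p'0 p't].
apply: clM; first exact: clC.
apply: closureB; apply: closure_cut_clock => //.
by rewrite le_min p0 p'0/= ge_min pt.
Qed.

End MonomialClosure.

Section ClockLaw.
Variable R : realType.
Implicit Types (s t : R) (l : seq (mark R)).

Lemma variance_along_cvg (I_ : nat -> R -> R) (I : R -> R) t l : 0 <= t ->
  (forall r, 0 <= r <= t -> I_ k r @[k --> \oo] --> I r) -> before t l ->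
  variance_along (I_ k) 0 l @[k --> \oo] --> variance_along I 0 l.
Proof.
move=> t0 cI lt; rewrite /variance_along.
have cs (J : eqType) (F_ : J -> nat -> R) (F : J -> R) (q : seq J) :
    (forall j, j \in q -> F_ j k @[k --> \oo] --> F j) ->
    \sum_(j <- q) F_ j k @[k --> \oo] --> \sum_(j <- q) F j.
  elim: q => [|j q IH] hF; first by rewrite big_nil; under eq_fun do rewrite big_nil; exact: cvg_cst.
  rewrite big_cons; under eq_fun do rewrite big_cons; apply: cvgD; first by apply: hF; rewrite mem_head.
  by apply: IH => i iq; apply: hF; rewrite inE iq orbT.
apply: (cs) => p /lt/andP[p0 pt]; apply: (cs) => p' /lt/andP[p'0 p't].
apply: cvgM; first exact: cvg_cst.
by apply: cvgB; apply: cI; rewrite ?lexx//= le_min p0 p'0/= ge_min pt.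
Qed.

Lemma lim_unique (u : nat -> R) (y z : R) : u k @[k --> \oo] --> y -> u k @[k --> \oo] --> z -> y = z.
Proof. by move=> h1 h2; apply: (cvg_unique _ h1 h2); exact: norm_hausdorff. Qed.

Definition finite_clock (x : R -> R) s : R := fine (extended_clock x s).

Lemma le_extended_clock (x : R -> R) s t : continuous x -> (forall r, 0 <= x r <= 1) ->
  s <= t -> (extended_clock x s <= extended_clock x t)%E.
Proof.
move=> cx x01 st; apply: ge0_subset_integral => //.
- apply/measurable_EFinP; apply: measurable_funTS.
  apply: (@measurable_fun_cvg _ _ _ _ (fun k r => cut_rate k (x r))).
    by move=> k; apply: continuous_measurable_fun; exact: cut_rate_continuous.
  by move=> r _; exact: cut_rate_cvg.
- by move=> r _; rewrite lee_fin rate_ge0.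
- by move=> r /=; rewrite !in_itv/= => /andP[-> /le_trans]; exact.
Qed.

Lemma cut_clock_cvg_fin (x : R -> R) s t : continuous x -> (forall r, 0 <= x r <= 1) ->
  s <= t -> (extended_clock x t < +oo)%E ->
  cut_clock k x s @[k --> \oo] --> finite_clock x s.
Proof.
move=> cx x01 st fin.
have hf : extended_clock x s \is a fin_num.
  rewrite ge0_fin_numE ?extended_clock_ge0//.
  exact: le_lt_trans (le_extended_clock cx x01 st) fin.
have := @cut_clock_cvg _ x cx x01 s; rewrite -(fineK hf) => /fine_cvg.
exact.
Qed.

Context d (T : measurableType d) d' (T' : measurableType d').
Variables (P : probability T R) (P' : probability T' R).
Variables (X : T -> R -> R) (X' : T' -> R -> R).
Hypotheses (cX : forall o, continuous (X o)) (cX' : forall o, continuous (X' o)).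
Hypotheses (X01 : forall o s, 0 <= X o s <= 1) (X'01 : forall o s, 0 <= X' o s <= 1).
Hypotheses (mX : forall s, measurable_fun setT (X ^~ s)) (mX' : forall s, measurable_fun setT (X' ^~ s)).
Variable t : R.
Hypothesis t0 : 0 <= t.
Hypothesis law : forall l, before t l ->
  mean P (fun o => monomial (X o) l) = mean P' (fun o => monomial (X' o) l).

Local Notation cl := (closure P P' (monomial_pair X X' t)).
Let clM := closureM (monomial_pairM P P' X01 X'01 mX mX' (t := t)).
Let clC := closure_cst (closure1 P P' X01 X'01 mX mX' t).

Lemma law_closure f f' : cl f f' -> mean P f = mean P' f'.
Proof.
by apply: closure_mean_eq => g g' [l lt [-> ->]]; exact: law.
Qed.

Let survival (x : R -> R) j : R :=
  if (extended_clock x t < +oo)%E then expR (- (j.+1%:R^-1 * finite_clock x t)) else 0.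

Let survival_cvg (x : R -> R) j : continuous x -> (forall r, 0 <= x r <= 1) ->
  expR (- (j.+1%:R^-1 * cut_clock k x t)) @[k --> \oo] --> survival x j.
Proof.
move=> cx x01; rewrite /survival; case: ifPn => [fin|].
  apply: (cvg_comp (fun k => - (j.+1%:R^-1 * cut_clock k x t)) expR); last exact: continuous_expR.
  apply: cvgN; apply: cvgM; first exact: cvg_cst.
  exact: cut_clock_cvg_fin (lexx t) fin.
rewrite ltey negbK => /eqP inf; have := @cut_clock_cvg _ x cx x01 t; rewrite inf => /cvgeryP h.
apply: (cvg_comp (fun k => j.+1%:R^-1 * cut_clock k x t) (fun z => expR (- z))); last exact: cvgr_expR.
move/cvgryPge: h => h; apply/cvgryPge => A; apply: filterS (h (j.+1%:R * A)) => k hk.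
by rewrite mulrC ler_pdivlMr// mulrC.
Qed.

Let survival01 (x : R -> R) j : (forall r, 0 <= x r <= 1) -> 0 <= survival x j <= 1.
Proof.
move=> x01; rewrite /survival; case: ifP => _; last by rewrite lexx ler01.
rewrite expR_ge0 expR_le1 oppr_le0 mulr_ge0// fine_ge0//.
exact: extended_clock_ge0.
Qed.

Let survival_lim (x : R -> R) : (forall r, 0 <= x r <= 1) ->
  survival x j @[j --> \oo] --> ((extended_clock x t < +oo)%E%:R : R).
Proof.
move=> x01; rewrite /survival; case: (extended_clock x t < +oo)%E; last exact: cvg_cst.
have -> : (true%:R : R) = expR 0 by rewrite expR0.
apply: (cvg_comp (fun j => - (j.+1%:R^-1 * finite_clock x t)) expR); last exact: continuous_expR.
rewrite -oppr0 -[X in - X](mul0r (finite_clock x t)); apply: cvgN; apply: cvgM; last exact: cvg_cst.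
exact: cvg_harmonic.
Qed.

Hypothesis finX : forall o, (extended_clock (X o) t < +oo)%E.

(** Finiteness is read off a Laplace transform: exp(- clock / (j + 1)), with value 0 for an infinite
    clock, tends to the indicator of finiteness as j grows. Its mean is determined by the monomials,
    hence equals that on the first space, where the limit is 1. *)
Lemma finite_clock_ae : {ae P', forall o, (extended_clock (X' o) t < +oo)%E}.
Proof.
have hj j k : cl (fun o => expR (- (j.+1%:R^-1 * cut_clock k (X o) t))) (fun o => expR (- (j.+1%:R^-1 * cut_clock k (X' o) t))).
  apply: (closure_expR (monomial_pairM P P' X01 X'01 mX mX' (t := t)) (closure1 P P' X01 X'01 mX mX' t)).
  have := clM (clC (- j.+1%:R^-1)) (closure_cut_clock P P' cX cX' X01 X'01 mX mX' k (introT andP (conj t0 (lexx t)))).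
  by under eq_fun do rewrite mulNr; under [X in closure _ _ _ _ X -> _]eq_fun do rewrite mulNr.
have mS e (S : measurableType e) (Y : S -> R -> R) j : (forall o, continuous (Y o)) ->
    (forall o s, 0 <= Y o s <= 1) -> (forall k, measurable_fun setT (fun o => expR (- (j.+1%:R^-1 * cut_clock k (Y o) t)))) ->
    measurable_fun setT (fun o => survival (Y o) j).
  move=> cY Y01 mk; apply: (@measurable_fun_cvg _ _ _ _ (fun k o => expR (- (j.+1%:R^-1 * cut_clock k (Y o) t)))) => //.
  by move=> o _; exact: survival_cvg.
have b1 (x : R -> R) j k : (forall r, 0 <= x r <= 1) -> `|expR (- (j.+1%:R^-1 * cut_clock k x t))| <= 1.
  move=> x01; rewrite ger0_norm ?expR_ge0// expR_le1 oppr_le0 mulr_ge0//.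
  exact: cut_clock_ge0.
have s1 (x : R -> R) j : (forall r, 0 <= x r <= 1) -> `|survival x j| <= 1.
  by move=> x01; have /andP[h0 h1] := survival01 j x01; rewrite ger0_norm.
have m1 j : measurable_fun setT (fun o => survival (X o) j).
  by apply: mS => // k; case: (closure_bounded (hj j k)).1.
have m2 j : measurable_fun setT (fun o => survival (X' o) j).
  by apply: mS => // k; case: (closure_bounded (hj j k)).2.
have e1 j : mean P (fun o => survival (X o) j) = mean P' (fun o => survival (X' o) j).
  apply: (@lim_unique (fun k => mean P (fun o => expR (- (j.+1%:R^-1 * cut_clock k (X o) t))))).
  - apply: (@cvg_mean _ _ _ P _ _ 1) => //.
    + by move=> k; case: (closure_bounded (hj j k)).1.
    + by move=> k o; exact: b1.
    + by apply: aeW => o; exact: survival_cvg.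
  - under eq_fun do rewrite (law_closure (hj j _)).
    apply: (@cvg_mean _ _ _ P' _ _ 1) => //.
    + by move=> k; case: (closure_bounded (hj j k)).2.
    + by move=> k o; exact: b1.
    + by apply: aeW => o; exact: survival_cvg.
pose F := [set o | (extended_clock (X' o) t < +oo)%E].
have mF : measurable_fun setT (fun o => (extended_clock (X' o) t < +oo)%E%:R : R).
  apply: (@measurable_fun_cvg _ _ _ _ (fun j o => survival (X' o) j)) => // o _.
  exact: survival_lim.
have F_measurable : measurable F.
  have -> : F = [set o | 1 <= (extended_clock (X' o) t < +oo)%E%:R :> R].
    by apply/seteqP; split => o; rewrite /F/=; case: (_ < _)%E; rewrite //= ler10.
  exact: measurable_ge.
have : mean P' (\1_F) = 1.
  apply: (@lim_unique (fun j => mean P (fun o => survival (X o) j))).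
  - under eq_fun do rewrite e1.
    apply: (@cvg_mean _ _ _ P' _ _ 1) => //.
    + by move=> j o; exact: s1.
    + apply: aeW => o; rewrite indicE.
      have -> : (o \in F) = (extended_clock (X' o) t < +oo)%E.
        by apply/idP/idP; rewrite inE.
      exact: survival_lim.
  - rewrite -(mean_cst P 1); apply: (@cvg_mean _ _ _ P _ _ 1) => //.
    + by move=> j o; exact: s1.
    + apply: aeW => o; have -> : (1 : R) = (extended_clock (X o) t < +oo)%E%:R by rewrite finX.
      exact: survival_lim.
rewrite mean_indic// => PF.
exists (~` F); split; [exact: measurableC| |by []].
rewrite probability_setC// -[P' F]fineK ?fin_num_measure// PF.
by rewrite subee.
Qed.

Let clE := closure_expR (monomial_pairM P P' X01 X'01 mX mX' (t := t)) (closure1 P P' X01 X'01 mX mX' t).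

Lemma measurable_finite_clock e (S : measurableType e) (Y : S -> R -> R) s :
  (forall o, continuous (Y o)) -> (forall o r, 0 <= Y o r <= 1) ->
  (forall k, measurable_fun setT (fun o => cut_clock k (Y o) s)) ->
  measurable_fun setT (fun o => finite_clock (Y o) s).
Proof.
move=> cY Y01 mk; apply: (measurableT_comp (fine_measurable measurableT)).
apply: (emeasurable_fun_cvg (fun k o => (cut_clock k (Y o) s)%:E)).
  by move=> k; apply/measurable_EFinP.
by move=> o _; exact: cut_clock_cvg.
Qed.

(** The cut clocks are radial functionals with equal means on both spaces. Their limit may be taken
    inside the expectations because variances along a clock are nonnegative, which bounds the
    exponentials by 1. *)
Lemma law_variance l : before t l ->
  mean P (fun o => expR (- (2^-1 * variance_along (finite_clock (X o)) 0 l)) * monomial (X o) l) =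
  mean P' (fun o => expR (- (2^-1 * variance_along (finite_clock (X' o)) 0 l)) * monomial (X' o) l).
Proof.
move=> lt; have t00 : (0 : R) <= 0 <= t by rewrite lexx.
have hk k : cl (fun o => expR (- (2^-1 * variance_along (cut_clock k (X o)) 0 l)) * monomial (X o) l)
  (fun o => expR (- (2^-1 * variance_along (cut_clock k (X' o)) 0 l)) * monomial (X' o) l).
  apply: clM; last exact: closure_monomial.
  apply: clE; have := clM (clC (- 2^-1)) (closure_variance P P' cX cX' X01 X'01 mX mX' t0 k lt).
  by under eq_fun do rewrite mulNr; under [X in closure _ _ _ _ X -> _]eq_fun do rewrite mulNr.
have mm e (S : measurableType e) (Y : S -> R -> R) : (forall o, continuous (Y o)) ->
    (forall o r, 0 <= Y o r <= 1) -> (forall r, measurable_fun setT (Y ^~ r)) ->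
    (forall k s, 0 <= s <= t -> measurable_fun setT (fun o => cut_clock k (Y o) s)) ->
    measurable_fun setT (fun o => expR (- (2^-1 * variance_along (finite_clock (Y o)) 0 l)) * monomial (Y o) l).
  move=> cY Y01 mY mk; apply: measurable_funM; last by case: (bounded_measurable_mono l Y01 mY).
  apply: measurableT_comp => //; apply: measurableT_comp => //; apply: measurable_funM => //.
  have mf s : 0 <= s <= t -> measurable_fun setT (fun o => finite_clock (Y o) s).
    by move=> st; apply: measurable_finite_clock => // k; exact: mk.
  have ms (J : eqType) (q : seq J) (F : J -> S -> R) : (forall j, j \in q -> measurable_fun setT (F j)) ->
      measurable_fun setT (fun o => \sum_(j <- q) F j o).
    elim: q => [|j q IH] hF; first by under eq_fun do rewrite big_nil; exact: measurable_cst.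
    under eq_fun do rewrite big_cons; apply: measurable_funD; first by apply: hF; rewrite mem_head.
    by apply: IH => i iq; apply: hF; rewrite inE iq orbT.
  apply: (ms) => p /lt/andP[p0 pt]; apply: (ms) => p' /lt/andP[p'0 p't].
  apply: measurable_funM => //; apply: measurable_funB; apply: mf => //.
  by rewrite le_min p0 p'0/= ge_min pt.
have bb (x : R -> R) k : continuous x -> (forall r, 0 <= x r <= 1) ->
    `|expR (- (2^-1 * variance_along (cut_clock k x) 0 l)) * monomial x l| <= 1.
  move=> cx x01; rewrite normrM mulr_ile1//.
    rewrite ger0_norm ?expR_ge0// expR_le1 oppr_le0 mulr_ge0//.
    apply: variance_along_ge0; first exact: cut_clock_homo.
    by move=> p /lt/andP[].
  have : 0 <= monomial x l <= 1.
    rewrite /monomial; elim: (l) => [|p q /andP[h0 h1]]; first by rewrite big_nil ler01 lexx.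
    have /andP[x0 x1] := x01 p.1.
    by rewrite big_cons mulr_ge0 ?exprn_ge0//= mulr_ile1 ?exprn_ge0 ?exprn_ile1.
  by move=> /andP[h0 h1]; rewrite ger0_norm.
have cc (x : R -> R) : continuous x -> (forall r, 0 <= x r <= 1) -> (extended_clock x t < +oo)%E ->
    expR (- (2^-1 * variance_along (cut_clock k x) 0 l)) * monomial x l @[k --> \oo] -->
    expR (- (2^-1 * variance_along (finite_clock x) 0 l)) * monomial x l.
  move=> cx x01 fin; apply: cvgM; last exact: cvg_cst.
  apply: (cvg_comp (fun k => - (2^-1 * variance_along (cut_clock k x) 0 l)) expR); last exact: continuous_expR.
  apply: cvgN; apply: cvgM; first exact: cvg_cst.
  apply: (variance_along_cvg t0) => // r /andP[_ rt].
  exact: cut_clock_cvg_fin rt fin.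
have mk1 k s : 0 <= s <= t -> measurable_fun setT (fun o => cut_clock k (X o) s).
  by move=> st; case: (closure_bounded (closure_cut_clock P P' cX cX' X01 X'01 mX mX' k st)) => -[].
have mk2 k s : 0 <= s <= t -> measurable_fun setT (fun o => cut_clock k (X' o) s).
  by move=> st; case: (closure_bounded (closure_cut_clock P P' cX cX' X01 X'01 mX mX' k st)) => _ [].
apply: (@lim_unique (fun k => mean P (fun o => expR (- (2^-1 * variance_along (cut_clock k (X o)) 0 l)) * monomial (X o) l))).
- apply: (@cvg_mean _ _ _ P _ _ 1).
  + by move=> k; case: (closure_bounded (hk k)).1.
  + exact: mm.
  + by move=> k o; exact: bb.
  + by apply: aeW => o; exact: cc.
- under eq_fun do rewrite (law_closure (hk _)).
  apply: (@cvg_mean _ _ _ P' _ _ 1).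
  + by move=> k; case: (closure_bounded (hk k)).2.
  + exact: mm.
  + by move=> k o; exact: bb.
  + by apply: filterS finite_clock_ae => o; exact: cc.
Qed.

End ClockLaw.

(** * Removing the killing and the power of phi *)

Section Undamping.
Variables (R : realType) (n : nat).
Notation V := 'M[R]_(n, 4).
Context d (T : measurableType d) (P : probability T R).
Variables (w : R -> T -> V) (a : R -> T -> 'rV[R]_3).
Hypothesis hw : hp_brownian_motion P w.
Hypothesis ha : stochastic_area P w a.
Implicit Types (r s : R) (o : T) (l : seq (mark R)).
Local Notation path := (path w).
Local Notation clock := (clock w).
Local Notation radial := (radial w).

Lemma radial_continuous o : continuous (radial o).
Proof. by apply: (along_continuous hw); apply: tame_continuous; exact: tame_phi. Qed.

Lemma measurable_radial r : measurable_fun setT (radial ^~ r).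
Proof. by apply: (measurable_path hw); apply: tame_continuous; exact: tame_phi. Qed.

Lemma rate_phi (x : V) : rate (phi x) = normsq x.
Proof.
have p0 := phi_gt0 x; rewrite /rate; apply: (mulIf (lt0r_neq0 p0)).
by rewrite divfK ?gt_eqF// normsq_phi.
Qed.

Lemma extended_clock_radial o s : extended_clock (radial o) s = (clock o s)%:E.
Proof.
rewrite /extended_clock; under eq_integral do rewrite rate_phi.
rewrite /clock /primitive /Rintegral fineK//.
apply: integrable_fin_num => //; apply: continuous_integrable.
by apply: (along_continuous hw); exact: normsq_continuous.
Qed.

Lemma finite_clock_radial o s : finite_clock (radial o) s = clock o s.
Proof. by rewrite /finite_clock extended_clock_radial. Qed.

Lemma radial_cut_clock_cvg o s : cut_clock k (radial o) s @[k --> \oo] --> clock o s.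
Proof.
rewrite -finite_clock_radial; apply: (cut_clock_cvg_fin (t := s)) => //.
- exact: radial_continuous.
- exact: radial01.
- by rewrite extended_clock_radial ltry.
Qed.

(** The gap between the clock and its cut version is itself the integral of a nonnegative rate, so
    every estimate for monotone clocks applies to it. *)
Lemma clock_sub_cut_homo o k :
  {homo (fun s => clock o s - cut_clock k (radial o) s) : s u / s <= u}.
Proof.
have cn : continuous (fun r => normsq (path o r)).
  by apply: (along_continuous hw); exact: normsq_continuous.
have cr := cut_rate_continuous (k := k) (@radial_continuous o).
have cd : continuous (fun r => normsq (path o r) - cut_rate k (radial o r)).
  by move=> r; apply: cvgB; [exact: cn | exact: cr].
have d0 r : 0 <= normsq (path o r) - cut_rate k (radial o r).
  by rewrite subr_ge0 -rate_phi; apply: cut_rate_le; exact: radial01.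
have e s : clock o s - cut_clock k (radial o) s = primitive (fun r => normsq (path o r) - cut_rate k (radial o r)) s.
  by rewrite /clock /cut_clock /primitive RintegralB//; exact: continuous_integrable.
by move=> s u su; rewrite !e; exact: primitive_homo.
Qed.

Lemma variance_alongB (I J : R -> R) s l :
  variance_along I s l - variance_along J s l = variance_along (fun r => I r - J r) s l.
Proof.
rewrite /variance_along -sumrB; apply: eq_bigr => p _; rewrite -sumrB; apply: eq_bigr => p' _.
by ring.
Qed.

(** Each covariance is at most the whole clock, so the variance is at most the squared total weight
    times the clock. This keeps the exponentials of half a variance minus C times a clock below
    1. *)
Lemma half_variance_le (I : R -> R) (C t : R) l : {homo I : s u / s <= u} -> 0 <= t -> before t l ->
  3 * total_weight l ^+ 2 <= 2 * C -> 2^-1 * variance_along I 0 l <= C * (I t - I 0).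
Proof.
move=> hI t0 lt hC; have It : 0 <= I t - I 0 by rewrite subr_ge0 hI.
have h : `|variance_along I 0 l| <= total_weight l ^+ 2 * (I t - I 0).
  apply: norm_variance_along_le => p p' /lt/andP[p0 pt] /lt/andP[p'0 p't].
  by rewrite subr_ge0 hI ?le_min ?p0//= lerD2r hI// ge_min pt.
have h2 := ler_norm (variance_along I 0 l).
have h3 : 3 * total_weight l ^+ 2 * (I t - I 0) <= 2 * C * (I t - I 0) by rewrite ler_wpM2r.
have h4 : 0 <= total_weight l ^+ 2 * (I t - I 0) by rewrite mulr_ge0// sqr_ge0.
lra.
Qed.

Variable t : R.
Hypothesis t0 : 0 <= t.

Let cR := radial_continuous.
Let R01 o r := radial01 w o r.
Let mR := measurable_radial.
Local Notation cl := (closure P P (monomial_pair radial radial t)).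

Lemma measurable_tested l : before t l -> measurable_fun setT (fun o => tested (a ^~ o) 0 l).
Proof.
rewrite /tested; elim: l => [|p l IH] lt; first by under eq_fun do rewrite big_nil; exact: measurable_cst.
under eq_fun do rewrite big_cons; apply: measurable_funD.
  have /andP[p0 _] : 0 <= p.1 <= t by apply: lt; rewrite mem_head.
  by apply: measurable_funB; exact: (measurable_dot_area ha).
by apply: IH => q ql; apply: lt; rewrite inE ql orbT.
Qed.

Lemma measurable_variance l : before t l ->
  measurable_fun setT (fun o => variance_along (clock o) 0 l).
Proof.
move=> lt; apply: (@measurable_fun_cvg _ _ _ _ (fun k o => variance_along (cut_clock k (radial o)) 0 l)).
  move=> k; have := closure_variance P P cR cR R01 R01 mR mR t0 k lt.
  by case/closure_bounded => -[].
move=> o _; apply: (variance_along_cvg t0) => // r _; exact: radial_cut_clock_cvg.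
Qed.

Lemma monomial01 (x : R -> R) l : (forall r, 0 <= x r <= 1) -> 0 <= monomial x l <= 1.
Proof.
move=> x01; rewrite /monomial; elim: l => [|p q /andP[h0 h1]]; first by rewrite big_nil ler01 lexx.
have /andP[x0 x1] := x01 p.1.
by rewrite big_cons mulr_ge0 ?exprn_ge0//= mulr_ile1 ?exprn_ge0 ?exprn_ile1.
Qed.

(** The weights W and W2 are those delivered by [chain]. The missing factor exp(C clock - V / 2)
    phi^(- m0) is unbounded, so it is approximated by bounded radial functionals F k, to which the
    identity extends by [closure_mean]. In the products with the weights only the gap between the
    clock and its cut version survives where the sign could be wrong, whence bounds by 1 uniform in
    k. *)
Theorem undamped l (p0 : R) : before t l ->
  mean P (fun o => cos (p0 + tested (a ^~ o) 0 l) * monomial (radial o) l) =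
  cos p0 * mean P (fun o => expR (- (2^-1 * variance_along (clock o) 0 l)) * monomial (radial o) l).
Proof.
move=> lt; pose m0 := (Num.bound (3 * total_weight l ^+ 2)).+1.
pose C : R := 2 * m0%:R * (m0%:R + 1).
have m0_gt0 : (0 < m0)%N by [].
have hC : 3 * total_weight l ^+ 2 <= 2 * C.
  have h : 3 * total_weight l ^+ 2 <= m0%:R.
    apply: le_trans (ltW (archi_boundP _)) _; first by rewrite mulr_ge0// sqr_ge0.
    by rewrite ler_nat.
  have m1 : 1 <= m0%:R :> R by rewrite ler1n.
  apply: le_trans h _; rewrite /C; nra.
have C0 : 0 <= C by rewrite /C !mulr_ge0// addr_ge0.
have clock0 o : clock o 0 = 0 by exact: primitive0.
have clockh o : {homo clock o : s u / s <= u}.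
  apply: primitive_homo => [|r]; last exact: normsq_ge0.
  by apply: (along_continuous hw); exact: normsq_continuous.
have mt := measurable_tested lt; have mv := measurable_variance lt.
have mc : measurable_fun setT (clock ^~ t) by exact: (measurable_clock hw t0).
pose W o := cos (p0 + tested (a ^~ o) 0 l) * expR (2^-1 * variance_along (clock o) 0 l - C * clock o t)
     * radial o t ^+ m0.
pose W2 o := cos p0 * (expR (- (C * clock o t)) * radial o t ^+ m0).
have bX : bounded_measurable (fun o => radial o t ^+ m0) by exact: (bounded_measurable_radialX hw).
have bcos : bounded_measurable (fun o => cos (p0 + tested (a ^~ o) 0 l)).
  split; last by exists 1 => o; exact: cos_max.
  apply: (measurableT_comp (continuous_measurable_fun (@continuous_cos R))).
  exact: measurable_funD.
have bW : bounded_measurable W.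
  apply: bounded_measurableM => //; apply: bounded_measurableM => //; split.
    by apply: measurableT_comp => //; apply: measurable_funB; exact: measurable_funM.
  exists 1 => o; rewrite ger0_norm ?expR_ge0// expR_le1 subr_le0.
  by have := half_variance_le (clockh o) t0 lt hC; rewrite clock0 subr0.
have bW2 : bounded_measurable W2.
  apply: bounded_measurableM; first exact: bounded_measurable_cst.
  apply: bounded_measurableM => //; split.
    by apply: measurableT_comp => //; apply: measurableT_comp => //; exact: measurable_funM.
  exists 1 => o; rewrite ger0_norm ?expR_ge0// expR_le1 oppr_le0 mulr_ge0// -(clock0 o).
  exact: clockh.
have hbase f f' : monomial_pair radial radial t f f' ->
    mean P (fun o => W o * f o) = mean P (fun o => W2 o * f' o).
  move=> [l' l't [-> ->]].
  (* Covectors come from l and exponents from the arbitrary list l'; the exponents of l are erased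
     here because F brings the monomial of l back. *)
  pose k := [seq (p.1, (p.2.1, 0%N)) | p <- l] ++ [seq (p.1, (0, p.2.2)) | p : mark R <- l'].
  have kt p : p \in k -> 0 <= p.1 <= t.
    by rewrite mem_cat => /orP[] /mapP[q ql ->]; [exact: lt ql | exact: l't ql].
  have testE al : tested al 0 k = tested al 0 l.
    rewrite /tested big_cat !big_map/= [X in _ + X]big1 ?addr0// => p _.
    by rewrite !dot0l subrr.
  have varE I : variance_along I 0 k = variance_along I 0 l.
    rewrite /variance_along big_cat !big_map/= [X in _ + X]big1 ?addr0 => [|p _]; last first.
      by rewrite big1// => p' _; rewrite dot0l mul0r.
    apply: eq_bigr => p _; rewrite big_cat !big_map/= [X in _ + X]big1 ?addr0// => p' _.
    by rewrite dotC dot0l mul0r.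
  have monE (x : R -> R) : monomial x k = monomial x l'.
    by rewrite /monomial big_cat !big_map/= big1 ?mul1r// => p _; rewrite expr0.
  have totE : total_weight k = total_weight l.
    rewrite /total_weight big_cat !big_map/= [X in _ + X]big1 ?addr0// => p _.
    by rewrite big1// => i _; rewrite mxE normr0.
  have hCk : 3 * total_weight k ^+ 2 <= 2 * C by rewrite totE.
  have := chain hw ha m0_gt0 p0 t0 kt hCk.
  have bm : bounded_measurable (fun o => expR (- (C * clock o t)) * monomial (radial o) k * radial o t ^+ m0).
    apply: bounded_measurableM => //; apply: bounded_measurableM; last exact: (bounded_measurable_monomial hw).
    split; first by apply: measurableT_comp => //; apply: measurableT_comp => //; exact: measurable_funM.
    exists 1 => o; rewrite ger0_norm ?expR_ge0// expR_le1 oppr_le0 mulr_ge0// -(clock0 o).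
    exact: clockh.
  rewrite -meanZ// => e; apply: etrans (etrans e _); congr (mean P _); apply/funext => o.
    by rewrite /W testE varE monE; move: (cos _) (expR _) (monomial _ _) (_ ^+ m0) => *; ring.
  by rewrite /W2 monE; move: (cos _) (expR _) (monomial _ _) (_ ^+ m0) => *; ring.
pose F k o := expR (C * cut_clock k (radial o) t - 2^-1 * variance_along (cut_clock k (radial o)) 0 l) *
  (radial o t + k.+2%:R^-1)^-1 ^+ m0 * monomial (radial o) l.
have clM := closureM (monomial_pairM P P R01 R01 mR mR (t := t)).
have clF k : cl (F k) (F k).
  have c1 := closure1 P P R01 R01 mR mR t.
  have cM := monomial_pairM P P R01 R01 mR mR (t := t).
  have tt : 0 <= t <= t by rewrite t0 lexx.
  apply: (clM); last exact: closure_monomial.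
  apply: (clM).
    apply: (closure_expR cM c1); apply: closureB; apply: closureZ.
      exact: closure_cut_clock.
    exact: closure_variance.
  apply: (closureX cM c1); apply: (closure_inv cM c1) => //.
  - by rewrite invr_gt0 ltr0n/= invf_lt1// ltr1n.
  - exact: closure_process.
have step k := closure_mean bW bW2 hbase (clF k).
have bF k : bounded_measurable (F k) by case: (closure_bounded (clF k)).
have ratio o k : 0 <= radial o t * (radial o t + k.+2%:R^-1)^-1 <= 1.
  have /andP[x0 x1] := R01 o t; have e0 : 0 < k.+2%:R^-1 :> R by rewrite invr_gt0.
  rewrite mulr_ge0//= ?invr_ge0 ?addr_ge0 ?(ltW e0)//.
  by rewrite ler_pdivrMr ?mul1r ?lerDl ?(ltW e0)// ltr_wpDl.
have ratio_cvg o : radial o t * (radial o t + k.+2%:R^-1)^-1 @[k --> \oo] --> (1 : R).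
  have x0 : 0 < radial o t by exact: phi_gt0.
  have h : radial o t * (radial o t + k.+2%:R^-1)^-1 @[k --> \oo] --> radial o t * (radial o t + 0)^-1.
    apply: cvgM; first exact: cvg_cst.
    apply: cvgV; first by rewrite addr0 gt_eqF.
    apply: cvgD; first exact: cvg_cst.
    by have := @cvg_harmonic R; rewrite -(cvg_shiftS (harmonic : R^nat)).
  by rewrite addr0 divff ?gt_eqF// in h.
have ratioX_cvg o : (radial o t * (radial o t + k.+2%:R^-1)^-1) ^+ m0 @[k --> \oo] --> (1 : R).
  elim: (m0) => [|m IH]; first by under eq_fun do rewrite expr0; exact: cvg_cst.
  rewrite (funext (fun k : nat => exprS (radial o t * (radial o t + k.+2%:R^-1)^-1) m)).
  by rewrite -[X in _ --> X]mulr1; apply: cvgM.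
have var_cvg o : variance_along (cut_clock k (radial o)) 0 l @[k --> \oo] --> variance_along (clock o) 0 l.
  by apply: (variance_along_cvg t0) => // r _; exact: radial_cut_clock_cvg.
have M01 o := monomial01 l (R01 o).
pose D k o s := clock o s - cut_clock k (radial o) s.
have D0 k o : D k o 0 = 0 by rewrite /D clock0 cut_clock0 subrr.
have Dh k o : {homo D k o : s u / s <= u} by exact: clock_sub_cut_homo.
(* By linearity of the variance in the clock, the two exponents combine into one of the same shape
   for the gap D. *)
have WF k o : W o * F k o = cos (p0 + tested (a ^~ o) 0 l) *
    expR (2^-1 * variance_along (D k o) 0 l - C * D k o t) *
    (radial o t * (radial o t + k.+2%:R^-1)^-1) ^+ m0 * monomial (radial o) l.
  have -> : 2^-1 * variance_along (D k o) 0 l - C * D k o t =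
     (2^-1 * variance_along (clock o) 0 l - C * clock o t) +
     (C * cut_clock k (radial o) t - 2^-1 * variance_along (cut_clock k (radial o)) 0 l).
    by rewrite -variance_alongB /D; ring.
  by rewrite expRD exprMn /W /F; move: (expR _) (expR _) (cos _) (_ ^+ m0) (_ ^+ m0) (monomial _ _) => *; ring.
have W2F k o : W2 o * F k o = cos p0 *
    expR (- (C * D k o t + 2^-1 * variance_along (cut_clock k (radial o)) 0 l)) *
    (radial o t * (radial o t + k.+2%:R^-1)^-1) ^+ m0 * monomial (radial o) l.
  have -> : - (C * D k o t + 2^-1 * variance_along (cut_clock k (radial o)) 0 l) =
     - (C * clock o t) + (C * cut_clock k (radial o) t - 2^-1 * variance_along (cut_clock k (radial o)) 0 l).
    by rewrite /D; ring.
  by rewrite expRD exprMn /W2 /F; move: (expR _) (expR _) (cos _) (_ ^+ m0) (_ ^+ m0) (monomial _ _) => *; ring.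
have bound k o (x c : R) : `|c| <= 1 -> x <= 0 ->
    `|c * expR x * (radial o t * (radial o t + k.+2%:R^-1)^-1) ^+ m0 * monomial (radial o) l| <= 1.
  move=> c1 x0; have /andP[r0 r1] := ratio o k; have /andP[h0 h1] := M01 o.
  have e0 : 0 <= expR x by exact: expR_ge0.
  have e1 : expR x <= 1 by rewrite expR_le1.
  have q0 := exprn_ge0 m0 r0; have q1 := exprn_ile1 m0 r0 r1.
  rewrite 3!normrM (ger0_norm e0) (ger0_norm h0) (ger0_norm q0).
  have h2 : `|c| * expR x <= 1 * 1 by apply: ler_pM.
  rewrite mulr1 in h2; have h3 := ler_pM (mulr_ge0 (normr_ge0 c) e0) q0 h2 q1.
  rewrite mulr1 in h3; have := ler_pM (mulr_ge0 (mulr_ge0 (normr_ge0 c) e0) q0) h0 h3 h1.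
  by rewrite mulr1.
have DC o : D k o t @[k --> \oo] --> 0.
  by rewrite -(subrr (clock o t)); apply: cvgB; [exact: cvg_cst | exact: radial_cut_clock_cvg].
have exp_cvg (u : nat -> R) (x : R) : u k @[k --> \oo] --> x -> expR (u k) @[k --> \oo] --> expR x.
  by move=> ux; apply: (cvg_comp u expR ux); exact: continuous_expR.
have bM : bounded_measurable (fun o => monomial (radial o) l) by exact: (bounded_measurable_monomial hw).
have bE : bounded_measurable (fun o => expR (- (2^-1 * variance_along (clock o) 0 l))).
  split; first by apply: measurableT_comp => //; apply: measurableT_comp => //; exact: measurable_funM.
  exists 1 => o; rewrite ger0_norm ?expR_ge0// expR_le1 oppr_le0 mulr_ge0//.
  by apply: variance_along_ge0 => // p /lt/andP[].
rewrite -meanZ; last exact: bounded_measurableM.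
apply: (@lim_unique R (fun k => mean P (fun o => W o * F k o))).
- apply: (@cvg_mean _ _ _ P _ _ 1).
  + by move=> k; case: (bounded_measurableM bW (bF k)).
  + by case: (bounded_measurableM bcos bM).
  + move=> k o; rewrite WF; apply: bound; first exact: cos_max.
    by rewrite subr_le0; have := half_variance_le (Dh k o) t0 lt hC; rewrite D0 subr0.
  + apply: aeW => o; rewrite (funext (fun k => WF k o)).
    have e1 : cos (p0 + tested (a ^~ o) 0 l) * monomial (radial o) l =
        cos (p0 + tested (a ^~ o) 0 l) * expR 0 * 1 * monomial (radial o) l by rewrite expR0 !mulr1.
    rewrite e1; apply: cvgM; last exact: cvg_cst.
    apply: cvgM; last exact: ratioX_cvg.
    apply: cvgM; first exact: cvg_cst.
    apply: (exp_cvg).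
    have e2 k : variance_along (D k o) 0 l = variance_along (clock o) 0 l - variance_along (cut_clock k (radial o)) 0 l.
      by rewrite variance_alongB.
    have e3 : variance_along (clock o) 0 l - variance_along (cut_clock k (radial o)) 0 l @[k --> \oo] -->
        variance_along (clock o) 0 l - variance_along (clock o) 0 l.
      by apply: cvgB; [exact: cvg_cst | exact: var_cvg].
    have {}e3 : variance_along (D k o) 0 l @[k --> \oo] --> (0 : R).
      rewrite subrr in e3; by apply: cvg_trans e3; apply: near_eq_cvg; apply: nearW => k; rewrite e2.
    have h : 2^-1 * variance_along (D k o) 0 l - C * D k o t @[k --> \oo] --> 2^-1 * 0 - C * 0.
      by apply: cvgB; apply: cvgM; [exact: cvg_cst | exact: e3 | exact: cvg_cst | exact: DC].
    by rewrite !mulr0 subr0 in h.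
- under eq_fun do rewrite step.
  apply: (@cvg_mean _ _ _ P _ _ 1).
  + by move=> k; case: (bounded_measurableM bW2 (bF k)).
  + by case: (bounded_measurableM (bounded_measurable_cst T (cos p0)) (bounded_measurableM bE bM)).
  + move=> k o; rewrite W2F; apply: bound; first exact: cos_max.
    rewrite oppr_le0 addr_ge0// mulr_ge0//; first by rewrite -(D0 k o); exact: Dh.
    apply: variance_along_ge0; first by apply: cut_clock_homo => //; exact: cR.
    by move=> p /lt/andP[].
  + apply: aeW => o; rewrite (funext (fun k => W2F k o)).
    have e1 : cos p0 * (expR (- (2^-1 * variance_along (clock o) 0 l)) * monomial (radial o) l) =
        cos p0 * expR (- (2^-1 * variance_along (clock o) 0 l)) * 1 * monomial (radial o) l by rewrite mulr1 mulrA.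
    rewrite e1; apply: cvgM; last exact: cvg_cst.
    apply: cvgM; last exact: ratioX_cvg.
    apply: cvgM; first exact: cvg_cst.
    apply: (exp_cvg); apply: cvgN.
    have -> : 2^-1 * variance_along (clock o) 0 l = C * 0 + 2^-1 * variance_along (clock o) 0 l by ring.
    apply: cvgD; first by apply: cvgM; [exact: cvg_cst | exact: DC].
    by apply: cvgM; [exact: cvg_cst | exact: var_cvg].
Qed.

End Undamping.

(** * Brownian motion at independent random times *)

Section GaussianFourier.
Variables (R : realType) (sg : R).
Hypothesis sg0 : 0 < sg.
Implicit Types (th lam z : R).
Local Notation mu := lebesgue_measure.
Local Notation g := (normal_pdf 0 sg).

Let sgn0 : sg != 0. Proof. by rewrite gt_eqF. Qed.

Lemma mean_normal (f : R -> R) : bounded_measurable f ->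
  mean (normal_prob 0 sg) f = \int[mu]_z (f z * g z).
Proof.
move=> bf; have fi := bounded_measurable_integrable (normal_prob 0 sg) bf.
have mf := bf.1; have dom := @normal_prob_dominates R 0 sg.
rewrite /mean /Rintegral; congr fine.
transitivity (\int[mu]_z ((f z)%:E * (g z)%:E))%E; last by apply: eq_integral => z _; rewrite EFinM.
rewrite -(Radon_Nikodym_change_of_variables dom)//=.
apply: ae_eq_integral => //.
- apply: emeasurable_funM; first exact/measurable_EFinP.
  by apply: (measurable_int mu); apply: Radon_Nikodym_integrable; exact: dom.
- apply: emeasurable_funM; first exact/measurable_EFinP.
  by apply/measurable_EFinP; exact: measurable_normal_pdf.
- apply: ae_eqe_mul2l => /=.
  apply: integral_ae_eq => //=.
  + by apply: Radon_Nikodym_integrable; exact: dom.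
  + by apply/measurable_EFinP; exact: measurable_normal_pdf.
  + by move=> E E01 mE; rewrite -Radon_Nikodym_integral.
Qed.

Lemma normal_pdf_derive z : is_derive z (1 : R) g (- z / sg ^+ 2 * g z).
Proof.
have s2 : sg ^+ 2 *+ 2 != 0 by rewrite -mulr_natr mulf_neq0// expf_neq0.
have h : is_derive z (1 : R) (fun y : R => - y ^+ 2 / (sg ^+ 2 *+ 2)) (- z / sg ^+ 2).
  by apply: is_derive_eq; rewrite /GRing.scale/=; field.
have -> : g = (fun=> normal_peak sg) * (expR \o (fun y : R => - y ^+ 2 / (sg ^+ 2 *+ 2))).
  by apply/funext => y; rewrite normal_pdfE// /normal_fun subr0.
have h2 := is_derive1_comp (is_derive_expR _) h.
apply: is_derive_eq.
by rewrite !fctE /GRing.scale/= mulr0 addr0; ring.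
Qed.

(** A Gaussian of twice the width absorbs the factor |z|. Being integrable, it dominates the
    integrands below, so that no moment of the normal law has to be computed. *)
Lemma normal_pdf_tail z : `|z| * g z <= sg * (normal_peak sg / normal_peak (2 * sg)) * normal_pdf 0 (2 * sg) z.
Proof.
have s2 : 2 * sg != 0 by rewrite mulf_neq0.
rewrite !normal_pdfE// /normal_fun !subr0.
have q0 := normal_peak_gt0 s2; have p0 := normal_peak_gt0 sgn0.
set p := normal_peak sg in p0 *; set q := normal_peak (2 * sg) in q0 *.
have -> : sg * (p / q) * (q * expR (- z ^+ 2 / ((2 * sg) ^+ 2 *+ 2))) = p * (sg * expR (- z ^+ 2 / ((2 * sg) ^+ 2 *+ 2))).
  by field; rewrite gt_eqF.
rewrite mulrCA ler_pM2l//.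
have -> : - z ^+ 2 / (sg ^+ 2 *+ 2) = - (3 * z ^+ 2 / (8 * sg ^+ 2)) + (- z ^+ 2 / ((2 * sg) ^+ 2 *+ 2)).
  by field.
rewrite expRD mulrA ler_wpM2r ?expR_ge0//.
rewrite expRN ler_pdivrMr ?expR_gt0//.
apply: le_trans (_ : sg * (1 + 3 * z ^+ 2 / (8 * sg ^+ 2)) <= _); last by rewrite ler_wpM2l ?(ltW sg0)// expR_ge1Dx.
have -> : sg * (1 + 3 * z ^+ 2 / (8 * sg ^+ 2)) = (8 * sg ^+ 2 + 3 * z ^+ 2) / (8 * sg) by field.
rewrite ler_pdivlMr ?mulr_gt0// -[z ^+ 2]real_normK ?num_real//.
have := normr_ge0 z; have := sqr_ge0 (8 * sg - 4 * `|z|); nra.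
Qed.

Let K : R := sg * (normal_peak sg / normal_peak (2 * sg)).
Let K0 : 0 <= K. Proof. by rewrite mulr_ge0 ?(ltW sg0)// divr_ge0// normal_peak_ge0. Qed.
Let dom z : R := K * normal_pdf 0 (2 * sg) z.

Let int_dom : mu.-integrable setT (EFin \o dom).
Proof.
have := integrable_normal_pdf (0 : R) (2 * sg) => /(integrableZl measurableT K).
by congr (_.-integrable _ _); apply/funext => z /=; rewrite EFinM.
Qed.

Let int_g (f : R -> R) : measurable_fun setT f -> (forall z, `|f z| <= 1) ->
  mu.-integrable setT (EFin \o (fun z => f z * g z)).
Proof.
move=> mf f1; apply: (le_integrable measurableT) (integrable_normal_pdf 0 sg) => /=.
  by apply/measurable_EFinP; apply: measurable_funM => //; exact: measurable_normal_pdf.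
move=> z _; rewrite lee_fin normrM ler_piMl//.
Qed.

Let int_zg (f : R -> R) : measurable_fun setT f -> (forall z, `|f z| <= 1) ->
  mu.-integrable setT (EFin \o (fun z => z * f z * g z)).
Proof.
move=> mf f1; apply: (le_integrable measurableT) int_dom => /=.
  apply/measurable_EFinP; apply: measurable_funM; last exact: measurable_normal_pdf.
  exact: measurable_funM.
move=> z _; rewrite lee_fin [leRHS]ger0_norm; last by rewrite mulr_ge0// normal_pdf_ge0.
rewrite !normrM (ger0_norm (normal_pdf_ge0 _ _ _)).
apply: le_trans (normal_pdf_tail z); rewrite ler_wpM2r ?normal_pdf_ge0//.
by rewrite ler_piMr.
Qed.

Let mcos th lam : measurable_fun setT (fun z : R => cos (th + lam * z)).
Proof.
apply: (measurableT_comp (continuous_measurable_fun (@continuous_cos R))).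
by apply: measurable_funD => //; exact: measurable_funM.
Qed.

Let msin th lam : measurable_fun setT (fun z : R => sin (th + lam * z)).
Proof.
apply: (measurableT_comp (continuous_measurable_fun (@continuous_sin R))).
by apply: measurable_funD => //; exact: measurable_funM.
Qed.

Let C lam th : R := \int[mu]_z (cos (th + lam * z) * g z).
Let S lam th : R := \int[mu]_z (z * sin (th + lam * z) * g z).

Let h_der lam th z : is_derive z (1 : R) (fun z => sin (th + lam * z) * g z)
  (lam * (cos (th + lam * z) * g z) - sg ^- 2 * (z * sin (th + lam * z) * g z)).
Proof.
have hg := normal_pdf_derive z.
have hl : is_derive z (1 : R) (fun y : R => th + lam * y) lam.
  by apply: is_derive_eq; rewrite /GRing.scale/=; ring.
have hs := is_derive1_comp (is_derive_sin _) hl.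
have := @is_deriveM _ _ (sin \o (fun y : R => th + lam * y)) g z 1 _ _ hs hg.
move/is_derive_eq; apply; rewrite /GRing.scale/=.
by move: (g z) (cos _) (sin _) => *; field.
Qed.

(** Integration over the line of the derivative of sin(th + lam z) g(z), a function that vanishes at
    both ends. *)
Lemma gaussian_by_parts lam th : S lam th = sg ^+ 2 * lam * C lam th.
Proof.
pose h z := sin (th + lam * z) * g z.
pose k z := lam * (cos (th + lam * z) * g z) - sg ^- 2 * (z * sin (th + lam * z) * g z).
have ic := int_g (mcos th lam) (fun z => cos_max _).
have is' := int_zg (msin th lam) (fun z => sin_max _).
have ik : mu.-integrable setT (EFin \o k).
  have := integrableB measurableT (integrableZl measurableT lam ic) (integrableZl measurableT (sg ^- 2) is').
  by congr (_.-integrable _ _); apply/funext => z /=; rewrite -!EFinM -EFinB.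
have ck : continuous k.
  have cl : continuous (fun z : R => th + lam * z).
    by move=> z; apply: cvgD; [exact: cvg_cst|apply: cvgM; [exact: cvg_cst|exact: cvg_id]].
  have cg : continuous g by exact: continuous_normal_pdf.
  move=> z; apply: cvgB; (apply: cvgM; first exact: cvg_cst).
    apply: cvgM; last exact: cg.
    exact: (continuous_comp (cl z) (@continuous_cos R _)).
  apply: cvgM; last exact: cg.
  by apply: cvgM; [exact: cvg_id|exact: (continuous_comp (cl z) (@continuous_sin R _))].
have hk n : \int[mu]_(z in `[- n.+1%:R, n.+1%:R]) k z = h n.+1%:R - h (- n.+1%:R).
  have nn : - n.+1%:R < n.+1%:R :> R by rewrite gtrN// ltr0n.
  rewrite /Rintegral (@continuous_FTC2 _ k h)//.
  - exact: continuous_subspaceT.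
  - have dh z : derivable h z 1 by exact: (@ex_derive _ _ _ _ _ _ _ (h_der lam th z)).
    have ch : continuous h by move=> z; exact/differentiable_continuous/derivable1_diffP.
    split; first by move=> z _.
    + exact: (cvg_at_right_filter (ch _)).
    + exact: (cvg_at_left_filter (ch _)).
  - by move=> z _; rewrite derive1E; apply: derive_val; exact: h_der.
have c1 : \int[mu]_(z in `[- n.+1%:R, n.+1%:R]) k z @[n --> \oo] --> \int[mu]_z k z.
  pose f_ n := EFin \o (k \_ `[- n.+1%:R, n.+1%:R]).
  have mk : measurable_fun setT k by exact: continuous_measurable_fun.
  have mf n : measurable_fun setT (f_ n).
    apply/measurable_EFinP; apply/(measurable_restrict _ (measurable_itv _) measurableT) => //.
    by rewrite setTI; exact: measurable_funTS.
  have fk : {ae mu, forall z, setT z -> f_ n z @[n --> \oo] --> (EFin \o k) z}.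
    apply: aeW => z _; apply: cvg_EFin; first exact: nearW.
    apply: cvg_near_cst; near=> n; rewrite /f_/= patchE mem_set//= in_itv/= -ler_norml.
    have : `|z| <= n%:R by near: n; exact: nbhs_infty_ger.
    by rewrite -natr1; lra.
  have dk : {ae mu, forall z n, setT z -> `|f_ n z| <= (abse \o (EFin \o k)) z}%E.
    apply: aeW => z n _; rewrite /f_/= lee_fin patchE.
    by case: ifP => // _; rewrite normr0.
  have [_ _ cv] := @dominated_convergence _ _ _ mu setT measurableT f_ (EFin \o k) (abse \o (EFin \o k)) mf (proj2 (measurable_EFinP _ _) mk) fk (integrable_abse ik) dk.
  rewrite (_ : (fun n => _) = (fun n => \int[mu]_z ((k \_ `[- n.+1%:R, n.+1%:R]) z))); last by apply/funext => n; rewrite Rintegral_mkcond.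
  by apply: fine_cvg; rewrite fineK//; exact: integrable_fin_num.
have c2 : h n.+1%:R - h (- n.+1%:R) @[n --> \oo] --> (0 : R).
  have hb z : z != 0 -> `|h z| <= `|z|^-1 * (K * normal_peak (2 * sg)).
    move=> z0; rewrite ler_pdivlMl ?normr_gt0//; apply: le_trans (_ : `|z| * g z <= _).
      rewrite ler_wpM2l// /h normrM (ger0_norm (normal_pdf_ge0 _ _ _)) ler_piMl ?normal_pdf_ge0//.
      exact: sin_max.
    apply: le_trans (normal_pdf_tail z) _; rewrite ler_wpM2l//.
    by apply: normal_pdf_ub; rewrite mulf_neq0.
  have cn : `|n.+1%:R|^-1 * (K * normal_peak (2 * sg)) @[n --> \oo] --> (0 : R).
    rewrite -[X in _ --> X](mul0r (K * normal_peak (2 * sg))); apply: cvgM; last exact: cvg_cst.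
    by under eq_fun do rewrite normr_nat; exact: cvg_harmonic.
  have nz n : n.+1%:R != 0 :> R by rewrite pnatr_eq0.
  rewrite -(subr0 0); apply: cvgB; apply/norm_cvg0P; apply: (squeeze_cvgr _ (cvg_cst 0) cn); apply: nearW => n.
    by rewrite normr_ge0 hb.
  by rewrite normr_ge0 -[X in X^-1]normrN hb ?oppr_eq0.
have : \int[mu]_z k z = 0.
  by apply: (@lim_unique R _ _ _ c1); rewrite (funext hk).
rewrite /k RintegralB//=.
- rewrite !RintegralZl// => /eqP; rewrite subr_eq0 => /eqP e.
  by rewrite /C mulrC mulrC -mulrA e mulVKf// expf_neq0.
- have := integrableZl measurableT lam ic.
  by congr (_.-integrable _ _); apply/funext => z /=; rewrite EFinM.
- have := integrableZl measurableT (sg ^- 2) is'.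
  by congr (_.-integrable _ _); apply/funext => z /=; rewrite EFinM.
Unshelve. all: by end_near.
Qed.

Lemma gaussian_fourier_derive lam th : is_derive lam (1 : R) (C ^~ th) (- S lam th).
Proof.
pose f (l z : R) := cos (th + l * z) * g z.
have df l z : is_derive l (1 : R) (f ^~ z) (- (z * sin (th + l * z) * g z)).
  have hl : is_derive l (1 : R) (fun y : R => th + y * z) z.
    by apply: is_derive_eq; rewrite /GRing.scale/=; ring.
  have hs := is_derive1_comp (is_derive_cos _) hl.
  have := @is_deriveM _ _ (cos \o (fun y : R => th + y * z)) (fun=> g z) l 1 _ _ hs (is_derive_cst _ _ _).
  move/is_derive_eq; apply; rewrite /GRing.scale/=.
  by move: (g z) (cos _) (sin _) => *; ring.
have Il : (`]lam - 1, lam + 1[%classic : set R) lam by rewrite /= in_itv/=; apply/andP; split; lra.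
have fi l : (`]lam - 1, lam + 1[%classic : set R) l -> mu.-integrable setT (EFin \o f l).
  by move=> _; exact: (int_g (mcos th l) (fun z => cos_max _)).
have dfd l z : (`]lam - 1, lam + 1[%classic : set R) l -> setT z -> derivable (f ^~ z) l 1.
  by move=> _ _; exact: (@ex_derive _ _ _ _ _ _ _ (df l z)).
have dom0 z : 0 <= dom z by rewrite mulr_ge0// normal_pdf_ge0.
have dE l z : partial1of2 f l z = - (z * sin (th + l * z) * g z).
  by rewrite partial1of2E; apply: derive_val; exact: df.
have dom_ub l z : (`]lam - 1, lam + 1[%classic : set R) l -> setT z -> `|partial1of2 f l z| <= dom z.
  move=> _ _; rewrite dE normrN !normrM (ger0_norm (normal_pdf_ge0 _ _ _)).
  apply: le_trans (normal_pdf_tail z); rewrite ler_wpM2r ?normal_pdf_ge0//.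
  by rewrite ler_piMr// sin_max.
have h1 := derivable_under_integral measurableT Il fi dfd dom0 int_dom dom_ub.
have h2 := differentiation_under_integral measurableT Il fi dfd dom0 int_dom dom_ub.
apply: DeriveDef => //; rewrite -derive1E h2 /S.
rewrite (_ : (fun y => _) = (fun z => - (z * sin (th + lam * z) * g z))); last by apply/funext => z; exact: dE.
rewrite -mulN1r -RintegralZl//; last exact: (int_zg (msin th lam) (fun z => sin_max _)).
by apply: eq_Rintegral => z _; rewrite mulN1r.
Qed.

(** As a function of lam the integral satisfies C' = - sg^2 lam C, so its product with exp(lam^2
    sg^2 / 2) is constant. The free phase includes the sine transform as the case th = - pi / 2. *)
Lemma gaussian_fourier lam th :
  mean (normal_prob 0 sg) (fun z => cos (th + lam * z)) = cos th * expR (- (lam ^+ 2 * sg ^+ 2 / 2)).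
Proof.
rewrite mean_normal; last by split => //; exists 1 => z; exact: cos_max.
have d (l : R) : is_derive l (1 : R) (fun l => C l th * expR (l ^+ 2 * sg ^+ 2 / 2)) 0.
  have hl : is_derive l (1 : R) (fun y : R => y ^+ 2 * sg ^+ 2 / 2) (l * sg ^+ 2).
    by apply: is_derive_eq; rewrite /GRing.scale/=; field.
  have hs := is_derive1_comp (is_derive_expR _) hl.
  have := @is_deriveM _ _ (C ^~ th) (expR \o (fun y : R => y ^+ 2 * sg ^+ 2 / 2)) l 1 _ _ (gaussian_fourier_derive l th) hs.
  move/is_derive_eq; apply; rewrite gaussian_by_parts /GRing.scale/=.
  by move: (C _ _) (expR _) => *; ring.
have := is_derive_0_is_cst lam 0 d.
rewrite expr0n/= !mul0r expR0 mulr1 => e.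
rewrite -/(C lam th) expRN -[LHS](mulfK (_ : expR (lam ^+ 2 * sg ^+ 2 / 2) != 0)) ?gt_eqF ?expR_gt0//.
rewrite e; congr (_ / _); rewrite /C.
under eq_Rintegral do rewrite mul0r addr0.
rewrite RintegralZl//; last exact: integrable_normal_pdf.
by rewrite /Rintegral integral_normal_pdf mulr1.
Qed.

End GaussianFourier.

(** * Fourier transform of a Brownian motion at fixed times *)

Section BrownianIncrements.
Context (R : realType) d (T : measurableType d) (P : probability T R).
Variable g : R -> T -> 'rV[R]_3.
Hypothesis hg : brownian_motion P g.
Implicit Types (s t : R) (l : seq (mark R)) (G : T -> R).

(** Monotone class from indicators to bounded functions, comparing the weight G on T with the
    constant weight [mean P G] on the line. *)
Lemma mean_comp_law (Q : probability (measurableTypeR R) R) (G K : T -> R) :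
  bounded_measurable G -> measurable_fun setT K ->
  (forall B, measurable B -> mean P (fun o => G o * \1_B (K o)) = mean P G * fine (Q B)) ->
  forall h : R -> R, bounded_measurable h ->
  mean P (fun o => G o * h (K o)) = mean P G * mean Q h.
Proof.
move=> bG mK hB h bh.
pose base (f : T -> R) (f' : R -> R) := exists2 B, measurable B & f = \1_B \o K /\ f' = \1_B.
have mKB B : measurable B -> bounded_measurable (\1_B \o K : T -> R).
  move=> mB; split; first by apply: measurableT_comp => //; exact: measurable_indic.
  by exists 1 => o /=; rewrite indicE; case: (_ \in _); rewrite ?normr1 ?normr0.
have cb B : measurable B -> closure P Q base (\1_B \o K) (\1_B).
  by move=> mB; apply: closure_base; [exact: mKB|exact: bounded_measurable_indic|exists B].
have c1 : closure P Q base (fun=> 1) (fun=> 1).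
  have := cb _ measurableT; rewrite indicT; congr closure.
have [M M0 hM] := bounded_measurable_pos bh.
have mh := bh.1.
have bhK : bounded_measurable (h \o K).
  by split; [exact: measurableT_comp | exists M => o /=].
have cl : closure P Q base (h \o K) h.
  apply: (closure_le c1 bhK bh M0) => //; [move=> o; exact: hM|move=> c].
  have e (x : R) : ((c <= h x)%R%:R : R) = \1_(h @^-1` `[c, +oo[) x.
    by rewrite indicE; congr ((nat_of_bool _)%:R); apply/idP/idP => hx;
      [rewrite inE/= in_itv/= hx | move: hx; rewrite inE/= in_itv/= andbT].
  rewrite (_ : (fun o => _) = \1_(h @^-1` `[c, +oo[) \o K); last by apply/funext => o; exact: e.
  rewrite [X in closure _ _ _ _ X](_ : _ = \1_(h @^-1` `[c, +oo[)); last by apply/funext => o; exact: e.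
  by apply: cb; rewrite -[X in measurable X]setTI; exact: mh.
have := closure_mean bG (bounded_measurable_cst _ (mean P G)) _ cl.
rewrite meanZ//; apply => f f' [B mB [-> ->]].
by rewrite meanZ ?mean_indic//; [exact: hB | exact: bounded_measurable_indic].
Qed.

Section OneStep.
Variables (s t : R).
Hypothesis st : 0 <= s < t.
Let sg := Num.sqrt (t - s).
Local Notation Q := (normal_prob 0 sg).
Let D (i : 'I_3) o : R := g t o 0 i - g s o 0 i.

Let s0 : 0 <= s. Proof. by case/andP: st. Qed.
Let s_lt_t : s < t. Proof. by case/andP: st. Qed.
Let sg0 : 0 < sg. Proof. by rewrite sqrtr_gt0 subr_gt0. Qed.

Lemma adapted_coord u v (i : 'I_3) : 0 <= u <= v -> adapted g (past v) (fun o => g u o 0 i).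
Proof.
move=> uv; apply: (@adapted_comp _ _ _ _ g (past v) u (fun x : 'rV[R]_3 => x 0 i)).
  by rewrite /past/= in_itv.
exact: coord_continuous3.
Qed.

Let mg : measurable_process g. Proof. by case: hg. Qed.

Lemma measurable_coord u (i : 'I_3) : 0 <= u -> measurable_fun setT (fun o => g u o 0 i).
Proof.
move=> u0; apply: (adapted_measurable mg (@past_ge0 _ u)).
by apply: adapted_coord; rewrite u0 lexx.
Qed.

Let mD i : measurable_fun setT (D i).
Proof. by apply: measurable_funB; apply: measurable_coord => //; exact: le_trans (ltW s_lt_t). Qed.

Let bh_D (h : R -> R) i : bounded_measurable h -> bounded_measurable (fun o => h (D i o)).
Proof.
move=> [mh [M hM]]; split; last by exists M => o; exact: hM.
by apply: (measurableT_comp mh).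
Qed.

Let ind (B : set R) : measurable B -> bounded_measurable (\1_B : R -> R).
Proof. exact: bounded_measurable_indic. Qed.

Let finQ B : measurable B -> normal_prob 0 sg B \is a fin_num.
Proof. by move=> mB; exact: fin_num_measure. Qed.

Let mean_increments_indic K (B : 'I_3 -> set R) : bounded_measurable K -> adapted g (past s) K ->
  (forall i, measurable (B i)) ->
  mean P (fun o => K o * \prod_i \1_(B i) (D i o)) = mean P K * \prod_i fine (Q (B i)).
Proof.
move=> bK aK mB.
pose A := [set o | forall i, B i (D i o)].
have AE : A = \bigcap_(i in [set: 'I_3]) (D i @^-1` B i).
  by apply/seteqP; split => o h => [i _|i]; exact: h.
have mA : measurable A.
  rewrite AE; apply: fin_bigcap_measurable => // i _; rewrite -[X in measurable X]setTI; exact: mD.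
have indA o : \prod_i \1_(B i) (D i o) = \1_A o :> R.
  rewrite [RHS]indicE; have [hA|hA] := boolP (o \in A).
    by rewrite big1// => i _; rewrite indicE mem_set//; move: hA; rewrite inE; exact.
  have /existsNP[i hi] : ~ (forall i, B i (D i o)) by move=> h; move: hA; rewrite notin_setE; exact.
  by rewrite (bigD1 i)//= indicE memNset// mul0r.
pose c := \prod_i fine (Q (B i)).
have [M M0 KM] := bounded_measurable_pos bK.
have bA := bounded_measurable_indic R mA.
have bc := bounded_measurable_cst T c.
have h0 : mean P (fun o => (\1_A o - c) * K o) = 0.
  apply: (mean_orthogonal mg (@past_ge0 _ s) _ _ aK M0 KM); first exact: bounded_measurableB.
  move=> E hE; have mE : measurable E by apply: mg; apply: sigma_process_sub (@past_ge0 _ s) _ hE.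
  have [_ _ _ hinc] := hg.
  have hEA := hinc _ _ st E hE B mB.
  have e1 : (fun o => (\1_A o - c) * \1_E o) = (fun o => \1_(E `&` A) o - c * \1_E o).
    by apply/funext => o; rewrite indicI/= ; ring.
  have bE := bounded_measurable_indic R mE.
  have mEA := measurableI _ _ mE mA.
  rewrite e1 meanB; [|exact: bounded_measurable_indic|exact: bounded_measurableM].
  rewrite meanZ// !mean_indic// hEA -/sg.
  have -> : (\big[*%E/1%E]_(i < 3) normal_prob 0 sg (B i))%E = c%:E.
    rewrite /c (eq_bigr (fun i => (fine (Q (B i)))%:E)); last first.
      by move=> i _; rewrite fineK// (finQ (mB i)).
    by elim/big_ind2 : _ => // x1 x2 y1 y2 -> ->; rewrite EFinM.
  by rewrite fineM ?fin_num_measure//= mulrC subrr.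
have e2 : (fun o => K o * \prod_i \1_(B i) (D i o)) = (fun o => (\1_A o - c) * K o + c * K o).
  by apply/funext => o; rewrite indA; ring.
rewrite e2 meanD ?h0 ?add0r ?meanZ 1?mulrC//; apply: bounded_measurableM => //.
exact: bounded_measurableB.
Qed.

(** Independence is given on product sets, that is for products of indicators. The indicators are
    replaced by bounded functions one coordinate at a time: the induction on j frees the first j
    coordinates. *)
Lemma mean_increments K (h : 'I_3 -> R -> R) : bounded_measurable K -> adapted g (past s) K ->
  (forall i, bounded_measurable (h i)) ->
  mean P (fun o => K o * \prod_i h i (D i o)) = mean P K * \prod_i mean Q (h i).
Proof.
move=> bK aK.
suff H j (f : 'I_3 -> R -> R) : (forall i, bounded_measurable (f i)) ->
    (forall i : 'I_3, (j <= i)%N -> exists2 B, measurable B & f i = \1_B) ->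
    mean P (fun o => K o * \prod_i f i (D i o)) = mean P K * \prod_i mean Q (f i).
  by move=> bh; apply: (H 3%N) => // i; rewrite leqNgt ltn_ord.
elim: j f => [|j IH] f bf hB.
  have [B /all_and2[mB fB]] : exists B : 'I_3 -> set R, forall i, measurable (B i) /\ f i = \1_(B i).
    have [|B hB'] := @boolp.choice _ _ (fun (i : 'I_3) (B : set R) => measurable B /\ f i = \1_B).
      by move=> i; have [B mB fB] := hB i isT; exists B.
    by exists B.
  rewrite [LHS](_ : _ = mean P (fun o => K o * \prod_i \1_(B i) (D i o))).
    rewrite mean_increments_indic//; congr (_ * _); apply: eq_bigr => i _.
    rewrite fB; exact (esym (mean_indic (normal_prob 0 sg) (mB i))).
  by congr (mean P _); apply/funext => o; congr (_ * _); apply: eq_bigr => i _; rewrite fB.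
have [j3|j3] := ltnP j 3; last first.
  by apply: IH => // i ji; have := ltn_ord i; rewrite ltnNge (leq_trans j3 ji).
pose i0 := Ordinal j3.
pose f' B i := if i == i0 then \1_B else f i.
have bf' B i : measurable B -> bounded_measurable (f' B i).
  by move=> mB; rewrite /f'; case: ifP => // _; exact: ind.
have hB' B : measurable B ->
    mean P (fun o => K o * \prod_i f' B i (D i o)) = mean P K * \prod_i mean Q (f' B i).
  move=> mB; apply: IH => [i|i ji]; first exact: bf'.
  rewrite /f'; case: (eqVneq i i0) => [_|ii0]; first by exists B.
  by apply: hB; rewrite ltn_neqAle ji andbT eq_sym; apply: contra ii0 => /eqP e; apply/eqP/val_inj.
pose G o := K o * \prod_(i | i != i0) f i (D i o).
have bG : bounded_measurable G.
  by apply: bounded_measurableM => //; apply: bounded_measurable_prod => i _; exact: bh_D.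
have prodE B o : \prod_i f' B i (D i o) = \1_B (D i0 o) * \prod_(i | i != i0) f i (D i o).
  rewrite (bigD1 i0)//= {1}/f' eqxx; congr (_ * _); apply: eq_bigr => i ii0.
  by rewrite /f' (negbTE ii0).
have prodE' B : measurable B -> \prod_i mean Q (f' B i) = fine (Q B) * \prod_(i | i != i0) mean Q (f i).
  move=> mB; rewrite (bigD1 i0)//= {1}/f' eqxx mean_indic//; congr (_ * _); apply: eq_bigr => i ii0.
  by rewrite /f' (negbTE ii0).
have GE : mean P G = mean P K * \prod_(i | i != i0) mean Q (f i).
  have := hB' _ measurableT; rewrite prodE'// probability_setT mul1r => <-.
  by congr (mean P _); apply/funext => o; rewrite prodE indicT mul1r.
have hG B : measurable B -> mean P (fun o => G o * \1_B (D i0 o)) = mean P G * fine (Q B).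
  move=> mB; rewrite GE -mulrA [X in _ * X]mulrC -prodE'// -hB'//.
  by congr (mean P _); apply/funext => o; rewrite prodE /G; ring.
have := @mean_comp_law (normal_prob 0 sg) G (D i0) bG (mD i0) hG (f i0) (bf i0).
rewrite GE => e; apply: etrans (etrans e _).
  by congr (mean P _); apply/funext => o; rewrite (bigD1 i0)//= /G; ring.
by rewrite [in RHS](bigD1 i0)//=; ring.
Qed.

Variable lam : 'rV[R]_3.
Let x o := dot lam (g t o) - dot lam (g s o).
Let trig (b : bool) z : R := if b then sin z else cos z.

(** Expanding the cosine or sine of a sum over three coordinates leaves products with one
    trigonometric factor per coordinate; a sine factor integrates to 0 against a centred
    Gaussian. *)
Let mean_trig K (b0 b1 b2 : bool) : bounded_measurable K -> adapted g (past s) K ->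
  mean P (fun o => K o * (trig b0 (lam 0 0 * D 0 o) * trig b1 (lam 0 (inord 1) * D (inord 1) o)
     * trig b2 (lam 0 (inord 2) * D (inord 2) o))) =
  if [|| b0, b1 | b2] then 0 else mean P K * expR (- (2^-1 * (sqnorm lam * (t - s)))).
Proof.
move=> bK aK.
pose b (i : 'I_3) := nth false [:: b0; b1; b2] i.
pose h i z := trig (b i) (lam 0 i * z).
have i1 : lift ord0 ord0 = inord 1 :> 'I_3 by apply/val_inj; rewrite /= inordK.
have i2 : lift ord0 (lift ord0 ord0) = inord 2 :> 'I_3 by apply/val_inj; rewrite /= inordK.
have bt i : bounded_measurable (h i).
  have ml : measurable_fun setT (fun z : R => lam 0 i * z) by exact: measurable_funM.
  by rewrite /h /trig; case: (b i); [exact: bounded_measurable_sin|exact: bounded_measurable_cos].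
have := mean_increments bK aK bt.
rewrite (funext (fun o => congr1 (GRing.mul (K o)) (_ : _ = trig b0 (lam 0 0 * D 0 o) *
  trig b1 (lam 0 (inord 1) * D (inord 1) o) * trig b2 (lam 0 (inord 2) * D (inord 2) o)))); last first.
  by move=> o; rewrite !big_ord_recl big_ord0 mulr1 i1 i2 /h /b /= !inordK//= mulrA.
move=> ->.
have mQ i : mean Q (h i) = if b i then 0 else expR (- (lam 0 i ^+ 2 * (t - s) / 2)).
  have s2 : sg ^+ 2 = t - s by rewrite sqr_sqrtr// subr_ge0 ltW.
  rewrite /h /trig; case: (b i).
    have := gaussian_fourier sg0 (lam 0 i) (- (pi / 2)).
    rewrite cosN cos_pihalf mul0r => e; rewrite -[RHS]e; congr (mean Q _); apply/funext => z.
    by rewrite addrC cosBpihalf.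
  have := gaussian_fourier sg0 (lam 0 i) 0; rewrite cos0 mul1r s2 => <-.
  by congr (mean Q _); apply/funext => z; rewrite add0r.
rewrite (eq_bigr _ (fun i _ => mQ i)) !big_ord_recl big_ord0 mulr1 i1 i2 /b /= !inordK//=.
rewrite {b h bt mQ}; case: b0 => /=; first by rewrite mul0r mulr0.
case: b1 => /=; first by rewrite mul0r !mulr0.
case: b2 => /=; first by rewrite !mulr0.
rewrite -!expRD; congr (_ * expR _); rewrite /sqnorm !big_ord_recl big_ord0 i1 i2; by field.
Qed.

Let xE o : x o = lam 0 0 * D 0 o + lam 0 (inord 1) * D (inord 1) o + lam 0 (inord 2) * D (inord 2) o.
Proof.
have i1 : lift ord0 ord0 = inord 1 :> 'I_3 by apply/val_inj; rewrite /= inordK.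
have i2 : lift ord0 (lift ord0 ord0) = inord 2 :> 'I_3 by apply/val_inj; rewrite /= inordK.
by rewrite /x /dot !big_ord_recl !big_ord0 i1 i2 /D; ring.
Qed.

Let bt K b0 b1 b2 : bounded_measurable K -> bounded_measurable (fun o => K o * (trig b0 (lam 0 0 * D 0 o) * trig b1 (lam 0 (inord 1) * D (inord 1) o)
     * trig b2 (lam 0 (inord 2) * D (inord 2) o))).
Proof.
have bi b i : bounded_measurable (fun o => trig b (lam 0 i * D i o)).
  have ml : measurable_fun setT (fun o => lam 0 i * D i o) by exact: measurable_funM.
  by case: b; [exact: bounded_measurable_sin|exact: bounded_measurable_cos].
by move=> bK; do 3 (apply: bounded_measurableM => //).
Qed.

Lemma mean_cos_increment K : bounded_measurable K -> adapted g (past s) K ->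
  mean P (fun o => K o * cos (x o)) = mean P K * expR (- (2^-1 * (sqnorm lam * (t - s)))).
Proof.
move=> bK aK; pose F b0 b1 b2 o := K o * (trig b0 (lam 0 0 * D 0 o) * trig b1 (lam 0 (inord 1) * D (inord 1) o)
     * trig b2 (lam 0 (inord 2) * D (inord 2) o)).
have bF b0 b1 b2 : bounded_measurable (F b0 b1 b2) by exact: bt.
rewrite (_ : (fun o => _) = (fun o => F false false false o - F true true false o -
   (F true false true o + F false true true o))).
  rewrite meanB; [|exact: bounded_measurableB|exact: bounded_measurableD].
  by rewrite meanB// meanD// !mean_trig//= addr0 !subr0.
apply/funext => o; rewrite xE !(cosD, sinD) /F /trig.
by move: (cos _) (cos _) (cos _) (sin _) (sin _) (sin _) => *; ring.
Qed.

Lemma mean_sin_increment K : bounded_measurable K -> adapted g (past s) K ->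
  mean P (fun o => K o * sin (x o)) = 0.
Proof.
move=> bK aK; pose F b0 b1 b2 o := K o * (trig b0 (lam 0 0 * D 0 o) * trig b1 (lam 0 (inord 1) * D (inord 1) o)
     * trig b2 (lam 0 (inord 2) * D (inord 2) o)).
have bF b0 b1 b2 : bounded_measurable (F b0 b1 b2) by exact: bt.
rewrite (_ : (fun o => _) = (fun o => F true false false o + F false true false o +
   (F false false true o - F true true true o))).
  rewrite meanD; [|exact: bounded_measurableD|exact: bounded_measurableB].
  by rewrite meanD// meanB// !mean_trig//= subr0 !addr0.
apply/funext => o; rewrite xE !(cosD, sinD) /F /trig.
by move: (cos _) (cos _) (cos _) (sin _) (sin _) (sin _) => *; ring.
Qed.

End OneStep.

Let mg : measurable_process g. Proof. by case: hg. Qed.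

Lemma adapted_dot (lam : 'rV[R]_3) s t : 0 <= s <= t -> adapted g (past t) (fun o => dot lam (g s o)).
Proof.
move=> st; apply: adapted_sum => k.
by apply: adaptedM; [exact: adapted_cst|exact: adapted_coord].
Qed.

(** The same passage from one time to the next as for the area, with the weights now adapted: the
    increment rotates the pair, its sine has mean 0 and its cosine multiplies the mean by the
    Gaussian factor. *)
Lemma brownian_chain s l G1 G2 : 0 <= s -> sorted (@mark_le R) l -> (forall p, p \in l -> s <= p.1) ->
  bounded_measurable G1 -> bounded_measurable G2 -> adapted g (past s) G1 -> adapted g (past s) G2 ->
  mean P (fun o => G1 o * cos (tested (g^~ o) s l) - G2 o * sin (tested (g^~ o) s l)) =
  mean P G1 * expR (- (2^-1 * variance_along id s l)).
Proof.
elim: l s G1 G2 => [|p l IH] s G1 G2 s0 sl hs b1 b2 a1 a2.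
  rewrite /variance_along big_nil mulr0 oppr0 expR0 mulr1.
  by congr (mean P _); apply/funext => o; rewrite /tested big_nil cos0 sin0 mulr0 subr0 mulr1.
move: sl; rewrite /= path_sortedE; last exact: mark_le_trans.
move=> /andP[/allP pl sl]; have sp : s <= p.1 by apply: hs; rewrite mem_head.
have p0 : 0 <= p.1 by exact: le_trans sp.
set lam := weight (p :: l).
pose x o := dot lam (g p.1 o) - dot lam (g s o).
have ax : adapted g (past p.1) x.
  rewrite /x; under eq_fun do rewrite -mulN1r; apply: adaptedD; first by apply: adapted_dot; rewrite p0 lexx.
  by apply: adaptedM; [exact: adapted_cst|apply: adapted_dot; rewrite s0].
have mx : measurable_fun setT x := adapted_measurable mg (@past_ge0 _ p.1) ax.
have bcx := bounded_measurable_cos mx; have bsx := bounded_measurable_sin mx.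
have acx := adapted_continuous (@continuous_cos R) ax.
have asx := adapted_continuous (@continuous_sin R) ax.
have a1' := adapted_sub (past_sub sp) a1; have a2' := adapted_sub (past_sub sp) a2.
have e : (fun o => G1 o * cos (tested (g^~ o) s (p :: l)) - G2 o * sin (tested (g^~ o) s (p :: l))) =
   (fun o => (G1 o * cos (x o) - G2 o * sin (x o)) * cos (tested (g^~ o) p.1 l) -
     (G1 o * sin (x o) + G2 o * cos (x o)) * sin (tested (g^~ o) p.1 l)).
  apply/funext => o; rewrite tested_cons -/lam -/(x o) cosD sinD.
  by move: (cos _) (sin _) (cos _) (sin _) => *; ring.
rewrite e IH//; last first.
- by apply: adaptedD; exact: adaptedM.
- by under eq_fun do rewrite -mulNr -mulN1r; apply: adaptedD; do ?apply: adaptedM => //; exact: adapted_cst.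
- by apply: bounded_measurableD; exact: bounded_measurableM.
- by apply: bounded_measurableB; exact: bounded_measurableM.
rewrite variance_along_cons// -/lam.
have -> : mean P (fun o => G1 o * cos (x o) - G2 o * sin (x o)) = mean P G1 * expR (- (2^-1 * (sqnorm lam * (p.1 - s)))).
  (* Times may repeat, whereas the law of increments is stated for s < t only; a repeated time gives
     a zero increment. *)
  move: sp; rewrite le_eqVlt => /orP[/eqP sp|sp].
    rewrite -sp subrr mulr0 mulr0 oppr0 expR0 mulr1; congr (mean P _); apply/funext => o.
    by rewrite /x -sp subrr cos0 sin0 mulr1 mulr0 subr0.
  rewrite meanB; [|exact: bounded_measurableM|exact: bounded_measurableM].
  have st : 0 <= s < p.1 by rewrite s0.
  have ec := mean_cos_increment st lam b1 (a1 : adapted g (past s) G1).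
  have es := mean_sin_increment st lam b2 (a2 : adapted g (past s) G2).
  by rewrite -[RHS]subr0 -ec -[X in _ = _ - X]es.
by rewrite -mulrA -expRD; congr (_ * expR _); ring.
Qed.

Theorem brownian_fourier l (p0 : R) : (forall p, p \in l -> 0 <= p.1) ->
  mean P (fun o => cos (p0 + tested (g^~ o) 0 l)) = cos p0 * expR (- (2^-1 * variance_along id 0 l)).
Proof.
move=> l0; pose k := sort (@mark_le R) l.
have kl : perm_eq l k by rewrite perm_sym; exact/permPl/perm_sort.
have sk : sorted (@mark_le R) k := sort_sorted (@mark_le_total R) l.
have k0 p : p \in k -> 0 <= p.1 by rewrite mem_sort; exact: l0.
have bc c := bounded_measurable_cst T (c : R).
have ac c := @adapted_cst _ T R _ g (past 0) c.
have := brownian_chain (lexx 0) sk k0 (bc (cos p0)) (bc (sin p0)) (ac _) (ac _).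
rewrite mean_cst -(variance_along_perm _ _ kl) => <-.
by congr (mean P _); apply/funext => o; rewrite cosD /tested (perm_big _ kl).
Qed.

End BrownianIncrements.

(** * Brownian motion at times independent of it *)

Section RandomTimes.
Variable R : realType.

Lemma cvgn_sum (J : Type) (q : seq J) (F_ : J -> nat -> R) (F : J -> R) :
  (forall j, F_ j n @[n --> \oo] --> F j) ->
  \sum_(j <- q) F_ j n @[n --> \oo] --> \sum_(j <- q) F j.
Proof.
move=> hF; elim: q => [|j q IH]; first by rewrite big_nil; under eq_fun do rewrite big_nil; exact: cvg_cst.
by rewrite big_cons; under eq_fun do rewrite big_cons; exact: cvgD.
Qed.

Definition at_time (a : R -> R) (l : seq (mark R)) : seq (mark R) := [seq (a p.1, p.2) | p <- l].

(** For nonnegative x, rounding down to a multiple of 1 / (n + 1), capped at n + 1. Having finitely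
    many values, it allows a random time to be split into constant ones. *)
Definition staircase (n : nat) (x : R) : R :=
  n.+1%:R^-1 * \sum_(j < n.+1 * n.+1) (j.+1%:R <= n.+1%:R * x)%R%:R.

Lemma staircase_ge0 n x : 0 <= staircase n x.
Proof. by rewrite mulr_ge0 ?invr_ge0// sumr_ge0. Qed.

Lemma staircase_values n x :
  staircase n x \in [seq n.+1%:R^-1 * j%:R | j <- iota 0 (n.+1 * n.+1).+1].
Proof.
apply/mapP; exists (\sum_(j < n.+1 * n.+1) (j.+1%:R <= n.+1%:R * x)%R)%N; last by rewrite natr_sum.
rewrite mem_iota/= add0n ltnS.
apply: leq_trans (_ : \sum_(j < n.+1 * n.+1) 1 <= _)%N.
  by apply: leq_sum => j _; case: (_ <= _).
by rewrite sum1_card card_ord.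
Qed.

Lemma measurable_staircase n : measurable_fun setT (staircase n).
Proof.
apply: measurable_funM => //; apply: measurable_sum => j.
have := @measurable_indic _ R R setT `[n.+1%:R^-1 * j.+1%:R, +oo[ (measurable_itv _).
congr measurable_fun; apply/funext => x; rewrite indicE; congr ((nat_of_bool _)%:R).
have n0 : 0 < n.+1%:R :> R by [].
by apply/idP/idP => [|h]; [rewrite inE/= in_itv/= andbT|rewrite inE/= in_itv/= andbT];
  rewrite ler_pdivrMl.
Qed.

Lemma staircase_cvg x : 0 <= x -> staircase n x @[n --> \oo] --> x.
Proof.
move=> x0; apply/cvgrPdist_le => e e0; near=> n.
have n0 : 0 < n.+1%:R :> R by [].
have [h1 h2 _] := @sum_le_indic R (n.+1%:R * x) (n.+1 * n.+1) (mulr_ge0 (ltW n0) x0).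
have xn : x <= n%:R by near: n; exact: nbhs_infty_ger.
have en : e^-1 <= n%:R by near: n; exact: nbhs_infty_ger.
have n1 : n%:R <= n.+1%:R :> R by rewrite ler_nat.
have {}h2 : n.+1%:R * x - 1 <= \sum_(j < n.+1 * n.+1) (j.+1%:R <= n.+1%:R * x)%R%:R.
  by apply: h2; rewrite natrM ler_pM2l// (le_trans xn).
rewrite /staircase; move: (\sum_(j < _) _) h1 h2 => S h1 h2.
have -> : x - n.+1%:R^-1 * S = n.+1%:R^-1 * (n.+1%:R * x - S) by field; rewrite gt_eqF.
rewrite normrM ger0_norm ?invr_ge0 ?(ltW n0)// ger0_norm ?subr_ge0//.
rewrite ler_pdivrMl//; apply: le_trans (_ : 1 <= _); first by lra.
by rewrite -ler_pdivrMr// mul1r (le_trans en).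
Unshelve. all: by end_near.
Qed.

Context d (T : measurableType d) (P : probability T R).
Variables (g : R -> T -> 'rV[R]_3) (r : R -> T -> R).
Hypothesis hg : brownian_motion P g.
Hypothesis mr : measurable_process r.
Hypothesis gr : independent_processes P g r.
Implicit Types (l m : seq (mark R)) (Z F : T -> R).
Local Notation halfline := (`[0, +oo[%classic : set R).

Let mg : measurable_process g. Proof. by case: hg. Qed.

(** Independence is given on events; two orthogonality arguments, each with one factor centred, free
    first Z and then F. *)
Lemma independent_mean F Z : bounded_measurable F -> bounded_measurable Z ->
  adapted g halfline F -> adapted r halfline Z ->
  mean P (fun o => F o * Z o) = mean P F * mean P Z.
Proof.
move=> bF bZ aF aZ.
have [M M0 FM] := bounded_measurable_pos bF; have [N N0 ZN] := bounded_measurable_pos bZ.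
have bc c := bounded_measurable_cst T (c : R).
have hA A : sigma_process g halfline A -> mean P (fun o => \1_A o * Z o) = fine (P A) * mean P Z.
  move=> gA; have mA : measurable A by exact: mg.
  have bA := bounded_measurable_indic R mA.
  have : mean P (fun o => (\1_A o - fine (P A)) * Z o) = 0.
    apply: (mean_orthogonal mr _ _ _ aZ N0 ZN) => //; first exact: bounded_measurableB.
    move=> B rB; have mB : measurable B by exact: mr.
    have bB := bounded_measurable_indic R mB.
    have -> : (fun o => (\1_A o - fine (P A)) * \1_B o) = (fun o => \1_(A `&` B) o - fine (P A) * \1_B o).
      by apply/funext => o; rewrite indicI/=; ring.
    rewrite meanB; [|by apply: bounded_measurable_indic; exact: measurableI|exact: bounded_measurableM].
    rewrite meanZ// !mean_indic//; last exact: measurableI.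
    by rewrite gr// fineM ?fin_num_measure// subrr.
  have -> : (fun o => (\1_A o - fine (P A)) * Z o) = (fun o => \1_A o * Z o - fine (P A) * Z o).
    by apply/funext => o; ring.
  rewrite meanB ?meanZ//; [|exact: bounded_measurableM|exact: bounded_measurableM].
  by move/eqP; rewrite subr_eq0 => /eqP.
have : mean P (fun o => (Z o - mean P Z) * F o) = 0.
  apply: (mean_orthogonal mg _ _ _ aF M0 FM) => //; first exact: bounded_measurableB.
  move=> A gA; have mA : measurable A by exact: mg.
  have bA := bounded_measurable_indic R mA.
  have -> : (fun o => (Z o - mean P Z) * \1_A o) = (fun o => \1_A o * Z o - mean P Z * \1_A o).
    by apply/funext => o; ring.
  rewrite meanB ?meanZ//; [|exact: bounded_measurableM|exact: bounded_measurableM].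
  by rewrite hA// mean_indic// mulrC subrr.
have -> : (fun o => (Z o - mean P Z) * F o) = (fun o => F o * Z o - mean P Z * F o).
  by apply/funext => o; ring.
rewrite meanB ?meanZ//; [|exact: bounded_measurableM|exact: bounded_measurableM].
by move/eqP; rewrite subr_eq0 => /eqP ->; rewrite mulrC.
Qed.

Lemma adapted_comp_measurable (E : topologicalType) (X : R -> T -> E) I (h : R -> R) K :
  measurable_fun setT h -> adapted X I K -> adapted X I (fun o => h (K o)).
Proof.
move=> mh aK B mB; have := aK (h @^-1` B).
by apply; rewrite -[X in measurable X]setTI; exact: mh.
Qed.

Section Discrete.
Variables (h : R -> R) (V : seq R) (A : R -> T -> R).
Hypothesis mh : measurable_fun setT h.
Hypothesis hV : forall x, h x \in V.
Hypothesis V0 : forall v, v \in V -> 0 <= v.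

Let value v x : R := (h x == v)%R%:R.

Let adapted_value v K : adapted r halfline K -> adapted r halfline (fun o => value v (K o)).
Proof.
apply: adapted_comp_measurable.
have := @measurable_indic _ R R setT (h @^-1` [set v]).
rewrite -[X in measurable X -> _]setTI => /(_ (mh measurableT (measurable_set1 v))).
congr measurable_fun; apply/funext => x; rewrite /value indicE; congr ((nat_of_bool _)%:R).
by apply/idP/idP => [|/eqP hx]; rewrite inE/= => // ->.
Qed.

Let sum_value (f : R -> R) x : \sum_(v <- undup V) value v x * f v = f (h x).
Proof.
have hx : h x \in undup V by rewrite mem_undup.
rewrite (bigD1_seq (h x))//= ?undup_uniq// /value eqxx mul1r big1 ?addr0// => v vx.
by rewrite eq_sym (negbTE vx) mul0r.
Qed.

(** Induction over the marks at random times: each moves to the list m of marks at fixed times by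
    splitting over the finitely many values of its time, and the indicator of the value is absorbed
    in the weight Z. When none is left, F factors by independence. *)
Lemma discrete_times l m Z (p0 : R) : (forall p, p \in l -> adapted r halfline (A p.1)) ->
  (forall p, p \in m -> 0 <= p.1) -> bounded_measurable Z -> adapted r halfline Z ->
  let k o := m ++ at_time (fun t => h (A t o)) l in
  let F o := cos (p0 + tested (g ^~ o) 0 (k o)) * Z o in
  let F' o := expR (- (2^-1 * variance_along id 0 (k o))) * Z o in
  [/\ bounded_measurable F, bounded_measurable F' & mean P F = cos p0 * mean P F'].
Proof.
elim: l m Z => [|p l IH] m Z lA m0 bZ aZ k F F'.
  pose G o := cos (p0 + tested (g ^~ o) 0 m).
  pose c := expR (- (2^-1 * variance_along id 0 m)).
  have kE o : k o = m by rewrite /k cats0.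
  have FE : F = (fun o => G o * Z o) by apply/funext => o; rewrite /F kE.
  have F'E : F' = (fun o => c * Z o) by apply/funext => o; rewrite /F' kE.
  have aG : adapted g halfline G.
    apply: adapted_continuous; first exact: continuous_cos.
    apply: adaptedD; first exact: adapted_cst.
    rewrite /tested; elim: (m) m0 => [|q j IHm] j0.
      by under [X in adapted _ _ X]eq_fun do rewrite big_nil; exact: adapted_cst.
    under [X in adapted _ _ X]eq_fun do rewrite big_cons -[X in (_ + X) + _]mulN1r.
    apply: adaptedD; last by apply: IHm => q' q'j; apply: j0; rewrite inE q'j orbT.
    have q0 : 0 <= q.1 by apply: j0; rewrite mem_head.
    apply: adaptedD; last (apply: adaptedM; first exact: adapted_cst).
      by apply: (adapted_sub (@past_ge0 _ q.1)); apply: adapted_dot; rewrite q0 lexx.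
    by apply: (adapted_sub (@past_ge0 _ 0)); apply: adapted_dot; rewrite lexx.
  have bG : bounded_measurable G.
    by split; [exact: (adapted_measurable mg _ aG)|exists 1 => o; exact: cos_max].
  rewrite FE F'E; split; [exact: bounded_measurableM|by apply: bounded_measurableM => //; exact: bounded_measurable_cst|].
  by rewrite independent_mean// meanZ// brownian_fourier// -mulrA.
pose m' v := rcons m (v, p.2).
pose Zv v o := value v (A p.1 o) * Z o.
have ap := lA p (mem_head _ _).
have av v : adapted r halfline (fun o => value v (A p.1 o)) by exact: adapted_value.
have bv v : bounded_measurable (fun o => value v (A p.1 o)).
  split; first exact: (adapted_measurable mr _ (av v)).
  by exists 1 => o; rewrite /value; case: (_ == _); rewrite ?normr1 ?normr0.
have bZv v : bounded_measurable (Zv v) by exact: bounded_measurableM.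
have aZv v : adapted r halfline (Zv v) by exact: adaptedM.
have lA' q : q \in l -> adapted r halfline (A q.1) by move=> ql; apply: lA; rewrite inE ql orbT.
have m'0 v : v \in undup V -> forall q, q \in m' v -> 0 <= q.1.
  by rewrite mem_undup => /V0 v0 q; rewrite mem_rcons inE => /orP[/eqP ->//|]; exact: m0.
pose kv v o := m' v ++ at_time (fun t => h (A t o)) l.
have kE o : k o = kv (h (A p.1 o)) o by rewrite /k /kv /m' cat_rcons.
pose Fv v o := cos (p0 + tested (g ^~ o) 0 (kv v o)) * Zv v o.
pose F'v v o := expR (- (2^-1 * variance_along id 0 (kv v o))) * Zv v o.
have FE : F = (fun o => \sum_(v <- undup V | v \in undup V) Fv v o).
  apply/funext => o; rewrite -big_seq /F kE -(sum_value (fun v => cos (p0 + tested (g^~ o) 0 (kv v o)) * Z o)).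
  by apply: eq_bigr => v _; rewrite /Fv /Zv; ring.
have F'E : F' = (fun o => \sum_(v <- undup V | v \in undup V) F'v v o).
  apply/funext => o; rewrite -big_seq /F' kE -(sum_value (fun v => expR (- (2^-1 * variance_along id 0 (kv v o))) * Z o)).
  by apply: eq_bigr => v _; rewrite /F'v /Zv; ring.
have H v (vV : v \in undup V) := IH (m' v) (Zv v) lA' (m'0 v vV) (bZv v) (aZv v).
rewrite FE F'E; split.
- by apply: bounded_measurable_sum => v /H[].
- by apply: bounded_measurable_sum => v /H[].
- rewrite !mean_sum; [|by move=> v /H[]|by move=> v /H[]].
  by rewrite mulr_sumr; apply: eq_bigr => v /H[_ _].
Qed.

Lemma measurable_discrete_time t (i : 'I_3) : adapted r halfline (A t) ->
  measurable_fun setT (fun o => g (h (A t o)) o 0 i).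
Proof.
move=> aA; have -> : (fun o => g (h (A t o)) o 0 i) =
    (fun o => \sum_(v <- undup V | v \in undup V) value v (A t o) * g v o 0 i).
  by apply/funext => o; rewrite -big_seq (sum_value (fun v => g v o 0 i)).
have mv v : v \in undup V -> measurable_fun setT (fun o => value v (A t o) * g v o 0 i).
  rewrite mem_undup => /V0 v0; apply: measurable_funM; last exact: (measurable_coord hg).
  exact: (adapted_measurable mr _ (adapted_value _ aA)).
under eq_fun do rewrite big_mkcond; apply: measurable_sum => v.
by case: (boolP (v \in undup V)) => [/mv//|_]; exact: measurable_cst.
Qed.

End Discrete.

Variable A : R -> T -> R.
Hypothesis A0 : forall t o, 0 <= A t o.

Let V n : seq R := [seq n.+1%:R^-1 * j%:R | j <- iota 0 (n.+1 * n.+1).+1].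
Let V0 n v : v \in V n -> 0 <= v.
Proof. by move=> /mapP[j _ ->]; rewrite mulr_ge0// invr_ge0. Qed.

Let g_cvg o t (i : 'I_3) : g (staircase n (A t o)) o 0 i @[n --> \oo] --> g (A t o) o 0 i.
Proof.
have cg : continuous (fun s : R => g (Num.max 0 s) o).
  by apply: (@continuous_extension _ _ (g ^~ o)); case: hg => _ + _ _; exact.
have e s : 0 <= s -> g s o 0 i = g (Num.max 0 s) o 0 i by move=> s0; rewrite max_r.
rewrite e//; under eq_fun do rewrite e ?staircase_ge0//.
apply: (cvg_comp (fun n => staircase n (A t o)) (fun s : R => g (Num.max 0 s) o 0 i)); first exact: staircase_cvg.
exact: (continuous_comp (cg _) (@coord_continuous3 _ i _)).
Qed.

Lemma measurable_at_time t (i : 'I_3) : adapted r halfline (A t) ->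
  measurable_fun setT (fun o => g (A t o) o 0 i).
Proof.
move=> aA; apply: (@measurable_fun_cvg _ _ _ _ (fun n o => g (staircase n (A t o)) o 0 i)).
  by move=> n; apply: (measurable_discrete_time (measurable_staircase n) (staircase_values n) (@V0 n)).
by move=> o _; exact: g_cvg.
Qed.

(** Staircase times converge to the true ones, and continuity of the paths of g and of the minimum
    carries the discrete identity to the limit under a fixed bound. *)
Theorem random_times l Z (p0 : R) : (forall p, p \in l -> adapted r halfline (A p.1)) ->
  bounded_measurable Z -> adapted r halfline Z ->
  mean P (fun o => cos (p0 + tested (g ^~ o) 0 (at_time (A ^~ o) l)) * Z o) =
  cos p0 * mean P (fun o => expR (- (2^-1 * variance_along id 0 (at_time (A ^~ o) l))) * Z o).
Proof.
move=> lA bZ aZ.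
have [M M0 ZM] := bounded_measurable_pos bZ.
pose k n o := at_time (fun t => staircase n (A t o)) l.
pose F n o := cos (p0 + tested (g ^~ o) 0 (k n o)) * Z o.
pose F' n o := expR (- (2^-1 * variance_along id 0 (k n o))) * Z o.
have hn n : [/\ bounded_measurable (F n), bounded_measurable (F' n) & mean P (F n) = cos p0 * mean P (F' n)].
  have m0 (p : mark R) : p \in [::] -> 0 <= p.1 by [].
  exact: (discrete_times (measurable_staircase n) (staircase_values n) (@V0 n) p0 lA m0 bZ aZ).
have cF o : F n o @[n --> \oo] --> cos (p0 + tested (g ^~ o) 0 (at_time (A ^~ o) l)) * Z o.
  apply: cvgM; last exact: cvg_cst.
  apply: (cvg_comp _ cos); last exact: continuous_cos.
  apply: cvgD; first exact: cvg_cst.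
  rewrite /tested /k /at_time big_map; under eq_fun do rewrite big_map.
  apply: cvgn_sum => p /=; apply: cvgB; last exact: cvg_cst.
  by apply: cvgn_sum => i; apply: cvgM; [exact: cvg_cst|exact: g_cvg].
have cF' o : F' n o @[n --> \oo] --> expR (- (2^-1 * variance_along id 0 (at_time (A ^~ o) l))) * Z o.
  apply: cvgM; last exact: cvg_cst.
  apply: (cvg_comp _ expR); last exact: continuous_expR.
  apply: cvgN; apply: cvgM; first exact: cvg_cst.
  rewrite /variance_along /k /at_time big_map; under eq_fun do rewrite big_map.
  apply: cvgn_sum => p; rewrite big_map; under eq_fun do rewrite big_map.
  apply: cvgn_sum => q /=; apply: cvgM; first exact: cvg_cst.
  apply: cvgB; last exact: cvg_cst.
  have cA t := staircase_cvg (A0 t o).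
  rewrite minr_absE (funext (fun n => minr_absE (staircase n (A p.1 o)) (staircase n (A q.1 o)))).
  apply: cvgM; last exact: cvg_cst.
  by apply: cvgB; [exact: cvgD|apply: cvg_norm; exact: cvgB].
have bF n o : `|F n o| <= M.
  by rewrite normrM -[M]mul1r ler_pM// cos_max.
have bF' n o : `|F' n o| <= M.
  rewrite normrM -[M]mul1r ler_pM// ger0_norm ?expR_ge0// expR_le1 oppr_le0 mulr_ge0//.
  apply: variance_along_ge0 => // p /mapP[q _ ->] /=; exact: staircase_ge0.
apply: (@lim_unique R (fun n => mean P (F n))).
  apply: (@cvg_mean _ _ _ P _ _ M) => //.
  - by move=> n; case: (hn n) => -[].
  - by apply: (@measurable_fun_cvg _ _ _ _ F) => [n|o _ //]; case: (hn n) => -[].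
  - exact: aeW.
have e n : mean P (F n) = cos p0 * mean P (F' n) by case: (hn n).
rewrite (funext e).
apply: cvgM; first exact: cvg_cst.
apply: (@cvg_mean _ _ _ P _ _ M) => //.
- by move=> n; case: (hn n) => _ [].
- by apply: (@measurable_fun_cvg _ _ _ _ F') => [n|o _ //]; case: (hn n) => _ [].
- exact: aeW.
Qed.

End RandomTimes.

(** * The time-changed Brownian motion *)

Section TimeChange.
Context (R : realType) d (T : measurableType d) (P : probability T R).
Variables (g : R -> T -> 'rV[R]_3) (r : R -> T -> R).
Hypothesis hg : brownian_motion P g.
Hypothesis mr : measurable_process r.
Hypothesis cr : continuous_process r.
Hypothesis gr : independent_processes P g r.
Implicit Types (l : seq (mark R)) (s t : R) (o : T).
Local Notation halfline := (`[0, +oo[%classic : set R).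

Definition cos2 (x : R -> R) s : R := cos (x (Num.max 0 s)) ^+ 2.
Let X o := cos2 (r ^~ o).

Lemma cos2_01 (x : R -> R) s : 0 <= cos2 x s <= 1.
Proof.
by rewrite /cos2 sqr_ge0/= -real_normK ?num_real// exprn_ile1// cos_max.
Qed.

Lemma continuous_cos_sqr : continuous (fun x : R => cos x ^+ 2).
Proof.
move=> x; rewrite /continuous_at; under eq_fun do rewrite expr2; rewrite expr2.
by apply: cvgM; exact: continuous_cos.
Qed.

Lemma continuous_cos2 (x : R -> R) : {within `[0, +oo[, continuous x} -> continuous (cos2 x).
Proof.
move=> /continuous_extension cx s.
exact: (continuous_comp (cx s) (@continuous_cos_sqr _)).
Qed.

Lemma rate_cos2 (z : R) : rate (cos z ^+ 2) = tan z ^+ 2.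
Proof.
rewrite /rate /tan; have [->|c0] := eqVneq (cos z) 0; first by rewrite expr0n/= invr0 !mulr0 expr0n.
by rewrite -(cos2Dsin2 z) exprMn exprVn; congr (_ * _); ring.
Qed.

(** Both sides are the real part of one extended integral, so they agree, with the value 0, even
    where that integral is infinite. *)
Lemma finite_clock_cos2 (x : R -> R) t :
  finite_clock (cos2 x) t = \int[lebesgue_measure]_(s in `[0, t]) tan (x s) ^+ 2.
Proof.
rewrite /finite_clock /extended_clock /Rintegral; congr fine; apply: eq_integral => s.
by rewrite inE/= in_itv/= => /andP[s0 _]; rewrite rate_cos2 max_r.
Qed.

Lemma finite_clock0 (x : R -> R) : finite_clock x 0 = 0.
Proof. by rewrite /finite_clock /extended_clock set_itv1 integral_set1. Qed.

Lemma finite_clock_ge0 (x : R -> R) t : (forall s, 0 <= x s <= 1) -> 0 <= finite_clock x t.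
Proof. by move=> x01; rewrite fine_ge0// extended_clock_ge0. Qed.

Let adapted_cos2 s : adapted r halfline (fun o => X o s).
Proof.
apply: (@adapted_comp _ _ _ _ r halfline (Num.max 0 s) (fun x : R => cos x ^+ 2)).
  by rewrite /= in_itv/= le_max lexx.
exact: continuous_cos_sqr.
Qed.

Let S := g_sigma_algebraType (events r halfline).

(** Adaptedness is measurability for the sigma-algebra generated by r. The measurability contained
    in [closure_cut_clock] is reused on that measurable space, with a Dirac mass as an arbitrary
    probability. *)
Lemma adapted_finite_clock t : adapted r halfline (fun o => finite_clock (X o) t).
Proof.
have [t0|t0] := leP 0 t; last first.
  rewrite (_ : (fun o => _) = (fun=> 0)); first exact: adapted_cst.
  apply/funext => o; rewrite /finite_clock /extended_clock (_ : [set` _] = set0) ?integral_set0//.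
  by rewrite set_itv_ge// bnd_simp -ltNge.
apply/adaptedP.
have cX (o : S) : continuous (X o) by apply: continuous_cos2; exact: cr.
have X01 (o : S) s : 0 <= X o s <= 1 by exact: cos2_01.
have mX s : measurable_fun setT (fun o : S => X o s) by apply/adaptedP; exact: adapted_cos2.
apply: (@measurable_finite_clock _ _ S) => // k.
have tt : 0 <= t <= t by rewrite t0 lexx.
have := closure_cut_clock (dirac (point : S)) (dirac (point : S)) cX cX X01 X01 mX mX k tt.
by case/closure_bounded => -[].
Qed.

Lemma adapted_monomial l : adapted r halfline (fun o => monomial (X o) l).
Proof.
rewrite /monomial; apply: adapted_prod => p.
apply: (@adapted_comp_measurable _ _ _ _ _ _ (fun x : R => x ^+ p.2.2)); last exact: adapted_cos2.
exact: measurable_funX.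
Qed.

(** After [random_times] the covariances involve the minimum of two clock values; monotonicity of
    the clock turns it into the clock at the minimum of the two times. *)
Theorem time_changed l p0 t : before t l -> {ae P, forall o, (extended_clock (X o) t < +oo)%E} ->
  mean P (fun o => cos (p0 + tested (fun s => g (finite_clock (X o) s) o) 0 l) * monomial (X o) l) =
  cos p0 * mean P (fun o => expR (- (2^-1 * variance_along (finite_clock (X o)) 0 l)) * monomial (X o) l).
Proof.
move=> lt fin; pose A s o := finite_clock (X o) s.
have X01 o s : 0 <= X o s <= 1 by exact: cos2_01.
have cX o : continuous (X o) by apply: continuous_cos2; exact: cr.
have A0 s o : 0 <= A s o by exact: finite_clock_ge0.
have aA p : p \in l -> adapted r halfline (A p.1) by move=> _; exact: adapted_finite_clock.
have aM := adapted_monomial l.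
have mM : measurable_fun setT (fun o => monomial (X o) l) := adapted_measurable mr (fun _ h => h) aM.
have bM : bounded_measurable (fun o => monomial (X o) l).
  split=> //; exists 1 => o; have /andP[h0 h1] := monomial01 l (X01 o).
  by rewrite ger0_norm.
have := random_times hg mr gr A0 p0 aA bM aM.
have -> : (fun o => cos (p0 + tested (g^~ o) 0 (at_time (A^~ o) l)) * monomial (X o) l) =
   (fun o => cos (p0 + tested (fun s => g (finite_clock (X o) s) o) 0 l) * monomial (X o) l).
  apply/funext => o; congr (cos (_ + _) * _).
  by rewrite /tested /at_time big_map finite_clock0.
move=> ->; congr (_ * _).
have mA s : measurable_fun setT (A s) := adapted_measurable mr (fun _ h => h) (adapted_finite_clock s).
have me (F : T -> R) : measurable_fun setT F -> measurable_fun setT (fun o => expR (- (2^-1 * F o)) * monomial (X o) l).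
  move=> mF; apply: measurable_funM => //; apply: measurableT_comp => //.
  by apply: measurableT_comp => //; exact: measurable_funM.
apply: ae_eq_mean.
- apply: me; rewrite /variance_along /at_time; under eq_fun do rewrite big_map.
  apply: measurable_sum => p; under eq_fun do rewrite big_map; apply: measurable_sum => q /=.
  by apply: measurable_funM => //; apply: measurable_funB => //; exact: measurable_minr.
- apply: me; apply: measurable_sum => p; apply: measurable_sum => q.
  by apply: measurable_funM => //; apply: measurable_funB; exact: mA.
- apply: filterS fin => o fino; congr (expR (- (_ * _)) * _).
  have t0 s : 0 <= s <= t -> extended_clock (X o) s \is a fin_num.
    move=> /andP[_ st]; rewrite ge0_fin_numE ?extended_clock_ge0//.
    exact: le_lt_trans (le_extended_clock (cX o) (X01 o) st) fino.
  (* An infinite clock has real value 0, which would break monotonicity; hence the restriction to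
     almost all o. *)
  have Ah : {in [pred s | 0 <= s <= t] &, {homo A^~ o : s u / s <= u}}.
    by move=> s u st ut su; apply: fine_le; [exact: t0|exact: t0|exact: le_extended_clock].
  rewrite /variance_along /at_time big_map; apply: eq_big_seq => p /lt pt.
  rewrite big_map; apply: eq_big_seq => q /lt qt /=; congr (_ * (_ - _)); last first.
    by rewrite -/(A _ _) /A finite_clock0.
  rewrite -/(A _ _); have [pq|qp] := leP p.1 q.1.
    by rewrite min_l// Ah.
  by rewrite min_r// Ah// ltW.
Qed.

End TimeChange.

(** * Comparison of the laws *)

Section PathSpace.
Variable R : realType.
Local Notation halfline := (`[0, +oo[%classic : set R).

Lemma sigma_process_algebra (S : Type) (E : topologicalType) (X : R -> S -> E) (I : set R) :
  sigma_algebra setT (sigma_process X I).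
Proof. exact: smallest_sigma_algebra. Qed.

Lemma sigma_algebra_pullback (S V : Type) (f : S -> V) (G : set (set S)) :
  sigma_algebra setT G -> sigma_algebra setT [set B | G (f @^-1` B)].
Proof.
move=> [h0 hC hU]; split; first by rewrite /= preimage_set0.
- by move=> A /= hA; rewrite setTD -preimage_setC -setTD; exact: hC.
- by move=> F /= hF; rewrite preimage_bigcup; exact: hU.
Qed.

Lemma path_preimage (S : Type) (E : topologicalType) (X : R -> S -> E) (C : set (R -> E)) :
  path_sigma C -> sigma_process X halfline [set o | C (X ^~ o)].
Proof.
move: C; apply: smallest_sub.
  exact: (sigma_algebra_pullback (fun o => X ^~ o) (sigma_process_algebra X halfline)).
by move=> _ [u [U [hu oU ->]]]; apply: sub_sigma_algebra; exists u, U.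
Qed.

Lemma measurable_process_comp d (T : measurableType d) (E F : topologicalType)
    (X : R -> T -> E) (f : E -> F) : continuous f -> measurable_process X ->
  measurable_process (fun t o => f (X t o)).
Proof.
move=> cf mX; apply: smallest_sub; first exact: sigma_algebra_measurable.
move=> _ [u [U [hu oU ->]]]; apply: mX; apply: sub_sigma_algebra.
by exists u, (f @^-1` U); split => //; move/continuousP: cf; exact.
Qed.

Lemma coordinate_event (h : R -> R) s (B : set R) : 0 <= s -> continuous h -> measurable B ->
  path_sigma [set x : R -> R | B (h (x s))].
Proof.
move=> s0 ch mB.
have {mB} : (@measurable _ (measurableTypeR R)) B := mB.
rewrite RGenOInfty.measurableE; move: B; apply: smallest_sub.
  exact: (sigma_algebra_pullback (fun x : R -> R => h (x s)) (sigma_process_algebra _ _)).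
move=> _ [c ->]; apply: sub_sigma_algebra; exists s, (h @^-1` `]c, +oo[%classic).
split => //; first by rewrite /= in_itv/= s0.
by move/continuousP: ch; apply; rewrite set_itvE; exact: open_gt.
Qed.

Context d (T : measurableType d) d' (T' : measurableType d').
Variables (P : probability T R) (P' : probability T' R).

Section Events.
Variable E : topologicalType.
Variables (Y : R -> T -> E) (Y' : R -> T' -> E).
Hypotheses (mY : measurable_process Y) (mY' : measurable_process Y').

Definition event_pair (f : T -> R) (f' : T' -> R) := exists2 C, path_sigma C &
  f = \1_[set o | C (Y ^~ o)] /\ f' = \1_[set o | C (Y' ^~ o)].

Lemma closure_event C : path_sigma C ->
  closure P P' event_pair (\1_[set o | C (Y ^~ o)]) (\1_[set o | C (Y' ^~ o)]).
Proof.
move=> hC; apply: closure_base; last by exists C.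
- by apply: bounded_measurable_indic; apply: mY; exact: path_preimage.
- by apply: bounded_measurable_indic; apply: mY'; exact: path_preimage.
Qed.

Lemma event_pairM f f' k k' : event_pair f f' -> event_pair k k' ->
  closure P P' event_pair (fun o => f o * k o) (fun o => f' o * k' o).
Proof.
move=> [C hC [-> ->]] [D hD [-> ->]].
have hCD : path_sigma (C `&` D).
  rewrite -[C]setCK -[D]setCK -setCU -bigcup2E; have [_ hN hU] := @sigma_process_algebra _ E (fun t (x : R -> E) => x t) halfline.
  rewrite -setTD; apply: (hN); apply: (hU) => -[|[|i]] /=; rewrite ?[bigcup2 _ _ _]/=.
  - by rewrite -setTD; exact: (hN).
  - by rewrite -setTD; exact: (hN).
  - by case: (@sigma_process_algebra _ E (fun t (x : R -> E) => x t) halfline).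
have := closure_event hCD.
by rewrite (_ : [set o | _] = [set o | C (Y^~ o)] `&` [set o | D (Y^~ o)])// indicI
  (_ : [set o | (C `&` D) _] = [set o | C (Y'^~ o)] `&` [set o | D (Y'^~ o)])// indicI.
Qed.

Lemma closure_event1 : closure P P' event_pair (fun=> 1) (fun=> 1).
Proof.
have hT : path_sigma [set: R -> E].
  have [h0 hN _] := @sigma_process_algebra _ E (fun t (x : R -> E) => x t) halfline.
  by have := hN _ h0; rewrite setD0.
by have := closure_event hT; rewrite !indicT.
Qed.

Lemma mean_event f f' : same_law P P' Y Y' -> closure P P' event_pair f f' -> mean P f = mean P' f'.
Proof.
move=> YY'; apply: closure_mean_eq => k k' [C hC [-> ->]].
rewrite !mean_indic; [by rewrite YY'| |].
- by apply: mY'; exact: path_preimage.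
- by apply: mY; exact: path_preimage.
Qed.

End Events.

Variables (Y : R -> T -> R) (Y' : R -> T' -> R).
Hypotheses (mY : measurable_process Y) (mY' : measurable_process Y').
Hypothesis YY' : same_law P P' Y Y'.

Lemma law_monomial l : mean P (fun o => monomial (cos2 (Y ^~ o)) l) =
  mean P' (fun o => monomial (cos2 (Y' ^~ o)) l).
Proof.
apply: (mean_event mY mY' YY').
have cM := event_pairM mY mY'; have c1 := closure_event1 mY mY'.
apply: (closure_prod cM c1) => p; apply: (closureX cM c1).
set s := Num.max 0 p.1; have s0 : 0 <= s by rewrite le_max lexx.
have ab e (S : measurableType e) (X : R -> S -> R) : measurable_process X ->
    bounded_measurable (fun o => cos2 (X ^~ o) p.1).
  move=> mX; split; last first.
    by exists 1 => o; have /andP[h0 h1] := cos2_01 (X ^~ o) p.1; rewrite ger0_norm.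
  apply: (adapted_measurable mX (fun _ h => h)).
  apply: (@adapted_comp _ _ _ _ X halfline s (fun x : R => cos x ^+ 2)); last exact: continuous_cos_sqr.
  by rewrite /= in_itv/= s0.
apply: (closure_le c1 (ab _ _ _ mY) (ab _ _ _ mY') ltr01).
- by move=> o; have /andP[h0 h1] := cos2_01 (Y ^~ o) p.1; rewrite ger0_norm.
- by move=> o; have /andP[h0 h1] := cos2_01 (Y' ^~ o) p.1; rewrite ger0_norm.
- move=> c; have hC := coordinate_event s0 (@continuous_cos_sqr R) (measurable_itv `[c, +oo[).
  have e S (X : R -> S -> R) : (fun o => (c <= cos2 (X ^~ o) p.1)%R%:R : R) =
      \1_[set o | `[c, +oo[%classic (cos (X s o) ^+ 2)].
    apply/funext => o; rewrite indicE /cos2 -/s; congr ((nat_of_bool _)%:R).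
    by apply/idP/idP => [h|]; rewrite inE/= in_itv/= ?andbT.
  by rewrite !e; exact: (closure_event mY mY' hC).
Qed.

Lemma law_coordinate s (B : set R) : 0 <= s -> measurable B ->
  {ae P, forall o, B (Y s o)} -> {ae P', forall o, B (Y' s o)}.
Proof.
move=> s0 mB hB; have cid : continuous (id : R -> R) by move=> x; exact: cvg_id.
have hC' := coordinate_event s0 cid (measurableC mB).
have m1 : measurable [set o | (~` B) (Y s o)] := mY (path_preimage (X := Y) hC').
have m2 : measurable [set o | (~` B) (Y' s o)] := mY' (path_preimage (X := Y') hC').
exists [set o | (~` B) (Y' s o)]; split => //.
apply: etrans (esym (YY' hC')) _.
apply/negligibleP => //.
Qed.

End PathSpace.

Section OpenPreimages.
Context (R : realType) d (S : measurableType d).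

(** The open set is the countable union of the boxes with rational centre and radius 1 / (n + 1)
    that it contains, and the preimage of a box is expressed by coordinates. *)
Lemma measurable_preimage_open (X : S -> R * 'rV[R]_3) (U : set (R * 'rV[R]_3)) :
  measurable_fun setT (fun o => (X o).1) ->
  (forall k, measurable_fun setT (fun o => (X o).2 0 k)) ->
  open U -> measurable (X @^-1` U).
Proof.
move=> m1 m2 oU.
pose I := (rat * {ffun 'I_3 -> rat} * nat)%type.
pose box (q : I) : set (R * 'rV[R]_3) := [set z : R * 'rV[R]_3 | `|ratr q.1.1 - z.1| < q.2.+1%:R^-1 /\
   forall k, `|ratr (q.1.2 k) - z.2 0 k| < q.2.+1%:R^-1].
have -> : X @^-1` U = \bigcup_(q in [set: I]) (X @^-1` (if pselect (box q `<=` U) then box q else set0)).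
  apply/seteqP; split; last by move=> o [q _] /=; case: pselect => // h; exact: h.
  move=> o Uo; have /nbhs_ballP[e /= e0 he] := open_nbhs_nbhs (conj oU Uo).
  have [n hn] : exists n, n.+1%:R^-1 < e / 2.
    exists (Num.bound (e / 2)^-1); rewrite invf_plt ?posrE ?divr_gt0//.
    apply: lt_le_trans (archi_boundP _) _; first by rewrite invr_ge0 divr_ge0// ltW.
    by rewrite ler_nat.
  have n0 : 0 < n.+1%:R^-1 :> R by rewrite invr_gt0.
  have rq (x : R) : exists q : rat, `|ratr q - x| < n.+1%:R^-1.
    have [|q] := @rat_in_itvoo R (x - n.+1%:R^-1) (x + n.+1%:R^-1).
      by apply: (@lt_trans _ _ x); rewrite ?gtrBl ?ltrDl.
    by rewrite in_itv/= => hq; exists q; rewrite ltr_distl.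
  have [q1 hq1] := rq (X o).1.
  have [q2 hq2] := boolp.choice (fun k => rq ((X o).2 0 k)).
  have bo : box (q1, [ffun k => q2 k], n) (X o).
    by split => //= k; rewrite ffunE.
  exists (q1, [ffun k => q2 k], n) => //; case: pselect => // nb; exfalso; apply: nb => z [/= hz1 hz2].
  apply: he; split => /=.
    rewrite -ball_normE /ball_/=; apply: le_lt_trans (ler_distD (ratr q1) _ _) _.
    by rewrite (distrC _ (ratr q1)) (splitr e); apply: ltrD; apply: lt_trans hn.
  split => // i k; rewrite ord1 -ball_normE /ball_/=.
  apply: le_lt_trans (ler_distD (ratr (q2 k)) _ _) _.
  rewrite (distrC _ (ratr (q2 k))) (splitr e); apply: ltrD; apply: lt_trans hn; first exact: hq2.
  by have := hz2 k; rewrite ffunE.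
apply: countable_bigcupT_measurable => [|q]; first exact: countableP.
case: ifP => _; last by rewrite preimage_set0.
have mlt (f : S -> R) (c e : R) : measurable_fun setT f -> measurable [set o | `|c - f o| < e].
  move=> mf; have := mf measurableT `]c - e, c + e[%classic (measurable_itv _); rewrite setTI.
  congr measurable; apply/seteqP; split => o /=; rewrite in_itv/= distrC ltr_distl//.
have -> : X @^-1` box q = [set o | `|ratr q.1.1 - (X o).1| < q.2.+1%:R^-1] `&`
    \bigcap_(k in [set: 'I_3]) [set o | `|ratr (q.1.2 k) - (X o).2 0 k| < q.2.+1%:R^-1].
  by apply/seteqP; split => o [h1 h2]; split => // k *; exact: h2.
apply: measurableI; first exact: mlt.
by apply: fin_bigcap_measurable => // k _; exact: mlt.
Qed.

End OpenPreimages.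

Lemma sin_lt0_small (R : realType) (y : R) : `|y| < pi -> (sin y < 0) = (y < 0).
Proof.
rewrite ltr_norml => /andP[y1 y2]; have [y0|y0|->] := ltgtP y 0.
- by rewrite -[y]opprK sinN oppr_lt0 sin_gt0_pi// oppr_gt0 y0/= ltrNl.
- by apply/negbTE; rewrite -leNgt ltW// sin_gt0_pi// y0.
- by rewrite sin0 ltxx.
Qed.

Lemma dotNl (R : realType) (u v : 'rV[R]_3) : dot (- u) v = - dot u v.
Proof. by rewrite /dot -sumrN; apply: eq_bigr => k _; rewrite mxE mulNr. Qed.

(** * From Fourier transforms to the joint law of radius and area *)

Section Conclusion.
Variables (R : realType) (n : nat).
Context d (T : measurableType d) (P : probability T R).
Variables (w : R -> T -> 'M[R]_(n, 4)) (a : R -> T -> 'rV[R]_3).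
Context d' (T' : measurableType d') (P' : probability T' R).
Variables (r : R -> T' -> R) (g : R -> T' -> 'rV[R]_3).
Hypothesis hw : hp_brownian_motion P w.
Hypothesis ha : stochastic_area P w a.
Hypothesis mr : measurable_process r.
Hypothesis cr : continuous_process r.
Hypothesis wr : same_law P P' (fun t o => hp_radius (w t o)) r.
Hypothesis hg : brownian_motion P' g.
Hypothesis gr : independent_processes P' g r.
Local Notation halfline := (`[0, +oo[%classic : set R).
Implicit Types (l : seq (mark R)) (s t : R).

Let X := radial w.
Let X' o := cos2 (r ^~ o).
Let g' s o := g (finite_clock (X' o) s) o.

Lemma continuous_hp_radius : continuous (@hp_radius R n).
Proof.
move=> x.
exact: (continuous_comp (continuous_comp (@normsq_continuous R n x) (@sqrt_continuous R _)) (@continuous_atan R _)).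
Qed.

Lemma cos2_radius o s : cos2 (fun t => hp_radius (w t o)) s = X o s.
Proof.
rewrite /cos2 /hp_radius cos_atan /X /radial /phi /path.
by rewrite exprVn sqr_sqrtr ?sqr_sqrtr ?addr_ge0 ?normsq_ge0.
Qed.

Let mY : measurable_process (fun t o => hp_radius (w t o)).
Proof. by apply: measurable_process_comp; [exact: continuous_hp_radius|exact: hp_measurable hw]. Qed.

Let law l : mean P (fun o => monomial (X o) l) = mean P' (fun o => monomial (X' o) l).
Proof.
rewrite -(law_monomial mY mr wr); congr (mean P _); apply/funext => o; congr monomial.
by apply/funext => s; rewrite cos2_radius.
Qed.

Let cX o : continuous (X o). Proof. exact: (radial_continuous hw). Qed.
Let cX' o : continuous (X' o). Proof. by apply: continuous_cos2; exact: cr. Qed.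
Let X01 o s : 0 <= X o s <= 1. Proof. exact: radial01. Qed.
Let X'01 o s : 0 <= X' o s <= 1. Proof. exact: cos2_01. Qed.
Let mX s : measurable_fun setT (X ^~ s). Proof. exact: (measurable_radial hw). Qed.
Let mX' s : measurable_fun setT (X' ^~ s).
Proof.
apply: (adapted_measurable mr (fun _ h => h)).
apply: (@adapted_comp _ _ _ _ r halfline (Num.max 0 s) (fun x : R => cos x ^+ 2)); last exact: continuous_cos_sqr.
by rewrite /= in_itv/= le_max lexx.
Qed.

Let mg' s k : measurable_fun setT (fun o => g' s o 0 k).
Proof.
apply: (measurable_at_time hg mr (A := fun s o => finite_clock (X' o) s)).
  by move=> t o; apply: finite_clock_ge0; exact: X'01.
exact: (adapted_finite_clock cr).
Qed.

(** The free phase p0 makes sines available along with cosines and makes the family stable under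
    products up to linear combinations. *)
Definition phase_pair (f : T -> R) (f' : T' -> R) := exists l (p0 : R),
  (forall p, p \in l -> 0 <= p.1) /\
  f = (fun o => cos (p0 + tested (a ^~ o) 0 l) * monomial (X o) l) /\
  f' = (fun o => cos (p0 + tested (g' ^~ o) 0 l) * monomial (X' o) l).

Lemma exists_before l : (forall p, p \in l -> 0 <= p.1) -> exists2 t, 0 <= t & before t l.
Proof.
elim: l => [|p l IH] hl; first by exists 0.
have [|t t0 lt] := IH; first by move=> q ql; apply: hl; rewrite inE ql orbT.
exists (Num.max p.1 t); first by rewrite le_max t0 orbT.
move=> q; rewrite inE => /orP[/eqP ->|/lt/andP[-> qt]]; last by rewrite le_max qt orbT.
by rewrite hl ?mem_head//= le_max lexx.
Qed.

(** Rotation is eliminated on each space separately, leaving on both sides a functional of the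
    radial part alone; these are compared by [law_variance]. *)
Lemma mean_phase_pair f f' : phase_pair f f' ->
  [/\ bounded_measurable f, bounded_measurable f' & mean P f = mean P' f'].
Proof.
move=> [l [p0 [l0 [-> ->]]]]; have [t t0 lt] := exists_before l0.
have bc e (S : measurableType e) (F G : S -> R) : measurable_fun setT F -> bounded_measurable G ->
    bounded_measurable (fun o => cos (p0 + F o) * G o).
  by move=> mF bG; apply: bounded_measurableM => //; apply: bounded_measurable_cos; exact: measurable_funD.
split.
- by apply: bc; [exact: (measurable_tested ha lt)|exact: bounded_measurable_monomial hw _].
- apply: bc; last exact: (bounded_measurable_mono l X'01 mX').
  rewrite /tested; apply: measurable_sum => p.
  by apply: measurable_funB; apply: measurable_sum => k; apply: measurable_funM => //; exact: mg'.
- have fX o : (extended_clock (X o) t < +oo)%E by rewrite (extended_clock_radial hw) ltry.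
  have fX' := finite_clock_ae cX cX' X01 X'01 mX mX' t0 (fun k _ => law k) fX.
  rewrite (undamped hw ha t0 p0 lt) (time_changed hg mr cr gr p0 lt fX'); congr (_ * _).
  rewrite -(law_variance cX cX' X01 X'01 mX mX' t0 (fun k _ => law k) fX lt).
  congr (mean P _); apply/funext => o.
  by rewrite (funext (finite_clock_radial hw o) : finite_clock (X o) = _).
Qed.

Local Notation cl := (closure P P' phase_pair).

(** Product-to-sum formula: the sum of two phases is tested by the concatenated marks, their
    difference by the marks of which the second part has opposite covectors and the same
    exponents. *)
Lemma phase_pairM f f' k k' : phase_pair f f' -> phase_pair k k' ->
  cl (fun o => f o * k o) (fun o => f' o * k' o).
Proof.
move=> [l [p [l0 [-> ->]]]] [m [q [m0 [-> ->]]]].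
pose neg m : seq (mark R) := [seq (p.1, (- p.2.1, p.2.2)) | p <- m].
pose F (S : Type) (al : S -> R -> 'rV[R]_3) (x : S -> R -> R) (u : R) j (o : S) := cos (u + tested (al o) 0 j) * monomial (x o) j.
have hF u j : (forall p, p \in j -> 0 <= p.1) -> cl (F _ (fun o => a ^~ o) X u j) (F _ (fun o => g' ^~ o) X' u j).
  move=> j0; have pk : phase_pair (F _ (fun o => a ^~ o) X u j) (F _ (fun o => g' ^~ o) X' u j) by exists j, u.
  by have [b1 b2 _] := mean_phase_pair pk; exact: closure_base.
have lm0 b : (forall z, z \in l ++ (if b then neg m else m) -> 0 <= z.1).
  move=> z; rewrite mem_cat => /orP[/l0//|]; case: b => [|/m0//].
  by move=> /mapP[y /m0 y0 ->].
have := closure_lin 2^-1 2^-1 (hF (p + q) _ (lm0 false)) (hF (p - q) _ (lm0 true)).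
have e (S : Type) (al : S -> R -> 'rV[R]_3) (x : S -> R -> R) (o : S) :
   2^-1 * F S al x (p + q) (l ++ m) o + 2^-1 * F S al x (p - q) (l ++ neg m) o =
   cos (p + tested (al o) 0 l) * monomial (x o) l * (cos (q + tested (al o) 0 m) * monomial (x o) m).
  have e1 : tested (al o) 0 (l ++ m) = tested (al o) 0 l + tested (al o) 0 m by rewrite /tested big_cat.
  have e2 : tested (al o) 0 (l ++ neg m) = tested (al o) 0 l - tested (al o) 0 m.
    rewrite /tested big_cat/= big_map -sumrN; congr (_ + _); apply: eq_bigr => z _ /=.
    by rewrite !dotNl; ring.
  have e3 : monomial (x o) (l ++ neg m) = monomial (x o) l * monomial (x o) m.
    by rewrite monomial_cat; congr (_ * _); rewrite /monomial big_map.
  rewrite /F e1 e2 e3 monomial_cat.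
  have -> : p + q + (tested (al o) 0 l + tested (al o) 0 m) = (p + tested (al o) 0 l) + (q + tested (al o) 0 m) by ring.
  have -> : p - q + (tested (al o) 0 l - tested (al o) 0 m) = (p + tested (al o) 0 l) - (q + tested (al o) 0 m) by ring.
  by rewrite cosD cosB; move: (cos _) (cos _) (sin _) (sin _) (monomial _ _) (monomial _ _) => *; field.
by rewrite (funext (e T (fun o => a ^~ o) X)) (funext (e T' (fun o => g' ^~ o) X')).
Qed.

Lemma closure_phase1 : cl (fun=> 1) (fun=> 1).
Proof.
apply: closure_base; try exact: bounded_measurable_cst.
exists [::], 0; split => //.
by split; apply/funext => o; rewrite /tested /monomial !big_nil addr0 cos0 mulr1.
Qed.

Lemma mean_closure_phase f f' : cl f f' -> mean P f = mean P' f'.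
Proof.
by apply: closure_mean_eq => k k' /mean_phase_pair[].
Qed.

(** Constant sequences suffice, because the limit clause of [closure] asks for convergence almost
    everywhere only. *)
Lemma closure_ae f f' k k' : cl f f' -> bounded_measurable k -> bounded_measurable k' ->
  {ae P, forall o, f o = k o} -> {ae P', forall o, f' o = k' o} -> cl k k'.
Proof.
move=> hf bk bk' fk fk'; have [[mf [M hM]] [mf' [M' hM']]] := closure_bounded hf.
apply: (@closure_lim _ _ _ _ _ _ _ _ (fun=> f) (fun=> f') k k' (`|M| + `|M'|)) => //.
- by move=> _ o; apply: le_trans (hM o) _; apply: le_trans (ler_norm _) _; rewrite lerDl.
- by move=> _ o; apply: le_trans (hM' o) _; apply: le_trans (ler_norm _) _; rewrite lerDr.
- by apply: filterS fk => o ->; exact: cvg_cst.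
- by apply: filterS fk' => o ->; exact: cvg_cst.
Qed.

Lemma bounded_measurable_gt e (S : measurableType e) (f : S -> R) (c : R) :
  measurable_fun setT f -> bounded_measurable (fun o => (c < f o)%R%:R : R).
Proof.
move=> mf; split; last by exists 1 => o; case: (_ < _); rewrite ?normr1 ?normr0.
rewrite (_ : (fun _ => _) = \1_(f @^-1` `]c, +oo[)).
  by apply: measurable_indic; rewrite -[X in measurable X]setTI; exact: mf.
by apply/funext => o; rewrite indicE; congr ((nat_of_bool _)%:R); apply/idP/idP => ho;
  [rewrite inE/= in_itv/= ho | move: ho; rewrite inE/= in_itv/= andbT].
Qed.

(** The empty partition of [0, 0] has sum 0, so the defining convergence in probability forces the
    area to start at 0 almost surely. *)
Lemma area_start k : {ae P, forall o, a 0 o 0 k = 0}.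
Proof.
pose lam : 'rV[R]_3 := delta_mx 0 k.
have lamE v : dot lam v = v 0 k.
  rewrite /dot (bigD1 k)//= mxE !eqxx mul1r big1 ?addr0// => j jk.
  by rewrite mxE (negbTE jk) andbF mul0r.
have m0 : measurable_fun setT (fun o => a 0 o 0 k) by exact: (measurable_area ha).
have bt : bounded_measurable (fun o => trunc (a 0 o 0 k)) by exact: bounded_measurable_trunc.
have : mean P (fun o => trunc (a 0 o 0 k)) = 0.
  apply/eqP; rewrite eq_le; apply/andP; split; last by apply: mean_ge0 => o; exact: trunc_ge0.
  apply/ler_addgt0Pl => e e0; rewrite addr0.
  have [delta d0 /(_ [::])] := area_sum_cvg hw ha lam (lexx 0) e0.
  have h1 : itv_partition 0 0 ([::] : seq R) by [].
  have h2 : mesh_lt delta 0 [::] by [].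
  move=> /(_ h1 h2); congr (mean P _ <= _); apply/funext => o.
  by rewrite big_ord0 sub0r lamE /trunc normrN.
move=> e; have /ae_eq_integral_abs : measurable_fun setT (EFin \o (fun o => trunc (a 0 o 0 k))).
  by apply/measurable_EFinP; case: bt.
move=> /(_ P measurableT)[+ _] => H.
have {}H : ae_eq P setT (EFin \o (fun o => trunc (a 0 o 0 k))) (cst 0%E).
  apply: H; under eq_integral do rewrite /= ger0_norm ?trunc_ge0//.
  have fin : (\int[P]_o (trunc (a 0 o 0 k))%:E)%E \is a fin_num.
    by apply: integrable_fin_num => //; exact: bounded_measurable_integrable.
  by rewrite -(fineK fin); congr (_%:E); exact: e.
apply: filterS H => o /(_ I)/= [].
rewrite /trunc => h; have [h1|h1] := leP 1 `|a 0 o 0 k|; move: h.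
  by rewrite min_l// => /eqP; rewrite oner_eq0.
by rewrite min_r ?(ltW h1)// => /eqP; rewrite normr_eq0 => /eqP.
Qed.

Lemma time_changed_start k : {ae P', forall o, g' 0 o 0 k = 0}.
Proof.
by case: hg => _ _ + _; apply: filterS => o g0; rewrite /g' finite_clock0 g0 mxE.
Qed.

(** The phase - pi / 2 converts the cosine into a sine, and the almost sure start at 0 converts
    increments from time 0 into positions. *)
Lemma closure_sin t k (c b : R) : 0 <= t ->
  cl (fun o => sin (c * (b - a t o 0 k))) (fun o => sin (c * (b - g' t o 0 k))).
Proof.
move=> t0; pose lam : 'rV[R]_3 := (- c) *: delta_mx 0 k.
have lamE v : dot lam v = - c * v 0 k.
  rewrite /dot (bigD1 k)//= !mxE !eqxx mulr1 big1 ?addr0// => j jk.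
  by rewrite !mxE (negbTE jk) andbF mulr0 mul0r.
have pk : phase_pair
   (fun o => cos ((c * b - pi / 2) + tested (a ^~ o) 0 [:: (t, (lam, 0%N))]) * monomial (X o) [:: (t, (lam, 0%N))])
   (fun o => cos ((c * b - pi / 2) + tested (g' ^~ o) 0 [:: (t, (lam, 0%N))]) * monomial (X' o) [:: (t, (lam, 0%N))]).
  by exists [:: (t, (lam, 0%N))], (c * b - pi / 2); split => // p; rewrite inE => /eqP ->.
have [b1 b2 _] := mean_phase_pair pk.
have e (S : Type) (al : S -> R -> 'rV[R]_3) (x : S -> R -> R) o : al o 0 0 k = 0 ->
    cos ((c * b - pi / 2) + tested (al o) 0 [:: (t, (lam, 0%N))]) * monomial (x o) [:: (t, (lam, 0%N))] =
    sin (c * (b - al o t 0 k)).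
  move=> a0; rewrite /tested /monomial !big_seq1/= expr0 mulr1 !lamE a0.
  rewrite (_ : _ + _ = c * (b - al o t 0 k) - pi / 2); last by ring.
  by rewrite cosBpihalf.
apply: (closure_ae (closure_base P P' b1 b2 pk)).
- apply: bounded_measurable_sin; apply: measurable_funM => //; apply: measurable_funB => //.
  exact: (measurable_area ha).
- by apply: bounded_measurable_sin; apply: measurable_funM => //; exact: measurable_funB.
- by apply: filterS (area_start k) => o a0; exact: (e _ (fun o => a ^~ o)).
- by apply: filterS (time_changed_start k) => o a0; exact: (e _ (fun o => g' ^~ o)).
Qed.

(** The area is unbounded, so its thresholds are reached through bounded functions: for large j the
    sine of (b - x) / (j + 1) has the sign of b - x. *)
Lemma closure_area_gt t k (b : R) : 0 <= t ->
  cl (fun o => (b < a t o 0 k)%R%:R) (fun o => (b < g' t o 0 k)%R%:R).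
Proof.
move=> t0.
have cv (x : R) : (sin (j.+1%:R^-1 * (b - x)) < 0)%R%:R @[j --> \oo] --> ((b < x)%R%:R : R).
  apply: cvg_near_cst; near=> j.
  have j0 : 0 < j.+1%:R^-1 :> R by rewrite invr_gt0.
  rewrite sin_lt0_small; first by rewrite pmulr_rlt0// subr_lt0.
  rewrite normrM gtr0_norm// ltr_pdivrMl//.
  have : `|b - x| / pi < j%:R by near: j; exact: nbhs_infty_gtr.
  have p0 := pi_gt0 R; rewrite ltr_pdivrMr// => /lt_le_trans; apply.
  by rewrite ler_pM2r// ler_nat.
apply: (@closure_lim _ _ _ _ _ _ _ _
  (fun j o => (sin (j.+1%:R^-1 * (b - a t o 0 k)) < 0)%R%:R) (fun j o => (sin (j.+1%:R^-1 * (b - g' t o 0 k)) < 0)%R%:R) _ _ 1).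
- by move=> j; apply: (closure_lt0 phase_pairM closure_phase1); exact: closure_sin.
- by move=> j o; case: (_ < _); rewrite ?normr1 ?normr0.
- by move=> j o; case: (_ < _); rewrite ?normr1 ?normr0.
- by apply: bounded_measurable_gt; exact: (measurable_area ha).
- exact: bounded_measurable_gt.
- by apply: aeW => o; exact: cv.
- by apply: aeW => o; exact: cv.
Unshelve. all: by end_near.
Qed.

Lemma closure_cos2 t : 0 <= t -> cl (X ^~ t) (X' ^~ t).
Proof.
move=> t0; have pk : phase_pair (X ^~ t) (X' ^~ t).
  exists [:: (t, (0, 1%N))], 0; split; first by move=> p; rewrite inE => /eqP ->.
  by split; apply/funext => o; rewrite /tested /monomial !big_seq1/= !dot0l subrr addr0 cos0 mul1r.
by have [b1 b2 _] := mean_phase_pair pk; exact: closure_base.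
Qed.

(** On [0, pi / 2[ the squared cosine is strictly decreasing, so it detects thresholds of the
    radius. The process r shares only the law of the radius and lies in this interval almost surely,
    which is why [closure_ae] intervenes; thresholds outside the interval are constant. *)
Lemma closure_radius_gt t (b : R) : 0 <= t ->
  cl (fun o => (b < hp_radius (w t o))%R%:R) (fun o => (b < r t o)%R%:R).
Proof.
move=> t0; pose rng := `[0, pi / 2[%classic : set R.
have rw o : rng (hp_radius (w t o)).
  rewrite /rng/= in_itv/= atan_ltpi2 andbT -(@atan0 R).
  by apply: le_atan; exact: sqrtr_ge0.
have rr : {ae P', forall o, rng (r t o)}.
  exact: (law_coordinate mY mr wr t0 (measurable_itv _) (aeW _ rw)).
have mw : measurable_fun setT (fun o => hp_radius (w t o)).
  apply: (adapted_measurable mY (fun _ h => h)).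
  by apply: (@adapted_comp _ _ _ _ (fun t o => hp_radius (w t o)) halfline t id) => [|x]; [rewrite /= in_itv/= t0|exact: cvg_id].
have mrt : measurable_fun setT (r t).
  apply: (adapted_measurable mr (fun _ h => h)).
  by apply: (@adapted_comp _ _ _ _ r halfline t id) => [|x]; [rewrite /= in_itv/= t0|exact: cvg_id].
have cst_case (c : R) : (forall x, rng x -> (b < x)%R%:R = c) ->
    cl (fun o => (b < hp_radius (w t o))%R%:R) (fun o => (b < r t o)%R%:R).
  move=> hc; apply: (closure_ae (closure_cst closure_phase1 c)).
  - exact: bounded_measurable_gt.
  - exact: bounded_measurable_gt.
  - by apply: aeW => o; rewrite hc.
  - by apply: filterS rr => o ro; rewrite hc.
have [b0|b0] := ltP b 0.
  by apply: (cst_case 1) => x; rewrite /rng/= in_itv/= => /andP[x0 _]; rewrite (lt_le_trans b0).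
have [b1|b1] := leP (pi / 2) b.
  by apply: (cst_case 0) => x; rewrite /rng/= in_itv/= => /andP[_ x1]; rewrite ltNge (le_trans (ltW x1)).
have e x : rng x -> (cos x ^+ 2 - cos b ^+ 2 < 0) = (b < x).
  rewrite /rng/= in_itv/= => /andP[x0 x1]; have p0 := pi_gt0 R.
  rewrite subr_lt0 ltr_pXn2r ?nnegrE ?cos_ge0_pihalf//; [|by apply/andP; split; lra|by apply/andP; split; lra].
  by rewrite ltr_cos// in_itv/=; apply/andP; split; lra.
apply: (closure_ae (closure_lt0 phase_pairM closure_phase1
   (closureB (closure_cos2 t0) (closure_cst closure_phase1 (cos b ^+ 2))))).
- exact: bounded_measurable_gt.
- exact: bounded_measurable_gt.
- by apply: aeW => o; rewrite -cos2_radius /cos2 max_r// e.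
- by apply: filterS rr => o ro; rewrite /X' /cos2 max_r// e.
Qed.

Local Notation Z := (fun t o => (hp_radius (w t o), a t o)).
Local Notation Z' := (fun t o => (r t o, g' t o)).

Let same : set (set (R -> R * 'rV[R]_3)) :=
  [set C | cl (\1_[set o | C (Z ^~ o)]) (\1_[set o | C (Z' ^~ o)])].

(** Finite unions are handled by the product of the complementary indicators, available since the
    closure is an algebra; countable unions are bounded limits of these. *)
Lemma same_sigma_algebra : sigma_algebra setT same.
Proof.
split.
- have := closure_cst closure_phase1 0; rewrite /same/=.
  by rewrite (_ : (fun=> 0) = \1_set0) ?indic0// (_ : (fun=> 0) = \1_set0) ?indic0.
- move=> A hA; have := closureB (closure_cst closure_phase1 1) hA; rewrite setTD /same/=.
  congr cl; apply/funext => o; rewrite !indicE.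
    by rewrite in_setC; case: (_ \in _); rewrite ?subrr ?subr0.
  by rewrite in_setC; case: (_ \in _); rewrite ?subrr ?subr0.
- move=> F hF; rewrite /same/=.
  pose f (S : Type) (z : S -> R -> R * 'rV[R]_3) (j : nat) o : R := 1 - \prod_(i < j) (1 - \1_[set o | F i (z o)] o).
  have f1 (S : Type) (z : S -> R -> R * 'rV[R]_3) j o : `|f S z j o| <= 1.
    have h (i : 'I_j) : 0 <= 1 - (\1_[set o | F i (z o)] o : R) <= 1.
      by rewrite indicE; case: (o \in _) => /=; apply/andP; split; lra.
    have p0 : 0 <= \prod_(i < j) (1 - \1_[set o | F i (z o)] o) :> R.
      by apply: prodr_ge0 => i _; have /andP[] := h i.
    have p1 : \prod_(i < j) (1 - \1_[set o | F i (z o)] o) <= 1 :> R.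
      by apply: prodr_ile1 => i _; exact: h.
    by rewrite /f ler_norml; apply/andP; split; lra.
  have fc (S : Type) (z : S -> R -> R * 'rV[R]_3) o :
      f S z j o @[j --> \oo] --> (\1_[set o | (\bigcup_k F k) (z o)] o : R).
    apply: cvg_near_cst; have [[i _ Fi]|nF] := pselect ((\bigcup_k F k) (z o)).
      near=> j; rewrite /f [RHS]indicE mem_set; last by exists i.
      have ij : (i < j)%N by near: j; exact: nbhs_infty_gt.
      by rewrite (bigD1 (Ordinal ij))//= indicE mem_set// subrr mul0r subr0.
    apply: nearW => j; rewrite /f [RHS]indicE memNset// big1 ?subrr// => i _.
    by rewrite indicE memNset ?subr0// => Fi; apply: nF; exists i.
  have clf j : cl (f _ (fun o => Z ^~ o) j) (f _ (fun o => Z' ^~ o) j).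
    apply: closureB; first exact: (closure_cst closure_phase1).
    apply: (closure_prod phase_pairM closure_phase1) => i.
    by apply: closureB; [exact: (closure_cst closure_phase1)|exact: hF].
  have bl e (S : measurableType e) (z : S -> R -> R * 'rV[R]_3) : (forall j, bounded_measurable (f S z j)) ->
      bounded_measurable (\1_[set o | (\bigcup_k F k) (z o)] : S -> R).
    move=> bf; split; last by exists 1 => o; rewrite indicE; case: (_ \in _); rewrite ?normr1 ?normr0.
    apply: (@measurable_fun_cvg _ _ _ _ (f S z)); first by move=> j; exact: (bf j).1.
    by move=> o _; exact: fc.
  apply: (@closure_lim _ _ _ _ _ _ _ _ (f _ (fun o => Z ^~ o)) (f _ (fun o => Z' ^~ o)) _ _ 1) => //.
  - by apply: bl => j; case: (closure_bounded (clf j)).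
  - by apply: bl => j; case: (closure_bounded (clf j)).
  - by apply: aeW => o; exact: fc.
  - by apply: aeW => o; exact: fc.
Unshelve. all: by end_near.
Qed.

(** The space of paths is itself regarded as a measurable space with the sigma-algebra [same].
    Thresholds of the four real coordinates belong to it, so each evaluation has measurable
    coordinates and pulls open sets back into [same]. *)
Lemma path_sigma_same : @path_sigma R (R * 'rV[R]_3)%type `<=` same.
Proof.
apply: smallest_sub; first exact: same_sigma_algebra.
move=> _ [u [U [hu oU ->]]]; have u0 : 0 <= u by move: hu; rewrite /= in_itv/= andbT.
pose S := g_sigma_algebraType same.
have SE (A : set S) : measurable A -> same A.
  by have := sigma_algebra_id same_sigma_algebra; rewrite /measurable/= => ->.
have mS (f : S -> R) : (forall b, same [set z | b < f z]) -> measurable_fun setT f.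
  move=> hf; apply: (measurability (@RGenOInfty.G R)); first exact: RGenOInfty.measurableE.
  move=> _ [_ [b ->] <-]; rewrite setTI; apply: sub_sigma_algebra.
  by rewrite (_ : _ @^-1` _ = [set z | b < f z])//; apply/seteqP; split => z /=; rewrite in_itv/= andbT.
have e (V : Type) (f : V -> R) (b : R) : (\1_[set o | b < f o] : V -> R) = (fun o => (b < f o)%R%:R).
  by apply/funext => o; rewrite indicE; congr ((nat_of_bool _)%:R); apply/idP/idP; rewrite inE.
apply: SE; apply: (@measurable_preimage_open R _ S (fun z : S => (z : R -> R * 'rV[R]_3) u) U) => //.
- by apply: mS => b; rewrite /same/= !e; exact: closure_radius_gt.
- by move=> k; apply: mS => b; rewrite /same/= !e; exact: closure_area_gt.
Qed.

Theorem radius_area_law : same_law P P' Z Z'.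
Proof.
move=> C /path_sigma_same hC; have [b1 b2] := closure_bounded hC.
have mI e (S : measurableType e) (A : set S) : bounded_measurable (\1_A : S -> R) -> measurable A.
  move=> [mA _]; have -> : A = [set o | 1 <= \1_A o :> R]; last exact: measurable_ge.
  by apply/seteqP; split => o /=; rewrite indicE; [move=> Ao; rewrite mem_set|case: (boolP (o \in A)) => [/set_mem|]; rewrite ?ler10].
have := mean_closure_phase hC; rewrite !mean_indic; [|exact: mI|exact: mI].
by move=> e; rewrite -[LHS]fineK ?fin_num_measure ?e ?fineK ?fin_num_measure//; exact: mI.
Qed.

End Conclusion.

Theorem corollary4p5 (R : realType) (n : nat) (n_ge1 : (1 <= n)%N)
    (d : measure_display) (T : measurableType d) (P : probability T R)
    (w : R -> T -> 'M[R]_(n, 4)) (a : R -> T -> 'rV[R]_3)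
    (d' : measure_display) (T' : measurableType d') (P' : probability T' R)
    (r' : R -> T' -> R) (gamma : R -> T' -> 'rV[R]_3) :
  hp_brownian_motion P w ->
  stochastic_area P w a ->
  measurable_process r' -> continuous_process r' ->
  same_law P P' (fun t o => hp_radius (w t o)) r' ->
  brownian_motion P' gamma ->
  independent_processes P' gamma r' ->
  same_law P P'
    (fun t o => (hp_radius (w t o), a t o))
    (fun t o =>
       (r' t o,
        gamma (\int[lebesgue_measure]_(s in `[0, t]) tan (r' s o) ^+ 2) o)).
Proof.
move=> hw ha mr cr wr hg gr.
have := radius_area_law hw ha mr cr wr hg gr.
congr same_law; apply/funext => t; apply/funext => o.
by rewrite finite_clock_cos2.
Qed.
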